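(* For every primitive idempotent $e\in\mathbb{C}[W(D_n)]$: (i) $e\widetilde{\mathcal O}_X$ is a nontrivial $\widetilde{\mathcal D}_Y$-submodule of $\widetilde{\mathcal O}_X$; (ii) the $\widetilde{\mathcal D}_Y$-module $e\widetilde{\mathcal O}_X$ is simple; (iii) there exist $\lambda\in\mathcal P_{2,n}/\!\sim$ and a higher Specht polynomial $F^l_{S,T}$ such that $e\widetilde{\mathcal O}_X=\widetilde{\mathcal D}_YF^l_{S,T}$. Moreover, $$\widetilde{\mathcal O}_X=\bigoplus_{\lambda\in\mathcal P_{2,n}/\sim}\bigoplus_{l=0}^{e(\lambda)-1}f^l_\lambda\,\widetilde{\mathcal D}_YF^l_{\lambda,1},\qquad f^l_\lambda=\dim_{\mathbb{C}}\big(V^l(\lambda)\big),$$ where $f^l_\lambda\,\widetilde{\mathcal D}_YF^l_{\lambda,1}$ stands for $f^l_\lambda$ copies of $\widetilde{\mathcal D}_YF^l_{\lambda,1}$.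
   Context: **Group and rings.** $W=W(D_n)=G(2,2,n)$ is the group of $n\times n$ signed permutation matrices whose nonzero entries have product $1$. Its elements are written $(\epsilon_1,\dots,\epsilon_n;\sigma)$ with $\epsilon_k\in\{\pm1\}$, $\prod_k\epsilon_k=1$, $\sigma\in\mathcal S_n$; it acts on $\mathcal O_X=\mathbb{C}[x_1,\dots,x_n]$ by $(\epsilon_1,\dots,\epsilon_n;\sigma)f=f(\epsilon_{\sigma(1)}x_{\sigma(1)},\dots,\epsilon_{\sigma(n)}x_{\sigma(n)})$. Put $y_j=\sum_i x_i^{2j}$ ($1\le j\le n-1$) and $y_n=x_1\cdots x_n$; the invariant ring is $\mathbb{C}[y_1,\dots,y_n]$. Let $\Delta=(-1)^{n-1}2^{n-1}(n-1)!\prod_{i<j}(x_j^2-x_i^2)$, $\widetilde{\mathcal O}_X=\mathbb{C}[x_1,\dots,x_n,\Delta^{-1}]$ and $\widetilde{\mathcal D}_Y=\mathbb{C}\langle y_1,\dots,y_n,\partial/\partial y_1,\dots,\partial/\partial y_n,\Delta^{-2}\rangle$, where $\partial/\partial y_j$ acts on $\widetilde{\mathcal O}_X$ as the derivation extending $\partial/\partial y_j$ on $\mathbb{C}[y_1,\dots,y_n]$. **Tableaux.** $\mathcal P_{2,n}$ is the set of pairs $\lambda=(\lambda^1,\lambda^2)$ of Young diagrams with $n$ cells in total. A $2$-tableau $T=(T^1,T^2)$ of shape $\lambda$ fills the cells with $1,\dots,n$, each once; $k\in T^\nu$ means that $k$ occurs in $T^\nu$. It is standard if entries increase along rows and columns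 of each component; $\mathrm{STab}(\lambda)$ is the set of standard ones, and $\mathrm{STab}(\lambda)_h$ the subset with $1\in T^\nu$ for some $1\le\nu\le h$. $\mathrm{Sh}$ exchanges the two components of a shape or tableau. $\lambda\sim\mu$ iff $\mu\in\{\lambda,\mathrm{Sh}(\lambda)\}$; $b(\lambda)$ is the size of the class of $\lambda$ and $e(\lambda)=2/b(\lambda)$. Elements of $\mathcal P_{2,n}/\!\sim$ are given by a system of representatives $\lambda$. **Higher Specht polynomials.** For $S\in\mathrm{STab}(\lambda)$ the word $w(S)$ is obtained by reading each column of $S^1$ from bottom to top, starting from the left, then $S^2$ likewise. The number $1$ has index $0$; if $k$ has index $q$, then $k+1$ has index $q+1$ if it sits to the left of $k$ in $w(S)$, and $q$ if to the right. $i(S)^\nu(c)$ is the index of the entry of $S^\nu$ in cell $c$. For a $2$-tableau $T$ of shape $\lambda$, $e_{T^\nu}=\frac1{\alpha_{T^\nu}}\sum_{\sigma\in R(T^\nu)}\sum_{\tau\in C(T^\nu)}\mathrm{sgn}(\tau)\,\tau\sigma$, with $\alpha_{T^\nu}$ the product of the hook lengths of $\lambda^\nu$ and $R(T^\nu),C(T^\nu)$ the row and column stabilizers. Put $$F_{S,T}=\prod_{\nu=1}^2\Big(e_{T^\nu}\Big(\prod_{c\in\lambda^\nu}x_{T^\nu(c)}^{2\,i(S)^\nu(c)}\Big)\prod_{k\in T^\nu}x_k^{\nu-1}\Big),\qquad F^l_{S,T}=\sum_{m=0}^{e(\lambda)-1}(-1)^{lm\,b(\lambda)}F_{S,\mathrm{Sh}^{mb(\lambda)}(T)},\quad0\le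 l<e(\lambda).$$ The higher Specht polynomials are the $F^l_{S,T}$ with $S\in\mathrm{STab}(\lambda)_1$, $T\in\mathrm{STab}(\lambda)_{b(\lambda)}$. Let $\Lambda_0=\mathcal O_X/J_+$, where $J_+$ is the ideal generated by the invariants of positive degree. The space $V^l_S(\lambda)=\bigoplus_{T\in\mathrm{STab}(\lambda)_{b(\lambda)}}\mathbb{C}F^l_{S,T}\subset\Lambda_0$ is an irreducible representation of $W$; its isomorphism class does not depend on $S$ and is denoted $V^l(\lambda)$. One has $\mathbb{C}[W]=\bigoplus_\lambda\bigoplus_{S\in\mathrm{STab}(\lambda)_1}\bigoplus_{l=0}^{e(\lambda)-1}V^l_S(\lambda)$. **The generator $F^l_{\lambda,1}$.** Enumerate $\mathrm{STab}(\lambda)_1=\{S_1,\dots,S_{f^l_\lambda}\}$. Fix a matrix realization $\rho^l_\lambda:W\to\mathrm{GL}_{f^l_\lambda}(\mathbb{C})$ of $V^l_S(\lambda)$ for one choice of $S$, and put $e^{\lambda,l}_i=\frac{f^l_\lambda}{|W|}\sum_{g\in W}\overline{\rho^l_\lambda(g)_{ii}}\,g$, the primitive idempotent corresponding to $S_i$ (the summand $V^l_{S_i}(\lambda)$ of $\mathbb{C}[W]$ being matched with the minimal left ideal $\mathbb{C}[W]e^{\lambda,l}_i$). Then $F^l_{\lambda,1}=F^l_{S_1,T}$, for some $T\in\mathrm{STab}(\lambda)_{b(\lambda)}$, denotes the higher Specht polynomial with $e^{\lambda,l}_1\widetilde{\mathcal O}_X=\widetilde{\mathcal D}_YF^l_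{S_1,T}$.
   Formalization: In (iii) the equality, false for general e when the representation has dimension > 1, is replaced by: the two modules are isomorphic over D̃_Y, and equality holds for some conjugate ueu⁻¹ of e by a unit u of C[W]. *)

(* Defs.v *)
From HB Require Import structures.
From mathcomp Require Import all_boot all_order all_algebra all_fingroup.
From mathcomp Require Import all_solvable all_field all_character.
From mathcomp Require Import fraction complex reals.
From mathcomp Require Import mpoly.

Set Implicit Arguments.
Unset Strict Implicit.
Unset Printing Implicit Defensive.

Import Order.TTheory GRing.Theory Num.Theory.
Local Open Scope ring_scope.

(* The pair (eps, sigma) stands for the signed permutation matrix with entry
   (-1) ^+ eps (sigma i) in row sigma i and column i. *)
Definition Dn_pred n (w : {ffun 'I_n -> bool} * {perm 'I_n}) : bool :=
  \prod_k (-1) ^+ w.1 k == 1 :> int.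

Definition WD n : Type := {w : {ffun 'I_n -> bool} * {perm 'I_n} | Dn_pred w}.

HB.instance Definition _ n := Finite.on (WD n).

Section WDGroup.
Variable n : nat.
Implicit Types u v w : WD n.

Definition sgnW w (k : 'I_n) : bool := (val w).1 k.
Definition prmW w : {perm 'I_n} := (val w).2.

(* Product of signed permutation matrices; [s * t] in MathComp is the
   permutation "s, then t", so [prmW v * prmW u] is sigma_u o sigma_v. *)
Definition WD_mul_val u v : {ffun 'I_n -> bool} * {perm 'I_n} :=
  ([ffun k => sgnW u k (+) sgnW v ((prmW u)^-1%g k)], (prmW v * prmW u)%g).
Definition WD_one_val : {ffun 'I_n -> bool} * {perm 'I_n} :=
  ([ffun => false], 1%g).
Definition WD_inv_val u : {ffun 'I_n -> bool} * {perm 'I_n} :=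
  ([ffun k => sgnW u (prmW u k)], (prmW u)^-1%g).

Lemma WD_mul_subproof u v : Dn_pred (WD_mul_val u v).
Proof.
rewrite /Dn_pred /=.
under eq_bigr do rewrite ffunE signr_addb.
rewrite big_split /= (eqP (valP u)) mul1r (reindex_inj (@perm_inj _ (prmW u))) /=.
under eq_bigr do rewrite permK.
exact: valP v.
Qed.

Lemma WD_one_subproof : Dn_pred WD_one_val.
Proof. by rewrite /Dn_pred /= big1 // => k _; rewrite ffunE. Qed.

Lemma WD_inv_subproof u : Dn_pred (WD_inv_val u).
Proof.
rewrite /Dn_pred /=; under eq_bigr do rewrite ffunE.
by have := valP u; rewrite /Dn_pred (reindex_inj (@perm_inj _ (prmW u))).
Qed.

Definition WD_mul u v : WD n := Sub (WD_mul_val u v) (WD_mul_subproof u v).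
Definition WD_one : WD n := Sub WD_one_val WD_one_subproof.
Definition WD_inv u : WD n := Sub (WD_inv_val u) (WD_inv_subproof u).

Lemma WD_mulA : associative WD_mul.
Proof.
move=> u v w; apply: val_inj; rewrite /= /WD_mul_val /=; congr pair.
  by apply/ffunP => k; rewrite !ffunE /sgnW /prmW /= !ffunE invMg permM addbA.
by rewrite /prmW /= mulgA.
Qed.

Lemma WD_mul1 : left_id WD_one WD_mul.
Proof.
move=> [[a s] h]; apply: val_inj; rewrite /= /WD_mul_val /=; congr pair.
  by apply/ffunP => k; rewrite !ffunE /sgnW /prmW /= !ffunE invg1 perm1.
by rewrite /prmW /= mulg1.
Qed.

Lemma WD_mulV : left_inverse WD_one WD_inv WD_mul.
Proof.
move=> [[a s] h]; apply: val_inj; rewrite /= /WD_mul_val /=; congr pair.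
  by apply/ffunP => k; rewrite !ffunE /sgnW /prmW /= !ffunE invgK addbb.
by rewrite /prmW /= mulgV.
Qed.

HB.instance Definition _ :=
  Finite_isGroup.Build (WD n) WD_mulA WD_mul1 WD_mulV.

End WDGroup.

(* A cell is (nu, (row, column)); nu = false is the first component and
   nu = true the second one.  Rows are numbered downwards.  A diagram with at
   most n cells fits in the n x n square, so a pair of diagrams with n cells
   in total is a set of cells. *)
Definition cell n : Type := (bool * ('I_n * 'I_n))%type.
HB.instance Definition _ n := Finite.on (cell n).

Section Tableaux.
Variable n : nat.
Implicit Types (lam : {set cell n}) (c : cell n) (nu : bool).

Definition crow c : 'I_n := c.2.1.
Definition ccol c : 'I_n := c.2.2.

Definition is_diagram lam : bool :=
  [forall c in lam, forall c' : cell n,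
     [&& c'.1 == c.1, crow c' <= crow c & ccol c' <= ccol c] ==> (c' \in lam)]%N.

Definition P2 : {set {set cell n}} :=
  [set lam | is_diagram lam && (#|lam| == n)].

Definition Sh_cell c : cell n := (~~ c.1, c.2).
Definition Sh lam : {set cell n} := [set Sh_cell c | c in lam].

(* b(lambda) and e(lambda) *)
Definition bnum lam : nat := #|[set lam; Sh lam]|.
Definition enumb lam : nat := 2 %/ bnum lam.

(* A tableau is given by the cell [T k] of each entry; the ordinal k : 'I_n
   stands for the entry k+1. *)
Definition tableau : Type := {ffun 'I_n -> cell n}.
Implicit Types S T : tableau.

Definition tshape T : {set cell n} := [set T k | k : 'I_n].
Definition ShT T : tableau := [ffun k => Sh_cell (T k)].

Definition is_standard T : bool :=
  [forall k : 'I_n, forall m : 'I_n,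
     [&& (T k).1 == (T m).1 &
         (crow (T k) == crow (T m)) && (ccol (T k) < ccol (T m)) ||
         (ccol (T k) == ccol (T m)) && (crow (T k) < crow (T m))]
     ==> (k < m)]%N.

(* The component number of T k is (T k).1 + 1. *)
Definition STab lam : {set tableau} :=
  [set T : {ffun 'I_n -> cell n} |
     [&& injectiveb T, tshape T == lam & is_standard T]].
Definition STabh lam (h : nat) : {set tableau} :=
  [set T in STab lam |
     [forall k : 'I_n, (k == 0 :> nat) ==> ((T k).1 < h)%N]].

(* One representative per class.  A representative has a standard tableau
   with 1 in its first component, i.e. its first diagram is not empty:
   otherwise no higher Specht polynomial would be attached to it. *)
Definition representatives (reps : {set {set cell n}}) : Prop :=
  [/\ reps \subset P2,
      forall lam, lam \in P2 -> #|reps :&: [set lam; Sh lam]| = 1%N &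
      forall lam, lam \in reps -> STabh lam 1 != set0].

Definition reading_cells : seq (cell n) :=
  flatten [seq flatten [seq [seq (nu, (i, j)) | i <- rev (enum 'I_n)]
                       | j <- enum 'I_n]
          | nu <- [:: false; true]].

Definition reading_word S : seq nat :=
  flatten [seq [seq val k | k <- enum 'I_n & S k == c] | c <- reading_cells].

Fixpoint charge_index (w : seq nat) (k : nat) : nat :=
  if k is k'.+1 then charge_index w k' + (index k w < index k' w)%N else 0%N.

Definition cell_index S c : nat :=
  \sum_(k : 'I_n | S k == c) charge_index (reading_word S) k.

Definition row_stab T nu : {set {perm 'I_n}} :=
  [set s : {perm 'I_n} | [forall k : 'I_n,
     if (T k).1 == nu
     then ((T (s k)).1 == nu) && (crow (T (s k)) == crow (T k))
     else s k == k]].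
Definition col_stab T nu : {set {perm 'I_n}} :=
  [set s : {perm 'I_n} | [forall k : 'I_n,
     if (T k).1 == nu
     then ((T (s k)).1 == nu) && (ccol (T (s k)) == ccol (T k))
     else s k == k]].

Definition hook_length lam c : nat :=
  #|[set c' in lam | (c'.1 == c.1) &&
      ((crow c' == crow c) && (ccol c <= ccol c') ||
       (ccol c' == ccol c) && (crow c < crow c'))]|%N.
Definition hook_prod lam nu : nat :=
  \prod_(c in lam | c.1 == nu) hook_length lam c.

(* The pairs (lambda, l) with 0 <= l < e(lambda) <= 2, and, for each of them,
   f lambda l copies. *)
Definition rep_index (reps : {set {set cell n}}) : finType :=
  {p : {set cell n} * 'I_2 | (p.1 \in reps) && (p.2 < enumb p.1)%N}.
Definition copy_index (reps : {set {set cell n}})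
    (f : {set cell n} -> nat -> nat) : finType :=
  {p : rep_index reps & 'I_(f (val p).1 (val p).2)}.
Definition copy_lam reps f (i : copy_index reps f) : {set cell n} :=
  (val (tag i)).1.
Definition copy_l reps f (i : copy_index reps f) : nat := (val (tag i)).2.

End Tableaux.

Section Rings.
Variables (R : realType) (n : nat).

Notation C := R[i].

(* All localizations are taken inside the field of rational functions. *)
Definition KX : Type := {fraction {mpoly C[n]}}.
HB.instance Definition _ := GRing.Field.on KX.

Definition inK (p : {mpoly C[n]}) : KX := FracField.tofrac p.
Definition cstK (c : C) : KX := inK c%:MP.

(* The last index stands for y_n = x_1 ... x_n; j : 'I_n stands for y_(j+1). *)
Definition yvar : n.-tuple {mpoly C[n]} :=
  [tuple if (j.+1 < n)%N then \sum_(i < n) 'X_i ^+ (2 * j.+1)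
         else \prod_(i < n) 'X_i | j < n].

Definition Delta : {mpoly C[n]} :=
  ((-1) ^+ n.-1 * 2%:R ^+ n.-1 * ((n.-1)`!)%:R)
    *: \prod_(i < n) \prod_(j < n | (i < j)%N) ('X_j ^+ 2 - 'X_i ^+ 2).

Definition Otilde (x : KX) : Prop :=
  exists (p : {mpoly C[n]}) (k : nat), x = inK p / inK Delta ^+ k.

(* d is the derivation extending d/dy_j on C[y_1, ..., y_n].  It is given on
   the fraction field of Otilde, to which a derivation of Otilde extends
   uniquely; such a d maps Otilde to itself because the Jacobian determinant
   of y_1, ..., y_n is Delta.  It is C-linear because q may be constant. *)
Definition extends_partial_y (j : 'I_n) (d : KX -> KX) : Prop :=
  [/\ forall a b, d (a + b) = d a + d b,
      forall a b, d (a * b) = d a * b + a * d b &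
      forall q : {mpoly C[n]},
        d (inK (q \mPo yvar)) = inK (mderiv j q \mPo yvar)].

(* The algebra of operators generated by C, the y_j, the d/dy_j and
   Delta ^ -2. *)
Inductive Dtilde : (KX -> KX) -> Prop :=
| Dtilde_cst (c : C) : Dtilde (fun x => cstK c * x)
| Dtilde_y (j : 'I_n) : Dtilde (fun x => inK (tnth yvar j) * x)
| Dtilde_dy (j : 'I_n) d : extends_partial_y j d -> Dtilde d
| Dtilde_invDelta2 : Dtilde (fun x => (inK Delta ^+ 2)^-1 * x)
| Dtilde_add P Q : Dtilde P -> Dtilde Q -> Dtilde (fun x => P x + Q x)
| Dtilde_comp P Q : Dtilde P -> Dtilde Q -> Dtilde (fun x => P (Q x)).

Definition Dgen (p : {mpoly C[n]}) (x : KX) : Prop :=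
  exists2 P, Dtilde P & x = P (inK p).

Definition same_set (A B : KX -> Prop) : Prop := forall x, A x <-> B x.

Definition Dsubmodule (M : KX -> Prop) : Prop :=
  [/\ M 0, forall x y, M x -> M y -> M (x + y) &
      forall P x, Dtilde P -> M x -> M (P x)].

Definition nonzero_set (M : KX -> Prop) : Prop := exists2 x, M x & x != 0.

Definition Dsimple (M : KX -> Prop) : Prop :=
  [/\ Dsubmodule M, nonzero_set M &
      forall N, Dsubmodule N -> (forall x, N x -> M x) ->
        same_set N (fun x => x = 0) \/ same_set N M].

(* aU and aV are the actions of operators on the ambient groups. *)
Definition Diso (U V : zmodType)
    (aU : (KX -> KX) -> U -> U) (aV : (KX -> KX) -> V -> V)
    (A : U -> Prop) (B : V -> Prop) : Prop :=
  exists phi : U -> V,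
    [/\ [/\ forall x, A x -> B (phi x),
            forall x y, A x -> A y -> phi x = phi y -> x = y &
            forall z, B z -> exists2 x, A x & phi x = z],
        forall x y, A x -> A y -> phi (x + y) = phi x + phi y &
        forall P x, Dtilde P -> A x -> phi (aU P x) = aV P (phi x)].

Definition applyK (P : KX -> KX) (x : KX) : KX := P x.

Section DirectSum.
Variable I : finType.

Definition act_family (P : KX -> KX) (m : {ffun I -> KX}) : {ffun I -> KX} :=
  [ffun i => P (m i)].
Definition dsum (M : I -> KX -> Prop) (m : {ffun I -> KX}) : Prop :=
  forall i, M i (m i).

End DirectSum.

Definition actP (w : WD n) (p : {mpoly C[n]}) : {mpoly C[n]} :=
  p \mPo [tuple (-1) ^+ sgnW w (prmW w i) *: 'X_(prmW w i) | i < n].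

(* Numerator and denominator of the chosen representative of x; the result
   does not depend on this choice, actP w being an automorphism. *)
Definition actF (w : WD n) (x : KX) : KX :=
  let r : {ratio {mpoly C[n]}} :=
    generic_quotient.repr (x : {fraction {mpoly C[n]}}) in
  inK (actP w \n_r) / inK (actP w \d_r).

Definition CW : Type := {ffun WD n -> C}.
HB.instance Definition _ := GRing.Zmodule.on CW.

Definition mulCW (a b : CW) : CW :=
  [ffun g => \sum_(h : WD n) a h * b (h^-1 * g)%g].
Definition oneCW : CW := [ffun g => (g == 1%g)%:R].

Definition actCW (a : CW) (x : KX) : KX :=
  \sum_(w : WD n) cstK (a w) * actF w x.

Definition idempotentCW (e : CW) : Prop := mulCW e e = e.

Definition primitive_idempotent (e : CW) : Prop :=
  [/\ idempotentCW e, e <> 0 &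
      forall e1 e2 : CW,
        idempotentCW e1 -> idempotentCW e2 ->
        mulCW e1 e2 = 0 -> mulCW e2 e1 = 0 ->
        e = e1 + e2 -> e1 = 0 \/ e2 = 0].

Definition eOtilde (e : CW) (x : KX) : Prop :=
  exists2 y, Otilde y & x = actCW e y.

Definition actS (s : {perm 'I_n}) (p : {mpoly C[n]}) : {mpoly C[n]} :=
  p \mPo [tuple 'X_(s i) | i < n].

Definition young_sym (T : tableau n) (nu : bool) (p : {mpoly C[n]})
    : {mpoly C[n]} :=
  (hook_prod (tshape T) nu)%:R^-1 *:
    \sum_(s in row_stab T nu) \sum_(t in col_stab T nu)
      (-1) ^+ t *: actS t (actS s p).

Definition specht_mono (S T : tableau n) (nu : bool) : {mpoly C[n]} :=
  \prod_(c in tshape T | c.1 == nu)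
    \prod_(k : 'I_n | T k == c) 'X_k ^+ (2 * cell_index S c).

Definition F_ST (S T : tableau n) : {mpoly C[n]} :=
  \prod_(nu : bool)
    (young_sym T nu (specht_mono S T nu) *
     \prod_(k : 'I_n | (T k).1 == nu) 'X_k ^+ nu).

Definition higher_specht (l : nat) (S T : tableau n) : {mpoly C[n]} :=
  let b := bnum (tshape T) in
  \sum_(m < enumb (tshape T))
    (-1) ^+ (l * m * b) *: F_ST S (iter (m * b) (@ShT n) T).

(* The ideal generated by the invariants without constant term. *)
Definition Jplus (p : {mpoly C[n]}) : Prop :=
  exists s : seq ({mpoly C[n]} * {mpoly C[n]}),
    (forall aq, aq \in s ->
       (forall w : WD n, actP w aq.2 = aq.2) /\ aq.2@_0%MM = 0) /\
    p = \sum_(aq <- s) aq.1 * aq.2.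

(* rho is the matrix of the representation V^l_S(lam) of W, inside
   Lambda_0 = C[x] / Jplus, in some basis v; so f is its dimension. *)
Definition matrix_realization (lam : {set cell n}) (l : nat) (S : tableau n)
    (f : nat) (rho : mx_representation C [set: WD n] f) : Prop :=
  exists v : 'I_f -> {mpoly C[n]},
    [/\ forall i, exists c : tableau n -> C,
          Jplus (v i - \sum_(T in STabh lam (bnum lam))
                          c T *: higher_specht l S T),
        forall T, T \in STabh lam (bnum lam) -> exists c : 'I_f -> C,
          Jplus (higher_specht l S T - \sum_i c i *: v i),
        forall c : 'I_f -> C, Jplus (\sum_i c i *: v i) -> forall i, c i = 0 &
        forall (w : WD n) j, Jplus (actP w (v j) - \sum_i rho w i j *: v i)].

Definition rho_idempotent (f : nat) (rho : mx_representation C [set: WD n] f)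
    (i : 'I_f) : CW :=
  [ffun g => f%:R / #|{: WD n}|%:R * (rho g i i)^*].

(* higher_specht l S1 T is a possible choice of F^l_(lam,1), for
   V^l(lam) of dimension f. *)
Definition specht_generator (lam : {set cell n}) (l f : nat) (S1 T : tableau n)
    : Prop :=
  [/\ S1 \in STabh lam 1, T \in STabh lam (bnum lam) &
      exists (S : tableau n) (rho : mx_representation C [set: WD n] f)
             (i0 : 'I_f),
        [/\ S \in STabh lam 1, matrix_realization lam l S rho,
            i0 = 0 :> nat &
            same_set (eOtilde (rho_idempotent rho i0))
                 (Dgen (higher_specht l S1 T))]].

End Rings.

(* Main.v *)
From HB Require Import structures.
Require Import Defs.
From mathcomp Require Import all_boot all_order all_algebra all_fingroup all_character.
From mathcomp Require Import fraction complex reals mpoly boolp.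
From mathcomp Require Import ring zify.

Set Implicit Arguments.
Unset Strict Implicit.
Unset Printing Implicit Defensive.
Import Order.TTheory GRing.Theory Num.Theory.
Local Open Scope ring_scope.

(** Every operator of the algebra generated by the y_j, the d/dy_j and
    Delta^-2 commutes with W, and conversely there are as many operators as
    this allows. Let O be the localized polynomial ring. If f_1, ..., f_d and
    g_1, ..., g_d are families in O which W transforms by the same matrices,
    and the f_i are linearly independent over C, then a single operator P
    sends each f_i to g_i (Dtilde_operator_exists). The reason is one of
    differential Galois theory. A relation sum a_i P(f_i) = 0 holding for all
    P stays a relation when its coefficients are differentiated, so one of
    minimal support can be normalized to have constant coefficients, which
    contradicts independence. Hence the vectors (P(f_i))_i span the full space
    of rational vectors; their O-span contains the unit vectors, because the
    polynomials q for which it contains q times a unit vector form a set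
    stable under derivations, and such a set contains 1 as soon as it is not
    zero. So O-combinations of operators send f to g, and averaging the
    coefficients over W makes them invariant. An invariant element of O is a
    polynomial in the y_j divided by a power of Delta^2 (Dtilde_invariant),
    hence an operator.

    Simplicity is then formal. Let E_ij be the matrix units of a block of C[W]
    and z a nonzero element of E_ii O. For each x in E_ii O the families (E_ji
    z)_j and (E_ji x)_j are transformed by the same matrices, so x = P(z) for
    some operator P: each nonzero element generates E_ii O (corner_generated).
    A primitive idempotent is conjugate to some E_ii (primitive_to_corner).

    The matrix units come from a Specht module argument. The lowest Specht
    polynomial of a tableau T is the antisymmetrization, along the columns of
    T, of the monomial in which the exponent of x_k is twice the row of k plus
    its component; for a shape equal to its exchange, the monomials of T and
    of its exchange are first combined with a sign (-1)^l. W permutes these W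
    permutes these polynomials up to sign. The class of the shape and l form
    the kind of such a polynomial. Order the shapes by the sum of the rows of
    their cells: an average over a column group fixes the polynomial of T,
    maps those of the same kind to multiples of it, and kills those of the
    other kinds of no larger sum (separating_elt). This gives the
    orthogonality of the matrix coefficients. The polynomials of standard
    tableaux are independent by triangularity (Std_low_free), and counting
    chains of diagrams shows that the squares of their numbers add up to at
    least the order of W (card_WD_le); so these matrix units exhaust C[W]
    (matrix_units, specht_units).

    Higher Specht polynomials are obtained from the lowest ones by a
    W-equivariant map, transport, which replaces the rows in the exponents by
    the charge indices of S (higher_spechtE). The result is not zero since the
    index increases strictly down the columns of a standard S. So F^l_{S,T_k}
    is a nonzero element of E_kk O and generates it, whatever S is.

    For the idempotent attached to a matrix realization, take the standard
    tableau S whose indices are the rows, so that the higher Specht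
    polynomials of S are the lowest ones, independent modulo J_+
    (low_notin_Jplus); after making the other basis vectors orthogonal to the
    first one for an invariant Hermitian form, the first idempotent is E_00
    plus a combination of the E_0k, with the same image as E_00 (image_eps).
    Finally the dimension f of any realization is the number of tableaux T
    (realization_dim), and the isomorphism of the direct sum with O sends a
    family (m_k) to the sum of the E_{k,i0} m_k (decomposition). *)

(** * The group algebra and the Schur relations *)

Section GroupAlgebra.
Variables (F : fieldType) (G : finGroupType).

Definition galg : Type := {ffun G -> F}.
HB.instance Definition _ := GRing.Zmodule.on galg.
Implicit Types a b : galg.

Definition gmul a b : galg := [ffun g => \sum_h a h * b (h^-1 * g)%g].
Definition gone : galg := [ffun g => (g == 1%g)%:R].
Definition gscale (k : F) a : galg := [ffun g => k * a g].

Fact gmulA : associative gmul.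
Proof.
move=> a b c; apply/ffunP => g; rewrite !ffunE.
under eq_bigr do rewrite ffunE big_distrr /=.
under [RHS]eq_bigr do rewrite ffunE big_distrl /=.
rewrite [RHS]exchange_big /=; apply: eq_bigr => h _.
rewrite [RHS](reindex_inj (mulgI h)) /=; apply: eq_bigr => k _.
by rewrite mulKg invMg !mulgA mulrA.
Qed.

Fact gmul1l : left_id gone gmul.
Proof.
move=> a; apply/ffunP => g; rewrite !ffunE (bigD1 1%g) //= big1.
  by rewrite ffunE eqxx mul1r invg1 mul1g addr0.
by move=> h /negPf hn; rewrite ffunE hn mul0r.
Qed.

Fact gmul1r : right_id gone gmul.
Proof.
move=> a; apply/ffunP => g; rewrite !ffunE (bigD1 g) //= big1.
  by rewrite ffunE mulVg eqxx mulr1 addr0.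
move=> h /negPf hn; rewrite ffunE.
by rewrite -(inj_eq (mulgI h)) mulKVg mulg1 eq_sym hn mulr0.
Qed.

Fact gmulDl : left_distributive gmul +%R.
Proof.
move=> a b c; apply/ffunP => g; rewrite !ffunE -big_split /=.
by apply: eq_bigr => h _; rewrite !ffunE mulrDl.
Qed.

Fact gmulDr : right_distributive gmul +%R.
Proof.
move=> a b c; apply/ffunP => g; rewrite !ffunE -big_split /=.
by apply: eq_bigr => h _; rewrite !ffunE mulrDr.
Qed.

Fact gone_neq0 : gone != 0.
Proof.
apply/negP => /eqP/ffunP /(_ 1%g); rewrite !ffunE eqxx => /eqP.
by rewrite oner_eq0.
Qed.

HB.instance Definition _ :=
  GRing.Zmodule_isNzRing.Build galg gmulA gmul1l gmul1r gmulDl gmulDr gone_neq0.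

Fact gscaleA (k l : F) a : gscale k (gscale l a) = gscale (k * l) a.
Proof. by apply/ffunP => g; rewrite !ffunE mulrA. Qed.
Fact gscale1 : left_id 1 gscale.
Proof. by move=> a; apply/ffunP => g; rewrite !ffunE mul1r. Qed.
Fact gscaleDr : right_distributive gscale +%R.
Proof. by move=> k a b; apply/ffunP => g; rewrite !ffunE mulrDr. Qed.
Fact gscaleDl a : {morph gscale^~ a : k l / k + l}.
Proof. by move=> k l; apply/ffunP => g; rewrite !ffunE mulrDl. Qed.
HB.instance Definition _ :=
  GRing.Zmodule_isLmodule.Build F galg gscaleA gscale1 gscaleDr gscaleDl.
Fact gscaleAl (k : F) a b : k *: (a * b) = (k *: a) * b.
Proof.
apply/ffunP => g; rewrite !ffunE big_distrr /=; apply: eq_bigr => h _.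
by rewrite !ffunE mulrA.
Qed.

HB.instance Definition _ := GRing.Lmodule_isLalgebra.Build F galg gscaleAl.
Fact gscaleAr (k : F) a b : k *: (a * b) = a * (k *: b).
Proof.
apply/ffunP => g; rewrite !ffunE big_distrr /=; apply: eq_bigr => h _.
by rewrite !ffunE mulrCA.
Qed.

HB.instance Definition _ := GRing.Lalgebra_isAlgebra.Build F galg gscaleAr.

Lemma galgE a b (g : G) : (a * b) g = \sum_h a h * b (h^-1 * g)%g.
Proof. by rewrite ffunE. Qed.
Lemma galg1E (g : G) : (1 : galg) g = (g == 1%g)%:R.
Proof. by rewrite ffunE. Qed.
Lemma galgZE k a (g : G) : (k *: a) g = k * a g.
Proof. by rewrite ffunE. Qed.
Lemma galgDE a b (g : G) : (a + b) g = a g + b g.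
Proof. by rewrite ffunE. Qed.
Lemma galg_sumE (I : Type) (r : seq I) (P : pred I) (f : I -> galg) g :
  (\sum_(i <- r | P i) f i) g = \sum_(i <- r | P i) f i g.
Proof.
by elim/big_rec2: _ => [|i y1 y2 _ <-]; rewrite ?ffunE.
Qed.

Section Action.
Variables (V : lmodType F) (act : G -> V -> V).
Hypothesis act_lin : forall g k u v, act g (k *: u + v) = k *: act g u + act g v.
Hypothesis act1 : forall v, act 1%g v = v.
Hypothesis actM : forall g h v, act (g * h)%g v = act g (act h v).

Lemma actD g u v : act g (u + v) = act g u + act g v.
Proof. by rewrite -[u in LHS]scale1r act_lin scale1r. Qed.
Lemma act0 g : act g 0 = 0.
Proof. by apply: (@addrI _ (act g 0)); rewrite -actD !addr0. Qed.
Lemma actZ g k u : act g (k *: u) = k *: act g u.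
Proof. by rewrite -[k *: u]addr0 act_lin act0 addr0. Qed.
Lemma act_sum g (I : Type) (r : seq I) (P : pred I) (f : I -> V) :
  act g (\sum_(i <- r | P i) f i) = \sum_(i <- r | P i) act g (f i).
Proof. by elim/big_rec2: _ => [|i y1 y2 _ <-]; rewrite ?act0 ?actD. Qed.

Definition gact (a : galg) (v : V) := \sum_g a g *: act g v.

Lemma gactDr a u v : gact a (u + v) = gact a u + gact a v.
Proof.
by rewrite -big_split; apply: eq_bigr => g _; rewrite actD scalerDr.
Qed.

Lemma gactZr a k u : gact a (k *: u) = k *: gact a u.
Proof.
rewrite scaler_sumr; apply: eq_bigr => g _.
by rewrite actZ !scalerA mulrC.
Qed.

Lemma gact0r a : gact a 0 = 0.
Proof. by rewrite /gact big1 // => g _; rewrite act0 scaler0. Qed.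
Lemma gact_sumr a (I : Type) (r : seq I) (P : pred I) (f : I -> V) :
  gact a (\sum_(i <- r | P i) f i) = \sum_(i <- r | P i) gact a (f i).
Proof. by elim/big_rec2: _ => [|i y1 y2 _ <-]; rewrite ?gact0r ?gactDr. Qed.
Lemma gactDl a b v : gact (a + b) v = gact a v + gact b v.
Proof.
by rewrite -big_split; apply: eq_bigr => g _; rewrite galgDE scalerDl.
Qed.

Lemma gactZl k a v : gact (k *: a) v = k *: gact a v.
Proof.
rewrite scaler_sumr; apply: eq_bigr => g _; by rewrite galgZE scalerA.
Qed.

Lemma gact0l v : gact 0 v = 0.
Proof. by rewrite /gact big1 // => g _; rewrite ffunE scale0r. Qed.
Lemma gact_suml (I : Type) (r : seq I) (P : pred I) (f : I -> galg) v :
  gact (\sum_(i <- r | P i) f i) v = \sum_(i <- r | P i) gact (f i) v.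
Proof. by elim/big_rec2: _ => [|i y1 y2 _ <-]; rewrite ?gact0l ?gactDl. Qed.
Lemma gact1 v : gact 1 v = v.
Proof.
rewrite /gact (bigD1 1%g) //= big1 ?addr0; first by rewrite galg1E eqxx scale1r act1.
by move=> g /negPf hg; rewrite galg1E hg scale0r.
Qed.

Lemma gactM a b v : gact (a * b) v = gact a (gact b v).
Proof.
rewrite /gact.
under eq_bigr do rewrite galgE scaler_suml.
rewrite exchange_big /=; apply: eq_bigr => h _.
rewrite act_sum scaler_sumr (reindex_inj (mulgI h)) /=.
apply: eq_bigr => g _; by rewrite mulKg actZ actM scalerA.
Qed.

End Action.

(** Schur's lemma for a representation r with a cyclic basis vector of index
    i0 and an element b of the group algebra that acts as a projection onto
    the line of this vector: an intertwiner commutes with b and is determined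
    by the image of the cyclic vector. Over a field that need not be
    algebraically closed, b replaces the existence of eigenvalues. *)
Section Schur.
Lemma col_mul m n p (A : 'M[F]_(m, n)) (B : 'M_(n, p)) j :
  col j (A *m B) = A *m col j B.
Proof. by rewrite !colE mulmxA. Qed.

Definition mxrep d (r : G -> 'M[F]_d) :=
  r 1%g = 1%:M /\ forall g h, r (g * h)%g = r g *m r h.
Definition mxext d (r : G -> 'M[F]_d) (a : galg) := \sum_g a g *: r g.

Variables (d : nat) (r : G -> 'M[F]_d) (i0 : 'I_d) (b : galg).
Hypothesis rP : mxrep r.
Hypothesis r_cyc : forall j, exists g (c : F), col j (1%:M : 'M_d) = c *: col i0 (r g).
Hypothesis r_fix : col i0 (mxext r b) = col i0 1%:M.

Lemma mxext_intertwine d' (r' : G -> 'M[F]_d') (Y : 'M_(d', d)) a :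
  (forall g, r' g *m Y = Y *m r g) -> mxext r' a *m Y = Y *m mxext r a.
Proof.
move=> Yi; rewrite /mxext mulmx_suml mulmx_sumr; apply: eq_bigr => g _.
by rewrite -scalemxAl -scalemxAr Yi.
Qed.

(** The translates of the generator span: an intertwiner is determined by its
    value on the generator. *)
Lemma cyc_eq d' (Y Z : 'M[F]_(d', d)) :
  (forall g, Y *m col i0 (r g) = Z *m col i0 (r g)) -> Y = Z.
Proof.
move=> YZ; rewrite -[Y]mulmx1 -[Z]mulmx1; apply/matrixP => i j.
have [g [c hc]] := r_cyc j.
have /matrixP/(_ i 0) : Y *m col j 1%:M = Z *m col j 1%:M.
  by rewrite hc -!scalemxAr YZ.
by rewrite -!col_mul !mxE.
Qed.

(** The projection of an arbitrary matrix to the intertwiners from r to r'.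
    Applied to the elementary matrices it produces the sums of products of
    matrix coefficients. *)
Definition average d' (r' : G -> 'M[F]_d') (Z : 'M_(d', d)) :=
  \sum_g r' g *m Z *m r g^-1%g.
Lemma averageP d' (r' : G -> 'M[F]_d') Z : mxrep r' ->
  forall g, r' g *m average r' Z = average r' Z *m r g.
Proof.
move=> [_ r'M] g; rewrite /average mulmx_sumr mulmx_suml.
rewrite [RHS](reindex_inj (mulgI g)) /=; apply: eq_bigr => h _.
by rewrite !mulmxA -r'M -[RHS]mulmxA -(proj2 rP) invMg mulgKV.
Qed.

Lemma averageE d' (r' : G -> 'M[F]_d') k l i j :
  average r' (delta_mx k l) i j = \sum_g r' g i k * r g^-1%g l j.
Proof.
rewrite summxE; apply: eq_bigr => g _.
rewrite !mxE (bigD1 l) //= big1 ?addr0.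
  rewrite mxE (bigD1 k) //= big1 ?addr0 ?mxE ?eqxx ?mulr1 //.
  by move=> m /negPf hm; rewrite mxE hm mulr0.
move=> m /negPf hm; rewrite mxE big1 ?mul0r // => p _.
by rewrite mxE hm andbF mulr0.
Qed.

(** An average is an intertwiner; it maps the generator, which b fixes, to a
    vector fixed by b, while b acts by zero on the target. *)
Lemma schur_zero d' (r' : G -> 'M[F]_d') : mxrep r' -> mxext r' b = 0 ->
  forall k l i j, \sum_g r' g i k * r g^-1%g l j = 0.
Proof.
move=> r'P r'b k l i j; rewrite -averageE.
set Y := average _ _; suff -> : Y = 0 by rewrite mxE.
have Yi := averageP (delta_mx k l) r'P; rewrite -/Y in Yi.
apply: cyc_eq => g; rewrite mul0mx -col_mul -Yi col_mul.
suff -> : col i0 Y = 0 by rewrite mulmx0.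
rewrite -[Y]mulmx1 col_mul -r_fix -col_mul -(mxext_intertwine _ Yi) r'b.
by rewrite mul0mx; apply/colP => m; rewrite !mxE.
Qed.

Hypothesis r_rank1 : forall j, exists c : F, col j (mxext r b) = c *: col i0 1%:M.
Hypothesis cardG : #|G|%:R != 0 :> F.

(** An endomorphism preserves the line of the generator, onto which b
    projects; being a scalar on the generator, it is a scalar everywhere. *)
Lemma schur_scalar (Y : 'M_d) : (forall g, r g *m Y = Y *m r g) ->
  exists c, Y = c%:M.
Proof.
move=> Yi; exists (Y i0 i0).
(* The matrix of b has nonzero entries in row i0 only. *)
have [u hu] : exists u : 'I_d -> F, mxext r b = \matrix_(i, j) (u j * (i == i0)%:R).
  have [u hu] : exists u : 'I_d -> F, forall j, col j (mxext r b) = u j *: col i0 1%:M.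
    by have [u hu] := choice r_rank1; exists u.
  by exists u; apply/matrixP => i j; have /colP/(_ i) := hu j; rewrite !mxE.
have Y0 : col i0 Y = Y i0 i0 *: col i0 1%:M.
  have : col i0 Y = mxext r b *m col i0 Y.
    rewrite -col_mul (mxext_intertwine _ Yi) col_mul r_fix -col_mul mulmx1 //.
  rewrite hu => h; apply/colP => i; have /colP hh := h.
  case: (eqVneq i i0) => [->|/negPf hi]; first by rewrite !mxE eqxx mulr1.
  rewrite hh !mxE hi mulr0 big1 // => j _.
  by rewrite !mxE hi mulr0 mul0r.
apply: cyc_eq => g; rewrite -!col_mul -Yi col_mul Y0.
by rewrite mul_scalar_mx -scalemxAr -col_mul mulmx1; apply/colP => i; rewrite !mxE.
Qed.

(** The scalar by which an average acts is found by taking traces. The trace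
    identity for k = l reads scalar * d = #|G|, so d is invertible along with
    #|G|. *)
Lemma schur_dim : d%:R != 0 :> F /\
  forall k l i j, \sum_g r g i k * r g^-1%g l j
    = (i == j)%:R * (k == l)%:R * (#|G|%:R / d%:R).
Proof.
have key k l : exists c, average r (delta_mx k l) = c%:M /\
    c * d%:R = (k == l)%:R * #|G|%:R.
  have [c hc] := schur_scalar (averageP (delta_mx k l) rP).
  exists c; split=> //.
  have : \tr (average r (delta_mx k l)) = c *+ d by rewrite hc mxtrace_scalar.
  rewrite mulr_natr => <-; rewrite raddf_sum /=.
  transitivity (\sum_(g : G) ((k == l)%:R : F)).
    apply: eq_bigr => g _; rewrite mxtrace_mulC mulmxA -(proj2 rP) mulVg.
    rewrite (proj1 rP) mul1mx /mxtrace (bigD1 k) //= big1 ?addr0 ?mxE ?eqxx //=.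
    by move=> m /negPf hm; rewrite mxE hm.
  by rewrite sumr_const mulr_natr -[#|xpredT|]/(#|G|).
have dn0 : d%:R != 0 :> F.
  apply/negP => /eqP d0; have [c [_]] := key i0 i0.
  rewrite d0 mulr0 eqxx mul1r => h.
  by move: cardG; rewrite -h eqxx.
split=> // k l i j; rewrite -averageE.
have [c [-> hc]] := key k l; rewrite !mxE.
have -> : c = (k == l)%:R * (#|G|%:R / d%:R) by rewrite mulrA -hc mulfK.
by case: (i == j); rewrite ?mul1r ?mul0r.
Qed.

End Schur.
End GroupAlgebra.

(** * Averages against a sign character *)

(** The average over H of the group elements weighted by a character chi with
    values +1 and -1 projects onto the vectors on which H acts through chi. *)
Section SignAverage.
Variables (F : fieldType) (G : finGroupType) (V : lmodType F).
Variable (act : G -> V -> V).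
Hypothesis act_lin : forall g k u v, act g (k *: u + v) = k *: act g u + act g v.
Hypothesis actM : forall g h v, act (g * h)%g v = act g (act h v).
Variables (H : {set G}) (chi : G -> F).
Hypothesis HM : forall u v, u \in H -> ((u * v)%g \in H) = (v \in H).
Hypothesis HMr : forall u v, v \in H -> ((u * v)%g \in H) = (u \in H).
Hypothesis chiM : forall u v, u \in H -> chi (u * v)%g = chi u * chi v.
Hypothesis chi_sq : forall u, chi u * chi u = 1.
Hypothesis cardH : #|H|%:R != 0 :> F.

Definition sign_average : galg F G :=
  [ffun g => if g \in H then #|H|%:R^-1 * chi g else 0].
Local Notation avg := (gact act sign_average).

Lemma avgE v : avg v = #|H|%:R^-1 *: \sum_(w in H) chi w *: act w v.
Proof.
rewrite /gact scaler_sumr [RHS]big_mkcond /=; apply: eq_bigr => g _; rewrite ffunE.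
by case: ifP => _; rewrite ?scalerA ?scale0r.
Qed.

Lemma avg_fix v : (forall w, w \in H -> act w v = chi w *: v) -> avg v = v.
Proof.
move=> h; rewrite avgE (eq_bigr (fun=> v)); last first.
  by move=> w /h ->; rewrite scalerA chi_sq scale1r.
by rewrite sumr_const -scaler_nat scalerA mulVf ?scale1r.
Qed.

Lemma act_avg w v : w \in H -> act w (avg v) = chi w *: avg v.
Proof.
move=> hw; rewrite !avgE (actZ act_lin) (act_sum act_lin) scalerA mulrC -scalerA; congr (_ *: _).
rewrite scaler_sumr [RHS](reindex_inj (mulgI w)) /=; apply: eq_big => u; first by rewrite HM.
by move=> hu; rewrite (actZ act_lin) -actM scalerA chiM // mulrA chi_sq mul1r.
Qed.

Lemma avg_act w v : w \in H -> avg (act w v) = chi w *: avg v.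
Proof.
move=> hw; rewrite !avgE scalerA mulrC -scalerA; congr (_ *: _).
rewrite scaler_sumr [RHS](reindex_inj (mulIg w)) /=; apply: eq_big => u; first by rewrite HMr.
by move=> hu; rewrite -actM scalerA chiM // mulrC -mulrA chi_sq mulr1.
Qed.

(** The standard way to show that an average vanishes: v is an eigenvector of
    an element w of H for the wrong eigenvalue. *)
Lemma avg_kill w v e : w \in H -> act w v = e *: v -> e != chi w -> avg v = 0.
Proof.
move=> hw h ne; have := avg_act v hw; rewrite h (gactZr act_lin) => /eqP.
rewrite -subr_eq0 -scalerBl scaler_eq0 subr_eq0 (negPf ne) /=.
by move/eqP.
Qed.

Lemma avg_sum (I : Type) (r : seq I) (P : pred I) (f : I -> F) (g : I -> V) :
  avg (\sum_(i <- r | P i) f i *: g i) = \sum_(i <- r | P i) f i *: avg (g i).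
Proof. by rewrite (gact_sumr act_lin); apply: eq_bigr => i _; rewrite (gactZr act_lin). Qed.

(** All the terms of an alternating sum over part of H have the same average.
 *)
Lemma avg_alternating (I : finType) (A : {set I}) (emb : I -> G) (v u : V) :
  (forall i, i \in A -> emb i \in H) -> #|A|%:R != 0 :> F ->
  u = \sum_(i in A) chi (emb i) *: act (emb i) v ->
  avg u = u -> avg v = #|A|%:R^-1 *: u.
Proof.
move=> hA cA uE <-; rewrite uE avg_sum (eq_bigr (fun=> avg v)); last first.
  by move=> i /hA hi; rewrite avg_act // scalerA chi_sq scale1r.
by rewrite sumr_const -scaler_nat scalerA mulVf ?scale1r.
Qed.

Definition gdelta (g : G) : galg F G := [ffun h => (h == g)%:R].
Lemma gact_delta g v : gact act (gdelta g) v = act g v.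
Proof.
rewrite /gact (bigD1 g) //= ffunE eqxx scale1r big1 ?addr0 // => h /negPf hg.
by rewrite ffunE hg scale0r.
Qed.

End SignAverage.

(** * Matrix units from a family permuted by the group *)

Section Families.
Variables (F : fieldType) (V : lmodType F) (I : finType).
Implicit Types (x : I -> V) (J Y : {set I}).

Definition free_family x J :=
  forall c : I -> F, \sum_(t in J) c t *: x t = 0 -> forall t, t \in J -> c t = 0.

(** A maximal independent subset of Y containing J spans. *)
Lemma free_extend x J Y : J \subset Y -> free_family x J ->
  exists2 K : {set I}, [/\ J \subset K, K \subset Y & free_family x K] &
    forall t, t \in Y -> exists c : I -> F, x t = \sum_(s in K) c s *: x s.
Proof.
move=> JY fJ.
pose P := [pred K : {set I} | (K \subset Y) && `[< free_family x K >]].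
have PJ : P J by rewrite /= JY /=; apply/asboolP.
have [K /maxsetP [/andP[KY /asboolP fK] Kmax] JK] := maxset_exists PJ.
exists K => // t tY; have [tK|tnK] := boolP (t \in K).
  exists (fun s => (s == t)%:R); rewrite (bigD1 t) //= eqxx scale1r big1 ?addr0 //.
  by move=> s /andP[_ /negPf ->]; rewrite scale0r.
have nfree : ~ free_family x (t |: K).
  move=> fr; have /Kmax : P (t |: K).
    by rewrite /= subUset sub1set tY KY; apply/asboolP.
  by move=> /(_ (subsetUr _ _)) KE; rewrite -KE setU11 in tnK.
move/existsNP: nfree => [c /not_implyP [c0 /existsNP [s /not_implyP[sK cs]]]].
rewrite big_setU1 //= in c0.
have ct : c t != 0.
  apply/negP => /eqP ct0; rewrite ct0 scale0r add0r in c0.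
  move: sK; rewrite in_setU1 => /orP [/eqP st|sK]; first by rewrite st in cs.
  by apply: cs; apply: fK sK.
exists (fun s => - (c t)^-1 * c s).
have -> : x t = (c t)^-1 *: (c t *: x t) by rewrite scalerA mulVf ?scale1r.
have -> : c t *: x t = - \sum_(s in K) c s *: x s by apply/eqP; rewrite -addr_eq0 c0.
by rewrite scalerN -scaleNr scaler_sumr; apply: eq_bigr => k _; rewrite scalerA.
Qed.

Lemma free_ord x J : free_family x J ->
  forall c : 'I_#|J| -> F, \sum_i c i *: x (enum_val i) = 0 -> forall i, c i = 0.
Proof.
move=> fJ c c0 i.
have iJ := enum_valP i.
pose c' t := c (enum_rank_in iJ t).
have /fJ /(_ _ iJ) : \sum_(t in J) c' t *: x t = 0.
  rewrite -[RHS]c0 (reindex_onto (enum_val : 'I_#|J| -> I) (enum_rank_in iJ)) /=.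
    apply: eq_big => [j|j _]; first by rewrite enum_valP enum_valK_in eqxx.
    by rewrite /c' enum_valK_in.
  by move=> t tJ; rewrite enum_rankK_in.
by rewrite /c' enum_valK_in.
Qed.

Lemma sum_ord (J : {set I}) (W : zmodType) (f : I -> W) :
  \sum_(t in J) f t = \sum_(i < #|J|) f (enum_val i).
Proof. by rewrite big_enum_val. Qed.
End Families.

(** The matrix unit E_ij by Fourier inversion; the indices are exchanged since
    g^-1 appears. *)
Definition munit (F : fieldType) (G : finGroupType) d (r : G -> 'M[F]_d)
    (i j : 'I_d) : galg F G := [ffun g => d%:R / #|G|%:R * r g^-1%g j i].

(** For each kind w, the vectors x w t, with t in Y w, are permuted by the
    group up to scalars, and beta w projects them onto the line of x w (t0 w),
    killing those of the other kinds of no larger weight. Any basis of the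
    span of the x w t that contains the independent family Std w carries a
    representation to which the Schur relations apply. The resulting matrix
    units are independent, so the sum of the squares of the dimensions is at
    most #|G|; a matching lower bound on #|Std w| forces the basis to be Std
    w, and the matrix units to span the group algebra. *)
Section MatrixUnits.
Variables (F : fieldType) (G : finGroupType) (V : lmodType F).
Variable (act : G -> V -> V).
Hypothesis act_lin : forall g k u v, act g (k *: u + v) = k *: act g u + act g v.
Hypothesis act1 : forall v, act 1%g v = v.
Hypothesis actM : forall g h v, act (g * h)%g v = act g (act h v).
Hypothesis cardG : #|G|%:R != 0 :> F.
Local Notation galg_act := (gact act).

Variables (Om : finType) (wt : Om -> nat) (I : finType).
Variables (x : Om -> I -> V) (Y Std : Om -> {set I}) (t0 : Om -> I).
Variable (beta : Om -> galg F G).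
Hypothesis x_stab : forall w g t, t \in Y w ->
  exists (c : F) t', t' \in Y w /\ act g (x w t) = c *: x w t'.
Hypothesis x_trans : forall w t, t \in Y w ->
  exists g (c : F), x w t = c *: act g (x w (t0 w)).
Hypothesis beta_fix : forall w, galg_act (beta w) (x w (t0 w)) = x w (t0 w).
Hypothesis beta_rank1 : forall w t, t \in Y w ->
  exists c : F, galg_act (beta w) (x w t) = c *: x w (t0 w).
Hypothesis beta_kill : forall w w' t, w' != w -> (wt w' <= wt w)%N ->
  t \in Y w' -> galg_act (beta w) (x w' t) = 0.
Hypothesis StdY : forall w, Std w \subset Y w.
Hypothesis t0Std : forall w, t0 w \in Std w.
Hypothesis Std_free : forall w, free_family (x w) (Std w).

Section Basis.
Variable (J : Om -> {set I}).
Hypothesis StdJ : forall w, Std w \subset J w.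
Hypothesis JY : forall w, J w \subset Y w.
Hypothesis J_free : forall w, free_family (x w) (J w).
Hypothesis J_span : forall w t, t \in Y w ->
  exists c : I -> F, x w t = \sum_(s in J w) c s *: x w s.

Local Notation d w := #|J w|.
Definition vec w (i : 'I_(d w)) : V := x w (enum_val i).
Lemma t0J w : t0 w \in J w. Proof. exact: subsetP (StdJ w) _ (t0Std w). Qed.
Definition ord0J w : 'I_(d w) := enum_rank_in (t0J w) (t0 w).
Lemma vec0 w : vec (ord0J w) = x w (t0 w).
Proof. by rewrite /vec enum_rankK_in ?t0J. Qed.
Lemma vecY w (i : 'I_(d w)) : enum_val i \in Y w.
Proof. exact: subsetP (JY w) _ (enum_valP i). Qed.
Lemma vec_free w (c : 'I_(d w) -> F) : \sum_i c i *: vec i = 0 -> forall i, c i = 0.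
Proof. exact: free_ord (@J_free w) c. Qed.
Lemma vec_inj w (c c' : 'I_(d w) -> F) :
  \sum_i c i *: vec i = \sum_i c' i *: vec i -> forall i, c i = c' i.
Proof.
move=> /eqP; rewrite -subr_eq0 -sumrB => /eqP h i.
apply/eqP; rewrite -subr_eq0; apply/eqP.
apply: (@vec_free w (fun i => c i - c' i)); rewrite -[RHS]h.
by apply: eq_bigr => j _; rewrite scalerBl.
Qed.

Lemma vec_span w t : t \in Y w -> exists c : 'I_(d w) -> F, x w t = \sum_i c i *: vec i.
Proof.
move=> /J_span [c ->]; exists (fun i => c (enum_val i)).
by rewrite sum_ord.
Qed.

Lemma rho_exists w g : exists r : 'M[F]_(d w),
  forall j, act g (vec j) = \sum_i r i j *: vec i.
Proof.
have h (j : 'I_(d w)) : exists u : 'I_(d w) -> F, act g (vec j) = \sum_i u i *: vec i.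
  have [c [t' [t'Y ->]]] := x_stab g (vecY j).
  have [u ->] := vec_span t'Y; exists (fun i => c * u i).
  by rewrite scaler_sumr; apply: eq_bigr => i _; rewrite scalerA.
have [u hu] := choice h; exists (\matrix_(i, j) u j i) => j.
by rewrite hu; apply: eq_bigr => i _; rewrite mxE.
Qed.

Definition rho w g : 'M[F]_(d w) := projT1 (cid (rho_exists w g)).
Lemma rhoE w g (j : 'I_(d w)) : act g (vec j) = \sum_i rho w g i j *: vec i.
Proof. by rewrite /rho; case: cid. Qed.

Lemma rho_rep w : mxrep (rho w).
Proof.
split=> [|g h]; apply/matrixP => i j.
  apply: (@vec_inj w (fun i => rho w 1%g i j) (fun i => (1%:M : 'M_(d w)) i j)).
  rewrite -rhoE act1 (bigD1 j) //= big1 ?addr0 ?mxE ?eqxx ?scale1r //.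
  by move=> k /negPf hk; rewrite mxE hk scale0r.
apply: (@vec_inj w (fun i => rho w (g * h)%g i j)
  (fun i => (rho w g *m rho w h) i j)).
rewrite -rhoE actM rhoE (act_sum act_lin).
under eq_bigr do rewrite (actZ act_lin) rhoE scaler_sumr.
rewrite exchange_big /=; apply: eq_bigr => k _.
rewrite mxE scaler_suml; apply: eq_bigr => m _.
by rewrite scalerA mulrC.
Qed.

Lemma gact_vec w a (j : 'I_(d w)) : galg_act a (vec j) = \sum_i mxext (rho w) a i j *: vec i.
Proof.
rewrite /gact; under eq_bigr do rewrite rhoE scaler_sumr.
rewrite exchange_big; apply: eq_bigr => i _.
rewrite summxE scaler_suml; apply: eq_bigr => g _.
by rewrite scalerA mxE.
Qed.

Lemma vec_delta w (j : 'I_(d w)) : vec j = \sum_i (i == j)%:R *: vec i.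
Proof.
rewrite (bigD1 j) //= big1 ?addr0 ?eqxx ?scale1r //.
by move=> k /negPf ->; rewrite scale0r.
Qed.

Lemma vec_scale0 w (k : 'I_(d w)) (c : F) : c *: vec k = 0 -> c = 0.
Proof.
rewrite {1}[vec k]vec_delta scaler_sumr => h.
have hk := @vec_free w (fun i => c * (i == k)%:R).
rewrite -[c]mulr1 -[1]/((true)%:R) -(eqxx k) hk // -[RHS]h.
by apply: eq_bigr => i _; rewrite scalerA.
Qed.

Lemma rho_cyc w (j : 'I_(d w)) : exists g (c : F),
  col j (1%:M : 'M_(d w)) = c *: col (ord0J w) (rho w g).
Proof.
have [g [c h]] := x_trans (vecY j).
exists g, c; apply/colP => i; rewrite !mxE.
apply: (@vec_inj w (fun i => (i == j)%:R) (fun i => c * rho w g i (ord0J w))).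
rewrite -vec_delta [LHS]h -vec0 rhoE scaler_sumr.
by apply: eq_bigr => k _; rewrite scalerA.
Qed.

Lemma rho_fix w : col (ord0J w) (mxext (rho w) (beta w)) = col (ord0J w) 1%:M.
Proof.
apply/colP => i; rewrite mxE [RHS]mxE mxE.
apply: (@vec_inj w (fun i => mxext (rho w) (beta w) i (ord0J w)) (fun i => (i == _)%:R)).
by rewrite -gact_vec -vec_delta vec0 beta_fix.
Qed.

Lemma rho_rank1 w (j : 'I_(d w)) : exists c : F,
  col j (mxext (rho w) (beta w)) = c *: col (ord0J w) 1%:M.
Proof.
have [c hc] := beta_rank1 (vecY j); exists c; apply/colP => i; rewrite !mxE.
apply: (@vec_inj w (fun i => mxext (rho w) (beta w) i j) (fun i => c * (i == ord0J w)%:R)).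
rewrite -gact_vec [LHS]hc -vec0 {1}[vec (ord0J w)]vec_delta scaler_sumr.
by apply: eq_bigr => k _; rewrite scalerA.
Qed.

Lemma rho_kill w w' : w' != w -> (wt w' <= wt w)%N -> mxext (rho w') (beta w) = 0.
Proof.
move=> ww' le; apply/matrixP => i j; rewrite mxE.
apply: (@vec_free w' (fun i => mxext (rho w') (beta w) i j)).
by rewrite -gact_vec (beta_kill ww' le (vecY j)).
Qed.

Lemma rho_orth w w' : w' != w -> forall k l i j,
  \sum_g rho w' g i k * rho w g^-1%g l j = 0.
Proof.
move=> ww' k l i j; have [le|/ltnW le] := leqP (wt w') (wt w).
  apply: (schur_zero (rho_rep w) _ (rho_fix w) (rho_rep w') (rho_kill ww' le)).
  exact: rho_cyc.
rewrite (reindex_inj invg_inj) /=; under eq_bigr do rewrite invgK mulrC.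
apply: (schur_zero (rho_rep w') _ (rho_fix w') (rho_rep w) (rho_kill _ le)).
  exact: rho_cyc.
by rewrite eq_sym.
Qed.

Lemma rho_orth1 w : (d w)%:R != 0 :> F /\ forall k l i j,
  \sum_g rho w g i k * rho w g^-1%g l j = (i == j)%:R * (k == l)%:R * (#|G|%:R / (d w)%:R).
Proof.
exact: (schur_dim (rho_rep w) (@rho_cyc w) (rho_fix w) (@rho_rank1 w) cardG).
Qed.

Definition Eord w (i j : 'I_(d w)) : galg F G :=
  [ffun g => (d w)%:R / #|G|%:R * rho w g^-1%g j i].

Lemma Eord_mul w (i j k l : 'I_(d w)) : Eord i j * Eord k l = (j == k)%:R *: Eord i l.
Proof.
have [dn0 orth] := rho_orth1 w.
apply/ffunP => g; rewrite galgE ffunE.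
transitivity (((d w)%:R / #|G|%:R) ^+ 2 * \sum_m rho w g^-1%g l m *
   \sum_h rho w h m k * rho w h^-1%g j i).
  rewrite big_distrr; under [RHS]eq_bigr do rewrite !big_distrr.
  rewrite [RHS]exchange_big; apply: eq_bigr => h _ /=.
  rewrite !ffunE invMg invgK (proj2 (rho_rep w)) mxE !big_distrr /=.
  by apply: eq_bigr => m _; rewrite expr2; ring.
under eq_bigr do rewrite orth.
rewrite (bigD1 i) //= [X in _ + X]big1 ?addr0.
  rewrite eqxx mul1r ffunE (eq_sym k j); case: (j == k); rewrite ?(mul0r,mulr0) // !mul1r.
  by field; rewrite ?dn0 ?cardG.
by move=> m /negPf hm; rewrite hm !mul0r mulr0.
Qed.

Lemma Eord_mul_ne w w' (i j : 'I_(d w)) (k l : 'I_(d w')) : w != w' ->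
  Eord i j * Eord k l = 0.
Proof.
move=> ww'; apply/ffunP => g; rewrite galgE !ffunE.
transitivity (((d w)%:R / #|G|%:R) * ((d w')%:R / #|G|%:R) * \sum_m rho w' g^-1%g l m *
   \sum_h rho w' h m k * rho w h^-1%g j i); last first.
  rewrite big1 ?mulr0 // => m _; rewrite rho_orth ?mulr0 //.
  by rewrite eq_sym.
rewrite big_distrr; under [RHS]eq_bigr do rewrite !big_distrr.
rewrite [RHS]exchange_big; apply: eq_bigr => h _ /=.
rewrite !ffunE invMg invgK (proj2 (rho_rep w')) mxE !big_distrr /=.
by apply: eq_bigr => m _; ring.
Qed.

Lemma Eord_vec w (i j k : 'I_(d w)) : galg_act (Eord i j) (vec k) = (j == k)%:R *: vec i.
Proof.
have [dn0 orth] := rho_orth1 w.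
rewrite gact_vec; transitivity (\sum_m ((m == i)%:R * (j == k)%:R) *: vec m); last first.
  by rewrite [in RHS]vec_delta scaler_sumr; apply: eq_bigr => m _; rewrite scalerA mulrC.
apply: eq_bigr => m _; congr (_ *: _).
transitivity ((d w)%:R / #|G|%:R * \sum_g rho w g m k * rho w g^-1%g j i).
  rewrite summxE big_distrr /=; apply: eq_bigr => g _.
  by rewrite mxE ffunE; ring.
rewrite orth (eq_sym k j); case: (m == i); case: (j == k); rewrite /= ?(mul0r,mulr0,mul1r) //.
by field; rewrite ?dn0 ?cardG.
Qed.

Lemma Eord_vec_ne w w' (i j : 'I_(d w)) (k : 'I_(d w')) : w != w' ->
  galg_act (Eord i j) (vec k) = 0.
Proof.
move=> ww'; rewrite gact_vec big1 // => m _.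
suff -> : mxext (rho w') (Eord i j) m k = 0 by rewrite scale0r.
transitivity ((d w)%:R / #|G|%:R * \sum_g rho w' g m k * rho w g^-1%g j i).
  rewrite summxE big_distrr /=; apply: eq_bigr => g _.
  by rewrite mxE ffunE; ring.
by rewrite rho_orth ?mulr0 // eq_sym.
Qed.

Definition Eidx := {w : Om & ('I_(d w) * 'I_(d w))%type}.
Definition Eall (p : Eidx) : galg F G := Eord (tagged p).1 (tagged p).2.

Lemma card_Eidx : #|{: Eidx}| = (\sum_w #|J w| ^ 2)%N.
Proof.
rewrite card_tagged sumnE big_map big_enum /=.
by apply: eq_bigr => w _; rewrite card_prod !card_ord.
Qed.

(** In a vanishing combination, multiplying by E_{0i} on the left and E_{j0}
    on the right isolates the coefficient of E_ij, times E_{00}, which does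
    not act by zero. *)
Lemma Eall_free (c : Eidx -> F) : \sum_p c p *: Eall p = 0 -> forall p, c p = 0.
Proof.
move=> c0 [w [i j]].
have h : Eord (ord0J w) i * (\sum_p c p *: Eall p) * Eord j (ord0J w)
   = c (Tagged _ (i, j)) *: Eord (ord0J w) (ord0J w).
  rewrite mulr_sumr mulr_suml (bigD1 (Tagged _ (i, j))) //= big1 ?addr0.
    by rewrite /Eall /= -scalerAr -scalerAl !Eord_mul !eqxx !scale1r Eord_mul eqxx scale1r.
  move=> [w' [k l]] hne; rewrite /Eall /= -scalerAr -scalerAl.
  have [eww'|ww'] := eqVneq w w'; last by rewrite Eord_mul_ne // mul0r scaler0.
  subst w'; rewrite !Eord_mul -scalerAl Eord_mul.
  have [eik|ik] := eqVneq i k; last by rewrite scale0r scaler0.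
  have [elj|lj] := eqVneq l j; last by rewrite scale0r !scaler0.
  by subst k l; rewrite eqxx in hne.
have : galg_act (c (Tagged _ (i, j)) *: Eord (ord0J w) (ord0J w)) (vec (ord0J w)) = 0.
  by rewrite -h c0 mulr0 mul0r (gact0l act).
rewrite (gactZl act) Eord_vec eqxx scale1r => e0.
exact: vec_scale0 e0.
Qed.

Definition Emx : 'M[F]_(#|{: Eidx}|, #|G|) := \matrix_(k, g) Eall (enum_val k) (enum_val g).

Lemma Emx_free : row_free Emx.
Proof.
apply/row_freeP; apply/row_freeP; rewrite -kermx_eq0.
apply/rowV0P => u /sub_kermxP uE; apply/rowP => k; rewrite [RHS]mxE.
have := @Eall_free (fun p => u 0 (enum_rank p)).
move=> /(_ _ (enum_val k)); rewrite enum_valK; apply.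
apply/ffunP => g; rewrite galg_sumE ffunE.
have /rowP/(_ (enum_rank g)) := uE; rewrite !mxE => h; rewrite -[RHS]h.
rewrite (reindex (enum_val : 'I_#|{: Eidx}| -> Eidx)) /=; last exact: onW_bij (enum_val_bij _).
by apply: eq_bigr => m _; rewrite galgZE enum_valK mxE enum_rankK.
Qed.

Hypothesis cardStd : (#|G| <= \sum_w #|Std w| ^ 2)%N.

(** Independence bounds the sum of the squares of the #|J w| by #|G|, and the
    sum over the smaller sets Std w already reaches this bound. *)
Lemma J_eq_Std : forall w, J w = Std w.
Proof.
(* The E_ij are #|J w|^2 independent vectors for each w, in a space of
   dimension #|G|. *)
have le : (\sum_w #|J w| ^ 2 <= \sum_w #|Std w| ^ 2)%N.
  apply: leq_trans cardStd; rewrite -card_Eidx.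
  have := Emx_free; rewrite /row_free => /eqP <-; exact: rank_leq_col.
have le2 w : (#|Std w| ^ 2 <= #|J w| ^ 2)%N by rewrite leq_sqr subset_leq_card ?StdJ.
move=> w; apply/esym/eqP; rewrite eqEcard StdJ -leq_sqr /=.
have : (\sum_(w' | w' != w) #|Std w'| ^ 2 <= \sum_(w' | w' != w) #|J w'| ^ 2)%N.
  exact: leq_sum.
move: le; rewrite (bigD1 w) //= [X in (_ <= X)%N](bigD1 w) //=; lia.
Qed.

Lemma Eall_span (a : galg F G) : exists c : Eidx -> F, a = \sum_p c p *: Eall p.
Proof.
have full : row_full Emx.
  rewrite /row_full eqn_leq rank_leq_col /=.
  have /eqP -> := Emx_free; rewrite card_Eidx.
  by apply: leq_trans cardStd _; apply: leq_sum => w _; rewrite J_eq_Std.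
have /submxP [D hD] : ((\row_g a (enum_val g)) <= Emx)%MS by apply: submx_full.
exists (fun p => D 0 (enum_rank p)).
apply/ffunP => g; rewrite galg_sumE.
have /rowP/(_ (enum_rank g)) := hD; rewrite !mxE enum_rankK => ->.
rewrite [RHS](reindex (enum_val : 'I_#|{: Eidx}| -> Eidx)) /=; last exact: onW_bij (enum_val_bij _).
by apply: eq_bigr => m _; rewrite galgZE enum_valK mxE enum_rankK.
Qed.

(** The sum of the diagonal matrix units is a left unit for each matrix unit,
    and 1 is a combination of matrix units. *)
Lemma Eord_sum1 : \sum_w \sum_i Eord (i : 'I_(d w)) i = 1.
Proof.
set u := LHS.
have uE p : u * Eall p = Eall p.
  case: p => [w [i j]]; rewrite /u /Eall /= mulr_suml (bigD1 w) //= [X in _ + X]big1 ?addr0.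
    rewrite mulr_suml (bigD1 i) //= big1 ?addr0 ?Eord_mul ?eqxx ?scale1r //.
    by move=> k /negPf hk; rewrite Eord_mul hk scale0r.
  by move=> w' ww'; rewrite mulr_suml big1 // => k _; rewrite Eord_mul_ne.
have [c hc] := Eall_span 1.
rewrite -[u]mulr1 hc mulr_sumr; apply: eq_bigr => p _.
by rewrite -scalerAr uE.
Qed.

End Basis.

Hypothesis cardStd : (#|G| <= \sum_w #|Std w| ^ 2)%N.

Lemma Std_span w t : t \in Y w ->
  exists c : I -> F, x w t = \sum_(s in Std w) c s *: x w s.
Proof.
have h w' : exists K : {set I}, [/\ Std w' \subset K, K \subset Y w',
   free_family (x w') K & forall t, t \in Y w' ->
     exists c : I -> F, x w' t = \sum_(s in K) c s *: x w' s].
  by have [K [? ? ?] ?] := free_extend (StdY w') (@Std_free w'); exists K.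
have [J hJ] := choice h.
have hJ1 w' : Std w' \subset J w' by case: (hJ w').
have hJ2 w' : J w' \subset Y w' by case: (hJ w').
have hJ3 w' : free_family (x w') (J w') by case: (hJ w').
have hJ4 w' : forall t, t \in Y w' ->
     exists c : I -> F, x w' t = \sum_(s in J w') c s *: x w' s by case: (hJ w').
rewrite -(J_eq_Std hJ1 hJ2 hJ3 hJ4 cardStd); exact: hJ4.
Qed.

Theorem matrix_units : exists rho : forall w, G -> 'M[F]_#|Std w|,
  [/\ forall w, mxrep (rho w),
      forall w g j, act g (x w (enum_val j)) =
        \sum_i rho w g i j *: x w (enum_val i),
      [/\ forall w i j k l, munit (rho w) i j * munit (rho w) k l
            = (j == k)%:R *: munit (rho w) i l,
          forall w w' i j k l, w != w' ->
            munit (rho w) i j * munit (rho w') k l = 0,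
          \sum_w \sum_i munit (rho w) i i = 1 &
          forall a : galg F G, exists c : forall w, 'I_#|Std w| -> 'I_#|Std w| -> F,
            a = \sum_w \sum_i \sum_j c w i j *: munit (rho w) i j],
      forall w i j k, galg_act (munit (rho w) i j) (x w (enum_val k))
            = (j == k)%:R *: x w (enum_val i) &
      forall w w' i j (k : 'I_#|Std w'|), w != w' ->
        galg_act (munit (rho w) i j) (x w' (enum_val k)) = 0].
Proof.
have SS w : Std w \subset Std w by [].
have sp := Std_span.
exists (rho StdY sp); split.
- by move=> w; apply: rho_rep.
- by move=> w g j; apply: rhoE.
- split.
  + by move=> w i j k l; apply: (Eord_mul SS StdY Std_free sp).
  + by move=> w w' i j k l; apply: (Eord_mul_ne SS StdY Std_free sp).
  + exact: (Eord_sum1 SS StdY Std_free sp cardStd).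
  + move=> a; have [c ->] := Eall_span SS StdY Std_free sp cardStd a.
    exists (fun w i j => c (Tagged _ (i, j))).
    under [RHS]eq_bigr do rewrite pair_bigA.
    by rewrite sig_big_dep; apply: eq_bigr => -[w [i j]].
- by move=> w i j k; apply: (Eord_vec SS StdY Std_free sp).
- by move=> w w' i j k; apply: (Eord_vec_ne SS StdY Std_free sp).
Qed.

End MatrixUnits.

(** * Conjugacy of primitive idempotents *)

Section ConjugateIdempotents.
Variables (F : numFieldType) (A : algType F).
Implicit Types (a b e f p q : A) (s t : F).

(** Two equivalent idempotents e = a b and f = b a are conjugate by u = 1 + c
    z, where z = (a - f) + (b - e) and c = 1 / (1 - s). All products of a, b,
    e, f are multiples of one of them, whence z^2 = (s + t - 2) z, and the
    inverse of u is 1 + d z with d = 1 / (1 - t). *)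
Lemma conj_idem_generic e f a b s t :
  a * b = e -> b * a = f -> f * b = b -> b * e = b -> e * a = a -> a * f = a ->
  a * a = s *: a -> b * b = t *: b -> s != 1 -> t != 1 ->
  exists u v, [/\ u * v = 1, v * u = 1 & u * e * v = f].
Proof.
move=> ab ba fb be ea af aa bb s1 t1.
have ae : a * e = s *: e by rewrite -ab mulrA aa -scalerAl.
have eb : e * b = t *: e by rewrite -ab -mulrA bb -scalerAr.
have fa : f * a = s *: f by rewrite -ba -mulrA aa -scalerAr.
have bf : b * f = t *: f by rewrite -ba mulrA bb -scalerAl.
have ef : e * f = t *: a by rewrite -{1}ab -mulrA bf -scalerAr af.
have fe : f * e = s *: b by rewrite -{1}ba -mulrA ae -scalerAr be.
have ee : e * e = e by rewrite -{2}ab mulrA ea ab.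
have ff : f * f = f by rewrite -{2}ba mulrA fb ba.
pose z := (a - f) + (b - e).
have za : z * a = (s - 1) *: (a - f).
  rewrite /z !(mulrDl, mulNr) aa fa ba ea scalerBr !scalerBl !scale1r opprB.
  by rewrite addrACA [RHS]addrACA; congr (_ + _); rewrite addrC.
have zf : z * f = - ((t - 1) *: (a - f)).
  rewrite /z !(mulrDl, mulNr) af ff bf ef scalerBr !scalerBl !scale1r !opprB.
  by rewrite addrC addrACA [RHS]addrACA; congr (_ + _); rewrite addrC.
have zb : z * b = (t - 1) *: (b - e).
  rewrite /z !(mulrDl, mulNr) ab fb bb eb scalerBr !scalerBl !scale1r !opprB.
  by rewrite addrC addrACA [RHS]addrACA; congr (_ + _); rewrite addrC.
have ze : z * e = - ((s - 1) *: (b - e)).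
  rewrite /z !(mulrDl, mulNr) ae fe be ee scalerBr !scalerBl !scale1r !opprB.
  by rewrite addrACA [RHS]addrACA; congr (_ + _); rewrite addrC.
have zz : z * z = (s + t - 2) *: z.
  rewrite {2}/z !(mulrDr, mulrN) za zf zb ze !opprK -!scalerDl.
  by rewrite [t - 1 + _]addrC -scalerDr; congr (_ *: _); ring.
have fz : f * z = (s - 1) *: (f - b).
  rewrite /z !(mulrDr, mulrN) fa ff fb fe scalerBr !scalerBl !scale1r !opprB.
  done.
have s10 : 1 - s != 0 by rewrite subr_eq0 eq_sym.
have t10 : 1 - t != 0 by rewrite subr_eq0 eq_sym.
pose c := (1 - s)^-1; pose d := (1 - t)^-1.
have uv (k l : F) : k + l + k * l * (s + t - 2) = 0 ->
    (1 + k *: z) * (1 + l *: z) = 1.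
  move=> kl; rewrite mulrDl mul1r mulrDr mulr1 -scalerAl -scalerAr zz !scalerA.
  rewrite -[RHS]addr0 -(scale0r z) -kl !scalerDl !addrA.
  by rewrite [in RHS](addrAC 1).
have cd : c + d + c * d * (s + t - 2) = 0 by rewrite /c /d; field; rewrite s10 t10.
have U1 : (1 + c *: z) * (1 + d *: z) = 1 by apply: uv.
exists (1 + c *: z), (1 + d *: z); split=> //.
  by apply: uv; rewrite -cd; ring.
suff -> : (1 + c *: z) * e = f * (1 + c *: z) by rewrite -mulrA U1 mulr1.
rewrite mulrDl mul1r -scalerAl ze mulrDr mulr1 -scalerAr fz scalerN !scalerA.
have -> : c * (s - 1) = - 1 by rewrite /c; field.
by rewrite !scaleN1r opprK opprB addrC subrK addrC subrK.
Qed.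

(** Replacing a by k^-1 a and b by k b changes s and t into s / k and k t; one
    of k = 1, 2, 3 avoids both s / k = 1 and k t = 1. *)
Lemma conj_idem e f a b s t :
  a * b = e -> b * a = f -> f * b = b -> b * e = b -> e * a = a -> a * f = a ->
  a * a = s *: a -> b * b = t *: b ->
  exists u v, [/\ u * v = 1, v * u = 1 & u * e * v = f].
Proof.
move=> ab ba fb be ea af aa bb.
have [k [k0 ks kt]] : exists k : F, [/\ k != 0, k^-1 * s != 1 & k * t != 1].
  (* k must differ from 0 and s, and k t from 1: two of the three values can
     be excluded. *)
  have good k : k != 0 -> k != s -> k * t != 1 -> exists k : F, [/\ k != 0, k^-1 * s != 1 & k * t != 1].
    move=> k0 ks kt; exists k; split=> //.
    apply: contra ks => /eqP h; apply/eqP; rewrite -[RHS]mul1r -(divff k0).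
    by rewrite -mulrA h mulr1.
  have three (k : F) (i : nat) : k = i%:R -> i != 0%N -> k != 0.
    by move=> -> i0; rewrite pnatr_eq0.
  have ne12 : (1 : F) != 2%:R by rewrite -[1]/(1%:R) eqr_nat.
  have ne13 : (1 : F) != 3%:R by rewrite -[1]/(1%:R) eqr_nat.
  have ne23 : (2%:R : F) != 3%:R by rewrite eqr_nat.
  have inj (k l : F) : k * t = 1 -> l * t = 1 -> k = l.
    move=> kt lt; have t0 : t != 0.
      by apply/negP => /eqP t0; move/eqP: kt; rewrite t0 mulr0 eq_sym oner_eq0.
    by apply: (mulIf t0); rewrite kt lt.
  have [s1|s1] := eqVneq (1 : F) s; have [t1|t1] := eqVneq (1 * t) 1.
  - have [t2|t2] := eqVneq (2%:R * t) 1.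
      by case/eqP: ne12; apply: inj t1 t2.
    by apply: (good 2%:R) => //; rewrite -?s1 ?pnatr_eq0 // eq_sym.
  - have [t2|t2] := eqVneq (2%:R * t) 1; last first.
      by apply: (good 2%:R) => //; rewrite -?s1 ?pnatr_eq0 // eq_sym.
    have [t3|t3] := eqVneq (3%:R * t) 1.
      by case/eqP: ne23; apply: inj t2 t3.
    by apply: (good 3%:R) => //; rewrite -?s1 ?pnatr_eq0 // eq_sym.
  - have [t2|t2] := eqVneq (2%:R * t) 1.
      by case/eqP: ne12; apply: inj t1 t2.
    have [t3|t3] := eqVneq (3%:R * t) 1.
      by case/eqP: ne13; apply: inj t1 t3.
    have [s2|s2] := eqVneq (2%:R : F) s.
      by apply: (good 3%:R) => //; rewrite -?s2 ?pnatr_eq0 // eq_sym.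
    by apply: (good 2%:R) => //; rewrite ?pnatr_eq0.
  - by apply: (good 1) => //; rewrite ?oner_eq0.
apply: (@conj_idem_generic e f (k^-1 *: a) (k *: b) (k^-1 * s) (k * t)) => //.
- by rewrite -scalerAl -scalerAr scalerA mulVf // scale1r.
- by rewrite -scalerAl -scalerAr scalerA divff // scale1r.
- by rewrite -scalerAr fb.
- by rewrite -scalerAl be.
- by rewrite -scalerAr ea.
- by rewrite -scalerAl af.
- by rewrite -scalerAl -scalerAr aa !scalerA; congr (_ *: _); ring.
- by rewrite -scalerAl -scalerAr bb !scalerA; congr (_ *: _); ring.
Qed.

Definition primitive_elt e := [/\ e * e = e, e != 0 &
  forall e1 e2, e1 * e1 = e1 -> e2 * e2 = e2 -> e1 * e2 = 0 -> e2 * e1 = 0 ->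
    e = e1 + e2 -> e1 = 0 \/ e2 = 0].

(** p q is an idempotent below e, and it is not zero since q (p q) p = f. *)
Lemma primitive_factor e f p q : primitive_elt e -> f * f = f -> f != 0 ->
  q * p = f -> p * f = p -> f * q = q -> e * p = p -> q * e = q -> p * q = e.
Proof.
move=> [ee e0 eprim] ff f0 qp pf fq ep qe.
have pqpq : p * q * (p * q) = p * q by rewrite mulrA -(mulrA p) qp pf.
have epq : e * (p * q) = p * q by rewrite mulrA ep.
have pqe : p * q * e = p * q by rewrite -mulrA qe.
case: (eprim (p * q) (e - p * q)) => //.
- by rewrite mulrBl !mulrBr ee epq pqe pqpq subrr subr0.
- by rewrite mulrBr pqe pqpq subrr.
- by rewrite mulrBl epq pqpq subrr.
- by rewrite addrC subrK.
- move=> pq0; case/eqP: f0; rewrite -ff -{1}qp -qp mulrA -(mulrA q).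
  by rewrite pq0 mulr0 mul0r.
- by move/eqP; rewrite subr_eq0 => /eqP ->.
Qed.

Lemma primitive_conj e f p q : primitive_elt e -> f * f = f -> f != 0 ->
  (forall x, exists c : F, f * x * f = c *: f) ->
  q * p = f -> p * f = p -> f * q = q -> e * p = p -> q * e = q ->
  exists u v, [/\ u * v = 1, v * u = 1 & u * e * v = f].
Proof.
move=> eP ff f0 fAf qp pf fq ep qe.
have pq := primitive_factor eP ff f0 qp pf fq ep qe.
have [s hs] := fAf p; have [t ht] := fAf q.
apply: (@conj_idem e f p q s t) => //.
  have -> : p * p = p * (f * p * f) by rewrite !mulrA pf -mulrA pf.
  by rewrite hs -scalerAr pf.
have -> : q * q = f * q * f * q by rewrite fq -mulrA fq.
by rewrite ht -scalerAl fq.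
Qed.

End ConjugateIdempotents.

(** * Extension of morphisms and derivations to the fraction field *)

Section FieldIdentities.
Variable F : fieldType.
Implicit Types P Q A B : F.
Lemma frac_subE P Q A B : Q != 0 -> B != 0 ->
  P / Q - A / B = (P * B - A * Q) / (Q * B).
Proof. by move=> Q0 B0; field; rewrite Q0 B0. Qed.
Lemma frac_mulE P Q A B : Q != 0 -> B != 0 -> P / Q * (A / B) = (P * A) / (Q * B).
Proof. by move=> Q0 B0; field; rewrite Q0 B0. Qed.
(** Differentiating P B = A Q shows that the quotient rule gives the same
    value on the two equal fractions P / Q and A / B. *)
Lemma quotient_rule_wd P Q A B P' Q' A' B' : Q != 0 -> B != 0 ->
  P * B = A * Q -> P' * B + P * B' = A' * Q + A * Q' ->
  (A' * B - A * B') / B ^+ 2 = (P' * Q - P * Q') / Q ^+ 2.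
Proof.
move=> Q0 B0 e1 e2.
have PE : P = A * Q / B by rewrite -e1 mulfK.
have P'E : P' = (A' * Q + A * Q' - P * B') / B by rewrite -e2 addrK mulfK.
by rewrite P'E PE; field; rewrite Q0 B0.
Qed.

Lemma quotient_rule_sub P Q A B P' Q' A' B' : Q != 0 -> B != 0 ->
  (((P' * B + P * B') - (A' * Q + A * Q')) * (Q * B)
    - (P * B - A * Q) * (Q' * B + Q * B')) / (Q * B) ^+ 2
  = (P' * Q - P * Q') / Q ^+ 2 - (A' * B - A * B') / B ^+ 2.
Proof. by move=> Q0 B0; field; rewrite Q0 B0. Qed.
Lemma quotient_rule_mul P Q A B P' Q' A' B' : Q != 0 -> B != 0 ->
  ((P' * A + P * A') * (Q * B) - P * A * (Q' * B + Q * B')) / (Q * B) ^+ 2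
  = (P' * Q - P * Q') / Q ^+ 2 * (A / B) + P / Q * ((A' * B - A * B') / B ^+ 2).
Proof. by move=> Q0 B0; field; rewrite Q0 B0. Qed.
End FieldIdentities.

Section FractionExtension.
Variable A : idomainType.
Local Notation K := {fraction A}.
Local Notation io := (@FracField.tofrac A).
Implicit Types (p q a b : A) (x y : K).

Lemma tofrac_inj : injective io.
Proof. by move=> p q /eqP; rewrite tofrac_eq => /eqP. Qed.

Definition numF x : A := \n_(generic_quotient.repr x).
Definition denF x : A := \d_(generic_quotient.repr x).
Lemma denF_neq0 x : denF x != 0. Proof. exact: denom_ratioP. Qed.
Lemma numdenF x : x = io (numF x) / io (denF x).
Proof.
have dn0 : io (denF x) != 0 by rewrite tofrac_eq0 denF_neq0.
apply: (canRL (mulfK dn0)); rewrite /numF /denF.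
set r := generic_quotient.repr _.
rewrite -[x in LHS]generic_quotient.reprK -/r; unlock FracField.tofrac.
rewrite -[LHS]FracField.pi_mul; apply/generic_quotient.eqmodP => /=.
rewrite FracField.equivfE /FracField.mulf !numden_Ratio ?mulf_neq0 ?oner_neq0 ?denom_ratioP // ?mulr1 ?mul1r.
by rewrite mulrC.
Qed.

Lemma frac_ind (P : K -> Prop) :
  (forall p q, q != 0 -> P (io p / io q)) -> forall x, P x.
Proof. by move=> h x; rewrite [x]numdenF; apply: h; apply: denF_neq0. Qed.

Lemma frac_cross p q a b : q != 0 -> b != 0 ->
  io p / io q = io a / io b -> p * b = a * q.
Proof.
move=> q0 b0 h; apply: tofrac_inj; rewrite !rmorphM /=.
by apply/eqP; rewrite -eqr_div ?tofrac_eq0 // h.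
Qed.

Lemma cross_frac p q a b : q != 0 -> b != 0 -> p * b = a * q ->
  io p / io q = io a / io b.
Proof.
by move=> q0 b0 h; apply/eqP; rewrite eqr_div ?tofrac_eq0 // -!rmorphM h.
Qed.

Section Morphism.
Variable (s : {rmorphism A -> A}).
Hypothesis s_inj : forall p, (s p == 0) = (p == 0).
(** The value is computed on a representative; extM_frac shows that it does
    not depend on it. *)
Definition extM x : K := io (s (numF x)) / io (s (denF x)).
Lemma extM_frac p q : q != 0 -> extM (io p / io q) = io (s p) / io (s q).
Proof.
move=> q0; have xE := numdenF (io p / io q); have d0 := denF_neq0 (io p / io q).
apply: cross_frac; rewrite ?s_inj //.
by rewrite -!rmorphM (frac_cross _ _ xE).
Qed.

Lemma extM_io p : extM (io p) = io (s p).
Proof. by rewrite -[io p]divr1 -tofrac1 extM_frac ?oner_eq0 // rmorph1 tofrac1 divr1. Qed.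
Lemma extM_zmod : zmod_morphism extM.
Proof.
move=> x y; elim/frac_ind: x => p q q0; elim/frac_ind: y => a b b0.
rewrite frac_subE ?tofrac_eq0 // -!tofracM -tofracB !extM_frac ?mulf_neq0 //.
rewrite !rmorphB !rmorphM /= frac_subE ?tofrac_eq0 ?s_inj //.
Qed.

Lemma extM_monoid : monoid_morphism extM.
Proof.
split; first by rewrite -{1}tofrac1 extM_io rmorph1 tofrac1.
move=> x y; elim/frac_ind: x => p q q0; elim/frac_ind: y => a b b0.
rewrite frac_mulE ?tofrac_eq0 // -!tofracM !extM_frac ?mulf_neq0 //.
rewrite !rmorphM /= frac_mulE ?tofrac_eq0 ?s_inj //.
Qed.

End Morphism.

Section Derivation.
Variable (d : A -> A).
Hypothesis dB : forall p q, d (p - q) = d p - d q.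
Hypothesis dM : forall p q, d (p * q) = d p * q + p * d q.
Definition extD x : K :=
  (io (d (numF x)) * io (denF x) - io (numF x) * io (d (denF x))) / io (denF x) ^+ 2.
Lemma extD_frac p q : q != 0 -> extD (io p / io q) =
  (io (d p) * io q - io p * io (d q)) / io q ^+ 2.
Proof.
move=> q0; rewrite /extD; set x := io p / io q.
have xE := numdenF x; have d0 := denF_neq0 x.
move: (numF x) (denF x) d0 xE => a b b0; rewrite /x => {x} xE.
have e0 := frac_cross q0 b0 xE.
apply: quotient_rule_wd; rewrite ?tofrac_eq0 //; first by rewrite -!tofracM e0.
by rewrite -!tofracM -!tofracD -!dM e0.
Qed.

Lemma extD_io p : extD (io p) = io (d p).
Proof.
have d1 : d 1 = 0.
  by apply: (@addrI _ (d 1)); rewrite addr0 -{3}[1]mulr1 dM mulr1 mul1r.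
rewrite -[io p]divr1 -tofrac1 extD_frac ?oner_eq0 // d1.
by rewrite tofrac0 tofrac1 mulr0 subr0 expr1n divr1 mulr1.
Qed.

Lemma extDB x y : extD (x - y) = extD x - extD y.
Proof.
elim/frac_ind: x => p q q0; elim/frac_ind: y => a b b0.
rewrite frac_subE ?tofrac_eq0 // -!tofracM -tofracB !extD_frac ?mulf_neq0 //.
rewrite dB !dM !(tofracB, tofracD, tofracM).
by rewrite quotient_rule_sub ?tofrac_eq0.
Qed.

Lemma extDM x y : extD (x * y) = extD x * y + x * extD y.
Proof.
elim/frac_ind: x => p q q0; elim/frac_ind: y => a b b0.
rewrite frac_mulE ?tofrac_eq0 // -!tofracM !extD_frac ?mulf_neq0 //.
rewrite !dM !(tofracD, tofracM).
by rewrite quotient_rule_mul ?tofrac_eq0.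
Qed.

End Derivation.
End FractionExtension.

(** Two ring morphisms, or two derivations, are compared on the constants and
    the variables. *)
Lemma mpoly_gen_ind (n : nat) (S : nzRingType) (P : {mpoly S[n]} -> Prop) :
  (forall c, P c%:MP) -> (forall i, P 'X_i) ->
  (forall p q, P p -> P q -> P (p + q)) ->
  (forall p q, P p -> P q -> P (p * q)) -> forall p, P p.
Proof.
move=> PC PX PD PM p; rewrite [p]mpolyE.
have P1 : P 1 by rewrite -mpolyC1.
elim/big_rec: _ => [|m q _ Pq]; first by rewrite -mpolyC0.
apply: (PD) => //; rewrite -mul_mpolyC; apply: (PM) => //.
rewrite mpolyXE_id; elim/big_rec: _ => // i r _ Pr.
apply: (PM) => //; elim: (m i) => [|k IH]; first by rewrite expr0.
by rewrite exprS; apply: PM.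
Qed.

Section FractionField.
Variables (R : realType) (n : nat).
Notation C := R[i].
Notation Pol := {mpoly C[n]}.
Notation K := (KX R n).
Implicit Types (p q : Pol) (x y z : K).

Fact inK_zmod : zmod_morphism (@inK R n).
Proof. exact: tofrac_is_zmod_morphism. Qed.
HB.instance Definition _ := GRing.isZmodMorphism.Build Pol K (@inK R n) inK_zmod.
Fact inK_monoid : monoid_morphism (@inK R n).
Proof. exact: tofrac_is_monoid_morphism. Qed.
HB.instance Definition _ := GRing.isMonoidMorphism.Build Pol K (@inK R n) inK_monoid.

Lemma inKD p q : inK (p + q) = inK p + inK q. Proof. exact: rmorphD. Qed.
Lemma inKN p : inK (- p) = - inK p. Proof. exact: rmorphN. Qed.
Lemma inKB p q : inK (p - q) = inK p - inK q. Proof. exact: rmorphB. Qed.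
Lemma inKM p q : inK (p * q) = inK p * inK q. Proof. exact: rmorphM. Qed.
Lemma inKXn p k : inK (p ^+ k) = inK p ^+ k. Proof. exact: rmorphXn. Qed.
Lemma inK1 : inK (1 : Pol) = 1. Proof. exact: rmorph1. Qed.
Lemma inK0 : inK (0 : Pol) = 0. Proof. exact: rmorph0. Qed.
Lemma inK_sum (I : Type) (r : seq I) (P : pred I) (f : I -> Pol) :
  inK (\sum_(i <- r | P i) f i) = \sum_(i <- r | P i) inK (f i).
Proof. exact: rmorph_sum. Qed.
Lemma inK_eq0 p : (inK p == 0) = (p == 0).
Proof. exact: tofrac_eq0. Qed.
Lemma inK_neq0 p : p != 0 -> inK p != 0. Proof. by rewrite inK_eq0. Qed.
Lemma inK_inj : injective (@inK R n).
Proof. exact: tofrac_inj. Qed.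
Lemma KX_ind (P : K -> Prop) :
  (forall p q, q != 0 -> P (inK p / inK q)) -> forall x, P x.
Proof. exact: frac_ind. Qed.

(** The images of the variables. With it, actP w is a substitution and
    inherits the structures of a ring morphism and of a linear map. *)
Definition act_tuple (w : WD n) : n.-tuple Pol :=
  [tuple (-1) ^+ sgnW w (prmW w i) *: 'X_(prmW w i) | i < n].
Lemma actPE w p : actP w p = comp_mpoly (act_tuple w) p. Proof. by []. Qed.
HB.instance Definition _ w := GRing.RMorphism.copy (@actP R n w) (comp_mpoly (act_tuple w)).
HB.instance Definition _ w := GRing.Linear.copy (@actP R n w) (comp_mpoly (act_tuple w)).

Lemma actPD w p q : actP w (p + q) = actP w p + actP w q. Proof. exact: rmorphD. Qed.
Lemma actPB w p q : actP w (p - q) = actP w p - actP w q. Proof. exact: rmorphB. Qed.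
Lemma actP_mul w p q : actP w (p * q) = actP w p * actP w q. Proof. exact: rmorphM. Qed.
Lemma actPXn w p k : actP w (p ^+ k) = actP w p ^+ k. Proof. exact: rmorphXn. Qed.
Lemma actPZ w (c : C) p : actP w (c *: p) = c *: actP w p. Proof. exact: linearZ. Qed.
Lemma actP0 w : actP w (0 : Pol) = 0. Proof. exact: rmorph0. Qed.
Lemma actP_sum w (I : Type) (r : seq I) (P : pred I) (f : I -> Pol) :
  actP w (\sum_(i <- r | P i) f i) = \sum_(i <- r | P i) actP w (f i).
Proof. exact: rmorph_sum. Qed.
Lemma actP_prod w (I : Type) (r : seq I) (P : pred I) (f : I -> Pol) :
  actP w (\prod_(i <- r | P i) f i) = \prod_(i <- r | P i) actP w (f i).
Proof. exact: rmorph_prod. Qed.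

Lemma actPC w c : actP w (c%:MP : Pol) = c%:MP.
Proof. exact: comp_mpolyC. Qed.
Lemma actPX w i : actP w ('X_i : Pol) = (-1) ^+ sgnW w (prmW w i) *: 'X_(prmW w i).
Proof. by rewrite actPE comp_mpolyXU -tnth_nth tnth_mktuple. Qed.

Lemma actPM v w p : actP (v * w)%g p = actP v (actP w p).
Proof.
elim/mpoly_gen_ind: p => [c|i|p q hp hq|p q hp hq].
- by rewrite !actPC.
- rewrite !actPX actPZ actPX scalerA; congr (_ *: 'X__).
    rewrite -signr_addb; congr (_ ^+ _); rewrite /sgnW /= ffunE permM permK addbC.
    by rewrite /sgnW /prmW.
  by rewrite /prmW /= permM.
- by rewrite !actPD hp hq.
- by rewrite !actP_mul hp hq.
Qed.

Lemma actP1 p : actP 1%g p = p.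
Proof.
elim/mpoly_gen_ind: p => [c|i|p q hp hq|p q hp hq].
- by rewrite !actPC.
- by rewrite actPX /sgnW /prmW /= ffunE perm1 expr0 scale1r.
- by rewrite !actPD hp hq.
- by rewrite !actP_mul hp hq.
Qed.

Lemma actPK w : cancel (@actP R n w) (actP w^-1%g).
Proof. by move=> p; rewrite -actPM mulVg actP1. Qed.
Lemma actP_eq0 w p : (actP w p == 0) = (p == 0).
Proof. by rewrite -{1}(actP0 w) (can_eq (actPK w)). Qed.

Definition actM w : {rmorphism Pol -> Pol} := @actP R n w.
Lemma actF_ext w x : actF w x = extM (actM w) x. Proof. reflexivity. Qed.
Lemma actF_frac w p q : q != 0 ->
  actF w (inK p / inK q) = inK (actP w p) / inK (actP w q).
Proof. move=> q0; rewrite actF_ext; exact: (@extM_frac _ (actM w) (actP_eq0 w) p q q0). Qed.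
Lemma actF_inK w p : actF w (inK p) = inK (actP w p).
Proof. rewrite actF_ext; exact: (@extM_io _ (actM w) (actP_eq0 w) p). Qed.
Fact actF_zmod w : zmod_morphism (@actF R n w).
Proof. move=> x y; rewrite !actF_ext; exact: (@extM_zmod _ (actM w) (actP_eq0 w) x y). Qed.
HB.instance Definition _ w := GRing.isZmodMorphism.Build K K (@actF R n w) (actF_zmod w).
Fact actF_monoid w : monoid_morphism (@actF R n w).
Proof.
split; first by rewrite actF_ext; exact: (extM_monoid (s := actM w) (actP_eq0 w)).1.
move=> x y; rewrite !actF_ext; exact: (extM_monoid (s := actM w) (actP_eq0 w)).2.
Qed.

HB.instance Definition _ w := GRing.isMonoidMorphism.Build K K (@actF R n w) (actF_monoid w).
Lemma actFM v w x : actF (v * w)%g x = actF v (actF w x).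
Proof.
elim/KX_ind: x => p q q0; have q1 : actP w q != 0 by rewrite actP_eq0.
by rewrite (actF_frac (v * w)%g p q0) (actF_frac w p q0) (actF_frac v _ q1) !actPM.
Qed.

Lemma actF1 x : actF 1%g x = x.
Proof. by elim/KX_ind: x => p q q0; rewrite (actF_frac _ _ q0) !actP1. Qed.
Lemma actF_mul w x y : actF w (x * y) = actF w x * actF w y. Proof. exact: rmorphM. Qed.
Lemma actFD w x y : actF w (x + y) = actF w x + actF w y. Proof. exact: rmorphD. Qed.
Lemma actFV w x : actF w x^-1 = (actF w x)^-1. Proof. exact: fmorphV. Qed.
Lemma actF_cst w (c : C) : actF w (cstK n c) = cstK n c.
Proof. by rewrite /cstK actF_inK actPC. Qed.

Definition dK (i : 'I_n) (x : K) : K := @extD Pol (mderiv i) x.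
Lemma dK_inK i p : dK i (inK p) = inK (mderiv i p).
Proof. rewrite /dK; exact: (@extD_io Pol _ (@mderivM _ _ i) p). Qed.
Lemma dKB i x y : dK i (x - y) = dK i x - dK i y.
Proof. rewrite /dK; exact: (@extDB Pol _ (@mderivB _ _ i) (@mderivM _ _ i) x y). Qed.
Lemma dKM i x y : dK i (x * y) = dK i x * y + x * dK i y.
Proof. rewrite /dK; exact: (@extDM Pol _ (@mderivM _ _ i) x y). Qed.
End FractionField.

(** * The Jacobian of the generating invariants *)

Lemma mderiv_euler (n : nat) (S : comNzRingType) i (m : 'X_{1..n}) :
  'X_i * mderiv i 'X_[S, m] = (m i)%:R *: 'X_[m].
Proof.
rewrite mderivX -scalerAr -mpolyXD.
have [mi0|mi] := eqVneq (m i) 0%N; first by rewrite mi0 !scale0r.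
by rewrite addmC submK // lep1mP.
Qed.

Lemma mul4_rearr (A : comPzRingType) (v s u x : A) : v * s * (u * x) = x * (s * u * v).
Proof. by ring. Qed.

Lemma mpolyX_neq0 (n : nat) (S : nzRingType) (m : 'X_{1..n}) : 'X_[S, m] != 0.
Proof. by rewrite -msize_poly_eq0 msizeX. Qed.

Lemma mpoly_hom_eq (n : nat) (S : nzRingType) (T : nzRingType)
    (f g : {rmorphism {mpoly S[n]} -> T}) :
  (forall c, f c%:MP = g c%:MP) -> (forall i, f 'X_i = g 'X_i) -> f =1 g.
Proof.
move=> fgC fgX p; elim/mpoly_gen_ind: p => [//|//|p q hp hq|p q hp hq].
  by rewrite !rmorphD hp hq.
by rewrite !rmorphM hp hq.
Qed.

(** The chain rule, for a derivation along a morphism from a polynomial ring.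
 *)
Lemma derivation_chain (m : nat) (S : nzRingType) (T : comNzRingType)
    (f : {rmorphism {mpoly S[m]} -> T}) (d : T -> T) :
  (forall a b, d (a + b) = d a + d b) ->
  (forall a b, d (a * b) = d a * b + a * d b) ->
  (forall c, d (f c%:MP) = 0) ->
  forall q, d (f q) = \sum_l f (mderiv l q) * d (f 'X_l).
Proof.
move=> dD dM dC q; elim/mpoly_gen_ind: q => [c|i|p q hp hq|p q hp hq].
- by rewrite dC big1 // => l _; rewrite mderivC rmorph0 mul0r.
- rewrite (bigD1 i) //= big1 ?addr0.
    have sub0 : (U_(i) - U_(i))%MM = 0%MM :> 'X_{1..m}.
      by apply/mnmP => k; rewrite mnmBE mnm0E subnn.
    by rewrite mderivX mnm1E eqxx scale1r sub0 mpolyX0 rmorph1 mul1r.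
  by move=> l /negPf li; rewrite mderivX mnm1E eq_sym li scale0r rmorph0 mul0r.
- rewrite rmorphD dD hp hq -big_split; apply: eq_bigr => l _ /=.
  by rewrite mderivD rmorphD mulrDl.
- rewrite rmorphM dM hp hq mulr_suml mulr_sumr -big_split; apply: eq_bigr => l _ /=.
  rewrite mderivM rmorphD !rmorphM /= mulrDl -!mulrA; congr (_ * _ + _ * _).
  by rewrite mulrC.
Qed.

Section Jacobian.
Variables (R : realType) (n : nat).
Hypothesis n_gt0 : (0 < n)%N.
Notation C := R[i].
Notation Pol := {mpoly C[n]}.
Notation K := (KX R n).
Implicit Types (p q : Pol) (x y z : K).

Lemma actP_yvar w j : actP w (tnth (yvar R n) j) = tnth (yvar R n) j.
Proof.
rewrite tnth_mktuple; case: ifP => _.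
  rewrite actP_sum [RHS](reindex_inj (@perm_inj _ (prmW w))) /=.
  apply: eq_bigr => i _; rewrite actPXn actPX exprZn exprM -signr_odd.
  by rewrite sqrr_sign expr1n scale1r.
have sgn1 : \prod_(i < n) (-1) ^+ sgnW w i = 1 :> C.
  have /eqP := valP w => /(congr1 (fun z : int => z%:~R : C)).
  rewrite rmorph_prod /= => h; rewrite -[RHS]h; apply: eq_bigr => i _.
  by rewrite rmorphXn /= mulrNz.
rewrite actP_prod; under eq_bigr do rewrite actPX -mul_mpolyC.
rewrite big_split /= -rmorph_prod /=.
rewrite [in RHS](reindex_perm (prmW w)) /=.
have -> : \prod_(i < n) (-1) ^+ sgnW w (prmW w i) = 1 :> C.
  by rewrite -[RHS]sgn1 [RHS](reindex_perm (prmW w)).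
by rewrite mpolyC1 mul1r.
Qed.

Lemma actP_comp_yvar w (q : Pol) : actP w (q \mPo yvar R n) = q \mPo yvar R n.
Proof.
pose f : {rmorphism Pol -> Pol} := actM R w \o comp_mpoly (yvar R n).
apply: (@mpoly_hom_eq _ _ _ f (comp_mpoly (yvar R n))) => [c|i] /=.
  by rewrite comp_mpolyC [LHS]actPC.
by rewrite comp_mpolyXU -tnth_nth [LHS]actP_yvar.
Qed.

Definition vdm : Pol :=
  \prod_(i < n) \prod_(j < n | (i < j)%N) ('X_j ^+ 2 - 'X_i ^+ 2).
(** As a determinant, this product changes by the sign of a permutation of the
    variables, and changes of signs do not affect it. *)
Lemma vdm_det : vdm = \det (Vandermonde n (\row_(i < n) ('X_i ^+ 2 : Pol))).
Proof.
by rewrite det_Vandermonde; apply: eq_bigr => i _; apply: eq_bigr => j _; rewrite !mxE.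
Qed.

Lemma actP_vdm w : actP w vdm = (-1) ^+ (prmW w : bool) * vdm.
Proof.
have -> : actP w vdm = \det (Vandermonde n (\row_(i < n) ('X_(prmW w i) ^+ 2 : Pol))).
  rewrite /vdm det_Vandermonde actP_prod; apply: eq_bigr => i _.
  rewrite actP_prod; apply: eq_bigr => j _; rewrite actPB !actPXn !mxE.
  by rewrite !actPX !exprZn -!exprM ![(_ * 2)%N]mulnC !exprM !sqrrN !expr1n !scale1r.
rewrite vdm_det mulrC -odd_permV -det_perm -det_mulmx -col_permE.
by congr (\det _); apply/matrixP => i j; rewrite !mxE.
Qed.

Lemma vdm_neq0 : vdm != 0.
Proof.
apply/prodf_neq0 => i _; apply/prodf_neq0 => j ij.
apply/negP => /eqP/(congr1 (mcoeff (U_(j) *+ 2)%MM)).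
rewrite mcoeffB !mpolyXn !mcoeffX mcoeff0 eqxx.
case: eqP => [/mnmP/(_ j)|_]; last by rewrite subr0 => /eqP; rewrite oner_eq0.
by rewrite !mulmnE !mnm1E eqxx; case: eqP ij => // ->; rewrite ltnn.
Qed.

Lemma DeltaE : exists2 k : C, k != 0 & Delta R n = k *: vdm.
Proof.
exists ((-1) ^+ n.-1 * 2%:R ^+ n.-1 * ((n.-1)`!)%:R) => //.
by rewrite !mulf_neq0 ?expf_neq0 ?oppr_eq0 ?oner_eq0 ?pnatr_eq0 // -lt0n fact_gt0.
Qed.

Lemma Delta_neq0 : Delta R n != 0.
Proof. by have [k k0 ->] := DeltaE; rewrite scaler_eq0 negb_or k0 vdm_neq0. Qed.
Lemma actP_Delta w : actP w (Delta R n) = (-1) ^+ (prmW w : bool) * Delta R n.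
Proof. by have [k k0 ->] := DeltaE; rewrite actPZ actP_vdm scalerAr. Qed.

Definition Jpol : 'M[Pol]_n := \matrix_(i, j) mderiv i (tnth (yvar R n) j).
(** The factor of column j of the Jacobian matrix after multiplication of each
    row by its variable: 2(j+1) for the power sum of the x_i^(2(j+1)), and the
    product of the variables for the last column, which becomes constant. *)
Definition jcol (j : 'I_n) : Pol :=
  if (j.+1 < n)%N then (2 * j.+1)%:R else \prod_(i < n) 'X_i.

(** Multiplication by x_i turns the Jacobian matrix into a Vandermonde matrix
    in the squares; the last column, which is that of the powers of exponent
    0, comes first there, whence the cyclic successor ordS. *)
Lemma Jpol_euler i j : 'X_i * Jpol i j = ('X_i ^+ 2) ^+ ordS j * jcol j.
Proof.
rewrite mxE tnth_mktuple /jcol; case: ifP => jn.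
  rewrite raddf_sum mulr_sumr (bigD1 i) //= big1 ?addr0.
    rewrite mpolyXn mderiv_euler mulmnE mnm1E eqxx mul1n -mpolyXn modn_small //.
    by rewrite -exprM scaler_nat mulr_natr.
  move=> k /negPf ki; rewrite mpolyXn mderiv_euler mulmnE mnm1E ki mul0n.
  by rewrite scale0r.
have jE : j.+1 = n by move: (ltn_ord j); lia.
have -> : \prod_(k < n) 'X_k = 'X_[[multinom 1%N | k < n]] :> Pol.
  by rewrite mpolyXE_id; apply: eq_bigr => k _; rewrite mnmE expr1.
by rewrite mderiv_euler mnmE scale1r /= jE modnn expr0 mul1r.
Qed.

(** By Jpol_euler, x_1...x_n times the determinant is a Vandermonde
    determinant in the squares with its columns permuted cyclically, times the
    product of the factors jcol, where x_1...x_n appears once; it is then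
    cancelled. *)
Lemma det_Jpol : exists2 k : C, k != 0 & \det Jpol = k *: vdm.
Proof.
pose c := perm (@ordS_inj n).
exists ((-1) ^+ c * \prod_(j < n | (j.+1 < n)%N) (2 * j.+1)%:R).
  rewrite mulf_neq0 ?expf_neq0 ?oppr_eq0 ?oner_eq0 //.
  by apply/prodf_neq0 => j _; rewrite pnatr_eq0 muln_eq0.
(* Multiply row i by x_i. *)
have X0 : \prod_(i < n) 'X_i != 0 :> Pol.
  by apply/prodf_neq0 => i _; exact: mpolyX_neq0.
apply: (mulfI X0).
have -> : \prod_(i < n) 'X_i * \det Jpol = \det (diag_mx (\row_i 'X_i) *m Jpol).
  by rewrite det_mulmx det_diag; congr (_ * _); apply: eq_bigr => i _; rewrite mxE.
have -> : diag_mx (\row_i 'X_i) *m Jpol =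
    col_perm c (Vandermonde n (\row_(i < n) ('X_i ^+ 2 : Pol)))^T
      *m diag_mx (\row_j jcol j).
  apply/matrixP => i j; rewrite mul_diag_mx mul_mx_diag !mxE permE.
  have := Jpol_euler i j; rewrite mxE; exact.
rewrite det_mulmx det_diag col_permE det_mulmx det_perm det_tr -vdm_det odd_permV.
have -> : \prod_(j < n) (\row_j jcol j) 0 j =
    (\prod_(j < n | (j.+1 < n)%N) (2 * j.+1)%:R)%:MP * \prod_(i < n) 'X_i.
  under eq_bigr do rewrite mxE.
  rewrite (bigID (fun j : 'I_n => j.+1 < n)%N) /=; congr (_ * _).
    rewrite rmorph_prod /=; apply: eq_bigr => j jn.
    by rewrite /jcol jn mpolyC_nat.
  have n1 : (n.-1 < n)%N by lia.
  rewrite (big_pred1 (Ordinal n1)) /=; first by rewrite /jcol /= prednK // ltnn.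
  move=> j /=; rewrite -leqNgt; apply/idP/eqP => [h|-> /=]; last by lia.
  by apply: val_inj => /=; move: (ltn_ord j); lia.
rewrite -mul_mpolyC mpolyCM; have -> : ((-1) ^+ c)%:MP = (-1) ^+ c :> Pol.
  by rewrite rmorphXn /= mpolyCN mpolyC1.
exact: mul4_rearr.
Qed.

End Jacobian.

(** * The derivations along the invariants *)

Lemma derivation_frac_eq (F : fieldType) (d e : F -> F) (x y : F) :
  (forall a b, d (a * b) = d a * b + a * d b) ->
  (forall a b, e (a * b) = e a * b + a * e b) ->
  y != 0 -> d x = e x -> d y = e y -> d (x / y) = e (x / y).
Proof.
move=> dM eM y0 dx dy; have xE : x = x / y * y by rewrite divfK.
have d1 := dM (x / y) y; have e1 := eM (x / y) y; rewrite -xE in d1 e1.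
apply: (mulIf y0); apply: (@addIr _ (x / y * d y)).
by rewrite -d1 dx e1 dy.
Qed.

Lemma conj_derivation (T : comNzRingType) (s s' d : T -> T) :
  (forall a b, s (a + b) = s a + s b) -> (forall a b, s (a * b) = s a * s b) ->
  (forall a b, s' (a + b) = s' a + s' b) -> (forall a b, s' (a * b) = s' a * s' b) ->
  cancel s s' ->
  (forall a b, d (a + b) = d a + d b) -> (forall a b, d (a * b) = d a * b + a * d b) ->
  (forall a b, s' (d (s (a + b))) = s' (d (s a)) + s' (d (s b))) /\
  (forall a b, s' (d (s (a * b))) = s' (d (s a)) * b + a * s' (d (s b))).
Proof.
move=> sD sM s'D s'M sK dD dM; split=> a b; first by rewrite sD dD s'D.
by rewrite sM dM s'D !s'M !sK.
Qed.

Section Operators.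
Variables (R : realType) (n : nat).
Hypothesis n_gt0 : (0 < n)%N.
Notation C := R[i].
Notation Pol := {mpoly C[n]}.
Notation K := (KX R n).
Implicit Types (p q : Pol) (x y z : K).
Notation Ot := (@Otilde R n).
Notation Dl := (Delta R n).

Lemma inK_Delta_neq0 : inK Dl != 0. Proof. exact/inK_neq0/Delta_neq0. Qed.
Lemma Ot_poly p : Ot (inK p).
Proof. by exists p, 0%N; rewrite expr0 divr1. Qed.
Lemma Ot0 : Ot 0. Proof. by rewrite -inK0; apply: Ot_poly. Qed.
Lemma Ot1 : Ot 1. Proof. by rewrite -inK1; apply: Ot_poly. Qed.
Lemma cstKM (a b : C) : cstK n (a * b) = cstK n a * cstK n b.
Proof. by rewrite /cstK mpolyCM inKM. Qed.
Lemma Ot_cst c : Ot (cstK n c). Proof. exact: Ot_poly. Qed.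
Lemma OtD x y : Ot x -> Ot y -> Ot (x + y).
Proof.
move=> [p [k ->]] [q [l ->]]; exists (p * Dl ^+ l + q * Dl ^+ k), (k + l)%N.
have D0 := inK_Delta_neq0.
by rewrite inKD !inKM !inKXn exprD addf_div ?expf_neq0.
Qed.

Lemma OtM x y : Ot x -> Ot y -> Ot (x * y).
Proof.
move=> [p [k ->]] [q [l ->]]; exists (p * q), (k + l)%N.
by rewrite inKM exprD mulf_div.
Qed.

Lemma Ot_invDelta : Ot (inK Dl)^-1.
Proof. by exists 1, 1%N; rewrite inK1 expr1 mul1r. Qed.
Lemma OtX x k : Ot x -> Ot (x ^+ k).
Proof.
by move=> h; elim: k => [|k IH]; rewrite ?expr0 ?exprS; [apply: Ot1|apply: OtM].
Qed.

Lemma OtN x : Ot x -> Ot (- x).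
Proof. by move=> [p [k ->]]; exists (- p), k; rewrite inKN mulNr. Qed.
Lemma Ot_sum (I : Type) (r : seq I) (P : pred I) (f : I -> K) :
  (forall i, P i -> Ot (f i)) -> Ot (\sum_(i <- r | P i) f i).
Proof. by move=> h; elim/big_rec: _ => [|i x Pi Ox]; [apply: Ot0|apply: OtD; first exact: h]. Qed.

Lemma actF_Ot w x : Ot x -> Ot (actF w x).
Proof.
move=> [p [k ->]]; exists (actP w p * ((-1) ^+ (prmW w : bool)) ^+ k), k.
rewrite actF_mul actFV; have -> : actF w (inK Dl ^+ k) = (inK (actP w Dl)) ^+ k.
  by rewrite rmorphXn /= actF_inK.
rewrite actF_inK actP_Delta inKM inKXn inKM.
set s := inK ((-1) ^+ _).
have s2 : s * s = 1 by rewrite /s -inKM -expr2 sqrr_sign inK1.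
have sk : s ^+ k * s ^+ k = 1 by rewrite -exprMn s2 expr1n.
have sk0 : s ^+ k != 0.
  by apply/negP => /eqP h; move: sk; rewrite h mul0r => /esym/eqP; rewrite oner_eq0.
rewrite exprMn invfM mulrA; congr (_ * _); congr (_ * _).
by rewrite -[LHS]mul1r -sk mulfK.
Qed.

Lemma dKD i x y : dK i (x + y) = dK i x + dK i y.
Proof.
have dK0 : dK i (0 : K) = 0.
  have := dKB i (0 : K) 0. by rewrite !subrr.
have dKN : dK i (- y) = - dK i y by rewrite -[- y]sub0r dKB dK0 sub0r.
by have := dKB i x (- y); rewrite dKN !opprK.
Qed.

Lemma dK_cst i (c : C) : dK i (cstK n c) = 0.
Proof. by rewrite /cstK dK_inK mderivC inK0. Qed.

Lemma dK_Ot i x : Ot x -> Ot (dK i x).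
Proof.
move=> [p [k ->]].
have D0 := inK_Delta_neq0.
have Oi : Ot (inK Dl ^+ k)^-1 by rewrite -exprVn; apply/OtX/Ot_invDelta.
rewrite dKM; apply: OtD; first by apply: OtM => //; rewrite dK_inK; apply: Ot_poly.
apply: OtM; first exact: Ot_poly.
have h : dK i ((inK Dl ^+ k)^-1) = - (dK i (inK Dl ^+ k) * ((inK Dl ^+ k)^-1 * (inK Dl ^+ k)^-1)).
  have u0 : inK Dl ^+ k != 0 by rewrite expf_neq0.
  have := dKM i (inK Dl ^+ k) ((inK Dl ^+ k)^-1).
  rewrite mulfV // -inK1 dK_inK; have -> : mderiv i 1 = 0 :> Pol by rewrite -mpolyC1 mderivC.
  rewrite inK0 => /esym/eqP; rewrite addr_eq0 => /eqP h.
  by rewrite mulrA h mulNr opprK mulrAC mulfV // mul1r.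
rewrite h; apply/OtN/OtM; last exact: OtM.
by rewrite -inKXn dK_inK; apply: Ot_poly.
Qed.

Definition JK : 'M[K]_n := \matrix_(i, j) inK (Jpol R n i j).
Lemma det_JK : \det JK = inK (\det (Jpol R n)).
Proof.
rewrite -(det_map_mx (@inK R n)); congr (\det _).
by apply/matrixP => i j; rewrite !mxE.
Qed.

Lemma det_JK_neq0 : \det JK != 0.
Proof.
have [k k0 h] := det_Jpol R n_gt0.
by rewrite det_JK h inK_eq0 scaler_eq0 negb_or k0 vdm_neq0.
Qed.

Lemma JK_unit : JK \in unitmx.
Proof. by rewrite unitmxE unitfE det_JK_neq0. Qed.
Definition GK : 'M[K]_n := invmx JK.
(** Cramer's rule: the cofactors are polynomials and the determinant is a
    multiple of Delta. *)
Lemma GK_Ot j i : Ot (GK j i).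
Proof.
rewrite /GK /invmx JK_unit mxE mxE; apply: OtM.
  have [k k0 h] := det_Jpol R n_gt0; have [l l0 h'] := DeltaE R n.
  have -> : (\det JK)^-1 = cstK n (l / k) * (inK Dl)^-1.
    rewrite det_JK h h' -!mul_mpolyC !inKM !invfM mulrA; congr (_ * _).
    have c0 (c : C) : c != 0 -> cstK n c != 0 by move=> c0; rewrite inK_eq0 mpolyC_eq0.
    have e : cstK n (l / k) * cstK n k = cstK n l by rewrite -cstKM divfK.
    by rewrite -/(cstK n l) -/(cstK n k) -e invfM mulrA mulfV ?mul1r // c0 // mulf_neq0 ?invr_neq0.
  by apply: OtM; [apply: Ot_cst|apply: Ot_invDelta].
have -> : cofactor JK i j = inK (cofactor (Jpol R n) i j).
  rewrite /cofactor inKM inKXn inKN inK1; congr (_ * _).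
  rewrite -(det_map_mx (@inK R n)); congr (\det _).
  by apply/matrixP => a b; rewrite !mxE.
exact: Ot_poly.
Qed.

Definition dY (j : 'I_n) (x : K) : K := \sum_i GK j i * dK i x.

Lemma dYD j x y : dY j (x + y) = dY j x + dY j y.
Proof. by rewrite -big_split; apply: eq_bigr => i _ /=; rewrite dKD mulrDr. Qed.
Lemma dYM j x y : dY j (x * y) = dY j x * y + x * dY j y.
Proof.
rewrite mulr_suml mulr_sumr -big_split; apply: eq_bigr => i _ /=.
rewrite dKM mulrDr mulrA; congr (_ + _); exact: mulrCA.
Qed.

Lemma dY_cst j (c : C) : dY j (cstK n c) = 0.
Proof. by rewrite /dY big1 // => i _; rewrite dK_cst mulr0. Qed.
Lemma dY_yvar j l : dY j (inK (tnth (yvar R n) l)) = (j == l)%:R.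
Proof.
have /matrixP/(_ j l) : GK *m JK = 1%:M by exact: (mulVmx JK_unit).
rewrite mxE [RHS]mxE => <-; apply: eq_bigr => i _; congr (_ * _).
by rewrite dK_inK mxE mxE.
Qed.

Lemma dY_Ot j x : Ot x -> Ot (dY j x).
Proof. by move=> Ox; apply: Ot_sum => i _; apply: OtM; [apply: GK_Ot|apply: dK_Ot]. Qed.
(** The chain rule backwards: the partial derivatives are combinations of the
    derivations along the invariants, with polynomial coefficients. *)
Lemma dK_dY i x : dK i x = \sum_j inK (Jpol R n i j) * dY j x.
Proof.
under eq_bigr do rewrite mulr_sumr.
rewrite exchange_big /= (bigD1 i) //= [X in _ + X]big1 ?addr0.
  under eq_bigr do rewrite mulrA.
  rewrite -mulr_suml; have /matrixP/(_ i i) : JK *m GK = 1%:M by exact: (mulmxV JK_unit).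
  rewrite mxE [RHS]mxE eqxx; under eq_bigr do rewrite [JK _ _]mxE.
  by move=> ->; rewrite mul1r.
move=> k /negPf ki; under eq_bigr do rewrite mulrA.
rewrite -mulr_suml; have /matrixP/(_ i k) : JK *m GK = 1%:M by exact: (mulmxV JK_unit).
rewrite mxE [RHS]mxE eq_sym ki; under eq_bigr do rewrite [JK _ _]mxE.
by move=> ->; rewrite mul0r.
Qed.

Definition inK_rmorph : {rmorphism Pol -> K} := @inK R n.
Definition inKY : {rmorphism Pol -> K} := @inK R n \o comp_mpoly (yvar R n).
Lemma derivation_inK (d : K -> K) :
  (forall a b, d (a + b) = d a + d b) ->
  (forall a b, d (a * b) = d a * b + a * d b) -> (forall c : C, d (cstK n c) = 0) ->
  forall p, d (inK p) = \sum_i inK (mderiv i p) * d (inK 'X_i).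
Proof. by move=> dD dM dC p; exact: (@derivation_chain _ _ _ inK_rmorph d dD dM dC p). Qed.
Lemma derivation_inKY (d : K -> K) :
  (forall a b, d (a + b) = d a + d b) ->
  (forall a b, d (a * b) = d a * b + a * d b) -> (forall c : C, d (cstK n c) = 0) ->
  forall q, d (inK (q \mPo yvar R n)) =
    \sum_i inK (mderiv i q \mPo yvar R n) * d (inK (tnth (yvar R n) i)).
Proof.
move=> dD dM dC q.
have dC' c : d (inKY c%:MP) = 0 by rewrite -(dC c); congr (d (inK _)); apply: comp_mpolyC.
rewrite (@derivation_chain _ _ _ inKY d dD dM dC' q).
apply: eq_bigr => i _.
have <- : 'X_i \mPo yvar R n = tnth (yvar R n) i by rewrite comp_mpolyXU -tnth_nth.
by [].
Qed.

Lemma extends_cst j d (c : C) : @extends_partial_y R n j d -> d (cstK n c) = 0.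
Proof.
move=> [_ _ /(_ c%:MP)]; rewrite comp_mpolyC => ->.
by rewrite mderivC comp_mpoly0 inK0.
Qed.

Lemma dY_extends j : @extends_partial_y R n j (dY j).
Proof.
split; [exact: dYD|exact: dYM|move=> q].
rewrite derivation_inKY; [|exact: dYD|exact: dYM|exact: dY_cst].
rewrite (bigD1 j) //= big1 ?addr0 ?dY_yvar ?eqxx ?mulr1 //.
by move=> i /negPf ij; rewrite dY_yvar eq_sym ij mulr0.
Qed.

Lemma mderivXU (i j : 'I_n) : mderiv i 'X_j = (i == j)%:R :> Pol.
Proof.
rewrite mderivX mnm1E eq_sym; case: eqP => [->|_]; last by rewrite scale0r.
have -> : (U_(j) - U_(j))%MM = 0%MM :> 'X_{1..n}.
  by apply/mnmP => k; rewrite mnmBE mnm0E subnn.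
by rewrite scale1r mpolyX0.
Qed.

(** Applied to the y_l, the chain rule is a linear system for the values on
    the variables x_i, with the invertible Jacobian matrix. These values
    determine a derivation of the field of fractions. *)
Lemma extends_uniq j d : @extends_partial_y R n j d -> forall x, d x = dY j x.
Proof.
move=> dE; have dC c := extends_cst c dE; have [dD dM dq] := dE.
have dX i : d (inK 'X_i) = GK j i.
  have h : (\row_i d (inK 'X_i)) *m JK = delta_mx 0 j.
    apply/rowP => l; rewrite mxE [RHS]mxE eqxx /=.
    have := dq 'X_l; rewrite comp_mpolyXU -tnth_nth mderivXU.
    rewrite derivation_inK // => h; transitivity (inK ((j == l)%:R \mPo yvar R n)).
      rewrite -h; apply: eq_bigr => k _; rewrite mxE mxE mxE mulrC; congr (_ * _).
    by rewrite (eq_sym j l); case: (l == j); rewrite /= ?mulr1n ?mulr0n ?comp_mpoly1 ?comp_mpoly0 ?inK1 ?inK0.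
  have : (\row_i d (inK 'X_i)) = delta_mx 0 j *m GK.
    by rewrite -h -mulmxA (mulmxV JK_unit) mulmx1.
  by rewrite -rowE => /rowP/(_ i); rewrite !mxE.
have dP p : d (inK p) = dY j (inK p).
  rewrite derivation_inK //; apply: eq_bigr => i _.
  by rewrite dX dK_inK mulrC.
move=> x; elim/KX_ind: x => p q q0.
by apply: derivation_frac_eq; [exact: dM|exact: dYM|exact: inK_neq0|exact: dP|exact: dP].
Qed.

Lemma actF_comp_yvar w (q : Pol) : actF w (inK (q \mPo yvar R n)) = inK (q \mPo yvar R n).
Proof. by rewrite actF_inK actP_comp_yvar. Qed.
(** The conjugate by w of the derivation along y_j also extends the partial
    derivative on the invariants, and there is only one such derivation. *)
Lemma dY_actF w j x : dY j (actF w x) = actF w (dY j x).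
Proof.
have actFK y : actF w (actF w^-1%g y) = y by rewrite -actFM mulgV actF1.
have actFK' : cancel (@actF R n w) (actF w^-1%g).
  by move=> y; rewrite -actFM mulVg actF1.
have [hD hM] := conj_derivation (actFD w) (actF_mul w) (actFD w^-1%g)
  (actF_mul w^-1%g) actFK' (dYD j) (dYM j).
have h : @extends_partial_y R n j (fun x => actF w^-1%g (dY j (actF w x))).
  split=> [a b|a b|q]; [exact: hD|exact: hM|].
  by rewrite actF_comp_yvar (let: And3 _ _ h := dY_extends j in h) actF_comp_yvar.
have e : actF w^-1%g (dY j (actF w x)) = dY j x := extends_uniq h x.
have e2 : actF w (actF w^-1%g (dY j (actF w x))) = actF w (dY j x) := congr1 (@actF R n w) e.
exact (etrans (esym (actFK (dY j (actF w x)))) e2).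
Qed.

Lemma DtildeD P : @Dtilde R n P -> forall x y, P (x + y) = P x + P y.
Proof.
elim=> {P} [c|j|j d dE||P Q _ hP _ hQ|P Q _ hP _ hQ] x y; rewrite ?mulrDr //.
- by rewrite !(extends_uniq dE) dYD.
- by rewrite hP hQ addrACA.
- by rewrite hQ hP.
Qed.

Lemma Dtilde_scale P : @Dtilde R n P -> forall (c : C) x, P (cstK n c * x) = cstK n c * P x.
Proof.
elim=> {P} [c'|j|j d dE||P Q _ hP _ hQ|P Q _ hP _ hQ] c x.
- by rewrite mulrCA.
- by rewrite mulrCA.
- by rewrite !(extends_uniq dE) dYM dY_cst mul0r add0r.
- by rewrite mulrCA.
- by rewrite hP hQ mulrDr.
- by rewrite hQ hP.
Qed.

Lemma Dtilde_actF P : @Dtilde R n P -> forall w x, P (actF w x) = actF w (P x).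
Proof.
elim=> {P} [c'|j|j d dE||P Q _ hP _ hQ|P Q _ hP _ hQ] w x.
- by rewrite (actF_mul w (cstK n c')) actF_cst.
- by rewrite (actF_mul w (inK (tnth (yvar R n) j))) actF_inK actP_yvar.
- by rewrite !(extends_uniq dE) dY_actF.
- have -> : inK Dl ^+ 2 = inK (Dl ^+ 2) by rewrite inKXn.
  have Dw : actP w (Dl ^+ 2) = Dl ^+ 2.
    by rewrite actPXn actP_Delta exprMn sqrr_sign mul1r.
  by rewrite (actF_mul w _ x) actFV actF_inK Dw.
- by rewrite hP hQ -actFD.
- by rewrite hQ hP.
Qed.

Lemma Dtilde_Ot P : @Dtilde R n P -> forall x, Ot x -> Ot (P x).
Proof.
elim=> {P} [c'|j|j d dE||P Q _ hP _ hQ|P Q _ hP _ hQ] x Ox.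
- by apply: OtM => //; apply: Ot_cst.
- by apply: OtM => //; apply: Ot_poly.
- by rewrite (extends_uniq dE); apply: dY_Ot.
- by apply: OtM => //; rewrite -exprVn; apply/OtX/Ot_invDelta.
- by apply: OtD; [apply: hP|apply: hQ].
- by apply: hP; apply: hQ.
Qed.

Lemma Dtilde_id : @Dtilde R n id.
Proof.
have -> : id = (fun x : K => cstK n 1 * x).
  by apply: funext => x; rewrite /cstK mpolyC1 inK1 mul1r.
exact: Dtilde_cst.
Qed.

Lemma Dtilde_poly (q : Pol) : @Dtilde R n (fun x => inK (q \mPo yvar R n) * x).
Proof.
elim/mpoly_gen_ind: q => [c|i|p q hp hq|p q hp hq].
- by rewrite comp_mpolyC; apply: Dtilde_cst.
- by rewrite comp_mpolyXU -tnth_nth; apply: Dtilde_y.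
- have -> : (fun x : K => inK ((p + q) \mPo yvar R n) * x) =
    (fun x => inK (p \mPo yvar R n) * x + inK (q \mPo yvar R n) * x).
    by apply: funext => x; rewrite comp_mpolyD inKD mulrDl.
  exact: Dtilde_add hp hq.
- have -> : (fun x : K => inK ((p * q) \mPo yvar R n) * x) =
    (fun x => inK (p \mPo yvar R n) * (inK (q \mPo yvar R n) * x)).
    by apply: funext => x; rewrite rmorphM /= inKM mulrA.
  exact: Dtilde_comp hp hq.
Qed.

Lemma Dtilde_dY j : @Dtilde R n (dY j).
Proof. exact: Dtilde_dy (dY_extends j). Qed.
End Operators.

(** * Invariant polynomials *)

Section Newton.
Variables (T : idomainType).

Lemma deriv_prod (n : nat) (f : 'I_n -> {poly T}) :
  (\prod_i f i)^`() = \sum_i (f i)^`() * \prod_(j | j != i) f j.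
Proof.
elim: n f => [|n IH] f; first by rewrite !big_ord0 -[1]/(1%:P) derivC.
rewrite big_ord_recl derivM IH [RHS]big_ord_recl; congr (_ * _ + _).
  by rewrite [RHS]big_mkcond big_ord_recl /= mul1r.
rewrite mulr_sumr; apply: eq_bigr => i _.
rewrite [in RHS]big_mkcond big_ord_recl /= mulrCA; congr (_ * _); congr (_ * _).
by rewrite big_mkcond; apply: eq_bigr => j _; rewrite (inj_eq lift_inj).
Qed.

Variables (n : nat) (a : 'I_n -> T).
Let P : {poly T} := \prod_i ('X - (a i)%:P).
Let Q i : {poly T} := \prod_(j | j != i) ('X - (a j)%:P).

Lemma size_P : size P = n.+1.
Proof. by rewrite size_prod_XsubC -[index_enum _]enumT size_enum_ord. Qed.
Lemma P_lead : P`_n = 1.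
Proof.
have := monic_prod_XsubC (index_enum 'I_n) predT a; rewrite -/P monicE /lead_coef size_P.
by move/eqP.
Qed.

Lemma PQ i : P = ('X - (a i)%:P) * Q i.
Proof. by rewrite /P (bigD1 i). Qed.
Lemma Q_coef i k : (Q i)`_k = P`_k.+1 + a i * (Q i)`_k.+1.
Proof. by rewrite (PQ i) mulrBl coefB coefXM coefCM subrK. Qed.
Lemma Q_coef_big i k : (n <= k)%N -> (Q i)`_k = 0.
Proof.
move=> nk; apply: nth_default; apply: leq_trans nk.
have Q0 : Q i != 0.
  by apply/negP => /eqP Q0; move: size_P; rewrite (PQ i) Q0 mulr0 size_poly0.
have := size_P; rewrite (PQ i) (size_monicM (monicXsubC _) Q0) size_XsubC => h.
by move: h; rewrite add2n /= => -[->].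
Qed.

(** The coefficients of P / (X - a_i), by synthetic division started from the
    top. *)
Lemma Q_coefE i m k : (n <= m + k)%N ->
  (Q i)`_k = \sum_(t < m) a i ^+ t * P`_(k.+1 + t).
Proof.
elim: m k => [|m IH] k h; first by rewrite big_ord0 Q_coef_big.
rewrite Q_coef big_ord_recl expr0 mul1r addn0 IH ?addnS // ?addSn //; congr (_ + _).
rewrite mulr_sumr; apply: eq_bigr => t _; rewrite mulrA -exprS.
by rewrite addnS addSn.
Qed.

(** Newton's identities, read off P' = \sum_i P / (X - a_i). *)
Lemma newton k : P`_k.+1 *+ k.+1 =
  \sum_(t < n - k) (\sum_i a i ^+ t) * P`_(k.+1 + t).
Proof.
rewrite -coef_deriv deriv_prod coef_sum.
transitivity (\sum_i \sum_(t < n - k) a i ^+ t * P`_(k.+1 + t)).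
  apply: eq_bigr => i _; rewrite derivXsubC mul1r -/(Q i) (@Q_coefE _ (n - k)%N) //.
  by lia.
by rewrite exchange_big; apply: eq_bigr => t _; rewrite mulr_suml.
Qed.

Variable S : T -> Prop.
Hypothesis S1 : S 1.
Hypothesis SD : forall x y, S x -> S y -> S (x + y).
Hypothesis SN : forall x, S x -> S (- x).
Hypothesis SM : forall x y, S x -> S y -> S (x * y).
Hypothesis Sdiv : forall x k, (0 < k)%N -> S (x *+ k) -> S x.

Lemma S0 : S 0. Proof. by rewrite -(subrr 1); apply: SD => //; apply: SN. Qed.

(** The power sum of exponent 0 is n, so that the identity of newton for the
    coefficient of index k, where 0 < k < n, gives (n - k) times this
    coefficient in terms of higher coefficients and of power sums of exponents
    below n. The power sum of exponent n would occur for k = 0 only. *)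
Lemma newton_sub : (forall t, (0 < t < n)%N -> S (\sum_i a i ^+ t)) ->
  forall k, (0 < k <= n)%N -> S P`_k.
Proof.
move=> hp k; move eqm: (n - k)%N => m; elim/ltn_ind: m k eqm => m IH [//|k] km /= kn.
have [kn1|kn1] := eqVneq k.+1 n; first by rewrite kn1 P_lead.
(* The term of exponent 0 of the right-hand side of newton is n times the
   coefficient. *)
apply: (@Sdiv _ (n - k.+1)%N); first by move: kn kn1; lia.
have := newton k; have -> : (n - k = (n - k.+1).+1)%N by lia.
rewrite big_ord_recl addn0; under eq_bigr do rewrite expr0.
rewrite sumr_const card_ord mulr_natl => h.
have -> : P`_k.+1 *+ (n - k.+1) = - \sum_(t < n - k.+1) (\sum_i a i ^+ t.+1) * P`_(k.+1 + t.+1).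
  apply/eqP; rewrite -addr_eq0; apply/eqP.
  apply: (@addrI _ (P`_k.+1 *+ k.+1)); rewrite addrA -mulrnDr subnKC // addr0.
  by rewrite h; congr (_ + _).
apply: SN; elim/big_rec: _ => [|t x _ Sx]; first exact: S0.
have tl := ltn_ord t; apply: SD => //; apply: SM; first by apply: hp; lia.
apply: (IH (n - (k.+1 + t.+1))%N) => //; lia.
Qed.

End Newton.

Lemma expV_mulK (F : fieldType) (d b : F) k : d != 0 -> b = d^-1 ^+ k * (b * d ^+ k).
Proof. by move=> d0; rewrite exprVn mulrC mulfK // expf_neq0. Qed.
Lemma sign_mulK (T : pzRingType) k (x : T) : x = (-1) ^+ k * ((-1) ^+ k * x).
Proof. by rewrite mulrA -expr2 sqrr_sign mul1r. Qed.
Lemma comp_mpoly_mul (n k : nat) (S : comNzRingType) (t : n.-tuple {mpoly S[k]}) p q :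
  (p * q) \mPo t = (p \mPo t) * (q \mPo t).
Proof. exact: rmorphM. Qed.

Lemma mesym_morph (n k : nat) (S S' : nzRingType) (T : comNzRingType)
    (f : {rmorphism {mpoly S[n]} -> T}) (g : {rmorphism {mpoly S'[n]} -> T}) :
  (forall i, f 'X_i = g 'X_i) -> f (mesym n S k) = g (mesym n S' k).
Proof.
move=> fg; rewrite /mesym !rmorph_sum /=; apply: eq_bigr => A _.
by rewrite !rmorph_prod /=; apply: eq_bigr => i _.
Qed.

Section Invariants.
Variables (R : realType) (n : nat).
Hypothesis n_gt0 : (0 < n)%N.
Notation C := R[i].
Notation Pol := {mpoly C[n]}.
Notation y := (yvar R n).

Definition InY (p : Pol) := exists q : Pol, p = q \mPo y.
Lemma InYC c : InY c%:MP. Proof. by exists c%:MP; rewrite comp_mpolyC. Qed.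
Lemma InY1 : InY 1. Proof. by rewrite -mpolyC1; apply: InYC. Qed.
Lemma InYD p q : InY p -> InY q -> InY (p + q).
Proof. by move=> [p' ->] [q' ->]; exists (p' + q'); rewrite comp_mpolyD. Qed.
Lemma InYN p : InY p -> InY (- p).
Proof. by move=> [p' ->]; exists (- p'); rewrite comp_mpolyN. Qed.
Lemma InYM p q : InY p -> InY q -> InY (p * q).
Proof. by move=> [p' ->] [q' ->]; exists (p' * q'); rewrite rmorphM. Qed.
Lemma InYZ c p : InY p -> InY (c *: p).
Proof. by move=> [p' ->]; exists (c *: p'); rewrite comp_mpolyZ. Qed.
Lemma InYX p k : InY p -> InY (p ^+ k).
Proof. by move=> h; elim: k => [|k IH]; rewrite ?expr0 ?exprS; [apply: InY1|apply: InYM]. Qed.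
Lemma InYdiv p k : (0 < k)%N -> InY (p *+ k) -> InY p.
Proof.
move=> k0 /(InYZ (k%:R)^-1); rewrite -scalerMnr scalerMnl -mulr_natr mulVf ?scale1r //.
by rewrite pnatr_eq0 -lt0n.
Qed.

Lemma InY_yvar j : InY (tnth y j).
Proof. by exists 'X_j; rewrite comp_mpolyXU -tnth_nth. Qed.
Lemma yvar_last : exists j, tnth y j = \prod_(i < n) 'X_i.
Proof.
have n1 : (n.-1 < n)%N by rewrite prednK.
by exists (Ordinal n1); rewrite tnth_mktuple /= prednK // ltnn.
Qed.

Lemma InY_prodX : InY (\prod_(i < n) 'X_i).
Proof. by have [j <-] := yvar_last; apply: InY_yvar. Qed.
Lemma InY_power t : (0 < t < n)%N -> InY (\sum_(i < n) ('X_i ^+ 2) ^+ t).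
Proof.
case: t => // t /= tn; have t1 : (t < n)%N by lia.
have := InY_yvar (Ordinal t1); rewrite tnth_mktuple /= tn.
by under [X in InY X -> _]eq_bigr do rewrite exprM.
Qed.

Definition sq : n.-tuple Pol := [tuple 'X_i ^+ 2 | i < n].
(** The invariants y_j with j < n are the power sums of the squares of
    exponents 1, ..., n - 1; the constant coefficient, not covered by
    newton_sub, is the square of y_n up to sign. *)
Lemma InY_sq_coef k : (k <= n)%N -> InY (\prod_(i < n) ('X - ('X_i ^+ 2)%:P) : {poly Pol})`_k.
Proof.
move=> kn; case: (posnP k) => [->|k0].
  rewrite -horner_coef0 horner_prod.
  under eq_bigr do rewrite hornerXsubC sub0r -mulN1r.
  rewrite big_split /=; apply: InYM.
    by elim/big_rec: _ => [|i x _ h]; [apply: InY1|apply: InYM => //; apply/InYN/InY1].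
  under eq_bigr do rewrite expr2.
  by rewrite big_split /=; apply: InYM; apply: InY_prodX.
apply: (@newton_sub _ n (fun i => 'X_i ^+ 2 : Pol) InY InY1 InYD InYN InYM InYdiv InY_power).
by rewrite k0.
Qed.

Lemma InY_mesym k : (k <= n)%N -> InY (mesym n C k \mPo sq).
Proof.
move=> kn; have k1 : (k < n.+1)%N by [].
have := mroots_coeff sq (Ordinal k1).
have -> : \prod_(c <- sq) ('X - c%:P) = \prod_(i < n) ('X - ('X_i ^+ 2)%:P) :> {poly Pol}.
  by rewrite big_tuple; apply: eq_bigr => i _; rewrite tnth_mktuple.
move=> h.
have e1 : mesym n C k \mPo sq = (mesym n Pol k).@[tnth sq].
  apply: (@mesym_morph _ _ _ _ _ (comp_mpoly sq) (@meval n Pol (tnth sq))) => i /=.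
  by rewrite comp_mpolyXU -tnth_nth mevalXU.
have e2 : (mesym n Pol k).@[tnth sq] = (-1) ^+ k * ((-1) ^+ k * (mesym n Pol k).@[tnth sq]).
  exact: sign_mulK.
rewrite e1 e2; apply: InYM; first by apply/InYX/InYN/InY1.
rewrite -[X in InY X]h; apply: InY_sq_coef; exact: leq_subr.
Qed.

(** The fundamental theorem on symmetric polynomials, the elementary symmetric
    polynomials of the squares being the coefficients above. *)
Lemma InY_sym (q : Pol) : q \is symmetric -> InY (q \mPo sq).
Proof.
move=> /sym_fundamental [t [<- _]].
elim/mpoly_gen_ind: t => [c|i|p q' hp hq|p q' hp hq].
- by rewrite !comp_mpolyC; apply: InYC.
- rewrite comp_mpolyXU -tnth_nth tnth_mktuple; exact: InY_mesym.
- rewrite (comp_mpolyD _ p q') (comp_mpolyD sq); exact: InYD hp hq.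
- rewrite (comp_mpoly_mul _ p q') (comp_mpoly_mul sq); exact: InYM hp hq.
Qed.

Lemma perm_in_WD (s : {perm 'I_n}) : Dn_pred ([ffun=> false], s).
Proof. by rewrite /Dn_pred big1 // => k _; rewrite ffunE. Qed.
Definition permW s : WD n := Sub _ (perm_in_WD s).
Lemma prmW_permW s : prmW (permW s) = s. Proof. by []. Qed.
Lemma sgnW_permW s k : sgnW (permW s) k = false. Proof. by rewrite /sgnW ffunE. Qed.
Lemma flip_in_WD (i j : 'I_n) : i != j ->
  Dn_pred ([ffun k => (k == i) || (k == j)], (1%g : {perm 'I_n})).
Proof.
move=> ij; rewrite /Dn_pred /= (bigD1 i) //= (bigD1 j) ?(eq_sym j) //=.
rewrite !ffunE !eqxx orbT big1 // => k /andP[/negPf ki /negPf kj].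
by rewrite ffunE ki kj.
Qed.

Definition flipW i j (ij : i != j) : WD n := Sub _ (flip_in_WD ij).

Lemma prmWM (u v : WD n) : prmW (u * v)%g = (prmW v * prmW u)%g. Proof. by []. Qed.

Definition reynolds (p : Pol) : Pol := \sum_(w : WD n) actP w p.
Lemma reynolds_act w p : reynolds (actP w p) = reynolds p.
Proof.
rewrite /reynolds [RHS](reindex_inj (mulIg w)) /=.
by apply: eq_bigr => v _; rewrite actPM.
Qed.

Definition mnm_act (s : {perm 'I_n}) (m : 'X_{1..n}) : 'X_{1..n} :=
  [multinom m ((s^-1)%g k) | k < n].
Definition msgn (w : WD n) (m : 'X_{1..n}) : bool :=
  \big[addb/false]_k (sgnW w k && odd (m k)).
Lemma msgnE w m : (-1) ^+ msgn w m = \prod_k ((-1) ^+ sgnW w k) ^+ m k :> C.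
Proof.
rewrite /msgn (big_morph (fun b : bool => (-1) ^+ b : C) (@signr_addb C) (erefl _)).
apply: eq_bigr => k _; case: (sgnW w k); last by rewrite expr0 expr1n.
by rewrite /= expr1 -[RHS]signr_odd.
Qed.

Lemma actP_mnm w (m : 'X_{1..n}) :
  actP w 'X_[C, m] = (-1) ^+ msgn w (mnm_act (prmW w) m) *: 'X_[mnm_act (prmW w) m].
Proof.
rewrite [in LHS]mpolyXE_id actP_prod.
under eq_bigr do rewrite actPXn actPX exprZn.
rewrite msgnE [in RHS]mpolyXE_id.
rewrite [in RHS](reindex_perm (prmW w)) /= [X in _ *: X](reindex_perm (prmW w)) /=.
rewrite -scaler_prod; apply: eq_bigr => k _.
by rewrite mnmE permK.
Qed.

Lemma sq_actP w (q : Pol) : actP w (q \mPo sq) = msym (prmW w) q \mPo sq.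
Proof.
pose f : {rmorphism Pol -> Pol} := actM R w \o comp_mpoly sq.
pose g : {rmorphism Pol -> Pol} := comp_mpoly sq \o (@msym n C (prmW w)).
apply: (@mpoly_hom_eq _ _ _ f g) => [c|i] /=.
  rewrite comp_mpolyC [LHS]actPC /msym.
  by rewrite mmapC comp_mpolyC.
rewrite comp_mpolyXU -tnth_nth tnth_mktuple [LHS]actPXn actPX exprZn -exprM mulnC exprM.
rewrite sqrrN expr1n expr1n scale1r /msym mmapX mmap1U.
by rewrite comp_mpolyXU -tnth_nth tnth_mktuple.
Qed.

Lemma InY_reynolds_sq (q : Pol) : InY (reynolds (q \mPo sq)).
Proof.
rewrite /reynolds; under eq_bigr do rewrite sq_actP.
rewrite -raddf_sum /=; apply: InY_sym; apply/issymP => s.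
rewrite raddf_sum /= [RHS](reindex_inj (mulgI (permW s))) /=.
by apply: eq_bigr => w _; rewrite prmWM msymMm prmW_permW.
Qed.

(** If the exponents of the monomial do not have the same parity, a change of
    two signs reverses it and its average vanishes; if they do, the monomial
    is y_n or 1 times a polynomial in the squares. *)
Lemma InY_reynolds_mnm m : InY (reynolds 'X_[C, m]).
Proof.
have [/forallP hpar|] := boolP [forall i, forall j, odd (m i) == odd (m j)].
  pose i0 := Ordinal n_gt0; pose c : nat := odd (m i0).
  have mE : 'X_[C, m] = (\prod_(i < n) 'X_i) ^+ c * ('X_[C, [multinom (m i)./2 | i < n]] \mPo sq).
    rewrite comp_mpolyX [LHS]mpolyXE_id -prodrXl -big_split; apply: eq_bigr => i _ /=.
    rewrite tnth_mktuple mnmE -exprM -exprD.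
    have /forallP/(_ i0)/eqP hi := hpar i; congr (_ ^+ _).
    by rewrite /c -hi mul2n odd_double_half.
  have prodW w : actP w (\prod_(i < n) 'X_i : Pol) = \prod_(i < n) 'X_i.
    by have [j <-] := yvar_last; apply: actP_yvar.
  rewrite /reynolds; have -> : \sum_(w : WD n) actP w 'X_[C, m] =
     (\prod_(i < n) 'X_i) ^+ c * reynolds ('X_[C, [multinom (m i)./2 | i < n]] \mPo sq).
    rewrite /reynolds mulr_sumr; apply: eq_bigr => w _.
    rewrite mE; apply: etrans (actP_mul _ _ _) _.
    by congr (_ * _); rewrite actPXn prodW.
  by apply: InYM; [apply/InYX/InY_prodX|apply: InY_reynolds_sq].
(* The exponents at i and j have different parities: flipping both signs
   changes the sign. *)
move/forallPn => [i /forallPn [j hij]].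
have ij : i != j by apply: contra hij => /eqP ->.
have /esym := reynolds_act (flipW ij) 'X_[C, m].
have h1 : mnm_act (prmW (flipW ij)) m = m.
  by apply/mnmP => k; rewrite mnmE /prmW /= invg1 perm1.
have h2 : msgn (flipW ij) m = true.
  rewrite /msgn (bigD1 i) //= (bigD1 j) ?(eq_sym j) //= big1 ?addbF.
    rewrite /sgnW !ffunE !eqxx orbT /=.
    by move: hij; case: (odd (m i)); case: (odd (m j)).
  by move=> k /andP[/negPf ki /negPf kj]; rewrite /sgnW ffunE ki kj.
rewrite actP_mnm h1 h2 expr1 => h.
have {h} : reynolds 'X_[C, m] = - reynolds 'X_[C, m].
  rewrite {1}h /reynolds -sumrN; apply: eq_bigr => w _.
  by rewrite actPZ scaleN1r.
move=> h; apply: (@InYdiv _ 2) => //.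
by rewrite mulr2n {1}h addNr -mpolyC0; apply: InYC.
Qed.

Theorem invariants_InY (p : Pol) : (forall w, actP w p = p) -> InY p.
Proof.
move=> pW; apply: (@InYdiv _ #|{: WD n}|); first by apply/card_gt0P; exists 1%g.
have -> : p *+ #|{: WD n}| = reynolds p.
  by rewrite /reynolds -sumr_const; apply: eq_bigr => w _; rewrite pW.
have -> : reynolds p = \sum_(m <- msupp p) p@_m *: reynolds 'X_[m].
  rewrite /reynolds; under [RHS]eq_bigr do rewrite scaler_sumr.
  rewrite [RHS]exchange_big; apply: eq_bigr => w _.
  apply: (etrans (congr1 (actP w) (mpolyE p))).
  by rewrite actP_sum; apply: eq_bigr => m _; rewrite actPZ.
elim/big_rec: _ => [|m x _ h]; first by rewrite -mpolyC0; apply: InYC.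
by apply: InYD => //; apply/InYZ/InY_reynolds_mnm.
Qed.

(** An invariant p / Delta^k equals p Delta^k / (Delta^2)^k, and its numerator
    is an invariant polynomial, because Delta^2 is invariant. *)
Theorem Dtilde_invariant (b : KX R n) : Otilde b -> (forall w, actF w b = b) ->
  Dtilde (fun x => b * x).
Proof.
move=> [p [k bE]] bW; pose D := Delta R n.
have D0 : inK D != 0 by exact: inK_Delta_neq0.
have D2W w : actP w (D ^+ 2) = D ^+ 2.
  by rewrite actPXn actP_Delta exprMn sqrr_sign mul1r.
have pE : inK (p * D ^+ k) = b * (inK D ^+ 2) ^+ k.
  by rewrite bE inKM inKXn -exprM mul2n -addnn exprD mulrA divfK ?expf_neq0.
have pW w : actP w (p * D ^+ k) = p * D ^+ k.
  apply: inK_inj; rewrite -actF_inK pE actF_mul bW; congr (_ * _).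
  by rewrite -!inKXn actF_inK actPXn D2W.
have [q hq] := invariants_InY pW.
have h m : Dtilde (fun x : KX R n => ((inK D ^+ 2)^-1) ^+ m * x).
  elim: m => [|m IH].
    have -> : (fun x : KX R n => ((inK D ^+ 2)^-1) ^+ 0 * x) = id.
      by apply: funext => x; rewrite expr0 mul1r.
    exact: Dtilde_id.
  have -> : (fun x : KX R n => ((inK D ^+ 2)^-1) ^+ m.+1 * x) =
     (fun x => (inK D ^+ 2)^-1 * (((inK D ^+ 2)^-1) ^+ m * x)).
    by apply: funext => x; rewrite exprS mulrA.
  exact: Dtilde_comp (@Dtilde_invDelta2 R n) IH.
have -> : (fun x => b * x) = (fun x => ((inK D ^+ 2)^-1) ^+ k * (inK (q \mPo y) * x)).
  apply: funext => x; rewrite -hq pE mulrA; congr (_ * _).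
  by apply: expV_mulK; rewrite expf_neq0.
exact: Dtilde_comp (h k) (Dtilde_poly q).
Qed.

End Invariants.

(** * Equivariant families related by an operator *)

(** O is the ring of coefficients, Poly its subring of polynomials, D the set
    of operators, der the partial derivations and dY those along the
    invariants, related by a Jacobian matrix with entries in O. *)
Section DifferentialGalois.
Variables (F K : fieldType) (cst : {rmorphism F -> K}) (W : finGroupType) (n : nat).
Variables (O Poly : K -> Prop) (der : 'I_n -> K -> K) (D : (K -> K) -> Prop).
Variables (aW : W -> {rmorphism K -> K}) (dY : 'I_n -> K -> K) (jac : 'I_n -> 'I_n -> K).
Hypothesis cardW : #|W|%:R != 0 :> F.
Hypothesis O_cst : forall c, O (cst c).
Hypothesis OD : forall x y, O x -> O y -> O (x + y).
Hypothesis OM : forall x y, O x -> O y -> O (x * y).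
Hypothesis O_poly : forall q, Poly q -> O q.
Hypothesis poly1 : Poly 1.
Hypothesis polyM : forall p q, Poly p -> Poly q -> Poly (p * q).
Hypothesis K_frac : forall x, exists b q, [/\ O b, Poly q, q != 0 & x = b / q].
Hypothesis poly_simple : forall I : K -> Prop,
  (forall c q, I q -> I (cst c * q)) -> (forall k q, I q -> I (der k q)) ->
  forall q, Poly q -> q != 0 -> I q -> I 1.
Hypothesis derD : forall k x y, der k (x + y) = der k x + der k y.
Hypothesis derM : forall k x y, der k (x * y) = der k x * y + x * der k y.
Hypothesis der_O : forall k x, O x -> O (der k x).
Hypothesis der_const : forall x, (forall k, der k x = 0) -> exists c, x = cst c.
Hypothesis D_id : D id.
Hypothesis D_add : forall P Q, D P -> D Q -> D (fun x => P x + Q x).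
Hypothesis D_dY : forall j P, D P -> D (fun x => dY j (P x)).
Hypothesis D_inv : forall b P, O b -> (forall w, aW w b = b) -> D P -> D (fun x => b * P x).
Hypothesis D_lin : forall P, D P -> forall x y, P (x + y) = P x + P y.
Hypothesis D_scale : forall P, D P -> forall c x, P (cst c * x) = cst c * P x.
Hypothesis D_aW : forall P, D P -> forall w x, P (aW w x) = aW w (P x).
Hypothesis jac_O : forall k j, O (jac k j).
Hypothesis der_dY : forall k x, der k x = \sum_j jac k j * dY j x.
Hypothesis aW_O : forall w x, O x -> O (aW w x).
Hypothesis aW_cst : forall w c, aW w (cst c) = cst c.
Hypothesis aWM : forall v w x, aW (v * w)%g x = aW v (aW w x).
Hypothesis aW1 : forall x, aW 1%g x = x.

Lemma O0 : O 0. Proof. by rewrite -(rmorph0 cst). Qed.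
Lemma O_sum (I : Type) (r : seq I) (P : pred I) (f : I -> K) :
  (forall i, P i -> O (f i)) -> O (\sum_(i <- r | P i) f i).
Proof. by move=> h; elim/big_rec: _ => [|i x Pi Ox]; [apply: O0|apply: OD; first exact: h]. Qed.
Lemma der0 k : der k 0 = 0.
Proof. by apply: (@addrI _ (der k 0)); rewrite -derD !addr0. Qed.
Lemma der1 k : der k 1 = 0.
Proof. by apply: (@addrI _ (der k 1)); rewrite addr0 -{3}[1]mulr1 derM mulr1 mul1r. Qed.
Lemma der_sum k (I : Type) (r : seq I) (P : pred I) (f : I -> K) :
  der k (\sum_(i <- r | P i) f i) = \sum_(i <- r | P i) der k (f i).
Proof. by elim/big_rec2: _ => [|i y1 y2 _ <-]; rewrite ?der0 ?derD. Qed.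
Lemma D0 P : D P -> P 0 = 0.
Proof. by move=> h; apply: (@addrI _ (P 0)); rewrite -D_lin // !addr0. Qed.
Lemma D_sum P (I : Type) (r : seq I) (Q : pred I) (f : I -> K) : D P ->
  P (\sum_(i <- r | Q i) f i) = \sum_(i <- r | Q i) P (f i).
Proof. by move=> h; elim/big_rec2: _ => [|i y1 y2 _ <-]; rewrite ?D0 ?D_lin. Qed.

(** The families f and g are transformed by the same matrices rho. The vectors
    (P f_i)_i, with P in D, are large enough for g to be obtained from f by
    one operator. *)
Section Pair.
Variables (d : nat) (f g : 'I_d -> K) (rho : W -> 'M[F]_d).
Hypothesis f_rho : forall w j, aW w (f j) = \sum_i cst (rho w i j) * f i.
Hypothesis g_rho : forall w j, aW w (g j) = \sum_i cst (rho w i j) * g i.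
Hypothesis g_O : forall i, O (g i).
Hypothesis f_free : forall c : 'I_d -> F, \sum_i cst (c i) * f i = 0 -> forall i, c i = 0.

Definition relation (a : 'I_d -> K) := forall P, D P -> \sum_i a i * P (f i) = 0.

(** Deriving the relation gives the relation between the derivatives of the
    coefficients, plus the sum of the a_i der (P f_i); the latter vanishes
    since der is a combination of the dY, and dY o P is an operator. *)
Lemma relation_der k a : relation a -> relation (fun i => der k (a i)).
Proof.
move=> ra P hP; have := congr1 (der k) (ra P hP); rewrite der0 der_sum.
under eq_bigr do rewrite derM; rewrite big_split /= => h.
suff h2 : \sum_i a i * der k (P (f i)) = 0 by rewrite h2 addr0 in h.
under eq_bigr do rewrite der_dY mulr_sumr.
rewrite exchange_big big1 //= => j _.
under eq_bigr do rewrite mulrCA.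
by rewrite -mulr_sumr (ra _ (D_dY j hP)) mulr0.
Qed.

(** A relation of minimal support with one coefficient equal to 1 has constant
    coefficients, because differentiating it shrinks its support; but the f_i
    are independent over the constants. *)
Lemma relation0 a : relation a -> forall i, a i = 0.
Proof.
move eqm: #|[set i | a i != 0]| => m; elim/ltn_ind: m a eqm => m IH a am ra.
case: (pickP (fun i => a i != 0)) => [i0 ai0|h i]; last first.
  by have /negbT := h i; rewrite negbK => /eqP.
exfalso; pose b i := a i / a i0.
have rb : relation b.
  move=> P hP; have := ra P hP => /(congr1 (fun x => (a i0)^-1 * x)); rewrite mulr0 mulr_sumr => h.
  by rewrite -[RHS]h; apply: eq_bigr => i _; rewrite /b mulrAC mulrC mulrA.
have b0 : b i0 = 1 by rewrite /b divff.
have db k i : der k (b i) = 0.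
  have lt : (#|[set j | (der k (b j) != 0)%R]| < m)%N.
    rewrite -am; apply: proper_card; apply/properP; split.
      apply/subsetP => j; rewrite !inE; apply: contra => /eqP aj.
      by rewrite /b aj mul0r der0.
    by exists i0; rewrite inE ?ai0 // b0 der1 eqxx.
  exact: (IH _ lt (fun i => der k (b i)) erefl (relation_der k rb) i).
have [c bc] : exists c : 'I_d -> F, forall i, b i = cst (c i).
  by have [c hc] := choice (fun i => der_const (fun k => db k i)); exists c.
have c0 := f_free (c := c).
have : c i0 = 0.
  apply: c0; rewrite -[RHS](rb _ D_id); apply: eq_bigr => i _; by rewrite bc.
move=> ci0; have := bc i0; rewrite b0 ci0 rmorph0 => /eqP; by rewrite oner_eq0.
Qed.

Definition opvec (P : K -> K) : 'rV[K]_d := \row_i P (f i).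
Definition oprows m (M : 'M[K]_(m, d)) :=
  forall j, exists2 P, D P & row j M = opvec P.

(** Choose operators whose vectors have maximal rank. A vector orthogonal to
    all of them is then a relation. *)
Lemma oprows_full : exists m (M : 'M[K]_(m, d)), oprows M /\ row_full M.
Proof.
pose Q r := `[< exists m (M : 'M[K]_(m, d)), oprows M /\ \rank M = r >].
have Q0 : exists r, Q r.
  exists 0%N; apply/asboolP; exists 0%N, 0; split; last by rewrite mxrank0.
  by case.
have Qb r : Q r -> (r <= d)%N.
  by move=> /asboolP [m [M [_ <-]]]; apply: rank_leq_col.
case: (ex_maxnP Q0 Qb) => r /asboolP [m [M [MD Mr]]] rmax.
exists m, M; split=> //; rewrite /row_full eqn_leq rank_leq_col leqNgt /=.
apply/negP => lt.
have : (kermx M^T != 0)%MS.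
  by rewrite -mxrank_eq0 mxrank_ker mxrank_tr subn_eq0 -ltnNge.
case/rowV0Pn => a /sub_kermxP aM a0.
have Ma : M *m a^T = 0 by rewrite -[LHS]trmxK trmx_mul trmxK aM trmx0.
have ra : relation (fun i => a 0 i).
  move=> P hP; pose M' := col_mx M (opvec P).
  have M'D : oprows M'.
    move=> j; case: (split_ordP j) => k ->; last by exists P => //; rewrite rowKd row_id.
    by have [Q' hQ' e] := MD k; exists Q' => //; rewrite rowKu.
  have le : (\rank M' <= \rank M)%N.
    by rewrite Mr; apply: rmax; apply/asboolP; exists (m + 1)%N, M'.
  have sub : (M <= M')%MS by rewrite -addsmxE addsmxSl.
  have : (M' <= M)%MS by rewrite -(geq_leqif (mxrank_leqif_sup sub)).
  rewrite -addsmxE addsmx_sub => /andP[_ /submxP [x xE]].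
  have /matrixP/(_ 0 0) : opvec P *m a^T = 0 by rewrite xE -mulmxA Ma mulmx0.
  rewrite !mxE => h; rewrite -[RHS]h; apply: eq_bigr => i _.
  by rewrite !mxE mulrC.
case/negP: a0; apply/eqP/rowP => i; rewrite mxE; exact: relation0 ra i.
Qed.

Inductive opspan : 'rV[K]_d -> Prop :=
| opspan0 : opspan 0
| opspan_gen b P : O b -> D P -> opspan (b *: opvec P)
| opspanD u v : opspan u -> opspan v -> opspan (u + v).

Lemma opspanZ b u : O b -> opspan u -> opspan (b *: u).
Proof.
move=> Ob; elim=> {u} [|c P Oc hP|u v _ hu _ hv].
- by rewrite scaler0; apply: opspan0.
- by rewrite scalerA; apply: opspan_gen => //; apply: OM.
- by rewrite scalerDr; apply: opspanD.
Qed.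

Lemma opspan_sum (I : Type) (r : seq I) (Q : pred I) (u : I -> 'rV[K]_d) :
  (forall i, Q i -> opspan (u i)) -> opspan (\sum_(i <- r | Q i) u i).
Proof. by move=> h; elim/big_rec: _ => [|i x Pi Ox]; [apply: opspan0|apply: opspanD; first exact: h]. Qed.
Lemma opspan_der k u : opspan u -> opspan (map_mx (der k) u).
Proof.
elim=> {u} [|c P Oc hP|u v _ hu _ hv].
- have -> : map_mx (der k) (0 : 'rV_d) = 0 by apply/rowP => i; rewrite !mxE der0.
  exact: opspan0.
- have -> : map_mx (der k) (c *: opvec P) =
     der k c *: opvec P + \sum_j (c * jac k j) *: opvec (fun x => dY j (P x)).
    apply/rowP => i; rewrite !mxE derM; congr (_ + _).
    rewrite der_dY mulr_sumr summxE; apply: eq_bigr => j _.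
    by rewrite !mxE mulrA.
  apply: opspanD; first by apply: opspan_gen => //; apply: der_O.
  by apply: opspan_sum => j _; apply: opspan_gen; [apply: OM|apply: D_dY].
- have -> : map_mx (der k) (u + v) = map_mx (der k) u + map_mx (der k) v.
    by apply/rowP => i; rewrite !mxE derD.
  exact: opspanD.
Qed.

Lemma common_denominator (m : nat) (x : 'I_m -> K) :
  exists q, [/\ Poly q, q != 0 & forall j, O (q * x j)].
Proof.
elim: m x => [|m IH] x; first by exists 1; split; rewrite ?oner_neq0 // => -[].
have [q [qP q0 qx]] := IH (fun j => x (lift ord0 j)).
have [b [r [Ob rP r0 xE]]] := K_frac (x ord0).
exists (q * r); split; [exact: polyM|by rewrite mulf_neq0|move=> j].
case: (unliftP ord0 j) => [j' ->|->].
  by rewrite mulrAC; apply: OM => //; apply: O_poly.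
have -> : q * r * x ord0 = q * b by rewrite xE; field.
by apply: OM => //; apply: O_poly.
Qed.

(** The q for which opspan contains q times the unit vector form a set stable
    under derivations, and a common denominator of the coefficients given by
    oprows_full belongs to it. *)
Lemma opspan_delta i0 : opspan (delta_mx 0 i0).
Proof.
have [m [M [MD Mfull]]] := oprows_full.
have /submxP [x xE] : ((delta_mx 0 i0 : 'rV[K]_d) <= M)%MS by apply: submx_full.
have [q [qP q0 qx]] := common_denominator (fun j => x 0 j).
rewrite -[delta_mx _ _]scale1r.
apply: (@poly_simple (fun q => opspan (q *: delta_mx 0 i0)) _ _ q) => //.
- by move=> c p hp; rewrite -scalerA; apply: opspanZ.
- move=> k p /(opspan_der k).
  suff -> : map_mx (der k) (p *: delta_mx 0 i0) = der k p *: (delta_mx 0 i0 : 'rV_d) by [].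
  apply/rowP => i; rewrite !mxE derM eqxx /=.
  by case: (i == i0); rewrite ?der1 ?der0 !mulr0 ?addr0.
- rewrite xE mulmx_sum_row scaler_sumr; apply: opspan_sum => j _.
  have [P hP ->] := MD j; rewrite scalerA; exact: opspan_gen.
Qed.

Lemma opspan_all (u : 'rV[K]_d) : (forall i, O (u 0 i)) -> opspan u.
Proof.
by move=> uO; rewrite [u]row_sum_delta; apply: opspan_sum => i _; apply: opspanZ (opspan_delta i).
Qed.

Lemma aW_cstM w c x : aW w (cst c * x) = cst c * aW w x.
Proof. by rewrite rmorphM /= aW_cst. Qed.

Lemma rho_fK w (h : 'I_d -> K) (hr : forall w j, aW w (h j) = \sum_i cst (rho w i j) * h i) i :
  \sum_k cst (rho w^-1%g k i) * aW w (h k) = h i.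
Proof.
rewrite -[RHS]aW1 -(mulgV w) aWM hr rmorph_sum /=.
by apply: eq_bigr => k _; rewrite aW_cstM.
Qed.

(** Averaging over W a combination sum_j b_j (P_j f_i) twisted by rho replaces
    each b_j by its average, since the P_j f_i are transformed by rho. The
    averaged coefficients are invariant, hence operators. *)
Lemma opspan_average u : opspan u -> exists2 P, D P & forall i,
  P (f i) = cst (#|W|%:R)^-1 * \sum_w \sum_k cst (rho w^-1%g k i) * aW w (u 0 k).
Proof.
elim=> {u} [|b P Ob hP|u v _ [P hP hu] _ [Q hQ hv]].
- exists (fun x => 0 * id x).
    by apply: D_inv => //; [apply: O0|move=> w; rewrite rmorph0].
  move=> i; rewrite mul0r big1 ?mulr0 // => w _; rewrite big1 // => k _.
  by rewrite mxE rmorph0 mulr0.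
- exists (fun x => (cst (#|W|%:R)^-1 * \sum_w aW w b) * P x).
    apply: D_inv => //; first by apply: OM => //; apply: O_sum => w _; apply: aW_O.
    move=> v; rewrite aW_cstM rmorph_sum /=; congr (_ * _).
    by rewrite [RHS](reindex_inj (mulgI v)); apply: eq_bigr => w _; rewrite aWM.
  move=> i; rewrite -mulrA mulr_suml; congr (_ * _); apply: eq_bigr => w _.
  rewrite -[in LHS](rho_fK w f_rho i) D_sum // mulr_sumr; apply: eq_bigr => k _.
  by rewrite !mxE rmorphM /= D_scale // D_aW // mulrCA.
- exists (fun x => P x + Q x); first exact: D_add.
  move=> i; rewrite hu hv -mulrDr -big_split; congr (_ * _); apply: eq_bigr => w _ /=.
  by rewrite -big_split; apply: eq_bigr => k _; rewrite !mxE rmorphD mulrDr.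
Qed.

(** g is in opspan, and it equals its own twisted average. *)
Theorem operator_exists : exists2 P, D P & forall i, g i = P (f i).
Proof.
have [|P hP h] := @opspan_average (\row_i g i).
  by apply: opspan_all => i; rewrite mxE.
exists P => // i; rewrite h.
transitivity (cst (#|W|%:R)^-1 * \sum_(w : W) g i).
  have cW : cst (#|W|%:R)^-1 * #|W|%:R = 1.
    by rewrite -(rmorph_nat cst) -rmorphM mulVf // rmorph1.
  by rewrite sumr_const -[g i *+ _]mulr_natl mulrA cW mul1r.
congr (_ * _); apply: eq_bigr => w _.
by under [RHS]eq_bigr do rewrite mxE; rewrite rho_fK.
Qed.

End Pair.
End DifferentialGalois.

(** * Constants and differential ideals of polynomials *)

Section PolynomialDerivatives.
Variables (F : numFieldType) (n : nat).
Implicit Types (p q : {mpoly F[n]}).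

Lemma mcoeff_euler k p m : ('X_k * mderiv k p)@_m = p@_m * (m k)%:R.
Proof.
transitivity (('X_k * mderiv k (\sum_(m' <- msupp p) p@_m' *: 'X_[m']))@_m).
  by rewrite -mpolyE.
transitivity ((\sum_(m' <- msupp p) p@_m' *: 'X_[m'])@_m * (m k)%:R); last by rewrite -mpolyE.
rewrite raddf_sum /= mulr_sumr !raddf_sum /= mulr_suml.
apply: eq_bigr => m' _; rewrite mderivZ -scalerAr mderiv_euler !mcoeffZ mcoeffX.
by case: eqP => [->|_]; rewrite ?mulr0 ?mul0r // mulr1 mulr1.
Qed.

(** The Euler operators x_k d/dx_k multiply each monomial by an integer, so
    they do not raise the leading monomial, and its new coefficient records
    the exponent of x_k. *)
Lemma euler_mlead k p : (mlead ('X_k * mderiv k p)%R <= mlead p)%O.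
Proof.
have [->|h] := eqVneq ('X_k * mderiv k p) 0; first by rewrite mlead0 le0m.
apply: msupp_le_mlead; rewrite mcoeff_msupp.
have : ('X_k * mderiv k p)@_(mlead ('X_k * mderiv k p)) != 0 by rewrite mleadc_eq0.
by rewrite mcoeff_euler mulf_eq0 negb_or => /andP[].
Qed.

(** Compare the coefficients of the largest monomial in x_k p' q = x_k p q'. *)
Lemma equal_logder_mlead p q : p != 0 -> q != 0 ->
  (forall k, mderiv k p * q = p * mderiv k q) -> mlead p = mlead q.
Proof.
move=> p0 q0 h; apply/mnmP => k.
have hk : ('X_k * mderiv k p) * q = p * ('X_k * mderiv k q).
  by rewrite -mulrA h mulrCA.
have := congr1 (mcoeff (mlead p + mlead q)%MM) hk.
rewrite (mleadcMW (euler_mlead k p) (lexx _)) (mleadcMW (lexx _) (euler_mlead k q)).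
rewrite !mcoeff_euler mulrAC -mulrA => /(mulfI _).
rewrite mleadc_eq0 => /(_ p0) /(mulfI _); rewrite mleadc_eq0 => /(_ q0)/eqP.
by rewrite eqr_nat => /eqP.
Qed.

(** Subtracting from p the multiple of q with the same leading coefficient
    gives a polynomial with the same logarithmic derivatives but another
    leading monomial, so it is zero. *)
Lemma equal_logder p q : q != 0 ->
  (forall k, mderiv k p * q = p * mderiv k q) -> exists c, p = c *: q.
Proof.
move=> q0 h; have [->|p0] := eqVneq p 0; first by exists 0; rewrite scale0r.
have mpq := equal_logder_mlead p0 q0 h.
pose c := mleadc p / mleadc q; exists c.
apply/eqP; rewrite -subr_eq0; apply/negPn/negP => r0.
have hr k : mderiv k (p - c *: q) * q = (p - c *: q) * mderiv k q.
  rewrite mderivB mderivZ !mulrBl h -!scalerAl; congr (_ - c *: _).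
  by rewrite mulrC.
have mr := equal_logder_mlead r0 q0 hr.
move: r0; rewrite -mleadc_eq0 mr mcoeffB mcoeffZ -{1}mpq /c divfK ?mleadc_eq0 //.
by rewrite subrr eqxx.
Qed.

Lemma mderiv_descent p : p != 0 -> (1 < msize p)%N ->
  exists k, mderiv k p != 0 /\ (msize (mderiv k p) < msize p)%N.
Proof.
move=> p0 sp; have := mlead_deg p0; set m := mlead p => ms.
have [k mk] : exists k, m k != 0%N.
  apply/existsP; rewrite -[[exists _, _]]negbK negb_exists; apply/negP => /forallP h.
  have : mdeg m = 0%N by rewrite mdegE big1 // => i _; have := h i; rewrite negbK => /eqP.
  by move=> m0; move: sp; rewrite -ms m0.
exists k; split.
  apply/negP => /eqP d0; have := mcoeff_euler k p m.
  rewrite d0 mulr0 mcoeff0 => /esym/eqP; rewrite mulf_eq0 mleadc_eq0 (negPf p0) /=.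
  by rewrite pnatr_eq0 (negPf mk).
rewrite {1}msizeE; case E: (msize p) sp => [//|s] sp; rewrite ltnS.
apply/bigmax_leqP_seq => m' m'd _.
have : (m' + U_(k))%MM \in msupp p.
  move: m'd; rewrite !mcoeff_msupp mcoeff_deriv; apply: contra => /eqP ->.
  by rewrite mul0rn.
by move=> /msize_mdeg_lt; rewrite mdegD mdeg1 addn1 E ltnS.
Qed.

End PolynomialDerivatives.

Section OperatorExists.
Variables (R : realType) (n : nat).
Hypothesis n_gt0 : (0 < n)%N.
Notation C := R[i].
Notation Pol := {mpoly C[n]}.
Notation K := (KX R n).

Fact cstK_zmod : zmod_morphism (@cstK R n).
Proof. by move=> a b; rewrite /cstK mpolyCB inKB. Qed.
HB.instance Definition _ := GRing.isZmodMorphism.Build C K (@cstK R n) cstK_zmod.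
Fact cstK_monoid : monoid_morphism (@cstK R n).
Proof. by split=> [|a b]; rewrite /cstK ?mpolyC1 ?inK1 // mpolyCM inKM. Qed.
HB.instance Definition _ := GRing.isMonoidMorphism.Build C K (@cstK R n) cstK_monoid.

Lemma dK_const (x : K) : (forall k, dK k x = 0) -> exists c : C, x = cstK n c.
Proof.
elim/KX_ind: x => p q q0 h.
have hk k : mderiv k p * q = p * mderiv k q.
  have Q0 := inK_neq0 q0; have e := dKM k (inK p / inK q) (inK q).
  have h2 : inK p / inK q * inK q = inK p by apply: divfK.
  rewrite h mul0r add0r h2 !dK_inK in e.
  apply: inK_inj; rewrite (inKM (mderiv k p)) (inKM p) e.
  by rewrite mulrAC h2.
have [c pE] := equal_logder q0 hk; exists c.
by rewrite pE -mul_mpolyC inKM mulfK // inK_neq0.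
Qed.

(** Differentiate until the polynomial becomes a nonzero constant. *)
Lemma poly_ideal1 (I : K -> Prop) :
  (forall (c : C) q, I q -> I (cstK n c * q)) -> (forall k q, I q -> I (dK k q)) ->
  forall q, (exists p : Pol, q = inK p) -> q != 0 -> I q -> I 1.
Proof.
move=> Ic Id q [p ->] {q}; rewrite inK_eq0.
move eqs: (msize p) => s; elim/ltn_ind: s p eqs => s IH p ps p0 Ip.
have [s1|s1] := leqP s 1.
  have /msize_poly1P [c c0 pE] : msize p == 1%N.
    by rewrite eqn_leq ps s1 -ps lt0n msize_poly_eq0.
  rewrite pE in Ip; have := Ic c^-1 _ Ip.
  by rewrite -[inK _]/(cstK n c) -rmorphM /= mulVf // rmorph1.
have [k [dk0 dks]] : exists k, mderiv k p != 0 /\ (msize (mderiv k p) < msize p)%N.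
  by apply: mderiv_descent => //; rewrite ps.
rewrite ps in dks; apply: (IH _ dks _ erefl dk0).
by rewrite -dK_inK; apply: Id.
Qed.

Definition aF (w : WD n) : {rmorphism K -> K} := @actF R n w.

Theorem Dtilde_operator_exists (d : nat) (f g : 'I_d -> K) (rho : WD n -> 'M[C]_d) :
  (forall w j, actF w (f j) = \sum_i cstK n (rho w i j) * f i) ->
  (forall w j, actF w (g j) = \sum_i cstK n (rho w i j) * g i) ->
  (forall i, Otilde (g i)) ->
  (forall c : 'I_d -> C, \sum_i cstK n (c i) * f i = 0 -> forall i, c i = 0) ->
  exists2 P, Dtilde P & forall i, g i = P (f i).
Proof.
move=> hf hg gO ff.
apply: (@operator_exists C K (@cstK R n) (WD n) n (@Otilde R n)
  (fun q => exists p : Pol, q = inK p) (@dK R n) (@Dtilde R n) aF (@dY R n)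
  (fun k j => inK (Jpol R n k j)) _ _ _ _ _ _ _ _ _ _ _ _ _ _ _ _ _ _ _ _ _ _ _ _ _ _ d f g rho).
- rewrite pnatr_eq0 -lt0n; apply/card_gt0P; by exists 1%g.
- exact: Ot_cst.
- exact: OtD.
- exact: OtM.
- by move=> q [p ->]; apply: Ot_poly.
- by exists 1; rewrite inK1.
- by move=> p q [a ->] [b ->]; exists (a * b); rewrite inKM.
- elim/KX_ind => p q q0; exists (inK p), (inK q); split; [exact: Ot_poly|by exists q|exact: inK_neq0|by []].
- exact: poly_ideal1.
- exact: dKD.
- exact: dKM.
- exact: dK_Ot.
- exact: dK_const.
- exact: Dtilde_id.
- exact: Dtilde_add.
- by move=> j P hP; apply: Dtilde_comp hP; apply: Dtilde_dY.
- move=> b P Ob bW hP; apply: (Dtilde_comp (P := fun x => b * x)) hP.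
  exact: Dtilde_invariant.
- exact: DtildeD.
- exact: Dtilde_scale.
- exact: Dtilde_actF.
- by move=> k j; apply: Ot_poly.
- exact: dK_dY.
- exact: actF_Ot.
- exact: actF_cst.
- exact: actFM.
- exact: actF1.
- exact: hf.
- exact: hg.
- exact: gO.
- exact: ff.
Qed.

End OperatorExists.

(** * The number of standard tableaux *)

Section Diagrams.
Local Open Scope nat_scope.
Variable n : nat.
Implicit Types (lam mu : {set cell n}) (c r : cell n).

Definition diagram_closed lam := forall c c', c \in lam -> c'.1 = c.1 ->
  crow c' <= crow c -> ccol c' <= ccol c -> c' \in lam.
Lemma is_diagramP lam : reflect (diagram_closed lam) (is_diagram lam).
Proof.
apply: (iffP idP) => [/forallP h c c' cl e1 e2 e3|h].
  have /implyP/(_ cl)/forallP/(_ c')/implyP := h c.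
  by rewrite e1 eqxx e2 e3; apply.
apply/forallP => c; apply/implyP => cl; apply/forallP => c'; apply/implyP.
by move=> /and3P[/eqP e1 e2 e3]; apply: h cl e1 e2 e3.
Qed.

Lemma diagramU lam mu : is_diagram lam -> is_diagram mu -> is_diagram (lam :|: mu).
Proof.
move=> /is_diagramP h /is_diagramP k; apply/is_diagramP => c c'.
rewrite !inE => /orP[cl|cl] e1 e2 e3; first by rewrite (h _ _ cl e1 e2 e3).
by rewrite (k _ _ cl e1 e2 e3) orbT.
Qed.

Lemma diagramI lam mu : is_diagram lam -> is_diagram mu -> is_diagram (lam :&: mu).
Proof.
move=> /is_diagramP h /is_diagramP k; apply/is_diagramP => c c'.
rewrite !inE => /andP[cl cm] e1 e2 e3.
by rewrite (h _ _ cl e1 e2 e3) (k _ _ cm e1 e2 e3).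
Qed.

Definition addable mu : {set cell n} := [set c | (c \notin mu) && is_diagram (c |: mu)].
Definition removable lam : {set cell n} := [set c in lam | is_diagram (lam :\ c)].

(** The number of ways to remove the m cells of lam one at a time. *)
Fixpoint nchains m lam : nat :=
  if m is m'.+1 then \sum_(c in removable lam) nchains m' (lam :\ c) else 1.

Definition rowset mu (nu : bool) (i : nat) : {set 'I_n} :=
  [set j : 'I_n | [exists i' : 'I_n, (i' == i :> nat) && ((nu, (i', j)) \in mu)]].
(** The row number is any integer, so that the row below the last one makes
    sense and is empty. *)
Definition rowlen mu nu i : nat := #|rowset mu nu i|.

Lemma card_below m : m <= n -> #|[set j : 'I_n | j < m]| = m.
Proof.
move=> mn; rewrite -[RHS]card_ord -(@card_imset _ _ (widen_ord mn)); last first.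
  by move=> a b /(congr1 val) /= /val_inj.
apply: eq_card => j; rewrite inE; apply/idP/imsetP => [jm|[k _ ->] //=].
by exists (Ordinal jm) => //; apply: val_inj.
Qed.

Lemma initial_segment (A : {set 'I_n}) :
  (forall i j : 'I_n, j \in A -> i <= j -> i \in A) -> forall i, (i \in A) = (i < #|A|).
Proof.
move=> h; have sub1 (i : 'I_n) : i \in A -> i < #|A|.
  move=> iA; rewrite -(card_below (ltn_ord i)).
  by apply: subset_leq_card; apply/subsetP => j; rewrite inE ltnS => ji; apply: h iA ji.
move=> i; apply/idP/idP => [|iA]; first exact: sub1.
apply/negPn/negP => iN.
have : #|A| <= i.
  rewrite -(card_below (ltnW (ltn_ord i))).
  apply: subset_leq_card; apply/subsetP => j jA; rewrite inE ltnNge.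
  by apply/negP => ij; case/negP: iN; apply: h jA ij.
by rewrite leqNgt iA.
Qed.

Lemma in_rowset mu nu (i j : 'I_n) : (j \in rowset mu nu i) = ((nu, (i, j)) \in mu).
Proof.
rewrite inE; apply/idP/idP => h.
  by move/existsP: h => [i' /andP[/eqP/val_inj -> //]].
by apply/existsP; exists i; rewrite eqxx.
Qed.

Lemma rowlenP mu nu (i j : 'I_n) : is_diagram mu ->
  ((nu, (i, j)) \in mu) = (j < rowlen mu nu i).
Proof.
move=> /is_diagramP h; rewrite -in_rowset; apply: initial_segment => a b.
by rewrite !in_rowset => bm ab; apply: h bm _ _ _.
Qed.

Lemma rowlen_n mu nu i : n <= i -> rowlen mu nu i = 0.
Proof.
move=> ni; apply/eqP; rewrite cards_eq0; apply/eqP/setP => j; rewrite !inE.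
apply/existsP => -[i' /andP[/eqP e _]]; move: (ltn_ord i'); lia.
Qed.

Lemma rowlen_anti mu nu i i' : is_diagram mu -> i <= i' -> rowlen mu nu i' <= rowlen mu nu i.
Proof.
move=> hd ii'; have [i'n|ni'] := ltnP i' n; last by rewrite rowlen_n.
have hin : i < n by lia.
apply: subset_leq_card; apply/subsetP => j.
rewrite -[i']/(nat_of_ord (Ordinal i'n)) -[ i ]/(nat_of_ord (Ordinal hin)) !in_rowset => h.
by move/is_diagramP: hd => hd; apply: hd h _ _ _.
Qed.

Lemma rowlen_le mu nu i : rowlen mu nu i <= #|mu|.
Proof.
have [hi|hi] := ltnP i n; last by rewrite rowlen_n.
rewrite /rowlen -(@card_imset _ _ (fun j => (nu, (Ordinal hi, j)) : cell n)); last first.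
  by move=> a b [].
apply: subset_leq_card; apply/subsetP => c /imsetP[j].
by rewrite -[ i ]/(nat_of_ord (Ordinal hi)) in_rowset => h ->.
Qed.

Lemma rowlen_last mu nu : is_diagram mu -> #|mu| < n -> rowlen mu nu n.-1 = 0.
Proof.
move=> hd hn; apply/eqP; rewrite -leqn0 leqNgt; apply/negP => h.
have n0 : 0 < n by lia.
have n1 : n.-1 < n by lia.
have : n <= #|mu|; last by lia.
rewrite -{1}[n]card_ord -(@card_imset _ _ (fun i => (nu, (i, Ordinal n0)) : cell n)); last first.
  by move=> a b [].
apply: subset_leq_card; apply/subsetP => c /imsetP[i _ ->].
rewrite rowlenP //=; apply: leq_trans h _; apply: rowlen_anti => //.
by have := ltn_ord i; lia.
Qed.

Lemma addableE mu nu (i j : 'I_n) : is_diagram mu ->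
  ((nu, (i, j)) \in addable mu) =
  (j == rowlen mu nu i :> nat) && ((i == 0 :> nat) || (rowlen mu nu i < rowlen mu nu i.-1)).
Proof.
move=> hd; have /is_diagramP hd' := hd; rewrite inE rowlenP // -leqNgt.
apply/andP/andP => [[h /is_diagramP hc]|[/eqP h hi]].
  have jE : j = rowlen mu nu i :> nat.
    apply/eqP; rewrite eqn_leq h andbT leqNgt; apply/negP => h2.
    have rn : rowlen mu nu i < n by apply: leq_ltn_trans (ltn_ord j); lia.
    have := hc (nu, (i, j)) (nu, (i, Ordinal rn)); rewrite setU11 => /(_ isT erefl).
    rewrite /crow /ccol /= leqnn (ltnW h2) => /(_ isT isT).
    rewrite in_setU1 rowlenP //= ltnn orbF => /eqP[e].
    by move: h2; rewrite -e /= ltnn.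
  rewrite jE eqxx; split=> //; case: posnP => //= i0.
  have pin : i.-1 < n by move: (ltn_ord i); lia.
  have := hc (nu, (i, j)) (nu, (Ordinal pin, j)); rewrite setU11 => /(_ isT erefl).
  rewrite /crow /ccol /= leqnn leq_pred => /(_ isT isT).
  rewrite in_setU1 rowlenP //= -jE => /orP[/eqP[e]|//].
  by have := congr1 val e; rewrite /=; lia.
rewrite -h leqnn; split=> //; apply/is_diagramP => c c'.
rewrite in_setU1 => /orP[/eqP ->|cm] e1 e2 e3; last first.
  by rewrite in_setU1 (hd' _ _ cm e1 e2 e3) orbT.
case: c' e1 e2 e3 => [nu' [i' j']] /= -> i'i j'j; rewrite /crow /ccol /= in i'i j'j.
rewrite in_setU1 rowlenP //.
have [ii|ii] := eqVneq i' i.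
  subst i'; have [jj|jj] := eqVneq j' j; first by rewrite jj eqxx.
  apply/orP; right; rewrite -h ltn_neqAle j'j andbT.
  by apply: contra jj => /eqP/val_inj ->.
apply/orP; right; have lt : i' < i.
  by rewrite ltn_neqAle i'i andbT; apply: contra ii => /eqP/val_inj ->.
case/orP: hi => [/eqP i0|hi]; first by rewrite i0 in lt.
apply: leq_trans (_ : rowlen mu nu i.-1 <= _); last by apply: rowlen_anti => //; lia.
by apply: leq_trans hi; rewrite ltnS -h.
Qed.

Lemma removableE mu nu (i j : 'I_n) : is_diagram mu ->
  ((nu, (i, j)) \in removable mu) =
  (j.+1 == rowlen mu nu i :> nat) && (rowlen mu nu i.+1 < rowlen mu nu i).
Proof.
move=> hd; have /is_diagramP hd' := hd; rewrite inE rowlenP //.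
apply/andP/andP => [[h /is_diagramP hc]|[/eqP h hi]].
  have jE : j.+1 = rowlen mu nu i :> nat.
    apply/eqP; rewrite eqn_leq h leqNgt; apply/negP => h2.
    have rn : j.+1 < n.
      have : rowlen mu nu i <= n by rewrite -[X in _ <= X]card_ord max_card.
      lia.
    have := hc (nu, (i, Ordinal rn)) (nu, (i, j)).
    rewrite !in_setD1 rowlenP //= h2 eqxx /=; rewrite /crow /ccol /= leqnn leqnSn.
    move=> /(_ _ erefl isT isT); case: eqP => [[e]|_ /(_ isT)//].
    by move: e => /(congr1 val) /=; lia.
  rewrite jE eqxx; split=> //; rewrite ltnNge; apply/negP => h2.
  have iS : i.+1 < n.
    rewrite ltnNge; apply/negP => h3; move: h2; rewrite (rowlen_n _ _ h3); lia.
  have := hc (nu, (Ordinal iS, j)) (nu, (i, j)).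
  rewrite !in_setD1 rowlenP //= (leq_trans _ h2) -?jE // eqxx /= /crow /ccol /= leqnn leqnSn.
  move=> /(_ _ erefl isT isT); case: eqP => [[e]|_ /(_ isT)//].
  by move: e => /(congr1 val) /=; lia.
split; first by rewrite -h.
apply/is_diagramP => c c'; rewrite in_setD1 => /andP[cne cm] e1 e2 e3.
rewrite in_setD1 (hd' _ _ cm e1 e2 e3) andbT; apply: contra cne => /eqP c'E.
case: c cm e1 e2 e3 => [nu' [i' j']]; rewrite c'E /crow /ccol /= => cm e1 e2 e3.
rewrite -e1 in cm *; rewrite rowlenP // in cm.
have i'i : i' = i.
  apply: val_inj => /=; apply/eqP; rewrite eqn_leq e2 andbT leqNgt; apply/negP => lt.
  have := @rowlen_anti mu nu i.+1 i' hd lt; lia.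
rewrite i'i in cm *; have -> // : j' = j; apply: val_inj => /=; lia.
Qed.

Lemma set_memE (A : {set cell n}) : [set c | c \in A] = A.
Proof. by apply/setP => c; rewrite inE. Qed.
Lemma card_cells (P : pred (cell n)) :
  #|[set c | P c]| = \sum_(nu : bool) \sum_(i < n) \sum_(j < n) P (nu, (i, j)).
Proof.
rewrite -sum1_card big_mkcond.
under [RHS]eq_bigr do rewrite pair_bigA.
rewrite pair_bigA; apply: eq_bigr => -[nu [i j]] _ /=.
by rewrite inE; case: (P _).
Qed.

Lemma sum_pick (m : nat) (b : bool) : m < n -> \sum_(j < n) ((j == m :> nat) && b : nat) = b.
Proof.
move=> mn; rewrite (bigD1 (Ordinal mn)) //= eqxx big1 ?addn0 // => j.
by rewrite -val_eqE /= => /negPf ->.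
Qed.

(** In each component, a cell can be removed at the end of row i if and only
    if one can be added at the end of row i + 1, and a cell can always be
    added to the first row. Both components are within the square, as fewer
    than n cells are used. *)
Lemma card_addable mu : is_diagram mu -> #|mu| < n ->
  #|addable mu| = #|removable mu| + 2.
Proof.
move=> hd hn.
have -> : #|addable mu| = \sum_(nu : bool) \sum_(i < n)
    ((i == 0 :> nat) || (rowlen mu nu i < rowlen mu nu i.-1)).
  rewrite -[addable mu]set_memE card_cells; apply: eq_bigr => nu _; apply: eq_bigr => i _.
  under eq_bigr do rewrite addableE //.
  by rewrite sum_pick // (leq_ltn_trans (rowlen_le _ _ _) hn).
have -> : #|removable mu| = \sum_(nu : bool) \sum_(i < n) (rowlen mu nu i.+1 < rowlen mu nu i).
  rewrite -[removable mu]set_memE card_cells; apply: eq_bigr => nu _; apply: eq_bigr => i _.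
  under eq_bigr do rewrite removableE //.
  case: (ltnP (rowlen mu nu i.+1)) => h; last by rewrite big1 // => j _; rewrite andbF.
  case E: (rowlen mu nu i) h => [//|l] h.
  under eq_bigr do rewrite eqSS.
  by rewrite sum_pick //; have := rowlen_le mu nu i; rewrite E; lia.
have step nu : \sum_(i < n) ((i == 0 :> nat) || (rowlen mu nu i < rowlen mu nu i.-1)) =
    \sum_(i < n) (rowlen mu nu i.+1 < rowlen mu nu i) + 1.
  have n1 : n = n.-1.+1 by rewrite prednK //; apply: leq_ltn_trans hn.
  have last0 := rowlen_last nu hd hn.
  move: (rowlen mu nu) last0 => L L0; rewrite n1 big_ord_recl big_ord_recr /= L0 ltn0 addn0 addnC.
  by congr (_ + _); apply: eq_bigr.
by rewrite !big_bool /= (step true) (step false) addnACA.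
Qed.

Lemma setU1D1 c r mu : r != c -> (c |: mu) :\ r = c |: (mu :\ r).
Proof.
move=> rc; apply/setP => x; rewrite !inE.
by case: (eqVneq x c) => // ->; rewrite eq_sym rc.
Qed.

(** Adding c and then removing r, or the reverse, leads to the same diagrams
    when r is not c. *)
Lemma addable_removable mu c r : is_diagram mu -> r != c ->
  (c \in addable mu) && (r \in removable (c |: mu)) =
  (r \in removable mu) && (c \in addable (mu :\ r)).
Proof.
move=> hd rc; rewrite !inE setU1D1 // (negPf rc) /= (eq_sym c r) (negPf rc) /=.
apply/andP/andP => [[/andP[cN h1] /andP[rm h2]]|[/andP[rm h1] /andP[cN h2]]].
  rewrite rm cN h2; split=> //=.
  have -> : mu :\ r = mu :&: (c |: mu :\ r); last exact: diagramI.
  apply/setP => x; rewrite !inE; case: (eqVneq x c) => [->|]; last by case: (x \in mu); rewrite ?andbF ?andbT.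
  by rewrite (negPf cN) andbF.
rewrite rm cN h2; split=> //=.
have -> : c |: mu = mu :|: (c |: mu :\ r); last exact: diagramU.
by apply/setP => x; rewrite !inE; case: (x == c); case: (x \in mu); rewrite ?andbF ?orbT.
Qed.

Lemma addable_setU1 mu c : c \in addable mu -> c \in removable (c |: mu) = is_diagram mu.
Proof. by rewrite !inE eqxx => /andP[cN _]; rewrite setU1K. Qed.
Lemma removable_setD1 mu r : r \in removable mu -> r \in addable (mu :\ r) = is_diagram mu.
Proof. by rewrite !inE eqxx => /andP[rm _]; rewrite setD1K. Qed.

(** The commutation of the two operations, up to the excess of 2 addable
    cells: if U and D denote adding and removing a cell, then D U = U D + 2,
    and the number of chains is an eigenvector by induction. *)
Lemma up_sum m mu : is_diagram mu -> #|mu| = m -> m < n ->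
  \sum_(c in addable mu) nchains m.+1 (c |: mu) = 2 * m.+1 * nchains m mu.
Proof.
elim: m mu => [|m IH] mu hd hm mn.
  have m0 : mu = set0 by apply: cards0_eq.
  have -> : \sum_(c in addable mu) nchains 1 (c |: mu) = #|addable mu|.
    rewrite -sum1_card; apply: eq_bigr => c ca /=.
    rewrite (bigD1 c) /=; last by rewrite addable_setU1.
    rewrite big1 // => r /andP[]; rewrite !inE m0 inE orbF => /andP[/eqP -> _].
    by rewrite eqxx.
  rewrite card_addable // ?hm //; have -> : removable mu = set0.
    by apply/setP => r; rewrite !inE m0 inE.
  by rewrite cards0.
pose N := nchains m.+1 mu.
(* Removing c again, or another cell r. *)
have E1 c : c \in addable mu -> nchains m.+2 (c |: mu) =
    N + \sum_(r | (r != c) && (r \in removable (c |: mu))) nchains m.+1 (c |: mu :\ r).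
  move=> ca; rewrite [LHS]/= (bigD1 c) /=; last by rewrite addable_setU1.
  congr (_ + _); first by rewrite setU1K //; move: ca; rewrite inE => /andP[].
  apply: eq_big => [r|r /andP[_ rc]]; first by rewrite andbC.
  by rewrite setU1D1.
rewrite (eq_bigr _ E1) big_split /= sum_nat_const.
set A := (X in _ + X).
have E2 : A + #|removable mu| * N = 2 * m.+1 * N.
  rewrite /A (exchange_big_dep predT) //= -sum_nat_const.
  have -> : N = \sum_(c in removable mu) nchains m (mu :\ c) by [].
  rewrite (big_mkcond (fun c => c \in removable mu)) /= big_distrr /= [RHS]big_mkcond /= -big_split /=.
  apply: eq_bigr => r _; have [rm|rm] := boolP (r \in removable mu); last first.
    rewrite addn0 big1 // => c /andP[ca /andP[rc h]]; exfalso.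
    by have := addable_removable hd rc; rewrite ca h (negPf rm).
  rewrite -(IH (mu :\ r)) ?(ltnW mn) //; last 2 first.
  - by move: rm; rewrite inE => /andP[].
  - by have := rm; rewrite inE => /andP[r1 _]; move: hm; rewrite (cardsD1 r) r1 => -[].
  rewrite (bigD1 r (P := fun c => c \in addable _)) /=; last by rewrite removable_setD1.
  rewrite addnC setD1K; last by move: rm; rewrite inE => /andP[].
  congr (_ + _); apply: eq_bigl => c; rewrite (eq_sym r c); have [_|cr] := eqVneq c r.
    by rewrite !andbF.
  by rewrite /= andbT addable_removable ?rm // eq_sym.
have E3 := card_addable hd; rewrite hm in E3; rewrite E3 // -/N mulnDl.
by rewrite addnAC [_ + A]addnC E2 -mulnDl; congr (_ * _); lia.
Qed.

(** Removing the last cell from one of the two chains, and exchanging the sums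
    over shapes and over cells, brings in up_sum. *)
Lemma sum_nchains_sq m : m <= n ->
  \sum_(lam : {set cell n} | is_diagram lam && (#|lam| == m)) nchains m lam ^ 2 = 2 ^ m * m`!.
Proof.
elim: m => [|m IH] hm.
  rewrite (bigD1 set0) /=; last first.
    by rewrite cards0 eqxx andbT; apply/is_diagramP => c c'; rewrite inE.
  by rewrite big1 // => lam /andP[/andP[_ /eqP/cards0_eq ->]]; rewrite eqxx.
rewrite factS expnS; transitivity (2 * m.+1 * (2 ^ m * m`!)); last by nia.
rewrite -IH ?(ltnW hm) // big_distrr /=.
transitivity (\sum_(lam : {set cell n} | is_diagram lam && (#|lam| == m.+1))
   \sum_(c in removable lam) nchains m.+1 lam * nchains m (lam :\ c)).
  by apply: eq_bigr => lam _; rewrite -big_distrr expnS expn1.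
rewrite (exchange_big_dep predT) //=.
transitivity (\sum_(c : cell n) \sum_(mu | [&& is_diagram mu, #|mu| == m & c \in addable mu])
   nchains m.+1 (c |: mu) * nchains m mu).
  apply: eq_bigr => c _.
  rewrite (reindex_onto (fun mu => c |: mu) (fun lam => lam :\ c)) /=; last first.
    by move=> lam /andP[_]; rewrite inE => /andP[h _]; rewrite setD1K.
  have E mu : (c |: mu) :\ c == mu = (c \notin mu).
    apply/eqP/idP => [<-|h]; first by rewrite !inE eqxx.
    exact: setU1K.
  apply: eq_big => [mu|mu /andP[_ /eqP ->] //].
  rewrite E !inE eqxx /= cardsU1; case: (boolP (c \in mu)) => cm /=; first by rewrite !andbF.
  rewrite setU1K // andbT add1n eqSS; case: (is_diagram mu); rewrite ?andbF ?andbT //=.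
  by rewrite andbC.
rewrite (exchange_big_dep (fun mu => is_diagram mu && (#|mu| == m))) /=; last first.
  by move=> c mu _ /and3P[-> -> _].
apply: eq_bigr => mu /andP[hd /eqP hm'].
under eq_bigl do rewrite hd hm' eqxx /=.
rewrite -big_distrl /= up_sum // expnS expn1; nia.
Qed.

Fixpoint chains m lam : seq (seq (cell n)) :=
  if m is m'.+1 then
    flatten [seq [seq rcons s c | s <- chains m' (lam :\ c)] | c <- enum (removable lam)]
  else [:: [::]].
Lemma size_chains m lam : size (chains m lam) = nchains m lam.
Proof.
elim: m lam => //= m IH lam; rewrite size_flatten /shape -map_comp sumnE big_map.
by rewrite big_enum /=; apply: eq_bigr => c _; rewrite size_map IH.
Qed.

Lemma chains_uniq m lam : uniq (chains m lam).
Proof.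
elim: m lam => //= m IH lam; apply: allpairs_uniq_dep => [||[a s] [b t] _ _ /=].
- exact: enum_uniq.
- by move=> c _; apply: IH.
by move/rcons_inj => -[-> ->].
Qed.

Lemma chains_prop m lam s : is_diagram lam -> #|lam| = m -> s \in chains m lam ->
  [/\ size s = m, uniq s, [set c in s] = lam & forall k, is_diagram [set c in take k s]].
Proof.
elim: m lam s => [|m IH] lam s hd hm /=.
  rewrite inE => /eqP ->; have e : [set c in [::]] = set0 :> {set cell n} by apply/setP => c; rewrite !inE.
  split=> //; first by rewrite e (cards0_eq hm).
  by move=> k; rewrite e; apply/is_diagramP => c c'; rewrite inE.
move/flatten_mapP => [c]; rewrite mem_enum => cr /mapP[t ht ->].
move: (cr); rewrite inE => /andP[cl hd'].
have [|st ut et pt] := IH (lam :\ c) t hd' _ ht.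
  by move: hm; rewrite (cardsD1 c) cl => -[].
have e : [set x in rcons t c] = lam.
  by apply/setP => x; rewrite inE mem_rcons inE; have := in_setD1 x lam c; rewrite -et inE => ->;
    case: eqVneq => //= ->.
have ct : c \notin t by have := in_setD1 c lam c; rewrite -et inE eqxx => ->.
split=> //; first by rewrite size_rcons st.
- by rewrite rcons_uniq ct.
move=> k; rewrite -cats1 take_cat; case: ltnP => h; first exact: pt.
case: (k - size t) => [|j]; first by rewrite /= cats0; have := pt (size t); rewrite take_size.
by rewrite /= cats1 e.
Qed.

(** Number the cells of a chain in the order in which they are added. *)
Lemma nchains_STab lam : lam \in P2 n -> nchains n lam <= #|STab lam|.
Proof.
rewrite inE => /andP[hd /eqP hn].
pose toT (s : seq (cell n)) : tableau n := [ffun k : 'I_n => nth (false, (k, k)) s k].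
have toTE s k c0 : size s = n -> toT s k = nth c0 s k.
  by move=> hs; rewrite ffunE; apply: set_nth_default; rewrite hs.
rewrite -size_chains -(size_map toT) cardE; apply: uniq_leq_size.
  rewrite map_inj_in_uniq ?chains_uniq // => s t /(chains_prop hd hn)[ss _ _ _].
  move=> /(chains_prop hd hn)[st _ _ _] e.
  case: s ss e => [|c0 s] ss e; first by apply/esym/size0nil; rewrite st -ss.
  apply: (@eq_from_nth _ c0); first by rewrite ss st.
  move=> i; rewrite ss => ilt; have := congr1 (fun T : tableau n => T (Ordinal ilt)) e.
  by rewrite /= !(toTE _ _ c0).
move=> _ /mapP[s /(chains_prop hd hn)[ss us es ps] ->]; rewrite mem_enum inE.
have toTinj : injective (toT s).
  move=> a b; rewrite (toTE _ b (false, (a, a))) // ffunE => /eqP.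
  by rewrite nth_uniq ?ss // => /eqP/val_inj.
apply/and3P; split; first exact/injectiveP.
  apply/eqP/setP => c; rewrite -es !inE; apply/imsetP/idP => [[k _ ->]|cs].
    by rewrite ffunE mem_nth ?ss.
  have h : index c s < n by rewrite -[X in _ < X]ss index_mem.
  by exists (Ordinal h) => //; rewrite ffunE nth_index.
apply/forallP => k; apply/forallP => m; apply/implyP => /andP[/eqP e1 h].
rewrite ltnNge; apply/negP => mk.
have km : k != m.
  apply: contraTneq h => ->; rewrite !ltnn !andbF //.
have mk' : m < k by rewrite ltn_neqAle mk andbT eq_sym.
have /is_diagramP/(_ (toT s m) (toT s k)) := ps m.+1.
rewrite !inE e1 => h2; have : toT s k \in take m.+1 s.
  apply: h2 => //.
  - rewrite (toTE _ _ (toT s k)) // -(nth_take (n0 := m.+1)) // mem_nth // size_take ss.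
    by case: ifP => // _; apply: ltn_ord.
  - by case/orP: h => /andP[/eqP e lt]; rewrite ?e // ltnW.
  - by case/orP: h => /andP[/eqP e lt]; rewrite ?e // ltnW.
pose c1 : cell n := (false, (k, k)).
move=> /(nthP c1)[j]; rewrite size_take ss => hj.
have jm : j < m.+1 by move: hj; case: (ltnP m.+1 n) => // h3 h4; apply: leq_trans h4 h3.
rewrite nth_take // (toTE _ _ c1) // => /eqP.
rewrite nth_uniq ?ss //; first by move=> /eqP jk; move: jm; rewrite jk ltnS leqNgt mk'.
by apply: leq_trans jm _; apply: leq_trans mk' (ltnW (ltn_ord k)).
Qed.

Lemma sum_STab_sq : 2 ^ n * n`! <= \sum_(lam in P2 n) #|STab lam| ^ 2.
Proof.
rewrite -(sum_nchains_sq (leqnn n)).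
rewrite [X in _ <= X](eq_bigl (fun lam => is_diagram lam && (#|lam| == n))); last first.
  by move=> lam; rewrite inE.
by apply: leq_sum => lam hl; rewrite leq_exp2r // nchains_STab // inE.
Qed.

End Diagrams.

(** * Exchange of the two components, and the order of the group *)

Section Shift.
Local Open Scope nat_scope.
Variable n : nat.
Implicit Types (lam mu : {set cell n}) (c : cell n) (S T : tableau n).

Lemma Sh_cellK : involutive (@Sh_cell n).
Proof. by move=> [a b]; rewrite /Sh_cell /= negbK. Qed.
Lemma in_Sh lam c : (c \in Sh lam) = (Sh_cell c \in lam).
Proof.
apply/imsetP/idP => [[d dl ->]|h]; first by rewrite Sh_cellK.
by exists (Sh_cell c) => //; rewrite Sh_cellK.
Qed.

Lemma ShK : involutive (@Sh n).
Proof. by move=> lam; apply/setP => c; rewrite !in_Sh Sh_cellK. Qed.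
Lemma Sh_P2 lam : lam \in P2 n -> Sh lam \in P2 n.
Proof.
rewrite !inE => /andP[/is_diagramP h /eqP c]; apply/andP; split.
  apply/is_diagramP => a b; rewrite !in_Sh => al e1 e2 e3.
  by apply: (h _ _ al) => //; rewrite /= e1.
by rewrite card_imset ?c //; apply: (can_inj Sh_cellK).
Qed.

Lemma ShTK : involutive (@ShT n).
Proof. by move=> T; apply/ffunP => k; rewrite !ffunE Sh_cellK. Qed.
Lemma tshape_ShT T : tshape (ShT T) = Sh (tshape T).
Proof.
apply/setP => c; rewrite in_Sh; apply/imsetP/imsetP => -[k _ e]; exists k => //.
  by rewrite e ffunE Sh_cellK.
by rewrite ffunE -e Sh_cellK.
Qed.

Lemma ShT_inj T : injective T -> injective (ShT T).
Proof. by move=> h a b; rewrite !ffunE => /(can_inj Sh_cellK)/h. Qed.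
Lemma is_standard_ShT T : is_standard (ShT T) = is_standard T.
Proof.
apply: eq_forallb => k; apply: eq_forallb => m; rewrite !ffunE /=.
by rewrite (inj_eq negb_inj).
Qed.

Lemma STab_Sh lam T : (ShT T \in STab (Sh lam)) = (T \in STab lam).
Proof.
rewrite !inE tshape_ShT (inj_eq (can_inj ShK)) is_standard_ShT; congr andb.
by apply/injectiveP/injectiveP => h; [rewrite -[T]ShTK|]; apply: ShT_inj.
Qed.

Lemma card_STab_Sh lam : #|STab (Sh lam)| = #|STab lam|.
Proof.
rewrite -[RHS](card_imset _ (can_inj ShTK)); apply: eq_card => T; apply/idP/imsetP.
  by move=> h; exists (ShT T); rewrite ?ShTK // -STab_Sh ShTK.
by case=> U h ->; rewrite STab_Sh.
Qed.

Variant bnum_spec lam : nat -> nat -> bool -> Type :=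
| BnumSym of Sh lam = lam : bnum_spec lam 1 2 true
| BnumAsym of Sh lam <> lam : bnum_spec lam 2 1 false.
Lemma bnumP lam : bnum_spec lam (bnum lam) (enumb lam) (Sh lam == lam).
Proof.
rewrite /enumb /bnum cards2 [_ == Sh _]eq_sym; case: eqP => h /=; constructor => //.
Qed.

Lemma STabh2 lam : STabh lam 2 = STab lam.
Proof.
apply/setP => T; rewrite inE; case: (T \in STab lam) => //=.
by apply/forallP => k; apply/implyP => _; case: (T k).1.
Qed.
Hypothesis n_gt0 : 0 < n.
Lemma STabh1E lam T : (T \in STabh lam 1) = (T \in STab lam) && ~~ (T (Ordinal n_gt0)).1.
Proof.
rewrite inE; congr andb; apply/forallP/idP => [/(_ (Ordinal n_gt0))|h k].
  by rewrite eqxx /=; case: (T _).1.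
apply/implyP => /eqP k0; have -> : k = Ordinal n_gt0 by apply: val_inj.
by move: h; case: (T _).1.
Qed.

(** When the shape equals its exchange, exchanging the components of a tableau
    moves 1 from one component to the other. *)
Lemma card_STabh1 lam : Sh lam = lam -> #|STab lam| = 2 * #|STabh lam 1|.
Proof.
move=> hl; rewrite mul2n -addnn -{2}(card_imset (mem (STabh lam 1)) (can_inj ShTK)).
rewrite -cardsUI [X in _ + X]eq_card0 ?addn0; last first.
  move=> T; rewrite inE; apply/negP => /andP[h1 /imsetP[U h2 e]].
  move: h1 h2; rewrite e !STabh1E => /andP[_]; rewrite ffunE /= negbK => ->.
  by rewrite andbF.
apply: eq_card => T; rewrite [in RHS]inE; apply/idP/orP; last first.
  rewrite STabh1E => -[/andP[]//|/imsetP[U]]; rewrite STabh1E => /andP[h _] ->.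
  by rewrite -hl STab_Sh.
move=> h; rewrite STabh1E h /=; case: (boolP (T (Ordinal n_gt0)).1) => h1; [right|by left].
apply/imsetP; exists (ShT T); rewrite ?ShTK // STabh1E ffunE /= h1 andbT.
by rewrite -hl STab_Sh.
Qed.

Variable reps : {set {set cell n}}.
Hypothesis reps_P2 : representatives reps.

Lemma sum_P2 (g : {set cell n} -> nat) :
  \sum_(lam in P2 n) g lam = \sum_(lam in reps) \sum_(mu in [set lam; Sh lam]) g mu.
Proof.
case: reps_P2 => /subsetP h1 h2 _.
rewrite (exchange_big_dep (mem (P2 n))) /=; last first.
  by move=> lam mu /h1 hl; rewrite !inE => /orP[]/eqP->; [have := hl|have := Sh_P2 hl]; rewrite inE.
apply: eq_bigr => mu hmu; rewrite sum_nat_const.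
rewrite -[LHS]mul1n; congr (_ * _); rewrite -(h2 mu hmu); apply: eq_card => lam.
rewrite [LHS]inE [RHS]inE; congr andb; rewrite !in_set2.
by rewrite (eq_sym mu lam); congr orb; apply/eqP/eqP => ->; rewrite ShK.
Qed.

Lemma sum_rep_index (g : {set cell n} -> nat) :
  \sum_(w : rep_index reps) g (val w).1 = \sum_(lam in reps) enumb lam * g lam.
Proof.
rewrite -(big_sub (fun p : {set cell n} * 'I_2 => (p.1 \in reps) && (p.2 < enumb p.1)) (fun p => g p.1)).
rewrite -(pair_big_dep (mem reps) (fun l (i : 'I_2) => i < enumb l) (fun l _ => g l)) /=.
apply: eq_bigr => lam _; rewrite sum_nat_const; congr (_ * _).
rewrite -sum1_card big_mkcond /= !big_ord_recl big_ord0 /= !unfold_in /=.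
by have [] := bnumP lam.
Qed.

(** Changing one sign maps W to its complement in the group of all signed
    permutations. *)
Lemma card_WD : 2 * #|{: WD n}| <= 2 ^ n * n`!.
Proof.
rewrite card_sig; set D := [pred w | _].
pose flip (w : {ffun 'I_n -> bool} * {perm 'I_n}) :=
  ([ffun k => w.1 k (+) (k == Ordinal n_gt0)], w.2).
have flipK : involutive flip.
  move=> [a s]; congr pair; apply/ffunP => k; rewrite !ffunE /= -addbA addbb; exact: addbF.
have flipD w : Dn_pred w -> ~~ Dn_pred (flip w).
  rewrite /Dn_pred => /eqP h; rewrite (_ : \prod_k _ = - 1)%R //.
  under eq_bigr do rewrite ffunE signr_addb.
  rewrite big_split /= h mul1r.
  rewrite (bigD1 (Ordinal n_gt0)) //= ?eqxx expr1 big1 ?mulr1 // => k /negPf ->.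
  exact: expr0.
have : #|D| + #|D| <= 2 ^ n * n`!; last by rewrite addnn mul2n.
rewrite -{2}(card_imset (mem D) (can_inj flipK)).
have -> : 2 ^ n * n`! = #|{: {ffun 'I_n -> bool} * {perm 'I_n}}|.
  rewrite card_prod card_ffun card_bool card_ord; congr (_ * _).
  have := card_Sn n; rewrite -[X in X`!](card_ord n) => <-.
  by apply: eq_card => s; rewrite !inE.
rewrite -[#|D|](eq_card (fun w => in_set D w)) -cardsUI.
rewrite [X in _ + X]eq_card0 ?addn0 ?max_card // => w; rewrite !inE.
by apply/negP => /andP[h /imsetP[v hv e]]; move: h; rewrite e => h; have := flipD v hv; rewrite h.
Qed.

(** A class of two shapes, with N standard tableaux each, carries one
    representation, of dimension N; a class of one shape with 2N standard
    tableaux carries two, of dimension N. In both cases the squares of the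
    dimensions add up to half of the squares of the numbers of tableaux, and W
    has index 2 in the signed permutations. *)
Lemma card_WD_le : #|{: WD n}| <= \sum_(w : rep_index reps) #|STabh (val w).1 (bnum (val w).1)| ^ 2.
Proof.
rewrite -(leq_pmul2l (ltn0Sn 1)); apply: leq_trans card_WD _.
apply: leq_trans (sum_STab_sq n) _.
rewrite sum_P2 (sum_rep_index (fun lam => #|STabh lam (bnum lam)| ^ 2)) big_distrr /=.
apply: leq_sum => lam _; have [hl|hl] := bnumP lam.
  by rewrite hl setUid big_set1 card_STabh1 // expnMn mulnA.
rewrite STabh2 big_setU1 ?inE 1?eq_sym; last exact/eqP.
by rewrite big_set1 /= card_STab_Sh mul1n mul2n addnn.
Qed.

End Shift.

(** * The action on tableaux and their monomials *)

Section TabAction.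
Variable n : nat.
Implicit Types (lam mu : {set cell n}) (c : cell n) (S T : tableau n) (s t : {perm 'I_n}) (w : WD n).

(** The exponent of x_k is even in the first component and odd in the second
    one, so the parities of the exponents determine the component of each
    entry. *)
Definition mono (r : cell n -> nat) T : 'X_{1..n} :=
  [multinom (2 * r (T k) + (T k).1)%N | k < n].
Definition rowc (c : cell n) : nat := crow c.
(** Here s acts on the entries, so that actT s T contains s k in the cell of
    k. *)
Definition actT s T : tableau n := [ffun k => T ((s^-1)%g k)].
(** The sign by which the sign changes of w act on a monomial with exponents
    odd in the second component of T. *)
Definition tsgn w T : bool := \big[addb/false]_k (sgnW w k && (T k).1).
Definition Tab lam : {set tableau n} :=
  [set T : {ffun 'I_n -> cell n} | injectiveb T && (tshape T == lam)].

Lemma actTM s t T : actT (s * t)%g T = actT t (actT s T).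
Proof. by apply/ffunP => k; rewrite !ffunE invMg permM. Qed.
Lemma actT1 T : actT 1%g T = T.
Proof. by apply/ffunP => k; rewrite !ffunE invg1 perm1. Qed.
Lemma actTV s T : actT s^-1 (actT s T) = T.
Proof. by rewrite -actTM mulgV actT1. Qed.
Lemma actT_ShT s T : actT s (ShT T) = ShT (actT s T).
Proof. by apply/ffunP => k; rewrite !ffunE. Qed.
Lemma mnm_act_mono s r T : mnm_act s (mono r T) = mono r (actT s T).
Proof. by apply/mnmP => k; rewrite !mnmE ffunE. Qed.
Lemma msgn_mono w r T : msgn w (mono r T) = tsgn w T.
Proof.
apply: eq_bigr => k _; rewrite mnmE oddD mul2n odd_double /=.
by case: (T k).1.
Qed.

Lemma sgnW_sum w : \big[addb/false]_k sgnW w k = false.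
Proof.
have /eqP := valP w; have -> : \prod_k (-1) ^+ (val w).1 k = (-1) ^+ (\big[addb/false]_k sgnW w k) :> int.
  by rewrite (big_morph (fun b : bool => (-1) ^+ b : int) (@signr_addb _) (erefl _)).
by case: (\big[_/_]_k _).
Qed.

(** The product of the two signs is the product of all signs of w, which is 1.
 *)
Lemma tsgn_ShT w T : tsgn w (ShT T) = tsgn w T.
Proof.
apply/eqP; rewrite eq_sym -subr_eq0 -[_ - _]/(_ (+) _) /tsgn -big_split /= -[X in _ == X](sgnW_sum w).
apply/eqP; apply: eq_bigr => k _; rewrite ffunE /=.
by case: (sgnW w k) => //=; case: (T k).1.
Qed.

Lemma tshape_actT s T : tshape (actT s T) = tshape T.
Proof.
apply/setP => c; apply/imsetP/imsetP => -[k _ ->].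
  by exists ((s^-1)%g k); rewrite ?ffunE.
by exists (s k); rewrite ?ffunE ?permK.
Qed.

Lemma TabP lam T : reflect (injective T /\ tshape T = lam) (T \in Tab lam).
Proof. by rewrite inE; apply: (iffP andP) => -[/injectiveP h /eqP k]. Qed.
Lemma Tab_actT lam s T : T \in Tab lam -> actT s T \in Tab lam.
Proof.
move=> /TabP[h k]; apply/TabP; rewrite tshape_actT; split=> // a b.
by rewrite !ffunE => /h /perm_inj.
Qed.

Lemma Tab_ShT lam T : T \in Tab lam -> ShT T \in Tab (Sh lam).
Proof. by move=> /TabP[h k]; apply/TabP; rewrite tshape_ShT k; split=> //; apply: ShT_inj. Qed.
Lemma Tab_in lam T k : T \in Tab lam -> T k \in lam.
Proof. by move=> /TabP[_ <-]; apply: imset_f. Qed.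
Lemma Tab_trans lam T T' : T \in Tab lam -> T' \in Tab lam -> exists s, T' = actT s T.
Proof.
move=> /TabP[h k] /TabP[h' k'].
have f_ex j : exists i, T' i == T j.
  have : T j \in tshape T' by rewrite k' -k imset_f.
  by move=> /imsetP[i _ e]; exists i; rewrite e.
have [f fE] : {f : 'I_n -> 'I_n | forall j, T' (f j) = T j}.
  by exists (fun j => xchoose (f_ex j)) => j; apply/eqP; apply: xchooseP (f_ex j).
have f_inj : injective f by move=> a b e; apply: h; rewrite -!fE e.
exists (perm f_inj); apply/ffunP => i; rewrite ffunE.
by rewrite -[in LHS](permKV (perm f_inj) i) permE fE.
Qed.

Lemma STab_Tab lam T : T \in STab lam -> T \in Tab lam.
Proof. by rewrite !inE => /and3P[-> -> _]. Qed.
Lemma STabh_Tab lam h T : T \in STabh lam h -> T \in Tab lam.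
Proof. by rewrite inE => /andP[/STab_Tab]. Qed.

Definition Cstab T : {set {perm 'I_n}} :=
  [set s : {perm 'I_n} | [forall k, ((T (s k)).1 == (T k).1) && (ccol (T (s k)) == ccol (T k))]].
Definition Rstab T : {set {perm 'I_n}} :=
  [set s : {perm 'I_n} | [forall k, ((T (s k)).1 == (T k).1) && (crow (T (s k)) == crow (T k))]].
Lemma CstabP T s : reflect (forall k, (T (s k)).1 = (T k).1 /\ ccol (T (s k)) = ccol (T k))
  (s \in Cstab T).
Proof.
rewrite inE; apply: (iffP forallP) => h k; first by have /andP[/eqP ? /eqP ?] := h k.
by have [-> ->] := h k; rewrite !eqxx.
Qed.

Lemma RstabP T s : reflect (forall k, (T (s k)).1 = (T k).1 /\ crow (T (s k)) = crow (T k))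
  (s \in Rstab T).
Proof.
rewrite inE; apply: (iffP forallP) => h k; first by have /andP[/eqP ? /eqP ?] := h k.
by have [-> ->] := h k; rewrite !eqxx.
Qed.

Lemma Cstab1 T : 1%g \in Cstab T. Proof. by apply/CstabP => k; rewrite perm1. Qed.
Lemma Rstab1 T : 1%g \in Rstab T. Proof. by apply/RstabP => k; rewrite perm1. Qed.
Lemma CstabM T s t : s \in Cstab T -> t \in Cstab T -> (s * t)%g \in Cstab T.
Proof.
move=> /CstabP hs /CstabP ht; apply/CstabP => k; rewrite permM.
by have [-> ->] := ht (s k); apply: hs.
Qed.

Lemma CstabV T s : (s^-1%g \in Cstab T) = (s \in Cstab T).
Proof.
apply/CstabP/CstabP => h k; last by have := h ((s^-1)%g k); rewrite permKV => -[-> ->].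
by have := h (s k); rewrite permK => -[-> ->].
Qed.

Lemma CstabMr T s t : s \in Cstab T -> ((s * t)%g \in Cstab T) = (t \in Cstab T).
Proof.
move=> h; apply/idP/idP => h2; last exact: CstabM.
by rewrite -[t](mulKg s) CstabM // CstabV.
Qed.

Lemma CstabMl T s t : t \in Cstab T -> ((s * t)%g \in Cstab T) = (s \in Cstab T).
Proof.
move=> h; apply/idP/idP => h2; last exact: CstabM.
by rewrite -[s](mulgK t) CstabM // CstabV.
Qed.

Lemma Cstab_actT T s t : (t \in Cstab (actT s T)) = ((t ^ s^-1)%g \in Cstab T).
Proof.
apply/CstabP/CstabP => h k.
  have := h (s k); rewrite !ffunE permK.
  by rewrite conjgE invgK !permM.
have := h ((s^-1)%g k); rewrite !ffunE; rewrite conjgE invgK !permM permKV //.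
Qed.

Lemma Rstab_actT T s t : (t \in Rstab (actT s T)) = ((t ^ s^-1)%g \in Rstab T).
Proof.
apply/RstabP/RstabP => h k.
  have := h (s k); rewrite !ffunE permK.
  by rewrite conjgE invgK !permM.
have := h ((s^-1)%g k); rewrite !ffunE; rewrite conjgE invgK !permM permKV //.
Qed.

Lemma Cstab_ShT T : Cstab (ShT T) = Cstab T.
Proof.
by apply/setP => s; rewrite !inE; apply: eq_forallb => k; rewrite !ffunE /= (inj_eq negb_inj).
Qed.

Lemma Rstab_ShT T : Rstab (ShT T) = Rstab T.
Proof.
by apply/setP => s; rewrite !inE; apply: eq_forallb => k; rewrite !ffunE /= (inj_eq negb_inj).
Qed.

Lemma Cstab_comp T s k : s \in Cstab T -> (T (s k)).1 = (T k).1.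
Proof. by move=> /CstabP/(_ k)[]. Qed.
Lemma actT_comp T s k : s \in Cstab T -> (actT s T k).1 = (T k).1.
Proof. by rewrite -CstabV ffunE => /Cstab_comp. Qed.
Lemma tsgn_comp w T T' : (forall k, (T k).1 = (T' k).1) -> tsgn w T = tsgn w T'.
Proof. by move=> h; apply: eq_bigr => k _; rewrite h. Qed.
Lemma tsgnM (u v : WD n) T : tsgn (u * v)%g (actT (prmW u) T) = tsgn u (actT (prmW u) T) (+) tsgn v T.
Proof.
rewrite /tsgn [X in _ = _ (+) X](reindex_inj (@perm_inj _ (prmW u)^-1%g)) /= -big_split /=.
by apply: eq_bigr => k _; rewrite /sgnW /= !ffunE andb_addl.
Qed.

Lemma rowlen_Tab lam T nu i : T \in Tab lam ->
  rowlen lam nu i = #|[set k | ((T k).1 == nu) && (crow (T k) == i :> nat)]|.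
Proof.
move=> hT; have [Tinj Tsh] := TabP _ _ hT.
have [hi|hi] := ltnP i n; last first.
  rewrite rowlen_n //; symmetry; apply: eq_card0 => k; rewrite inE; apply/negP => /andP[_ /eqP h].
  by have := ltn_ord (crow (T k)); rewrite h ltnNge hi.
rewrite /rowlen -[RHS](card_imset _ Tinj) -(@card_imset _ _ (fun j => (nu, (Ordinal hi, j)) : cell n)); last first.
  by move=> a b [].
apply: eq_card => c; apply/imsetP/imsetP => [[j]|[k]].
  rewrite -[ i ]/(nat_of_ord (Ordinal hi)) in_rowset -Tsh => /imsetP[k _ e] ->.
  by exists k => //; rewrite inE -e /crow /= !eqxx.
rewrite inE => /andP[/eqP h1 /eqP h2] ->; exists (ccol (T k)).
  have e : T k = (nu, (Ordinal hi, ccol (T k))).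
    rewrite -h1; case: (T k) h2 => a [b d]; rewrite /crow /ccol /= => h2.
    by congr (_, (_, _)); apply: val_inj.
  by rewrite -[ i ]/(nat_of_ord (Ordinal hi)) in_rowset -e Tab_in.
rewrite -h1; case: (T k) h2 => a [b d]; rewrite /crow /ccol /= => h2.
by congr (_, (_, _)); apply: val_inj.
Qed.

Lemma diagram_rowlen lam mu : is_diagram lam -> is_diagram mu ->
  (forall nu i, rowlen lam nu i = rowlen mu nu i) -> lam = mu.
Proof. by move=> h1 h2 h; apply/setP => -[nu [i j]]; rewrite !rowlenP // h. Qed.
(** The row lengths of a shape can be counted on any tableau of this shape. *)
Lemma shape_from_rows lam mu T T' : lam \in P2 n -> mu \in P2 n ->
  T \in Tab lam -> T' \in Tab mu ->
  (forall k, (T k).1 = (T' k).1) -> (forall k, crow (T k) = crow (T' k)) -> lam = mu.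
Proof.
move=> h1 h2 hT hT' hc hr; move: h1 h2; rewrite !inE => /andP[h1 _] /andP[h2 _]; apply: diagram_rowlen => // nu i.
rewrite (rowlen_Tab _ _ hT) (rowlen_Tab _ _ hT'); apply: eq_card => k.
by rewrite !inE hc hr.
Qed.

(** The order on shapes that makes the Specht argument triangular. *)
Definition wt lam : nat := (\sum_(c in lam) crow c)%N.
Lemma wt_Tab lam T : T \in Tab lam -> wt lam = (\sum_k crow (T k))%N.
Proof.
by move=> /TabP[h <-]; rewrite /wt big_imset //= => a b _ _; apply: h.
Qed.

End TabAction.

(** * Rearrangement along the columns *)

Section ColumnLemma.
Local Open Scope nat_scope.
Variable n : nat.
Implicit Types (lam mu : {set cell n}) (c : cell n) (S T : tableau n) (s t : {perm 'I_n}).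

Definition same_col T i j := ((T i).1 == (T j).1) && (ccol (T i) == ccol (T j)).
Definition col_inj T (a : 'I_n -> nat) := forall i j, same_col T i j -> a i = a j -> i = j.

Lemma same_col_eq T i j k : same_col T i j -> same_col T k i = same_col T k j.
Proof. by rewrite /same_col => /andP[/eqP -> /eqP ->]. Qed.
Lemma same_colxx T i : same_col T i i.
Proof. by rewrite /same_col !eqxx. Qed.
Lemma same_colC T i j : same_col T i j = same_col T j i.
Proof. by rewrite /same_col eq_sym [X in _ && X]eq_sym. Qed.

Lemma same_col2 T i j k : same_col T i k -> same_col T j k -> same_col T i j.
Proof. by rewrite /same_col => /andP[/eqP -> /eqP ->] /andP[/eqP -> /eqP ->]; rewrite !eqxx. Qed.
Lemma row_col_inj lam T : T \in Tab lam -> col_inj T (fun k => crow (T k)).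
Proof.
move=> /TabP[h _] i j /andP[/eqP e1 /eqP e2] /val_inj e3; apply: h.
by case: (T i) (T j) e1 e2 e3 => [a [b c]] [a' [b' c']]; rewrite /crow /ccol /= => -> -> ->.
Qed.

(** Along a column, replace each value of a by its rank among the values of
    the column. The ranks are the numbers 0, 1, ..., like the rows of the
    cells of the column, and a rank is at most the value; in the case of
    equality a is the rank itself, that is, the row of another cell of the
    column. *)
Lemma column_rearrangement lam T (a : 'I_n -> nat) : lam \in P2 n -> T \in Tab lam -> col_inj T a ->
  (\sum_k crow (T k) <= \sum_k a k) /\
  (\sum_k crow (T k) = \sum_k a k -> exists2 t, t \in Cstab T & forall k, a k = crow (T (t k))).
Proof.
rewrite inE => /andP[/is_diagramP hd _] hT ai.
pose col k : {set 'I_n} := [set j | same_col T j k].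
pose rk k := #|[set j in col k | a j < a k]|.
have rk_le k : rk k <= a k.
  have [an|an] := leqP n (a k).
    by apply: leq_trans an; rewrite -[X in _ <= X](card_ord n) max_card.
  rewrite -[X in _ <= X](card_below (ltnW an)).
  have im j : j \in [set j in col k | a j < a k] -> a j < n.
    by rewrite inE => /andP[_ h]; apply: ltn_trans h an.
  pose f (j : 'I_n) : 'I_n := insubd j (a j).
  have fE j : j \in [set j in col k | a j < a k] -> f j = a j :> nat.
    by move=> /im h; rewrite /f val_insubd h.
  rewrite /rk -[X in X <= _](@card_in_imset _ _ f); last first.
    move=> i j hi hj e; have : a i = a j by rewrite -(fE _ hi) -(fE _ hj) e.
    apply: ai; move: hi hj; rewrite !inE => /andP[h1 _] /andP[h2 _].
    exact: same_col2 h1 h2.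
  apply: subset_leq_card; apply/subsetP => _ /imsetP[j hj ->].
  by rewrite inE fE //; move: hj; rewrite inE => /andP[].
have rk_lt k : rk k < #|col k|.
  apply: proper_card; apply/properP; split.
    by apply/subsetP => j; rewrite inE => /andP[].
  by exists k; rewrite !inE ?same_colxx //= ltnn.
have ex k : exists j, (j \in col k) && (crow (T j) == rk k :> nat).
  pose A : {set 'I_n} := [set crow (T j) | j in col k].
  have cA : #|A| = #|col k|.
    rewrite card_in_imset // => i j; rewrite !inE => h1 h2 e.
    apply: (row_col_inj hT) (congr1 val e).
    exact: same_col2 h1 h2.
  have dA (i j : 'I_n) : j \in A -> i <= j -> i \in A.
    move=> /imsetP[m mk ->] im; apply/imsetP.
    have : ((T m).1, (i, ccol (T m))) \in lam by apply: (hd _ _ (Tab_in m hT)).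
    have [_ <-] := TabP _ _ hT => /imsetP[p _ e]; exists p; rewrite -?e //.
    by move: mk; rewrite !inE /same_col -e.
  have rn : rk k < n.
    by apply: leq_trans (rk_lt k) _; rewrite -[X in _ <= X](card_ord n) max_card.
  have : Ordinal rn \in A by rewrite (initial_segment dA) cA rk_lt.
  by move=> /imsetP[j jk e]; exists j; rewrite jk -e /=.
have [f fE] : {f : 'I_n -> 'I_n | forall k, same_col T (f k) k /\ crow (T (f k)) = rk k :> nat}.
  by exists (fun k => xchoose (ex k)) => k; have /andP[] := xchooseP (ex k); rewrite inE => h /eqP.
(* f sends k to the cell of its column in the row given by its rank. *)
have f_inj : injective f.
  move=> i j e; have [h1 r1] := fE i; have [h2 r2] := fE j.
  have ij : same_col T i j by rewrite same_colC -(same_col_eq _ h1) e same_colC.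
  have rr : rk i = rk j by rewrite -r1 -r2 e.
  have cc : col i = col j by apply/setP => m; rewrite !inE (same_col_eq _ ij).
  apply: (ai _ _ ij); apply/eqP; rewrite eqn_leq; apply/andP; split; rewrite leqNgt; apply/negP => lt.
    have : rk j < rk i; last by rewrite rr ltnn.
    apply: proper_card; apply/properP; split.
      by apply/subsetP => m; rewrite !inE -(same_col_eq _ ij) => /andP[-> /ltn_trans->].
    by exists j; rewrite !inE ?ltnn ?andbF // same_colC ij lt.
  have : rk i < rk j; last by rewrite rr ltnn.
  apply: proper_card; apply/properP; split.
    by apply/subsetP => m; rewrite !inE -(same_col_eq _ ij) => /andP[-> /ltn_trans->].
  by exists i; rewrite !inE ?ltnn ?andbF // ij lt.
have sE : \sum_k crow (T k) = \sum_k rk k.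
  by rewrite (reindex_inj f_inj); apply: eq_bigr => k _; have [_ ->] := fE k.
split; first by rewrite sE; apply: leq_sum.
move=> e; exists (perm f_inj).
  by apply/CstabP => k; rewrite permE; have [/andP[/eqP -> /eqP ->]] := fE k.
move=> k; rewrite permE; have [_ ->] := fE k; apply/eqP; rewrite eq_sym eqn_leq rk_le /= leqNgt.
apply/negP => lt; have : \sum_k rk k < \sum_k a k; last by rewrite -sE e ltnn.
by rewrite (bigD1 k) //= [X in _ < X](bigD1 k) //= -addSn leq_add // leq_sum.
Qed.

End ColumnLemma.

(** * Lowest Specht polynomials *)

Section LowestSpecht.
Variables (R : realType) (n : nat).
Local Notation C := R[i].
Local Notation Pol := {mpoly C[n]}.
Implicit Types (lam mu : {set cell n}) (c : cell n) (S T : tableau n) (s t : {perm 'I_n}) (w : WD n).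

Lemma mcoeff_actP w (p : Pol) (m : 'X_{1..n}) :
  (actP w p)@_m = (-1) ^+ msgn w m * p@_(mnm_act (prmW w)^-1 m).
Proof.
rewrite {1}[p]mpolyE actP_sum raddf_sum /=.
have hm k : (mnm_act (prmW w) k == m) = (k == mnm_act (prmW w)^-1 m).
  apply/eqP/eqP => [<-|->]; apply/mnmP => i; rewrite !mnmE ?invgK ?permK //.
  by rewrite permKV.
under eq_bigr => k _ do
  rewrite actPZ actP_mnm !mcoeffZ mcoeffX hm.
have [h|h] := boolP (mnm_act (prmW w)^-1 m \in msupp p); last first.
  rewrite (memN_msupp_eq0 h) mulr0 big_seq big1 // => k hk.
  case: eqVneq => [e|_]; last by rewrite !mulr0.
  by move: h; rewrite -e hk.
rewrite (bigD1_seq _ h (msupp_uniq p)) /= eqxx mulr1 big1 ?addr0; last first.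
  by move=> k /negPf ->; rewrite !mulr0.
rewrite mulrC; congr ((-1) ^+ msgn w _ * _).
by apply/mnmP => i; rewrite !mnmE invgK permKV.
Qed.

(** For a shape equal to its exchange, the exchange of the components acts by
    (-1)^l on this combination; so l = 0, 1 distinguishes the two
    representations attached to the shape. *)
Definition tab_poly (r : cell n -> nat) (l : nat) T : Pol :=
  if Sh (tshape T) == tshape T
  then 'X_[mono r T] + (-1) ^+ l *: 'X_[mono r (ShT T)] else 'X_[mono r T].

Lemma actP_tab_poly w r l T : actP w (tab_poly r l T) =
  (-1) ^+ tsgn w (actT (prmW w) T) *: tab_poly r l (actT (prmW w) T).
Proof.
rewrite /tab_poly tshape_actT; case: ifP => _; last by rewrite actP_mnm mnm_act_mono msgn_mono.
rewrite actPD actPZ !actP_mnm !mnm_act_mono !msgn_mono actT_ShT tsgn_ShT.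
by rewrite scalerDr; congr (_ + _); rewrite !scalerA mulrC.
Qed.

Lemma tsgn_permW s T : tsgn (permW s) T = false.
Proof. by rewrite /tsgn big1 // => k _; rewrite sgnW_permW andFb. Qed.
Lemma actP_permW_tab_poly s r l T : actP (permW s) (tab_poly r l T) = tab_poly r l (actT s T).
Proof. by rewrite actP_tab_poly prmW_permW tsgn_permW scale1r. Qed.
Lemma tab_poly_ShT r l T : Sh (tshape T) = tshape T -> tab_poly r l (ShT T) = (-1) ^+ l *: tab_poly r l T.
Proof.
move=> h; rewrite /tab_poly tshape_ShT !h !eqxx ShTK scalerDr scalerA -expr2 sqrr_sign scale1r.
exact: addrC.
Qed.

Lemma mono_row T T' : (forall k, (T k).1 = (T' k).1) -> (forall k, crow (T k) = crow (T' k)) ->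
  mono (@rowc n) T = mono (@rowc n) T'.
Proof. by move=> h1 h2; apply/mnmP => k; rewrite !mnmE /rowc h1 h2. Qed.
(** The columns of T do not occur in the exponents. *)
Lemma tab_poly_row l T T' : tshape T = tshape T' -> (forall k, (T k).1 = (T' k).1) ->
  (forall k, crow (T k) = crow (T' k)) -> tab_poly (@rowc n) l T = tab_poly (@rowc n) l T'.
Proof.
move=> h h1 h2; rewrite /tab_poly h (mono_row h1 h2) (@mono_row (ShT T) (ShT T')) // => k.
  by rewrite !ffunE /= h1.
by rewrite !ffunE; apply: h2.
Qed.

(** The Specht polynomial of the monomial whose exponents are the smallest
    ones that are distinct along the columns of T. *)
Definition low_specht (l : nat) T : Pol :=
  \sum_(t in Cstab T) (-1) ^+ (t : bool) *: tab_poly (@rowc n) l (actT t T).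

(** Conjugation by the permutation part of w carries the column stabilizer of
    T to that of its image, and a column permutation does not change the
    components, hence not the sign. *)
Lemma actP_low w l T : actP w (low_specht l T) = (-1) ^+ tsgn w (actT (prmW w) T) *: low_specht l (actT (prmW w) T).
Proof.
rewrite /low_specht actP_sum scaler_sumr [RHS](reindex_inj (conjg_inj (prmW w))) /=.
apply: eq_big => [t|t ht]; first by rewrite Cstab_actT conjgK.
rewrite actPZ actP_tab_poly !scalerA odd_permJ mulrC -!actTM -conjgC.
rewrite (@tsgn_comp _ _ (actT (t * prmW w)%g T) (actT (prmW w) T)) // => k.
by have := actT_comp ((prmW w)^-1%g k) ht; rewrite actTM !ffunE.
Qed.

Lemma actP_permW_low s l T : actP (permW s) (low_specht l T) = low_specht l (actT s T).
Proof. by rewrite actP_low prmW_permW tsgn_permW scale1r. Qed.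
Lemma low_ShT l T : Sh (tshape T) = tshape T -> low_specht l (ShT T) = (-1) ^+ l *: low_specht l T.
Proof.
move=> h; rewrite /low_specht Cstab_ShT scaler_sumr; apply: eq_bigr => t _.
by rewrite actT_ShT tab_poly_ShT ?tshape_actT // !scalerA mulrC.
Qed.

Lemma low_Cstab l T s : s \in Cstab T -> low_specht l (actT s T) = (-1) ^+ (s : bool) *: low_specht l T.
Proof.
move=> hs; rewrite /low_specht scaler_sumr [RHS](reindex_inj (mulgI s)) /=.
apply: eq_big => [t|t ht].
  by rewrite Cstab_actT conjgE invgK !(CstabMr _ hs) CstabMl ?CstabV.
by rewrite actTM scalerA odd_permM -signr_addb addbA addbb.
Qed.

(** All sign changes are included: they act on the polynomial of T by a sign,
    and they detect the components of T. *)
Definition CstabW T : {set WD n} := [set w | prmW w \in Cstab T].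
Lemma CstabWE T w : (w \in CstabW T) = (prmW w \in Cstab T). Proof. by rewrite in_set. Qed.
(** The character through which CstabW T acts on the lowest Specht polynomial
    of T. *)
Definition chi T w : C := (-1) ^+ (prmW w (+) tsgn w T).
Lemma chi_sq T w : chi T w * chi T w = 1.
Proof. by rewrite /chi -expr2 sqrr_sign. Qed.
Lemma CstabW_permW T s : (permW s \in CstabW T) = (s \in Cstab T).
Proof. by rewrite CstabWE prmW_permW. Qed.
Lemma chi_permW T s : chi T (permW s) = (-1) ^+ (s : bool).
Proof. by rewrite /chi tsgn_permW prmW_permW addbF. Qed.
Lemma tsgn_CstabW w s T : s \in Cstab T -> tsgn w (actT s T) = tsgn w T.
Proof. by move=> h; apply: tsgn_comp => k; apply: actT_comp. Qed.
Lemma chiM T (u v : WD n) : u \in CstabW T -> chi T (u * v)%g = chi T u * chi T v.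
Proof.
rewrite CstabWE => hu; rewrite /chi -signr_addb prmWM odd_permM; congr (_ ^+ _).
have <- := tsgn_CstabW (u * v)%g hu; rewrite tsgnM tsgn_CstabW //.
by case: (prmW u : bool) (prmW v : bool) (tsgn u T) (tsgn v T) => [] [] [] [].
Qed.

Lemma CstabWM T (u v : WD n) : u \in CstabW T -> ((u * v)%g \in CstabW T) = (v \in CstabW T).
Proof. by rewrite !CstabWE prmWM => hu; rewrite CstabMl. Qed.
Lemma CstabWMr T (u v : WD n) : v \in CstabW T -> ((u * v)%g \in CstabW T) = (u \in CstabW T).
Proof. by rewrite !CstabWE prmWM => hu; rewrite CstabMr. Qed.
Lemma CstabW1 T : 1%g \in CstabW T.
Proof. by rewrite CstabWE Cstab1. Qed.
Lemma actP_CstabW_low w l T : w \in CstabW T -> actP w (low_specht l T) = chi T w *: low_specht l T.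
Proof.
rewrite CstabWE => hw; rewrite actP_low (tsgn_CstabW w hw) (low_Cstab l hw) scalerA; congr (_ *: _).
by rewrite /chi signr_addb; apply: mulrC.
Qed.

Lemma card_CstabW T : #|CstabW T|%:R != 0 :> C.
Proof. by rewrite pnatr_eq0 -lt0n; apply/card_gt0P; exists 1%g; apply: CstabW1. Qed.
Lemma actP_lin w (k : C) (p q : Pol) : actP w (k *: p + q) = k *: actP w p + actP w q.
Proof. by rewrite actPD actPZ. Qed.
Definition col_avg_elt T : galg C (WD n) := sign_average (CstabW T) (chi T).
Definition col_avg T : Pol -> Pol := gact (@actP R n) (col_avg_elt T).
Lemma col_avg_fix T p : (forall w, w \in CstabW T -> actP w p = chi T w *: p) -> col_avg T p = p.
Proof. exact: (avg_fix (chi_sq T) (card_CstabW T)). Qed.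
Lemma actP_col_avg T w p : w \in CstabW T -> actP w (col_avg T p) = chi T w *: col_avg T p.
Proof. exact: (act_avg actP_lin (@actPM R n) (@CstabWM T) (@chiM T) (chi_sq T)). Qed.
Lemma col_avg_actP T w p : w \in CstabW T -> col_avg T (actP w p) = chi T w *: col_avg T p.
Proof. exact: (avg_act (@actPM R n) (@CstabWMr T) (@chiM T) (chi_sq T)). Qed.
Lemma col_avg_kill T w p e : w \in CstabW T -> actP w p = e *: p -> e != chi T w -> col_avg T p = 0.
Proof. exact: (avg_kill actP_lin (@actPM R n) (@CstabWMr T) (@chiM T) (chi_sq T)). Qed.
Lemma col_avg_low l T : col_avg T (low_specht l T) = low_specht l T.
Proof. by apply: col_avg_fix => w; apply: actP_CstabW_low. Qed.
(** The lowest Specht polynomial is an alternating sum of column translates of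
    tab_poly, and it is equal to its own average. *)
Lemma col_avg_tab_poly l T : col_avg T (tab_poly (@rowc n) l T) = #|Cstab T|%:R^-1 *: low_specht l T.
Proof.
apply: (avg_alternating actP_lin (@actPM R n) (@CstabWMr T) (@chiM T) (chi_sq T)
  (A := Cstab T) (emb := @permW n)) => [s hs|||].
- by rewrite CstabW_permW.
- by rewrite pnatr_eq0 -lt0n; apply/card_gt0P; exists 1%g; apply: Cstab1.
- by apply: eq_bigr => s _; rewrite chi_permW actP_permW_tab_poly.
- exact: col_avg_low.
Qed.

Lemma flip_sum i j (ij : i != j) (f : 'I_n -> bool) :
  \big[addb/false]_k (sgnW (flipW ij) k && f k) = f i (+) f j.
Proof.
rewrite (bigD1 i) //= (bigD1 j) ?(eq_sym j) //= big1 ?addbF.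
  by rewrite /sgnW /= !ffunE !eqxx ?orbT.
by move=> k /andP[/negPf ki /negPf kj]; rewrite /sgnW /= ffunE ki kj.
Qed.

Lemma flip_CstabW T i j (ij : i != j) : flipW ij \in CstabW T.
Proof. by rewrite CstabWE; apply: Cstab1. Qed.
Lemma chi_flip T i j (ij : i != j) : chi T (flipW ij) = (-1) ^+ ((T i).1 (+) (T j).1).
Proof. by rewrite /chi /tsgn flip_sum /prmW /= odd_perm1. Qed.
Lemma tperm_Cstab T i j : same_col T i j -> tperm i j \in Cstab T.
Proof.
move=> /andP[/eqP h1 /eqP h2]; apply/CstabP => k.
by case: tpermP => [->|->|_ _].
Qed.

Lemma sign_inj (a b : bool) : (-1) ^+ a = (-1) ^+ b :> C -> a = b.
Proof. exact: signr_inj. Qed.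

(** A monomial of a polynomial on which CstabW T acts through chi cannot be an
    eigenvector of a stabilizing element for another value: sign changes at i
    and j give the parities, and the transposition of i and j, when they are
    in the same column, excludes equal exponents. *)
Lemma anti_support T p (m : 'X_{1..n}) : (forall w, w \in CstabW T -> actP w p = chi T w *: p) ->
  p@_m != 0 -> (forall i j, odd (m i) (+) odd (m j) = (T i).1 (+) (T j).1) /\ col_inj T m.
Proof.
move=> h pm; have pE w : w \in CstabW T -> mnm_act (prmW w)^-1 m = m -> (-1) ^+ msgn w m = chi T w.
  move=> hw e; have := congr1 (fun q : Pol => q@_m) (h _ hw); rewrite mcoeff_actP mcoeffZ e.
  by move/(mulIf pm).
split=> i j.
  have [->|ij] := eqVneq i j; first by rewrite !addbb.
  have := pE _ (flip_CstabW T ij); rewrite /msgn flip_sum chi_flip => hh.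
  by apply: sign_inj; apply: hh; apply/mnmP => k; rewrite mnmE invgK /prmW /= perm1.
move=> sc mm; apply/eqP; apply: contraT => ij.
have := pE (permW (tperm i j)); rewrite CstabW_permW tperm_Cstab // chi_permW => /(_ isT).
rewrite odd_tperm ij /msgn big1; last by move=> k _; rewrite sgnW_permW.
move=> hh; suff : false = true by [].
apply: sign_inj; apply: hh; apply/mnmP => k; rewrite mnmE invgK prmW_permW; case: tpermP => // ->; by rewrite mm.
Qed.

End LowestSpecht.

(** * Separation of the lowest Specht polynomials *)

Section Kill.
Variables (R : realType) (n : nat).
Local Notation C := R[i].
Hypothesis n_gt0 : (0 < n)%N.
Implicit Types (lam mu : {set cell n}) (c : cell n) (S T : tableau n) (s t : {perm 'I_n}) (w : WD n).
Local Notation tab_poly := (tab_poly R).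
Local Notation low_specht := (low_specht R).
Local Notation rowc := (@rowc n).
Let i0 : 'I_n := Ordinal n_gt0.

(** If the monomial of T' survives the average over the columns of T, then by
    sign changes T' separates the components as T does, possibly exchanged,
    and by transpositions its rows are distinct along the columns of T; as
    their sum is not larger than that of T, column_rearrangement shows that
    they are the rows of T up to a column permutation. *)
Lemma tab_poly_support_cases lam lam' l T T' : lam \in P2 n -> lam' \in P2 n ->
  T \in Tab lam -> T' \in Tab lam' -> (wt lam' <= wt lam)%N ->
  col_avg T (tab_poly rowc l T') = 0 \/
  exists2 t, t \in Cstab T & exists b : bool, forall k,
    (T' k).1 = (T (t k)).1 (+) b /\ crow (T' k) = crow (T (t k)).
Proof.
move=> hl hl' hT hT' hw.
have [hpar|] := boolP [forall i, forall j, ((T' i).1 (+) (T' j).1) == ((T i).1 (+) (T j).1)]; last first.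
  move=> /forallPn[i /forallPn[j hij]]; left.
  have ij : i != j by apply: contraNneq hij => ->; rewrite !addbb.
  apply: (@col_avg_kill R n T (flipW ij) _ ((-1) ^+ ((T' i).1 (+) (T' j).1)) (flip_CstabW _ _)).
    rewrite actP_tab_poly; have -> : prmW (flipW ij) = 1%g by [].
    by rewrite actT1 /tsgn flip_sum.
  by rewrite chi_flip; apply: contraNneq hij => /sign_inj ->; rewrite eqxx.
have {}hpar i j : (T' i).1 (+) (T' j).1 = (T i).1 (+) (T j).1.
  by move/forallP: hpar => /(_ i) /forallP/(_ j)/eqP.
have [hcol|] := boolP [forall i, forall j, (same_col T i j && (crow (T' i) == crow (T' j))) ==> (i == j)]; last first.
  move=> /forallPn[i /forallPn[j]]; rewrite negb_imply => /andP[/andP[sc /eqP rr] ij]; left.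
  apply: (@col_avg_kill R n T (permW (tperm i j)) _ 1); rewrite ?CstabW_permW ?tperm_Cstab //.
    rewrite actP_permW_tab_poly scale1r; apply: tab_poly_row; first exact: tshape_actT.
      have e : (T' i).1 = (T' j).1.
        by have := hpar i j; move/andP: sc => [/eqP -> _]; rewrite addbb; case: (T' i).1; case: (T' j).1.
      by move=> k; rewrite ffunE tpermV; case: tpermP => [->|->|] //; rewrite e.
    by move=> k; rewrite ffunE tpermV; case: tpermP => [->|->|] //; rewrite rr.
  rewrite chi_permW odd_tperm ij; apply/eqP => h.
  by suff : false = true by []; apply: sign_inj; rewrite expr0; exact: h.
have {}hcol : col_inj T (fun k => crow (T' k)).
  move=> i j sc /val_inj rr; move/forallP: hcol => /(_ i) /forallP/(_ j)/implyP.
  by rewrite sc rr eqxx => /(_ isT)/eqP.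
right; have [le eq] := column_rearrangement hl hT hcol.
have [t ht tE] : exists2 t, t \in Cstab T & forall k, crow (T' k) = crow (T (t k)) :> nat.
  by apply: eq; apply/eqP; rewrite eqn_leq le /= -(wt_Tab hT) -(wt_Tab hT').
exists t => //; exists ((T' i0).1 (+) (T i0).1) => k; split; last exact/val_inj/tE.
rewrite (Cstab_comp _ ht); have := hpar k i0.
by case: (T' k).1; case: (T' i0).1; case: (T k).1; case: (T i0).1.
Qed.

(** Up to a column permutation of T, the tableau T' has the rows and the
    components of T, or the rows of T and the components exchanged; in the
    second case the shape equals its exchange. *)
Lemma col_avg_tab_poly_same lam l T T' : lam \in P2 n -> T \in Tab lam -> T' \in Tab lam ->
  exists c : C, col_avg T (tab_poly rowc l T') = c *: low_specht l T.
Proof.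
move=> hl hT hT'.
have [->|[t ht [b hb]]] := tab_poly_support_cases l hl hl hT hT' (leqnn _).
  by exists 0; rewrite scale0r.
have htV : t^-1%g \in Cstab T by rewrite CstabV.
have [_ shT] := TabP _ _ hT; have [_ shT'] := TabP _ _ hT'.
have key : exists c : C, tab_poly rowc l T' = c *: tab_poly rowc l (actT t^-1%g T).
  case: b hb => hb; last first.
    exists 1; rewrite scale1r; apply: tab_poly_row; first by rewrite tshape_actT shT.
      by move=> k; rewrite ffunE invgK; have [-> _] := hb k; rewrite addbF.
    by move=> k; rewrite ffunE invgK; have [_ ->] := hb k.
  have e : lam = Sh lam.
    apply: (shape_from_rows (T := T') (T' := ShT (actT t^-1%g T))) => //.
    - exact: Sh_P2.
    - exact/Tab_ShT/Tab_actT.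
    - by move=> k; rewrite !ffunE invgK; have [-> _] := hb k; rewrite addbT.
    - by move=> k; rewrite !ffunE invgK; have [_ ->] := hb k.
  exists ((-1) ^+ l); rewrite -tab_poly_ShT ?tshape_actT ?shT //; apply: tab_poly_row.
  - by rewrite tshape_ShT tshape_actT shT shT'.
  - by move=> k; rewrite !ffunE invgK; have [-> _] := hb k; rewrite addbT.
  - by move=> k; rewrite !ffunE invgK; have [_ ->] := hb k.
case: key => c ->; exists (c * (chi R T (permW t^-1%g) * #|Cstab T|%:R^-1)).
rewrite -actP_permW_tab_poly /col_avg (gactZr (@actP_lin R n)) -!/(col_avg _ _).
by rewrite col_avg_actP ?CstabW_permW // col_avg_tab_poly !scalerA mulrA.
Qed.

(** A surviving T' has the row lengths of T, or those of its exchange. *)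
Lemma col_avg_tab_poly_other lam lam' l T T' : lam \in P2 n -> lam' \in P2 n ->
  T \in Tab lam -> T' \in Tab lam' -> (wt lam' <= wt lam)%N ->
  lam' != lam -> lam' != Sh lam -> col_avg T (tab_poly rowc l T') = 0.
Proof.
move=> hl hl' hT hT' hw ne1 ne2.
have [//|[t ht [b hb]]] := tab_poly_support_cases l hl hl' hT hT' hw; exfalso.
have htV : t^-1%g \in Cstab T by rewrite CstabV.
case: b hb => hb.
  case/negP: ne2; apply/eqP; apply: (shape_from_rows (T := T') (T' := ShT (actT t^-1%g T))) => //.
  - exact: Sh_P2.
  - exact/Tab_ShT/Tab_actT.
  - by move=> k; rewrite !ffunE invgK; have [-> _] := hb k; rewrite addbT.
  - by move=> k; rewrite !ffunE invgK; have [_ ->] := hb k.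
case/negP: ne1; apply/eqP; apply: (shape_from_rows (T := T') (T' := actT t^-1%g T)) => //.
- exact/Tab_actT.
- by move=> k; rewrite !ffunE invgK; have [-> _] := hb k; rewrite addbF.
- by move=> k; rewrite !ffunE invgK; have [_ ->] := hb k.
Qed.

Lemma col_avg_low_same lam l T T' : lam \in P2 n -> T \in Tab lam -> T' \in Tab lam ->
  exists c : C, col_avg T (low_specht l T') = c *: low_specht l T.
Proof.
move=> hl hT hT'; rewrite /col_avg (gact_sumr (@actP_lin R n)).
have h t : exists c : C, col_avg T (tab_poly rowc l (actT t T')) = c *: low_specht l T.
  exact: (col_avg_tab_poly_same l hl hT (Tab_actT t hT')).
exists (\sum_(t in Cstab T') (-1) ^+ (t : bool) * projT1 (cid (h t))).
rewrite scaler_suml; apply: eq_bigr => t _; rewrite (gactZr (@actP_lin R n)) -!/(col_avg _ _).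
by case: (cid (h t)) => c /= ->; rewrite scalerA.
Qed.

Lemma col_avg_low_other lam lam' l T T' : lam \in P2 n -> lam' \in P2 n ->
  T \in Tab lam -> T' \in Tab lam' -> (wt lam' <= wt lam)%N ->
  lam' != lam -> lam' != Sh lam -> col_avg T (low_specht l T') = 0.
Proof.
move=> hl hl' hT hT' hw ne1 ne2; rewrite /col_avg (gact_sumr (@actP_lin R n)).
rewrite big1 // => t _; rewrite (gactZr (@actP_lin R n)) -!/(col_avg _ _).
by rewrite (col_avg_tab_poly_other l hl hl' hT (Tab_actT t hT') hw ne1 ne2) scaler0.
Qed.

Lemma scale_collect (A : comRingType) (V : lmodType A) (a c e f : A) (v : V) :
  a *: (c *: v + e *: (c *: (f *: v))) = (a * (c + e * (c * f))) *: v.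
Proof. by rewrite [c *: (f *: v)]scalerA [e *: _]scalerA -scalerDl scalerA. Qed.
Lemma two_neq0 : 2%:R != 0 :> C. Proof. by rewrite pnatr_eq0. Qed.

(** The average over the column group of T suffices when the shape differs
    from its exchange. Otherwise it does not distinguish l = 0 from l = 1, and
    it is followed by the projection (1 + (-1)^l s) / 2, where s renumbers T
    as its exchange and acts by (-1)^l' on the polynomial of T and l'. *)
Lemma separating_elt lam l T : lam \in P2 n -> (l < enumb lam)%N -> T \in Tab lam ->
  exists b : galg C (WD n),
  [/\ gact (@actP R n) b (low_specht l T) = low_specht l T,
      forall T', T' \in Tab lam -> exists c : C, gact (@actP R n) b (low_specht l T') = c *: low_specht l T,
      forall l' T', (l' < enumb lam)%N -> l' != l -> T' \in Tab lam ->
        gact (@actP R n) b (low_specht l' T') = 0 &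
      forall lam' l' T', lam' \in P2 n -> (wt lam' <= wt lam)%N -> lam' != lam -> lam' != Sh lam ->
        T' \in Tab lam' -> gact (@actP R n) b (low_specht l' T') = 0].
Proof.
move=> hl; have [hs|hs] := bnumP lam => hle hT; last first.
  exists (col_avg_elt R T); split.
  - exact: col_avg_low.
  - by move=> T'; apply: col_avg_low_same.
  - by move=> l' T'; case: l l' hle => [|l] [|l'].
  - by move=> lam' l' T' hl' hw n1 n2 hT'; apply: (col_avg_low_other l' hl hl').
have [_ shT] := TabP _ _ hT.
have [s sE] : exists s, ShT T = actT s T.
  by apply: (Tab_trans hT); rewrite -hs; apply: Tab_ShT.
pose th : galg C (WD n) := gdelta C (permW s).
pose b : galg C (WD n) := 2%:R^-1 *: ((1 + (-1) ^+ l *: th) * col_avg_elt R T).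
have bE p : gact (@actP R n) b p = 2%:R^-1 *: (col_avg T p + (-1) ^+ l *: actP (permW s) (col_avg T p)).
  rewrite /b gactZl (gactM (@actP_lin R n) (@actPM R n)) gactDl (gact1 (@actP1 R n)) gactZl.
  by rewrite gact_delta.
(* The exchange acts on the polynomial of T and l' by (-1)^l', through the
   renumbering s. *)
have sG l' : actP (permW s) (low_specht l' T) = (-1) ^+ l' *: low_specht l' T.
  by rewrite actP_permW_low -sE low_ShT ?shT.
have sgG l' (c : C) : 2%:R^-1 *: (c *: low_specht l' T + (-1) ^+ l *: actP (permW s) (c *: low_specht l' T)) =
   (2%:R^-1 * (c + (-1) ^+ l * (c * (-1) ^+ l'))) *: low_specht l' T.
  by rewrite actPZ sG; apply: scale_collect.
have sq1 (x : C) : 2%:R^-1 * (x + x) = x.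
  by rewrite -[x + x]mulr2n -[x *+ 2]mulr_natl mulKf ?two_neq0.
have sgn2 : (-1) ^+ l * (-1) ^+ l = 1 :> C by rewrite -expr2 sqrr_sign.
have bG (c : C) l' T' : col_avg T (low_specht l' T') = c *: low_specht l' T ->
    gact (@actP R n) b (low_specht l' T') = (2%:R^-1 * (c + (-1) ^+ l * (c * (-1) ^+ l'))) *: low_specht l' T.
  by move=> e; rewrite bE e sgG.
exists b; split.
- have -> := @bG 1 l T; last by rewrite scale1r col_avg_low.
  by rewrite mul1r sgn2 sq1 scale1r.
- move=> T' hT'; have [c hc] := col_avg_low_same l hl hT hT'; exists c; rewrite (bG _ _ _ hc).
  by rewrite mulrCA sgn2 mulr1 sq1.
- move=> l' T' hl' ne hT'; have [c hc] := col_avg_low_same l' hl hT hT'; rewrite (bG _ _ _ hc).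
  have -> : (-1) ^+ l' = - (-1) ^+ l :> C.
    by move: ne hle hl'; clear; case: l l' => [|[|l]] [|[|l']] //; rewrite ?expr0 ?expr1 ?opprK.
  rewrite mulrN mulrN mulrCA sgn2 mulr1 subrr mulr0. by rewrite scale0r.
- move=> lam' l' T' hl' hw n1 n2 hT'; rewrite bE (col_avg_low_other l' hl hl' hT hT' hw n1 n2).
  by rewrite actP0 scaler0 addr0 scaler0.
Qed.

End Kill.

(** * Row weights of standard tableaux *)

Section StandardWeights.
Local Open Scope nat_scope.
Variable n : nat.
Implicit Types (lam mu : {set cell n}) (c : cell n) (S T U : tableau n) (s t : {perm 'I_n}).

(** The rows of the entries, read as the digits of a number: this orders
    tableaux lexicographically by the rows of their largest entries. *)
Definition row_weight T : nat := \sum_k crow (T k) * n ^ k.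

Lemma digits_bound (a : 'I_n -> nat) (k0 : 'I_n) : (forall k, a k < n) ->
  \sum_(k : 'I_n | k < k0) a k * n ^ k < n ^ k0.
Proof.
move=> an; have h j : j <= n -> \sum_(k < n | k < j) a k * n ^ k < n ^ j.
  elim: j => [|j IH] hj; first by rewrite big1 ?expn0.
  rewrite (bigD1 (Ordinal hj)) /= ?leqnn // expnS.
  have /IH h : j <= n by apply: ltnW.
  rewrite (eq_bigl (fun k : 'I_n => k < j)); last first.
    by move=> k; rewrite -val_eqE /= ltnS ltn_neqAle andbC.
  have := an (Ordinal hj); set x := \sum_(_ < _ | _) _ in h *; set y := n ^ j in h *; nia.
by apply: h; apply: ltnW.
Qed.

Lemma row_weight_lt T U (k0 : 'I_n) : crow (T k0) < crow (U k0) ->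
  (forall k : 'I_n, k0 < k -> crow (T k) = crow (U k)) -> row_weight T < row_weight U.
Proof.
move=> h0 h; rewrite /row_weight.
have split_k0 (V : tableau n) : \sum_k crow (V k) * n ^ k =
   \sum_(k : 'I_n | k < k0) crow (V k) * n ^ k + (crow (V k0) * n ^ k0 + \sum_(k : 'I_n | k0 < k) crow (V k) * n ^ k).
  rewrite (bigID (fun k : 'I_n => k < k0)) /=; congr (_ + _).
  rewrite (bigD1 k0) ?ltnn //=; congr (_ + _); apply: eq_bigl => k.
  by rewrite -leqNgt -val_eqE /= ltn_neqAle andbC eq_sym.
rewrite !split_k0 (eq_bigr (fun k => crow (U k) * n ^ k)
  (P := fun k : 'I_n => k0 < k)); last by move=> k /h ->.
have hb := @digits_bound (fun k => crow (T k)) k0 (fun k => ltn_ord (crow (T k))).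
set x := \sum_(k : 'I_n | k < k0) _ in hb *; set y := n ^ k0 in hb *; set z := \sum_(k : 'I_n | k0 < k) _.
set x' := \sum_(k : 'I_n | k < k0) _.
have : (crow (T k0)).+1 * y <= crow (U k0) * y by rewrite leq_mul2r h0 orbT.
by rewrite mulSn; lia.
Qed.

Lemma standardP T k m : is_standard T -> (T k).1 = (T m).1 ->
  (crow (T k) = crow (T m) /\ ccol (T k) < ccol (T m)) \/
  (ccol (T k) = ccol (T m) /\ crow (T k) < crow (T m)) -> k < m.
Proof.
move=> /forallP/(_ k)/forallP/(_ m)/implyP h e1 h2; apply: h; rewrite e1 eqxx /=.
by case: h2 => -[-> ->]; rewrite eqxx ?orbT.
Qed.

(** The largest entry moved by t is replaced, in the standard tableau T, by a
    smaller one of the same column, which sits in a higher row. *)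
Lemma row_weight_Cstab lam T t : T \in STab lam -> t \in Cstab T -> t != 1%g ->
  row_weight (actT t T) < row_weight T.
Proof.
move=> hT ht t1; have hT' := STab_Tab hT.
have st : is_standard T by move: hT; rewrite inE => /and3P[].
have [k1 hk1] : exists k, (t^-1)%g k != k.
  apply/existsP; rewrite -negb_forall; apply: contra t1 => /forallP h.
  by apply/eqP/invg_inj; rewrite invg1; apply/permP => k; rewrite perm1; apply/eqP.
case: (@arg_maxnP _ k1 (fun k => (t^-1)%g k != k) (fun k : 'I_n => k) hk1) => k0 hk0 hmax.
have fixk (k : 'I_n) : k0 < k -> (t^-1)%g k = k.
  move=> h; apply/eqP; apply: contraLR h => /hmax; by rewrite -leqNgt.
apply: (@row_weight_lt _ _ k0); last by move=> k /fixk e; rewrite ffunE e.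
rewrite ffunE; set k' := (t^-1)%g k0 in hk0 *.
have lt : k' < k0.
  rewrite ltnNge leq_eqVlt; apply/negP => /orP[/eqP/val_inj e|/fixk e].
    by rewrite -e eqxx in hk0.
  by move: e => /perm_inj e; rewrite e eqxx in hk0.
have /CstabP/(_ k0) [e1 e2] : t^-1%g \in Cstab T by rewrite CstabV.
rewrite ltnNge leq_eqVlt; apply/negP => /orP[/eqP e|h].
  have : k' = k0; last by move=> e'; rewrite e' ltnn in lt.
  apply: (row_col_inj hT'); last by rewrite e.
  by rewrite /same_col e1 e2 !eqxx.
by have := standardP st (esym e1) (or_intror (conj (esym e2) h)); rewrite ltnNge ltnW.
Qed.

(** The entries to the left of k in its row are exactly the smaller entries of
    this row, and they fill all the columns before that of k. *)
Lemma standard_col lam T k : lam \in P2 n -> T \in STab lam ->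
  ccol (T k) = #|[set j : 'I_n | [&& j < k, (T j).1 == (T k).1 & crow (T j) == crow (T k)]]| :> nat.
Proof.
move=> hl hT; have hT' := STab_Tab hT; have [Tinj Tsh] := TabP _ _ hT'.
have /is_diagramP hd : is_diagram lam by move: hl; rewrite inE => /andP[].
have st : is_standard T by move: hT; rewrite inE => /and3P[].
rewrite -[LHS](card_below (ltnW (ltn_ord _))) -[RHS](@card_in_imset _ _ (fun j => ccol (T j))); last first.
  move=> i j; rewrite !inE => /and3P[_ /eqP e1 /eqP e2] /and3P[_ /eqP e3 /eqP e4] e5; apply: Tinj.
  move: e1 e2 e3 e4 e5.
  case: (T i) (T j) (T k) => [a [b c]] [a' [b' c']] [? [? ?]]; rewrite /crow /ccol /=.
  by move=> -> -> -> -> ->.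
apply: eq_card => c; rewrite inE; apply/idP/imsetP => [h|[j]].
  have : ((T k).1, (crow (T k), c)) \in lam by apply: (hd _ _ (Tab_in k hT')) => //; apply: ltnW.
  rewrite -Tsh => /imsetP[j _ e]; exists j; last by rewrite -e.
  rewrite inE -e /= /crow /= !eqxx !andbT; apply: (standardP st); first by rewrite -e.
  by left; rewrite -e.
rewrite inE => /and3P[jk /eqP e1 /eqP e2] ->.
rewrite ltnNge leq_eqVlt; apply/negP => /orP[/eqP/val_inj e|h].
  have e' : j = k; last by rewrite e' ltnn in jk.
  apply: Tinj; move: e1 e2 e; case: (T j) (T k) => [a [b d]] [a' [b' d']]; rewrite /crow /ccol /=.
  by move=> -> -> ->.
by have := standardP st (esym e1) (or_introl (conj (esym e2) h)); rewrite ltnNge ltnW.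
Qed.

(** By standard_col the rows and components of the entries determine the
    columns. *)
Lemma standard_row_inj lam T U : lam \in P2 n -> T \in STab lam -> U \in STab lam ->
  (forall k, (T k).1 = (U k).1) -> (forall k, crow (T k) = crow (U k)) -> T = U.
Proof.
move=> hl hT hU h1 h2; apply/ffunP => k.
have e : ccol (T k) = ccol (U k).
  apply: val_inj; rewrite /= (standard_col k hl hT) (standard_col k hl hU).
  by apply: eq_card => j; rewrite !inE !h1 !h2.
by move: e (h1 k) (h2 k); case: (T k) (U k) => [a [b d]] [a' [b' d']]; rewrite /crow /ccol /= => -> -> ->.
Qed.

End StandardWeights.

(** * Independence, and independence modulo the invariants *)

Section Coefficients.
Variables (R : realType) (n : nat).
Local Notation C := R[i].
Local Notation Pol := {mpoly C[n]}.
Hypothesis n_gt0 : (0 < n)%N.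
Implicit Types (lam mu : {set cell n}) (S T U : tableau n) (s t : {perm 'I_n}) (w : WD n).
Local Notation tab_poly := (tab_poly R).
Local Notation low_specht := (low_specht R).
Local Notation rowc := (@rowc n).
Local Notation i0 := (Ordinal n_gt0).

Lemma mono_inj r r' T U k : mono r T = mono r' U -> (T k).1 = (U k).1 /\ r (T k) = r' (U k).
Proof.
move=> /mnmP/(_ k); rewrite !mnmE => e.
have e1 : (T k).1 = (U k).1.
  by have := congr1 odd e; rewrite [LHS]oddD [RHS]oddD !oddM /= !oddb.
by split=> //; move: e; rewrite e1 => /addIn /eqP; rewrite eqn_pmul2l // => /eqP.
Qed.

(** For a shape equal to its exchange, tableaux with 1 in the same component:
    it rules out that the exchange of one has the monomial of the other. *)
Definition same_side T U := Sh (tshape T) = tshape T -> (T i0).1 = (U i0).1.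
Lemma mcoeff_tab_poly r r' l T U : same_side T U ->
  (tab_poly r l T)@_(mono r' U) = (mono r T == mono r' U)%:R.
Proof.
rewrite /same_side /tab_poly; case: eqP => [e /(_ e) h|_ _]; last exact: mcoeffX.
have /negPf ne : mono r (ShT T) != mono r' U.
  apply/eqP => /(mono_inj i0)[e' _]; move: e'; rewrite ffunE /= h.
  by case: (U i0).1.
by rewrite mcoeffD mcoeffZ !mcoeffX ne mulr0 addr0.
Qed.

Lemma same_side_actT T U t : t \in Cstab T -> same_side T U -> same_side (actT t T) U.
Proof. by move=> ht h; rewrite /same_side tshape_actT actT_comp. Qed.
Lemma mcoeff_low l T U : same_side T U -> (low_specht l T)@_(mono rowc U) =
  \sum_(t in Cstab T) (-1) ^+ (t : bool) * (mono rowc (actT t T) == mono rowc U)%:R.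
Proof.
move=> h; rewrite /low_specht raddf_sum /=; apply: eq_bigr => t ht.
by rewrite mcoeffZ mcoeff_tab_poly //; apply: same_side_actT.
Qed.

Lemma Cstab_mono lam T t : T \in Tab lam -> t \in Cstab T ->
  mono rowc (actT t T) = mono rowc T -> t = 1%g.
Proof.
move=> hT ht e; apply/invg_inj; rewrite invg1; apply/permP => k; rewrite perm1.
have [_] := mono_inj k e; rewrite /rowc ffunE => e'.
apply: (row_col_inj hT); last exact: e'.
by move: ht; rewrite -CstabV => /CstabP/(_ k)[h1 h2]; rewrite /same_col h1 h2 !eqxx.
Qed.

Lemma mcoeff_low_self lam l T : T \in Tab lam -> (low_specht l T)@_(mono rowc T) = 1.
Proof.
move=> hT; rewrite mcoeff_low // (bigD1 1%g) ?Cstab1 //= actT1 eqxx odd_perm1 mulr1 big1 ?addr0 //.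
move=> t /andP[ht t1]; case: eqP => [e|_]; last by rewrite mulr0.
by rewrite (Cstab_mono hT ht e) eqxx in t1.
Qed.

Lemma low_neq0 lam l T : T \in Tab lam -> low_specht l T != 0.
Proof.
move=> hT; apply/eqP => e; have := mcoeff_low_self l hT; rewrite e mcoeff0 => /eqP.
by rewrite eq_sym oner_eq0.
Qed.

Lemma row_weight_mono T U : mono rowc T = mono rowc U -> row_weight T = row_weight U.
Proof.
by move=> e; apply: eq_bigr => k _; have [_] := mono_inj k e; rewrite /rowc => ->.
Qed.

(** The monomials of the lowest Specht polynomial of T are those of the column
    translates of T. *)
Lemma mcoeff_low_tri lam l T U : lam \in P2 n -> T \in STab lam -> U \in STab lam -> same_side T U ->
  (low_specht l T)@_(mono rowc U) != 0 -> T != U -> (row_weight U < row_weight T)%N.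
Proof.
move=> hl hT hU h; rewrite mcoeff_low // => /eqP ne TU; apply: contrapT => /negP nlt; apply: ne.
rewrite big1 // => t ht; case: eqP => [e|_]; last by rewrite mulr0.
have [t1|t1] := eqVneq t 1%g.
  case/negP: TU; apply/eqP; apply: (standard_row_inj hl hT hU) => k;
    have := mono_inj k e; rewrite t1 actT1 => -[h1 h2] //.
  exact: val_inj.
by case/negP: nlt; rewrite -(row_weight_mono e) (row_weight_Cstab hT).
Qed.

Lemma Std_same_side lam T U : T \in STabh lam (bnum lam) -> U \in STabh lam (bnum lam) -> same_side T U.
Proof.
move=> hT hU; have [_ shT] := TabP _ _ (STabh_Tab hT); rewrite /same_side shT => hs.
move: hT hU; have [_|//] := bnumP lam.
by rewrite !(STabh1E n_gt0) => /andP[_ /negPf ->] /andP[_ /negPf ->].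
Qed.

(** In a vanishing combination, look at the coefficient of the monomial of the
    tableau of largest row weight that occurs. *)
Lemma Std_low_free lam l : lam \in P2 n -> free_family (low_specht l) (STabh lam (bnum lam)).
Proof.
move=> hl c c0 T0 hT0; apply/eqP; apply: contraT => cT0.
pose P T := (T \in STabh lam (bnum lam)) && (c T != 0).
have P0 : P T0 by rewrite /P hT0.
case: (@arg_maxnP _ T0 P (@row_weight n) P0) => U /andP[hU cU] hmax.
have := congr1 (fun p : Pol => p@_(mono rowc U)) c0.
have off T : T \in STabh lam (bnum lam) -> T != U -> c T * (low_specht l T)@_(mono rowc U) = 0.
  move=> hT TU; have [z|cT] := eqVneq (c T) 0; first by apply: etrans (mul0r _); congr (_ * _).
  have [z|ne] := eqVneq ((low_specht l T)@_(mono rowc U)) 0; first by apply: etrans (mulr0 _); congr (_ * _).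
  have hT' : T \in STab lam by move: hT; rewrite inE => /andP[].
  have hU' : U \in STab lam by move: hU; rewrite inE => /andP[].
  have := mcoeff_low_tri hl hT' hU' (Std_same_side hT hU) ne TU.
  have PT : P T by rewrite /P hT cT.
  by have le : (row_weight T <= row_weight U)%N := hmax T PT; rewrite ltnNge le.
rewrite mcoeff0 raddf_sum (bigD1 U) //= big1 ?addr0 => [|T /andP[hT TU]]; last first.
  exact: etrans (mcoeffZ _ _ _) (off T hT TU).
rewrite mcoeffZ (mcoeff_low_self l (STabh_Tab hU)) mulr1 => z.
by move/eqP: cU.
Qed.

Lemma Jplus0 : Jplus (0 : Pol).
Proof. by exists [::]; rewrite big_nil. Qed.
Lemma JplusD (p q : Pol) : Jplus p -> Jplus q -> Jplus (p + q).
Proof.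
move=> [s [hs ->]] [s' [hs' ->]]; exists (s ++ s'); rewrite big_cat; split=> // aq.
by rewrite mem_cat => /orP[/hs|/hs'].
Qed.

Lemma JplusM (a p : Pol) : Jplus p -> Jplus (a * p).
Proof.
move=> [s [hs ->]]; exists [seq (a * aq.1, aq.2) | aq <- s]; split.
  by move=> _ /mapP[aq /hs h ->].
by rewrite big_map mulr_sumr; apply: eq_bigr => aq _; rewrite mulrA.
Qed.

Lemma JplusZ (k : C) (p : Pol) : Jplus p -> Jplus (k *: p).
Proof. by rewrite -mul_mpolyC; apply: JplusM. Qed.
Lemma Jplus_sum (I : Type) (r : seq I) (P : pred I) (f : I -> Pol) :
  (forall i, P i -> Jplus (f i)) -> Jplus (\sum_(i <- r | P i) f i).
Proof. by move=> h; apply: big_ind => //; [exact: Jplus0|exact: JplusD]. Qed.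
Lemma Jplus_actP w (p : Pol) : Jplus p -> Jplus (actP w p).
Proof.
move=> [s [hs ->]]; exists [seq (actP w aq.1, aq.2) | aq <- s]; split.
  by move=> _ /mapP[aq /hs h ->].
rewrite big_map actP_sum [LHS]big_seq [RHS]big_seq; apply: eq_bigr => aq /hs[h _].
by apply: etrans (actP_mul w aq.1 aq.2) _; congr (_ * _).
Qed.

Lemma Jplus_gact (a : galg C (WD n)) p : Jplus p -> Jplus (gact (@actP R n) a p).
Proof. by move=> h; apply: Jplus_sum => w _; apply/JplusZ/Jplus_actP. Qed.

Lemma col_avg_mul_inv T (a q : Pol) : (forall w, actP w q = q) -> col_avg T (a * q) = col_avg T a * q.
Proof.
move=> h; rewrite /col_avg /gact mulr_suml; apply: eq_bigr => w _.
rewrite -scalerAl; congr (_ *: _); apply: etrans (actP_mul w a q) _.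
by congr (_ * _).
Qed.

(** Change the signs of x_i and x_j. *)
Lemma invariant_parity (q : Pol) (m : 'X_{1..n}) i j : (forall w, actP w q = q) -> q@_m != 0 ->
  odd (m i) = odd (m j).
Proof.
move=> h qm; have [->//|ij] := eqVneq i j.
have := congr1 (fun p : Pol => p@_m) (h (flipW ij)); rewrite mcoeff_actP.
have -> : mnm_act (prmW (flipW ij))^-1 m = m.
  by apply/mnmP => k; rewrite mnmE invgK /prmW /= perm1.
rewrite /msgn flip_sum -[RHS]mul1r => /(mulIf qm) e.
have : odd (m i) (+) odd (m j) = false by apply: (@sign_inj R); rewrite e expr0.
by case: (odd (m i)); case: (odd (m j)).
Qed.

(** If it belonged to the ideal, then its column average, which is itself,
    would be a sum of products a q with a antisymmetric along the columns and
    q invariant without constant term. Let the monomial of T be a product of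
    monomials of a and q. The exponents in q have the same parity, which is
    even because x_k occurs with exponent 0 for an entry k of the first
    component in the first row. So the exponents in a have the parities of the
    components of T, they are distinct along its columns, and by
    column_rearrangement their sum is at least that of all the exponents of
    the monomial of T; nothing is left for q. *)
Lemma low_notin_Jplus lam l T : lam \in P2 n -> T \in Tab lam -> (exists k, (T k).1 = false) ->
  ~ Jplus (low_specht l T).
Proof.
move=> hl hT [k1 hk1] [s [hs e]].
have [_ Tsh] := TabP _ _ hT.
have [k hk hr] : exists2 k, (T k).1 = false & crow (T k) = 0%N :> nat.
  have /is_diagramP hd : is_diagram lam by move: hl; rewrite inE => /andP[].
  have : (false, (i0, ccol (T k1))) \in lam.
    by apply: (hd _ _ (Tab_in k1 hT)) => //.
  by rewrite -Tsh => /imsetP[k _ ek]; exists k; rewrite -ek.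
(* The coefficient of the monomial of T is 1. *)
have := mcoeff_low_self l hT; rewrite -(col_avg_low R l T) e.
rewrite /col_avg (gact_sumr (@actP_lin R n)) -/(col_avg _ _) big_seq raddf_sum /= big1 => [/eqP|aq /hs[qi q0]].
  by rewrite eq_sym oner_eq0.
rewrite -/(col_avg _ _) (col_avg_mul_inv T aq.1 qi) mcoeffM big1 // => m /eqP hm.
apply/eqP; rewrite mulf_eq0; apply: contraT; rewrite negb_or => /andP[n1 n2].
have [par ci] := anti_support (@actP_col_avg R n T ^~ aq.1) n1.
have mE i : (mono rowc T i = m.1 i + m.2 i)%N.
  by rewrite -mnmDE; congr ((_ : 'X_{1..n}) i).
have mr i : (2 * crow (T i) + (T i).1 = m.1 i + m.2 i)%N by rewrite -mE mnmE.
have par2 i : odd (m.2 i) = odd (m.2 k) by apply: invariant_parity n2.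
have ev i : odd (m.2 i) = false.
  rewrite par2; apply/negP => o; have := mr k; rewrite hk hr /=.
  by case: (m.2 k) o => // x _; rewrite addnS.
have par1 i : odd (m.1 i) = (T i).1.
  by have := congr1 odd (mr i); rewrite [LHS]oddD [RHS]oddD oddM /= ev addbF oddb.
have hc : col_inj T (fun i => (m.1 i)./2).
  move=> i j sc hh; apply: ci => //; rewrite -[LHS]odd_double_half -[RHS]odd_double_half hh !par1.
  by case/andP: sc => /eqP ->.
have [le _] := column_rearrangement hl hT hc.
have hle i : ((m.1 i)./2 <= crow (T i))%N.
  have : ((m.1 i)./2.*2 <= (crow (T i)).*2)%N; last by rewrite leq_double.
  rewrite -(leq_add2l (T i).1) -{1}(par1 i) odd_double_half -[X in (_ <= X)%N]addnC -mul2n mr.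
  exact: leq_addr.
have heq i : (m.1 i)./2 = crow (T i).
  apply/eqP; rewrite eqn_leq hle /= leqNgt; apply/negP => lt; move: le; rewrite leqNgt => /negP; apply.
  by rewrite (bigD1 i) //= [X in (_ < X)%N](bigD1 i) //= -addSn leq_add // leq_sum.
case/negP: n2; apply/eqP; rewrite -[RHS]q0; congr (_ @_ _); apply/mnmP => i; rewrite mnm0E.
have h1 : m.1 i = ((T i).1 + (crow (T i)).*2)%N by rewrite -[LHS]odd_double_half par1 heq.
by apply: (@addnI (m.1 i)); rewrite addn0 -mr h1 mul2n addnC.
Qed.

End Coefficients.

(** * Higher Specht polynomials as alternating sums of monomials *)

(** A permutation preserving the classes of e, and hence the two sides given
    by p, is in a unique way the product of one moving only the first side and
    one moving only the second side. *)
Section SplitStabilizer.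
Variables (I : finType) (p : I -> bool) (e : rel I).
Hypothesis e_p : forall a b, e a b -> p a = p b.
Definition class_stab : {set {perm I}} := [set s : {perm I} | [forall k, e (s k) k]].
Definition part_stab (nu : bool) : {set {perm I}} :=
  [set s : {perm I} | [forall k, if p k == nu then e (s k) k else s k == k]].
Lemma class_stabP (s : {perm I}) : reflect (forall k, e (s k) k) (s \in class_stab).
Proof. by rewrite inE; apply: forallP. Qed.
Lemma part_stabP nu (s : {perm I}) : reflect
  ((forall k, p k = nu -> e (s k) k) /\ (forall k, p k != nu -> s k = k)) (s \in part_stab nu).
Proof.
rewrite inE; apply: (iffP forallP) => [h|[h1 h2] k].
  by split=> k hk; have := h k; [rewrite hk eqxx|rewrite (negPf hk) => /eqP].
by case: eqP => [|/eqP] hk; [apply: h1|rewrite h2].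
Qed.

Lemma part_stab_p nu (s : {perm I}) k : s \in part_stab nu -> p (s k) = p k.
Proof.
move=> /part_stabP[h1 h2]; have [hk|hk] := eqVneq (p k) nu; first exact/e_p/h1.
by rewrite h2.
Qed.

Lemma sum_class_stab (W : nmodType) (f : {perm I} -> W) :
  \sum_(s in class_stab) f s =
  \sum_(a in part_stab false) \sum_(b in part_stab true) f (a * b)%g.
Proof.
rewrite pair_big /=.
pose side nu := [set k | p k == nu].
pose h' (s : {perm I}) := (restr_perm (side false) s, restr_perm (side true) s).
have prodE (a b : {perm I}) k : a \in part_stab false -> b \in part_stab true ->
    (a * b)%g k = if p k then b k else a k.
  move=> ha hb; rewrite permM; case hp: (p k).
    by case/part_stabP: ha => _ ->; rewrite ?hp.
  by case/part_stabP: hb => _ ->; rewrite // (part_stab_p _ ha) hp.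
have resE (s : {perm I}) nu k : s \in class_stab -> restr_perm (side nu) s k = if p k == nu then s k else k.
  move=> /class_stabP hs; case: ifP => hk; last first.
    by apply: (out_perm (restr_perm_on _ _)); rewrite inE hk.
  apply: restr_permE; last by rewrite inE.
  rewrite inE /=; apply/andP; split; first by rewrite inE.
  rewrite inE; apply/subsetP => x; rewrite !inE => /eqP <-.
  by apply/eqP; apply: e_p; apply: hs.
rewrite (reindex_onto (fun ab : {perm I} * {perm I} => (ab.1 * ab.2)%g) h') /=; last first.
  move=> s hs; apply/permP => k; rewrite permM !resE //.
  have /class_stabP/(_ k)/e_p hp := hs.
  by case hk: (p k); rewrite /= ?hk ?hp ?hk.
apply: eq_bigl => -[a b] /=; apply/andP/andP => [[hab /eqP[e1 e2]]|[ha hb]].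
  have /class_stabP hs := hab.
  have key nu : restr_perm (side nu) (a * b)%g \in part_stab nu.
    apply/part_stabP; split=> k hk; rewrite (resE _ nu k hab); last by rewrite (negPf hk).
    by rewrite hk eqxx.
  have e1' : restr_perm (side false) (a * b)%g = a := e1.
  have e2' : restr_perm (side true) (a * b)%g = b := e2.
  by move: (key false) (key true); rewrite e1' e2'.
have hab : (a * b)%g \in class_stab.
  apply/class_stabP => k; rewrite prodE //.
  by case hp: (p k); [case/part_stabP: hb => h _|case/part_stabP: ha => h _]; apply: h.
split=> //; apply/eqP; congr pair; apply/permP => k; rewrite resE // prodE //.
  by case: eqP => [->//|/eqP hk]; case/part_stabP: ha => _ ->.
by case: eqP => [->//|/eqP hk]; case/part_stabP: hb => _ ->.
Qed.

End SplitStabilizer.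

Section SpechtFormula.
Variables (R : realType) (n : nat).
Local Notation C := R[i].
Local Notation Pol := {mpoly C[n]}.
Implicit Types (lam mu : {set cell n}) (S T U : tableau n) (s t : {perm 'I_n}) (w : WD n).

Definition row_rel T : rel 'I_n := fun a b => ((T a).1 == (T b).1) && (crow (T a) == crow (T b)).
Definition col_rel T : rel 'I_n := fun a b => ((T a).1 == (T b).1) && (ccol (T a) == ccol (T b)).
Lemma row_rel_side T a b : row_rel T a b -> (T a).1 = (T b).1. Proof. by case/andP=> /eqP. Qed.
Lemma col_rel_side T a b : col_rel T a b -> (T a).1 = (T b).1. Proof. by case/andP=> /eqP. Qed.
Lemma row_stabE T nu : row_stab T nu = part_stab (fun k => (T k).1) (row_rel T) nu.
Proof.
apply/setP => s; rewrite !inE; apply: eq_forallb => k; rewrite /row_rel.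
by case: eqP => // ->.
Qed.

Lemma col_stabE T nu : col_stab T nu = part_stab (fun k => (T k).1) (col_rel T) nu.
Proof.
apply/setP => s; rewrite !inE; apply: eq_forallb => k; rewrite /col_rel.
by case: eqP => // ->.
Qed.

Lemma sum_Rstab (W : nmodType) T (f : {perm 'I_n} -> W) : \sum_(s in Rstab T) f s =
  \sum_(a in row_stab T false) \sum_(b in row_stab T true) f (a * b)%g.
Proof.
rewrite !row_stabE -(sum_class_stab (@row_rel_side T)) //.
Qed.

Lemma sum_Cstab (W : nmodType) T (f : {perm 'I_n} -> W) : \sum_(s in Cstab T) f s =
  \sum_(a in col_stab T false) \sum_(b in col_stab T true) f (a * b)%g.
Proof.
rewrite !col_stabE -(sum_class_stab (@col_rel_side T)) //.
Qed.

Lemma actS_mnm s (m : 'X_{1..n}) : actS s 'X_[C, m] = 'X_[mnm_act s m].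
Proof.
have E : [tuple ('X_(s i) : Pol) | i < n] =
    [tuple (-1) ^+ sgnW (permW s) (prmW (permW s) i) *: ('X_(prmW (permW s) i) : Pol) | i < n].
  by apply: eq_from_tnth => i; rewrite !tnth_mktuple sgnW_permW expr0 scale1r.
rewrite /actS E -/(actP (permW s) _) actP_mnm prmW_permW /msgn big1 ?scale1r // => k _.
by rewrite sgnW_permW.
Qed.

Definition half_mono (r : cell n -> nat) T nu : 'X_{1..n} :=
  [multinom (if (T k).1 == nu then 2 * r (T k) else 0)%N | k < n].
Definition side_mono T nu : 'X_{1..n} :=
  [multinom (if (T k).1 == nu then nat_of_bool nu else 0)%N | k < n].

Lemma specht_monoE S T nu : specht_mono R S T nu = 'X_[half_mono (cell_index S) T nu].
Proof.
rewrite /specht_mono [RHS]mpolyXE_id.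
rewrite [RHS](bigID (fun k => (T k).1 == nu)) /= [X in _ * X]big1 ?mulr1; last first.
  by move=> k /negPf hk; rewrite mnmE hk expr0.
rewrite [RHS](partition_big T (fun c => (c \in tshape T) && (c.1 == nu))) /=; last first.
  by move=> k ->; rewrite imset_f.
apply: eq_bigr => c /andP[_ /eqP hc]; apply: eq_big => k.
  by case: eqP => [->|]; rewrite ?andbF // hc eqxx.
by move=> /eqP e; rewrite mnmE e hc eqxx.
Qed.

Lemma side_monoE T (nu : bool) : \prod_(k : 'I_n | (T k).1 == nu) ('X_k : Pol) ^+ nu = 'X_[side_mono T nu].
Proof.
rewrite [RHS]mpolyXE_id [RHS](bigID (fun k => (T k).1 == nu)) /= [X in _ * X]big1 ?mulr1; last first.
  by move=> k /negPf hk; rewrite mnmE hk expr0.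
by apply: eq_bigr => k hk; rewrite mnmE hk.
Qed.

Definition half_term S T nu s t : 'X_{1..n} :=
  (mnm_act t (mnm_act s (half_mono (cell_index S) T nu)) + side_mono T nu)%MM.
Lemma half_termE S T a b c d : a \in row_stab T false -> b \in row_stab T true ->
  c \in col_stab T false -> d \in col_stab T true ->
  (half_term S T false a c + half_term S T true b d)%MM =
  mono (cell_index S) (actT (c * d)%g (actT (a * b)%g T)).
Proof.
rewrite !row_stabE !col_stabE => ha hb hc hd.
have ra := @row_rel_side T; have rb := @col_rel_side T.
have inv nu (e : rel 'I_n) (h : forall a b, e a b -> (T a).1 = (T b).1) (s : {perm 'I_n}) k :
    s \in part_stab (fun k => (T k).1) e nu -> (T ((s^-1)%g k)).1 = (T k).1.
  by move=> hs; have := part_stab_p h ((s^-1)%g k) hs; rewrite permKV.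
have fixo nu (e : rel 'I_n) (s : {perm 'I_n}) k : s \in part_stab (fun k => (T k).1) e nu -> (T k).1 != nu -> (s^-1)%g k = k.
  by move=> /part_stabP[_ h2] hk; rewrite -{1}(h2 k hk) permK.
apply/mnmP => k; rewrite !mnmDE !mnmE !ffunE !invMg !permM.
rewrite !(inv _ _ ra _ _ ha) !(inv _ _ ra _ _ hb) !(inv _ _ rb _ _ hc) !(inv _ _ rb _ _ hd).
case hk : (T k).1 => /=.
  have hk1 : (T ((d^-1)%g k)).1 = true by rewrite (inv _ _ rb d k hd).
  have e2 : (c^-1)%g ((d^-1)%g k) = (d^-1)%g k by apply: (fixo _ _ c _ hc); rewrite hk1.
  have hk3 : (T ((b^-1)%g ((d^-1)%g k))).1 = true by rewrite (inv _ _ ra b _ hb).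
  have e4 : (a^-1)%g ((b^-1)%g ((d^-1)%g k)) = (b^-1)%g ((d^-1)%g k).
    by apply: (fixo _ _ a _ ha); rewrite hk3.
  by rewrite add0n e2 e4.
have e1 : (d^-1)%g k = k by apply: (fixo _ _ d _ hd); rewrite hk.
have hk1 : (T ((c^-1)%g k)).1 = false by rewrite (inv _ _ rb c k hc).
have e2 : (b^-1)%g ((c^-1)%g k) = (c^-1)%g k by apply: (fixo _ _ b _ hb); rewrite hk1.
by rewrite e1 e2; apply: addn0.
Qed.

Definition hook_const T : C := (hook_prod (tshape T) true)%:R^-1 * (hook_prod (tshape T) false)%:R^-1.
Lemma hook_const_neq0 T : hook_const T != 0.
Proof.
have h nu : (hook_prod (tshape T) nu)%:R != 0 :> C.
  rewrite pnatr_eq0 -lt0n; apply: prodn_cond_gt0 => c /andP[hc _].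
  by apply/card_gt0P; exists c; rewrite inE hc !eqxx leqnn.
by rewrite mulf_neq0 // invr_eq0.
Qed.

Lemma scale_mul2 (A : comNzRingType) (V : algType A) (a b : A) (u v : V) :
  (a *: u) * (b *: v) = (a * b) *: (u * v).
Proof. by rewrite -scalerAl -scalerAr scalerA. Qed.
Lemma mul_sum4 (A : pzRingType) (I : finType) (P Q P' Q' : {set I}) (f g : I -> I -> A) :
  (\sum_(i in P) \sum_(j in Q) f i j) * (\sum_(i in P') \sum_(j in Q') g i j) =
  \sum_(i in P') \sum_(i' in P) \sum_(j in Q') \sum_(j' in Q) f i' j' * g i j.
Proof.
rewrite mulr_sumr; apply: eq_bigr => i _; rewrite mulr_suml; apply: eq_bigr => i' _.
rewrite mulr_sumr; apply: eq_bigr => j _; rewrite mulr_suml; apply: eq_bigr => j' _ //.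
Qed.

Lemma half_young S T nu : young_sym T nu (specht_mono R S T nu) *
    \prod_(k : 'I_n | (T k).1 == nu) 'X_k ^+ nu =
  (hook_prod (tshape T) nu)%:R^-1 *: \sum_(s in row_stab T nu) \sum_(t in col_stab T nu)
     (-1) ^+ (t : bool) *: 'X_[half_term S T nu s t].
Proof.
rewrite side_monoE /young_sym -scalerAl; congr (_ *: _).
rewrite mulr_suml; apply: eq_bigr => s _; rewrite mulr_suml; apply: eq_bigr => t _.
by rewrite specht_monoE !actS_mnm -scalerAl -mpolyXD.
Qed.

(** The product of the two Young symmetrizers is one alternating sum over the
    row and column stabilizers of the whole tableau, by sum_class_stab. *)
Lemma F_STE S T : F_ST R S T = hook_const T *: \sum_(s in Rstab T) \sum_(t in Cstab T)
   (-1) ^+ (t : bool) *: 'X_[mono (cell_index S) (actT t (actT s T))].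
Proof.
pose A nu := young_sym T nu (specht_mono R S T nu) * \prod_(k : 'I_n | (T k).1 == nu) 'X_k ^+ nu.
have -> : F_ST R S T = A true * A false by rewrite /F_ST big_bool.
apply: etrans (congr2 *%R (half_young S T true) (half_young S T false)) _.
apply: etrans (scale_mul2 _ _ _ _) _; congr (_ *: _).
apply: etrans (mul_sum4 _ _ _ _ _ _) _.
rewrite sum_Rstab; apply: eq_bigr => a ha; apply: eq_bigr => b hb.
rewrite sum_Cstab; apply: eq_bigr => c hc; apply: eq_bigr => d hd.
apply: etrans (scale_mul2 _ _ _ _) _.
rewrite -(half_termE S ha hb hc hd) mpolyXD odd_permM signr_addb.
by congr (_ *: _); apply: mulrC.
Qed.

End SpechtFormula.

(** * Transport from lowest to higher Specht polynomials *)

Section Transport.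
Variables (R : realType) (n : nat).
Local Notation C := R[i].
Local Notation Pol := {mpoly C[n]}.
Implicit Types (lam mu : {set cell n}) (S T U : tableau n) (s t : {perm 'I_n}) (w : WD n).
Local Notation tab_poly := (tab_poly R).
Local Notation low_specht := (low_specht R).
Local Notation rowc := (@rowc n).

Lemma actT_inj lam T s t : T \in Tab lam -> actT s T = actT t T -> s = t.
Proof.
move=> /TabP[Tinj _] e; apply/invg_inj/permP => k; apply: Tinj.
by have := congr1 (fun U : tableau n => U k) e; rewrite !ffunE.
Qed.

Lemma sum_Tab (W : nmodType) lam T (f : tableau n -> W) : T \in Tab lam ->
  \sum_(U in Tab lam) f U = \sum_s f (actT s T).
Proof.
move=> hT; have e : Tab lam = [set actT s T | s : {perm 'I_n}].
  apply/setP => U; apply/idP/imsetP => [hU|[s _ ->]]; last exact: Tab_actT.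
  by have [s ->] := Tab_trans hT hU; exists s.
by rewrite e big_imset // => s t _ _; apply: actT_inj hT.
Qed.

(** Replaces, in the monomials of tableaux of shape lam, the exponents given
    by rows by those given by r. A monomial determines a tableau only up to
    row permutations, and all these tableaux contribute; this produces the row
    symmetrization of the Young symmetrizer. *)
Definition transport (r : cell n -> nat) lam (p : Pol) : Pol :=
  \sum_(U in Tab lam) p@_(mono rowc U) *: 'X_[mono r U].

Lemma transport_lin r lam (k : C) p q :
  transport r lam (k *: p + q) = k *: transport r lam p + transport r lam q.
Proof.
rewrite /transport scaler_sumr -big_split /=; apply: eq_bigr => U _.
by rewrite mcoeffD mcoeffZ scalerDl scalerA.
Qed.

Lemma transport0 r lam : transport r lam 0 = 0.
Proof. by rewrite /transport big1 // => U _; rewrite mcoeff0 scale0r. Qed.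
Lemma transportZ r lam (k : C) p : transport r lam (k *: p) = k *: transport r lam p.
Proof. by have := transport_lin r lam k p 0; rewrite !addr0 transport0 addr0. Qed.
Lemma transportD r lam p q : transport r lam (p + q) = transport r lam p + transport r lam q.
Proof. by have := transport_lin r lam 1 p q; rewrite !scale1r. Qed.
Lemma transport_sum r lam (I : Type) (s : seq I) (P : pred I) (f : I -> Pol) :
  transport r lam (\sum_(i <- s | P i) f i) = \sum_(i <- s | P i) transport r lam (f i).
Proof. by elim/big_rec2: _ => [|i y x _ <-]; rewrite ?transport0 ?transportD. Qed.

(** W acts on the monomials of tableaux by renumbering and by signs that
    depend only on the components of the entries. *)
Lemma transport_actP r lam w p : transport r lam (actP w p) = actP w (transport r lam p).
Proof.
rewrite /transport actP_sum [LHS](reindex_inj (can_inj (actTV (prmW w)))) /=.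
apply: eq_big => U; first by rewrite !inE tshape_actT; congr (_ && _);
  apply/injectiveP/injectiveP => h a b; [|by rewrite !ffunE => /h/perm_inj];
  have := h (prmW w a) (prmW w b); rewrite !ffunE !permK => hh /hh/perm_inj.
move=> _; rewrite actPZ actP_mnm !mnm_act_mono !msgn_mono mcoeff_actP msgn_mono mnm_act_mono.
by rewrite actTV scalerA mulrC.
Qed.

Lemma transport_mono r lam T : T \in Tab lam ->
  transport r lam 'X_[mono rowc T] = \sum_(s in Rstab T) 'X_[mono r (actT s T)].
Proof.
move=> hT; rewrite /transport (sum_Tab _ hT) [RHS]big_mkcond /=; apply: eq_bigr => s _.
rewrite mcoeffX; have -> : (mono rowc T == mono rowc (actT s T)) = (s \in Rstab T).
  apply/eqP/RstabP => [e k|h].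
    have [h1 h2] := mono_inj (s k) e; move: h1 h2; rewrite /rowc ffunE permK => -> /val_inj -> //.
  apply/mnmP => k; rewrite !mnmE /rowc !ffunE.
  by have := h ((s^-1)%g k); rewrite permKV => -[-> ->].
by case: ifP => _; rewrite ?scale1r ?scale0r.
Qed.

Lemma transport_tab_poly r lam l T : T \in Tab lam ->
  transport r lam (tab_poly rowc l T) = \sum_(s in Rstab T) tab_poly r l (actT s T).
Proof.
move=> hT; have [_ shT] := TabP _ _ hT; rewrite /tab_poly shT.
have -> : \sum_(s in Rstab T) (if Sh (tshape (actT s T)) == tshape (actT s T)
    then 'X_[mono r (actT s T)] + (-1) ^+ l *: 'X_[mono r (ShT (actT s T))] else 'X_[mono r (actT s T)])
  = \sum_(s in Rstab T) (if Sh lam == lam then 'X_[mono r (actT s T)] +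
       (-1) ^+ l *: 'X_[mono r (ShT (actT s T))] else 'X_[mono r (actT s T)]) :> Pol.
  by apply: eq_bigr => s _; rewrite tshape_actT shT.
case: eqP => hs; last exact: transport_mono.
rewrite transportD transportZ transport_mono // transport_mono; last by rewrite -hs; apply: Tab_ShT.
rewrite Rstab_ShT scaler_sumr -big_split /=; apply: eq_bigr => s _.
by rewrite actT_ShT.
Qed.

Lemma transport_low r lam l T : T \in Tab lam -> transport r lam (low_specht l T) =
  \sum_(t in Cstab T) \sum_(s in Rstab T) (-1) ^+ (t : bool) *: tab_poly r l (actT t (actT s T)).
Proof.
move=> hT; rewrite /low_specht transport_sum; apply: eq_bigr => t ht.
rewrite transportZ transport_tab_poly; last exact: Tab_actT.
rewrite scaler_sumr [LHS](reindex_inj (conjg_inj t)) /=.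
by apply: eq_big => s; rewrite ?Rstab_actT ?conjgK // => _; rewrite -!actTM -conjgC.
Qed.

Lemma scale_swap (A : comNzRingType) (V : lmodType A) (a b : A) (v : V) :
  a *: (b *: v) = b *: (a *: v).
Proof. by rewrite !scalerA mulrC. Qed.
Lemma hook_const_ShT T : Sh (tshape T) = tshape T -> hook_const R (ShT T) = hook_const R T.
Proof. by move=> h; rewrite /hook_const tshape_ShT h. Qed.

(** Both sides are alternating sums over the column stabilizer and sums over
    the row stabilizer; for a shape equal to its exchange, the sum over the
    iterated exchanges is that of tab_poly. *)
Lemma higher_spechtE lam l S T : T \in Tab lam -> (l < enumb lam)%N ->
  higher_specht R l S T = hook_const R T *: transport (cell_index S) lam (low_specht l T).
Proof.
move=> hT; have [_ shT] := TabP _ _ hT.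
have F1 U : F_ST R S U = hook_const R U *: \sum_(t in Cstab U) \sum_(s in Rstab U)
   (-1) ^+ (t : bool) *: 'X_[mono (cell_index S) (actT t (actT s U))].
  by rewrite F_STE exchange_big.
rewrite (transport_low _ _ hT) /higher_specht shT.
have [hs|hs] := bnumP lam => _.
  rewrite !big_ord_recl big_ord0 addr0 /= muln0 mul0n expr0 scale1r.
  rewrite muln1 [X in (-1) ^+ X](_ : _ = l) ?muln1 //= !F1 Cstab_ShT Rstab_ShT hook_const_ShT ?shT //.
  rewrite (scale_swap _ (hook_const R T)) -scalerDr; congr (_ *: _).
  rewrite scaler_sumr -big_split /=; apply: eq_bigr => t _.
  rewrite scaler_sumr -big_split /=; apply: eq_bigr => s _.
  rewrite /tab_poly !tshape_actT shT hs eqxx !actT_ShT scalerDr; congr (_ + _).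
  by rewrite !scalerA mulrC.
rewrite big_ord_recl big_ord0 addr0 /= muln0 mul0n expr0 scale1r F1; congr (_ *: _).
apply: eq_bigr => t _; apply: eq_bigr => s _.
by rewrite /tab_poly !tshape_actT shT; case: eqP.
Qed.

End Transport.

(** * Charge indices *)

Section ChargeIndex.
Local Open Scope nat_scope.
Variable n : nat.
Implicit Types (lam mu : {set cell n}) (c : cell n) (S T U : tableau n) (s t : {perm 'I_n}).

(** The index never decreases, and it increases at some step between k and k'
    if k' is to the left of k. *)
Lemma charge_lt w k k' : k < k' -> index k' w < index k w -> charge_index w k < charge_index w k'.
Proof.
move=> kk'; rewrite -(subnKC (ltnW kk')); move: (k' - k) => d {kk'} h.
have [le eq] : charge_index w k <= charge_index w (k + d) /\
    (charge_index w (k + d) = charge_index w k -> index k w <= index (k + d) w).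
  elim: d {h} => [|d [le eq]]; first by rewrite addn0.
  rewrite addnS /=; split; first by apply: leq_trans le (leq_addr _ _).
  case: ltnP => h; first by rewrite addn1 => e; move: le; rewrite -e ltnn.
  by rewrite addn0 => /eq le'; apply: leq_trans le' h.
rewrite ltn_neqAle le andbT; apply/eqP => e.
by have := eq (esym e); rewrite leqNgt h.
Qed.

Lemma index_word S (L : seq (cell n)) (k k' : 'I_n) : index (S k') L < index (S k) L ->
  let w := flatten [seq [seq val k | k <- enum 'I_n & S k == c] | c <- L] in index (val k') w < index (val k) w.
Proof.
have mem m c : (val m \in [seq val k | k <- enum 'I_n & S k == c]) = (S m == c).
  by rewrite (mem_map val_inj) mem_filter mem_enum andbT.
elim: L => //= c L IH; rewrite !index_cat !mem !(eq_sym c).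
case: (S k' =P c) => [e'|hk']; case: (S k =P c) => [e|hk] //; last first.
  by rewrite ltnS ltn_add2l; apply: IH.
by move=> _; apply: leq_trans (leq_addr _ _); rewrite index_mem mem e'.
Qed.

Lemma index_blocks (A B : eqType) (f : A -> seq B) m (s : seq A) x a0 : a0 \in s ->
  x \in f a0 -> (forall a, x \in f a -> a = a0) -> (forall a, size (f a) = m) ->
  index x (flatten [seq f a | a <- s]) = index a0 s * m + index x (f a0).
Proof.
move=> + xa h hm; elim: s => //= a s IH; rewrite inE index_cat (eq_sym a).
case: (eqVneq a0 a) => [<- _|ne /= /IH ->]; first by rewrite xa.
case: ifP => [/h e|_]; first by rewrite e eqxx in ne.
by rewrite hm mulSn addnA.
Qed.

(** The position of a cell in the reading order: components, then columns,
    then rows from the bottom. *)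
Definition pos c : nat := c.1 * (n * n) + (ccol c * n + (n.-1 - crow c)).
Lemma index_reading c : index c (reading_cells n) = pos c.
Proof.
case: c => nu [i j]; rewrite /reading_cells /pos /ccol /crow /=.
pose blk (nu : bool) (j : 'I_n) := [seq (nu, (i, j)) : cell n | i <- rev (enum 'I_n)].
have sz nu' j' : size (blk nu' j') = n by rewrite size_map size_rev size_enum_ord.
have mb nu' j' : ((nu, (i, j)) \in blk nu' j') = (nu' == nu) && (j' == j).
  apply/mapP/andP => [[i' _ [-> _ ->]]|[/eqP -> /eqP ->]]; first by rewrite !eqxx.
  by exists i; rewrite ?mem_rev ?mem_enum.
have mb2 nu' : ((nu, (i, j)) \in flatten [seq blk nu' j | j <- enum 'I_n]) = (nu' == nu).
  apply/flatten_mapP/eqP => [[j' _]|->]; first by rewrite mb => /andP[/eqP].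
  by exists j; rewrite ?mem_enum ?mb ?eqxx.
rewrite (@index_blocks _ _ (fun nu => flatten [seq blk nu j | j <- enum 'I_n]) (n * n)
    [:: false; true] _ nu); last 4 first.
- by case: (nu).
- by rewrite mb2.
- by move=> a; rewrite mb2 => /eqP.
- move=> a; rewrite size_flatten /shape -map_comp sumnE big_map big_enum /=.
  by under eq_bigr do rewrite sz; rewrite sum_nat_const card_ord.
rewrite (@index_blocks _ _ (blk nu) n _ _ j); last 4 first.
- by rewrite mem_enum.
- by rewrite mb !eqxx.
- by move=> a; rewrite mb => /andP[_ /eqP].
- exact: sz.
rewrite index_enum_ord index_map; last by move=> a b [].
congr (_ * _ + (_ + _)); first by case: (nu).
have hi := ltn_ord i.
have e : nth i (rev (enum 'I_n)) (n.-1 - i) = i.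
  rewrite nth_rev size_enum_ord; last by lia.
  have -> : n - (n.-1 - i).+1 = i by lia.
  exact: nth_ord_enum.
by rewrite -{1}e index_uniq ?rev_uniq ?enum_uniq // size_rev size_enum_ord; lia.
Qed.

Lemma index_reading_word S (k k' : 'I_n) : pos (S k') < pos (S k) ->
  index (val k') (reading_word S) < index (val k) (reading_word S).
Proof. by rewrite -!index_reading; apply: index_word. Qed.

Lemma cell_indexE S k : injective S -> cell_index S (S k) = charge_index (reading_word S) k.
Proof.
move=> h; rewrite /cell_index (bigD1 k) //= big1 ?addn0 // => m /andP[/eqP/h ->].
by rewrite eqxx.
Qed.

Definition column_strict lam (r : cell n -> nat) := forall c c', c \in lam -> c' \in lam ->
  c.1 = c'.1 -> ccol c = ccol c' -> crow c < crow c' -> r c < r c'.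
(** Down a column the entries increase, and the lower cell is read first. *)
Lemma cell_index_strict lam S : S \in STab lam -> column_strict lam (cell_index S).
Proof.
move=> hS; have [Sinj Ssh] := TabP _ _ (STab_Tab hS).
have st : is_standard S by move: hS; rewrite inE => /and3P[].
move=> c c'; rewrite -Ssh => /imsetP[k _ ->] /imsetP[k' _ ->] e1 e2 lt.
rewrite !cell_indexE //; apply: charge_lt.
  by apply: (standardP st e1); right.
apply: index_reading_word; rewrite /pos e1 e2 !ltn_add2l.
have := ltn_ord (crow (S k')); lia.
Qed.

End ChargeIndex.

Section CanonicalTableau.
Local Open Scope nat_scope.
Variable n : nat.
Hypothesis n_gt0 : 0 < n.
Local Notation i0 := (Ordinal n_gt0).
Implicit Types (lam mu : {set cell n}) (c d : cell n) (S T U : tableau n).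
(** The order of the canonical tableau: rows of the two components
    alternately, each from left to right. The factors 2 and n make it
    lexicographic. *)
Definition key c : nat := (crow c * 2 + c.1) * n + ccol c.
Lemma key_ltP c d : (key c < key d) =
  (crow c < crow d) || (crow c == crow d) && ((c.1 < d.1) || (c.1 == d.1) && (ccol c < ccol d)).
Proof.
case: c d => [a [i j]] [b [i' j']]; rewrite /key /crow /ccol /= -(inj_eq val_inj) /=.
have := ltn_ord j; have := ltn_ord j'; have := ltn_ord i; have := ltn_ord i'.
case: (ltngtP i i') => [lt|gt|->] /=.
- case: a; case: b => /=; nia.
- case: a; case: b => /=; nia.
case: a; case: b => /=; nia.
Qed.

Lemma key_inj : injective key.
Proof.
move=> c d e; have h1 := key_ltP c d; have h2 := key_ltP d c; rewrite e ltnn in h1 h2.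
move: h1 h2; case: c d {e} => [a [i j]] [b [i' j']]; rewrite /crow /ccol /=.
rewrite -!(inj_eq val_inj) /=.
case: (ltngtP i i') => //= /val_inj ->; case: a; case: b => //=;
 by case: (ltngtP j j') => //= /val_inj ->.
Qed.

(** Fill the diagrams row by row, alternating between the two components. Two
    successive cells in the same row number are read in this order, so the
    index does not change. When the row number increases, the next cell is at
    the beginning of a row, in the first column, and it is read before the
    current one, so the index increases by one. *)
Lemma canonical_tableau lam : lam \in P2 n -> (false, (i0, i0)) \in lam ->
  exists2 S, S \in STabh lam 1 & forall c, c \in lam -> cell_index S c = crow c.
Proof.
move=> hl h00; have /is_diagramP hd : is_diagram lam by move: hl; rewrite inE => /andP[].
have hn : #|lam| = n by move: hl; rewrite inE => /andP[_ /eqP].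
pose c0 : cell n := (false, (i0, i0)).
pose s := sort (relpre key leq) (enum lam).
have ss : size s = n by rewrite size_sort -cardE hn.
have us : uniq s by rewrite sort_uniq enum_uniq.
have ms c : (c \in s) = (c \in lam) by rewrite mem_sort mem_enum.
have so : sorted (relpre key leq) s by apply: sort_sorted => a b; apply: leq_total.
pose S : tableau n := [ffun k : 'I_n => nth c0 s k].
have key_le (k m : 'I_n) : k <= m -> key (S k) <= key (S m).
  move=> km; rewrite !ffunE; apply: (sorted_leq_nth _ _ c0 so); rewrite ?inE ?ss //.
  - by move=> a b d; apply: leq_trans.
  - by move=> a; apply: leqnn.
have Sinj : injective S.
  by move=> a b /eqP; rewrite !ffunE nth_uniq ?ss // => /eqP/val_inj.
have key_lt (k m : 'I_n) : (key (S k) < key (S m)) = (k < m).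
  apply/idP/idP => [h|km]; first by rewrite ltnNge; apply/negP => /key_le; rewrite leqNgt h.
  rewrite ltn_neqAle key_le ?(ltnW km) // andbT; apply/eqP => /key_inj/Sinj e.
  by rewrite e ltnn in km.
have Slam (k : 'I_n) : S k \in lam by rewrite -ms ffunE mem_nth ?ss.
have Ssurj c : c \in lam -> exists k, S k = c.
  rewrite -ms => cs; have h : index c s < n by rewrite -[X in _ < X]ss index_mem.
  by exists (Ordinal h); rewrite ffunE nth_index.
have S0 : S i0 = c0.
  apply: key_inj; apply/eqP; rewrite eqn_leq [X in _ && X](_ : _ = true) ?andbT; last first.
    by rewrite /key /c0 /crow /ccol /= !mul0n.
  by have [k <-] := Ssurj c0 h00; apply: key_le.
have SS : S \in STab lam.
  rewrite inE; apply/and3P; split; first exact/injectiveP.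
    apply/eqP/setP => c; apply/imsetP/idP => [[k _ ->]|/Ssurj[k <-]]; [exact: Slam|by exists k].
  apply/forallP => k; apply/forallP => m; apply/implyP => /andP[/eqP e1 h].
  rewrite -key_lt key_ltP e1 ltnn eqxx /=.
  by case/orP: h => /andP[/eqP e2 ->]; rewrite ?e2 ?eqxx ?orbT.
have charge (k : nat) (hk : k < n) : charge_index (reading_word S) k = crow (S (Ordinal hk)).
  elim: k hk => [|k IH] hk.
    have -> : Ordinal hk = i0 by apply: val_inj.
    by rewrite S0.
  have hk' : k < n by apply: ltnW.
  rewrite [LHS]/= (IH hk').
  set c := S (Ordinal hk'); set c' := S (Ordinal hk).
  have cc' : key c < key c' by rewrite key_lt.
  have between d : d \in lam -> key c < key d -> key d < key c' -> False.
    by move=> /Ssurj[m <-]; rewrite !key_lt /= ltnS => h1 h2; move: (leq_trans h1 h2); rewrite ltnn.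
  have cl' : c' \in lam by apply: Slam.
  (* No cell lies strictly between two successive ones, which excludes the
     other relative positions. *)
  have step : (crow c' = crow c :> nat /\ pos c < pos c') \/
              (crow c' = (crow c).+1 :> nat /\ pos c' < pos c).
    move: cc' between cl'; move: c c' => [a [i j]] [a' [i' j']] {S0 SS key_lt key_le}.
    rewrite key_ltP /crow /ccol /pos /crow /ccol /= => cc' between cl'.
    have hj := ltn_ord j; have hj' := ltn_ord j'; have hi := ltn_ord i; have hi' := ltn_ord i'.
    case/orP: cc' => [lt|/andP[/eqP ei h]]; last first.
      left; rewrite -ei; split=> //.
      by case: (a) (a') h => [] [] //=; rewrite ?add1n; nia.
    right; have hp : i'.-1 < n by lia.
    have ei : i' = i.+1 :> nat.
      apply/eqP; rewrite eqn_leq lt andbT leqNgt; apply/negP => lt2.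
      apply: (between (a', (Ordinal hp, j'))).
      - by apply: (hd _ _ cl'); rewrite /crow /ccol //=; lia.
      - by rewrite key_ltP /crow /=; apply/orP; left; lia.
      - by rewrite key_ltP /crow /=; apply/orP; left; lia.
    have ej : j' = 0 :> nat.
      apply/eqP; rewrite -leqn0 leqNgt; apply/negP => lt2.
      apply: (between (a', (i', i0))).
      - by apply: (hd _ _ cl'); rewrite /crow /ccol //=; lia.
      - by rewrite key_ltP /crow /= lt.
      - by rewrite key_ltP /crow /ccol /= ltnn eqxx /= ltnn eqxx /=.
    have ea : a' -> a.
      move=> ha'; apply: contraT => ha; exfalso.
      apply: (between (a', (i, j'))).
      - by apply: (hd _ _ cl'); rewrite /crow /ccol //=; lia.
      - by rewrite key_ltP /crow /= ltnn eqxx ha' (negPf ha).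
      - by rewrite key_ltP /crow /= lt.
    split; first exact: ei.
    rewrite ei ej; clear between cl'; case: (a) (a') ea => [] [] //=; nia.
  have [[-> /index_reading_word h]|[-> /index_reading_word h]] := step.
    by rewrite ltnNge ltnW ?addn0.
  by rewrite h addn1.
exists S; last first.
  move=> c /Ssurj[k <-]; rewrite cell_indexE // (charge k (ltn_ord k)).
  by congr (nat_of_ord (crow (S _))); apply: val_inj.
by rewrite (STabh1E n_gt0) SS S0.
Qed.

End CanonicalTableau.

(** * The transported polynomials do not vanish *)

Section TransportNonzero.
Variables (R : realType) (n : nat).
Local Notation C := R[i].
Local Notation Pol := {mpoly C[n]}.
Hypothesis n_gt0 : (0 < n)%N.
Implicit Types (lam mu : {set cell n}) (S T U : tableau n) (s t : {perm 'I_n}) (w : WD n).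
Local Notation tab_poly := (tab_poly R).
Local Notation low_specht := (low_specht R).
Local Notation rowc := (@rowc n).

(** Among the entries moved by t consider the cells in the smallest row. On
    this row, t moves entries to strictly lower cells of their columns, so it
    increases the sum of the values of r; but the hypothesis says that the
    value of r at the cell of t j is its value at the cell of s^-1 j, and s
    preserves the row. *)
Lemma column_strict_trivial lam r T s t : column_strict lam r -> T \in Tab lam ->
  s \in Rstab T -> t \in Cstab T -> mono r (actT t (actT s T)) = mono r T -> t = 1%g.
Proof.
move=> hr hT hs ht e; apply/eqP; apply: contraT => t1.
have e' j : r (T ((s^-1)%g j)) = r (T (t j)).
  by have [_] := mono_inj (t j) e; rewrite !ffunE permK.
have [j1 hj1] : exists j, t j != j.
  apply/existsP; rewrite -negb_forall; apply: contra t1 => /forallP h.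
  by apply/eqP/permP => j; rewrite perm1; apply/eqP.
case: (@arg_minnP _ j1 (fun j => t j != j) (fun j => crow (T j)) hj1) => j0 hj0 hmin.
pose rho := crow (T j0).
have tcol j : same_col T (t j) j.
  by have /CstabP/(_ j)[h1 h2] := ht; rewrite /same_col h1 h2 !eqxx.
have up j : crow (T j) = rho -> t j != j -> (r (T j) < r (T (t j)))%N.
  move=> hj tj; have /andP[/eqP h1 /eqP h2] := tcol j.
  apply: hr; rewrite ?(Tab_in _ hT) // ltn_neqAle hj hmin ?andbT; last by rewrite (inj_eq perm_inj).
  apply: contra tj => /eqP e2; apply/eqP; apply: (row_col_inj hT (tcol j)).
  by rewrite -e2 hj.
(* s preserves the row, so both sides sum r over the same cells. *)
have E1 : (\sum_(j | crow (T j) == rho) r (T (t j)) = \sum_(j | crow (T j) == rho) r (T j))%N.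
  rewrite -(eq_bigr _ (fun j _ => e' j)) [LHS](reindex_inj (@perm_inj _ s)) /=.
  apply: eq_big => j; first by have /RstabP/(_ j)[_ ->] := hs.
  by rewrite permK.
have : (\sum_(j | crow (T j) == rho) r (T j) < \sum_(j | crow (T j) == rho) r (T (t j)))%N.
  rewrite (bigD1 j0) //= [X in (_ < X)%N](bigD1 j0) //= -addSn leq_add ?up //.
  apply: leq_sum => j /andP[/eqP hj _].
  by have [->//|tj] := eqVneq (t j) j; apply/ltnW/up.
by rewrite E1 ltnn.
Qed.

Lemma side_RC T s t k : s \in Rstab T -> t \in Cstab T -> (actT t (actT s T) k).1 = (T k).1.
Proof.
move=> /RstabP hs /CstabP ht; rewrite !ffunE.
have [<- _] := hs ((s^-1)%g ((t^-1)%g k)); rewrite permKV.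
by have [<- _] := ht ((t^-1)%g k); rewrite permKV.
Qed.

(** The coefficient of the monomial of T is a number of row permutations,
    among which is the identity: by column_strict_trivial no other term of the
    alternating sum contributes. *)
Lemma transport_low_neq0 lam r l T : column_strict lam r -> T \in Tab lam ->
  transport r lam (low_specht l T) != 0.
Proof.
move=> hr hT; apply/eqP => /(congr1 (fun p : Pol => p@_(mono r T))).
have coef s t : s \in Rstab T -> t \in Cstab T ->
    (tab_poly r l (actT t (actT s T)))@_(mono r T) = (mono r (actT t (actT s T)) == mono r T)%:R.
  by move=> hs ht; apply: (@mcoeff_tab_poly R n n_gt0) => _; apply: side_RC.
have -> : (transport r lam (low_specht l T))@_(mono r T) =
    (\sum_(s in Rstab T) nat_of_bool (mono r (actT s T) == mono r T))%N%:R.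
  rewrite (transport_low R r l hT) raddf_sum (bigD1 1%g) ?Cstab1 //= [X in _ + X]big1 ?addr0.
    rewrite raddf_sum natr_sum; apply: eq_bigr => s hs /=.
    by rewrite odd_perm1 expr0 scale1r coef ?Cstab1 // actT1.
  move=> t /andP[ht t1]; rewrite raddf_sum big1 // => s hs /=.
  rewrite mcoeffZ coef //; case: eqP => [e|_]; last exact: mulr0.
  by rewrite (column_strict_trivial hr hT hs ht e) eqxx in t1.
rewrite mcoeff0 => /eqP; rewrite pnatr_eq0 (bigD1 1%g) ?Rstab1 //= actT1 eqxx.
by rewrite addnC addn1.
Qed.

Lemma transport_low_row lam (r : cell n -> nat) l T : (forall c, c \in lam -> r c = crow c :> nat) -> T \in Tab lam ->
  transport r lam (low_specht l T) = #|Rstab T|%:R *: low_specht l T.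
Proof.
move=> hr hT; have monoE U : U \in Tab lam -> mono r U = mono rowc U.
  by move=> hU; apply/mnmP => k; rewrite !mnmE hr // (Tab_in _ hU).
have tab_polyE U : U \in Tab lam -> tab_poly r l U = tab_poly rowc l U.
  move=> hU; have [_ shU] := TabP _ _ hU; rewrite /tab_poly shU; case: eqP => hs; last by rewrite monoE.
  by rewrite monoE // monoE // -hs; apply: Tab_ShT.
have key s t : s \in Rstab T -> tab_poly r l (actT t (actT s T)) = tab_poly rowc l (actT t T).
  move=> /RstabP hs; rewrite tab_polyE ?Tab_actT //; apply: tab_poly_row; first by rewrite !tshape_actT.
    by move=> k; rewrite !ffunE; have [h _] := hs ((s^-1)%g ((t^-1)%g k)); move: h; rewrite permKV.
  by move=> k; rewrite !ffunE; have [_ h] := hs ((s^-1)%g ((t^-1)%g k)); move: h; rewrite permKV.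
rewrite (transport_low R r l hT) /low_specht scaler_sumr; apply: eq_bigr => t ht.
rewrite (eq_bigr (fun=> (-1) ^+ (t : bool) *: tab_poly rowc l (actT t T))); last by move=> s hs; rewrite key.
by rewrite sumr_const scaler_nat.
Qed.

End TransportNonzero.

(** * Corners of a semisimple group algebra *)

Lemma gdelta_munit (F : fieldType) (G : finGroupType) d (r : G -> 'M[F]_d) w (j i : 'I_d) :
  mxrep r -> gdelta F w * munit r j i = \sum_k r w k j *: munit r k i.
Proof.
move=> [_ rM]; apply/ffunP => g; rewrite galgE galg_sumE (bigD1 w) //= ffunE eqxx mul1r.
rewrite big1 ?addr0 => [|h /negPf hw]; last by rewrite ffunE hw mul0r.
rewrite ffunE invMg invgK rM mxE mulr_sumr; apply: eq_bigr => k _.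
rewrite galgZE ffunE [RHS]mulrCA; congr (_ * _); exact: mulrC.
Qed.

(** B is a module for the operators in D, stable under the group, and D_exists
    says that two families in it that are transformed by the same matrices,
    the first one being independent, are related by an operator. The E w i j
    are the matrix units of the group algebra. *)
Section Isotypic.
Variables (F : numFieldType) (G : finGroupType) (K : lmodType F).
Variable act : G -> K -> K.
Hypothesis act_lin : forall g k u v, act g (k *: u + v) = k *: act g u + act g v.
Hypothesis act1 : forall v, act 1%g v = v.
Hypothesis actM : forall g h v, act (g * h)%g v = act g (act h v).
Variables (B : K -> Prop) (D : (K -> K) -> Prop).
Hypothesis B0 : B 0.
Hypothesis BD : forall x y, B x -> B y -> B (x + y).
Hypothesis BZ : forall k x, B x -> B (k *: x).
Hypothesis Bact : forall g x, B x -> B (act g x).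
Hypothesis D_D : forall P, D P -> forall x y, P (x + y) = P x + P y.
Hypothesis D_Z : forall P, D P -> forall k x, P (k *: x) = k *: P x.
Hypothesis D_act : forall P, D P -> forall g x, P (act g x) = act g (P x).
Hypothesis D_B : forall P, D P -> forall x, B x -> B (P x).
Hypothesis D_exists : forall (d : nat) (f g : 'I_d -> K) (rho : G -> 'M[F]_d),
  (forall w j, act w (f j) = \sum_i rho w i j *: f i) ->
  (forall w j, act w (g j) = \sum_i rho w i j *: g i) ->
  (forall i, B (g i)) ->
  (forall c : 'I_d -> F, \sum_i c i *: f i = 0 -> forall i, c i = 0) ->
  exists2 P, D P & forall i, g i = P (f i).
Local Notation A := (galg F G).
Local Notation op := (gact act).
Definition image_of (e : A) (x : K) : Prop := exists2 y, B y & x = op e y.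
Definition generated_by (z x : K) : Prop := exists2 P, D P & x = P z.

Variables (Om : finType) (d : Om -> nat) (rho : forall w, G -> 'M[F]_(d w)).
Local Notation E w i j := (munit (@rho w) i j).
Hypothesis rho_rep : forall w, mxrep (@rho w).
Hypothesis Emul : forall w i j k l, E w i j * E w k l = (j == k)%:R *: E w i l.
Hypothesis Eorth : forall w w' i j k l, w != w' -> E w i j * E w' k l = 0.
Hypothesis Esum : \sum_w \sum_i E w i i = 1.
Hypothesis Espan : forall a : A, exists c : forall w, 'I_(d w) -> 'I_(d w) -> F,
  a = \sum_w \sum_i \sum_j c w i j *: E w i j.

Let opM a b v : op (a * b) v = op a (op b v). Proof. exact: (gactM act_lin actM). Qed.
Lemma diff_0 P : D P -> P 0 = 0.
Proof. by move=> hP; have := D_Z hP 0 0; rewrite !scale0r. Qed.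
Lemma diff_sum P : D P -> forall (I : Type) (r : seq I) (Q : pred I) (f : I -> K),
  P (\sum_(i <- r | Q i) f i) = \sum_(i <- r | Q i) P (f i).
Proof. by move=> hP I r Q f; elim/big_rec2: _ => [|i y x _ <-]; rewrite ?diff_0 ?D_D. Qed.
Lemma diff_gact P : D P -> forall a x, P (op a x) = op a (P x).
Proof.
by move=> hP a x; rewrite /gact diff_sum //; apply: eq_bigr => g _; rewrite D_Z // D_act.
Qed.

Lemma B_sum (I : Type) (r : seq I) (Q : pred I) (f : I -> K) :
  (forall i, Q i -> B (f i)) -> B (\sum_(i <- r | Q i) f i).
Proof. by move=> h; apply: big_ind. Qed.
Lemma B_op a x : B x -> B (op a x).
Proof. by move=> h; apply: B_sum => g _; apply/BZ/Bact. Qed.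

Lemma image_ofP e x : e * e = e -> image_of e x <-> B x /\ op e x = x.
Proof.
move=> ee; split=> [[y yB ->]|[xB ex]]; last by exists x.
by split; [apply: B_op|rewrite -opM ee].
Qed.

Lemma Eidem w i : E w i i * E w i i = E w i i.
Proof. by rewrite Emul eqxx scale1r. Qed.

(** For x in the image of E_ii, the families (E_ji z)_j and (E_ji x)_j are
    transformed by the same matrices rho, and the first one is independent
    since E_ik isolates its members. So an operator maps E_ii z = z to E_ii x
    = x. *)
Lemma corner_generated w i z : B z -> op (E w i i) z = z -> z <> 0 ->
  forall x, image_of (E w i i) x <-> generated_by z x.
Proof.
move=> zB Ez z0 x; rewrite image_ofP ?Eidem //; split; last first.
  case=> P hP ->; split; first exact: D_B.
  by rewrite -diff_gact // Ez.
move=> [xB Ex].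
(* The matrix units E_{ji} with i fixed are transformed by rho. *)
have tr y : forall g j, act g (op (E w j i) y) = \sum_k rho w g k j *: op (E w k i) y.
  move=> g j; rewrite -gact_delta -opM gdelta_munit // gact_suml.
  by apply: eq_bigr => k _; rewrite gactZl.
have [||k|c hc k|P hP h] := @D_exists (d w) (fun j => op (E w j i) z)
  (fun j => op (E w j i) x) (@rho w).
- exact: tr.
- exact: tr.
- exact: B_op.
- have := congr1 (op (E w i k)) hc; rewrite (gact_sumr act_lin) (gact0r act_lin).
  rewrite (bigD1 k) //= big1 ?addr0 => [|j /negPf jk]; last first.
    rewrite (gactZr act_lin) -opM Emul eq_sym jk scale0r gact0l scaler0 //.
  rewrite (gactZr act_lin) -opM Emul eqxx scale1r Ez => /eqP.
  by rewrite scaler_eq0 => /orP[/eqP//|/eqP].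
by exists P => //; rewrite -Ex h Ez.
Qed.

Lemma sandwich w a i k b (c : forall w, 'I_(d w) -> 'I_(d w) -> F) :
  E w a i * (\sum_w \sum_i \sum_j c w i j *: E w i j) * E w k b = c w i k *: E w a b.
Proof.
rewrite mulr_sumr mulr_suml (bigD1 w) //= [X in _ + X]big1 ?addr0 => [|w' ww']; last first.
  rewrite mulr_sumr mulr_suml big1 // => j _; rewrite mulr_sumr mulr_suml big1 // => l _.
  by rewrite -scalerAr Eorth 1?eq_sym // scaler0 mul0r.
rewrite mulr_sumr mulr_suml (bigD1 i) //= [X in _ + X]big1 ?addr0 => [|j ji]; last first.
  rewrite mulr_sumr mulr_suml big1 // => l _.
  by rewrite -scalerAr Emul eq_sym (negPf ji) scale0r scaler0 mul0r.
rewrite mulr_sumr mulr_suml (bigD1 k) //= [X in _ + X]big1 ?addr0 => [|j ji]; last first.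
  by rewrite -scalerAr Emul eqxx scale1r -scalerAl Emul (negPf ji) scale0r scaler0.
by rewrite -scalerAr Emul eqxx scale1r -scalerAl Emul eqxx scale1r.
Qed.

Lemma corner_scalar w i x : exists c : F, E w i i * x * E w i i = c *: E w i i.
Proof. by have [c ->] := Espan x; exists (c w i i); apply: sandwich. Qed.

Variable z0 : forall w, 'I_(d w) -> K.
Hypothesis z0_B : forall w i, B (@z0 w i).
Hypothesis z0_E : forall w i, op (E w i i) (@z0 w i) = @z0 w i.
Hypothesis z0_neq0 : forall w i, @z0 w i <> 0.
Lemma E_neq0 w i : E w i i <> 0.
Proof. by move=> e; apply: (@z0_neq0 w i); rewrite -z0_E e gact0l. Qed.

(** Some E_ii e E_ki is a nonzero multiple of E_ii. Then p = e E_ki and q, a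
    multiple of E_ii e, satisfy q p = E_ii, and primitivity gives p q = e. *)
Lemma primitive_to_corner (e : A) : primitive_elt e -> exists w i u v,
  [/\ u * v = 1, v * u = 1 & u * e * v = E w i i].
Proof.
move=> pe; have [ee e0 _] := pe.
have [c ce] := Espan e.
have [[w [i k]] cn0] : exists t : {w & 'I_(d w) * 'I_(d w)}%type, c (tag t) (tagged t).1 (tagged t).2 != 0.
  apply: contrapT => /forallNP h; case/eqP: e0; rewrite ce big1 // => w _; rewrite big1 // => i _.
  rewrite big1 // => k _; have := h (Tagged _ (i, k)); case: eqP => //= -> _.
  by rewrite scale0r.
have EeE : E w i i * e * E w k i = c w i k *: E w i i by rewrite {1}ce sandwich.
exists w, i; apply: (@primitive_conj _ _ e (E w i i) (e * E w k i) ((c w i k)^-1 *: (E w i i * e))).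
- exact: pe.
- exact: Eidem.
- by apply/eqP; apply: E_neq0.
- exact: corner_scalar.
- by rewrite -scalerAl mulrA -(mulrA (E w i i)) ee EeE scalerA mulVf ?scale1r.
- by rewrite -mulrA Emul eqxx scale1r.
- by rewrite -scalerAr mulrA Eidem.
- by rewrite mulrA ee.
- by rewrite -scalerAl -mulrA ee.
Qed.

Definition submodule (M : K -> Prop) : Prop :=
  [/\ M 0, forall x y, M x -> M y -> M (x + y) & forall P x, D P -> M x -> M (P x)].
Lemma image_submodule e : submodule (image_of e).
Proof.
split; first by exists 0; rewrite ?(gact0r act_lin).
- by move=> _ _ [x xB ->] [y yB ->]; exists (x + y); rewrite ?(gactDr act_lin) //; apply: BD.
- by move=> P _ hP [x xB ->]; exists (P x); rewrite ?diff_gact //; apply: D_B.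
Qed.

Lemma image_B e x : image_of e x -> B x.
Proof. by case=> y yB ->; apply: B_op. Qed.

(** An idempotent e conjugate to the diagonal matrix unit E w i i: the action
    of u is an isomorphism of D-modules from the image of e onto the image of
    E w i i. *)
Section Conjugate.
Variables (e u v : A) (w : Om) (i : 'I_(d w)).
Hypothesis ee : e * e = e.
Hypothesis uv : u * v = 1.
Hypothesis vu : v * u = 1.
Hypothesis uev : u * e * v = E w i i.
Let vK x : op v (op u x) = x. Proof. by rewrite -opM vu (gact1 act1). Qed.
Let uK x : op u (op v x) = x. Proof. by rewrite -opM uv (gact1 act1). Qed.

Lemma image_conj x : image_of e x <-> image_of (E w i i) (op u x).
Proof.
have Eu : E w i i * u = u * e by rewrite -uev -mulrA vu mulr1.
rewrite !image_ofP ?Eidem // -opM Eu opM; split=> -[xB ex]; split.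
- exact: B_op.
- by rewrite ex.
- by rewrite -[x]vK; apply: B_op.
- by rewrite -[LHS]vK ex vK.
Qed.

Lemma image_nonzero : exists2 x, image_of e x & x != 0.
Proof.
exists (op v (z0 i)); first by apply/image_conj; rewrite uK; apply/image_ofP; rewrite ?Eidem.
by apply/eqP => h; apply: (@z0_neq0 w i); rewrite -[z0 i]uK h (gact0r act_lin).
Qed.

Lemma image_simple (N : K -> Prop) : submodule N -> (forall x, N x -> image_of e x) ->
  (forall x, N x <-> x = 0) \/ (forall x, N x <-> image_of e x).
Proof.
move=> [N0 ND NP] Ne; have [h|/existsNP[z /not_implyP[Nz z0']]] := pselect (forall x, N x -> x = 0).
  by left => x; split=> [/h|->].
right=> x; split; first exact: Ne.
move=> ex.
have /image_conj/image_ofP := Ne _ Nz; rewrite Eidem => /(_ erefl)[uzB uzE].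
have uz0 : op u z <> 0 by move=> h; apply: z0'; rewrite -[z]vK h (gact0r act_lin).
have /image_conj/(corner_generated uzB uzE uz0)[P hP hx] := ex.
have -> : x = P z by rewrite -[x]vK hx (diff_gact hP) vK.
exact: NP.
Qed.

End Conjugate.

(** A finite type Idx enumerating all the diagonal matrix units, and modules M
    a that are images of one chosen diagonal matrix unit of the same block. *)
Section Decomposition.
Variables (Idx : finType) (wt : Idx -> Om) (k : forall a, 'I_(d (wt a))) (i0 : forall w, 'I_(d w)).
Hypothesis k_bij : forall (W : nmodType) (f : forall w, 'I_(d w) -> W),
  \sum_w \sum_i f w i = \sum_a f (wt a) (k a).
Hypothesis k_orth : forall a b, b != a ->
  E (wt a) (i0 (wt a)) (k a) * E (wt b) (k b) (i0 (wt b)) = 0.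
Variable M : Idx -> K -> Prop.
Hypothesis ME : forall a x, M a x <-> image_of (E (wt a) (i0 (wt a)) (i0 (wt a))) x.

(** The inverse sends z to the family of the E_{i0,k} z. *)
Lemma decomposition : let phi := fun m : {ffun Idx -> K} => \sum_a op (E (wt a) (k a) (i0 (wt a))) (m a) in
  [/\ [/\ forall m : {ffun Idx -> K}, (forall a, M a (m a)) -> B (phi m),
          forall m m' : {ffun Idx -> K}, (forall a, M a (m a)) -> (forall a, M a (m' a)) -> phi m = phi m' -> m = m' &
          forall z, B z -> exists2 m : {ffun Idx -> K}, (forall a, M a (m a)) & phi m = z],
      forall m m', phi (m + m') = phi m + phi m' &
      forall P (m : {ffun Idx -> K}), D P -> phi [ffun a => P (m a)] = P (phi m)].
Proof.
move=> phi.
have MB a x : M a x -> B x by move/ME/image_B.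
have MEx a x : M a x -> op (E (wt a) (i0 (wt a)) (i0 (wt a))) x = x.
  by move/ME; rewrite image_ofP ?Eidem // => -[].
have back (m : {ffun Idx -> K}) a : (forall a, M a (m a)) -> op (E (wt a) (i0 (wt a)) (k a)) (phi m) = m a.
  move=> hm; rewrite /phi (gact_sumr act_lin) (bigD1 a) //= -opM Emul eqxx scale1r MEx //.
  by rewrite big1 ?addr0 // => b ba; rewrite -opM k_orth // gact0l.
split.
- split.
  + by move=> m hm; apply: B_sum => a _; apply/B_op/MB/hm.
  + by move=> m m' hm hm' e; apply/ffunP => a; rewrite -(back m a hm) e back.
  + move=> z zB; exists [ffun a => op (E (wt a) (i0 (wt a)) (k a)) z].
      move=> a; rewrite ffunE; apply/ME/image_ofP; first exact: Eidem.
      by split; [apply: B_op|rewrite -opM Emul eqxx scale1r].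
    rewrite /phi; under eq_bigr do rewrite ffunE -opM Emul eqxx scale1r.
    by rewrite -[RHS](gact1 act1) -Esum (k_bij (fun w i => E w i i)) gact_suml.
- move=> m m'; rewrite /phi -big_split; apply: eq_bigr => a _.
  by rewrite ffunE (gactDr act_lin).
- move=> P m hP; rewrite /phi diff_sum //; apply: eq_bigr => a _.
  by rewrite ffunE diff_gact.
Qed.

End Decomposition.
End Isotypic.

(** * The matrix units of the group *)

Section FunctionSpace.
Variables (R : realType) (n : nat).
Local Notation C := R[i].
Local Notation Pol := {mpoly C[n]}.
Local Notation K := (KX R n).

(** The field of rational functions as a vector space over C, under a new name
    as it is also a vector space over itself. *)
Definition KC : Type := K.
HB.instance Definition _ := GRing.Zmodule.on KC.
Definition scaleKC (c : C) (x : KC) : KC := (cstK n c * (x : K) : K).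
Fact scaleKCA a b x : scaleKC a (scaleKC b x) = scaleKC (a * b) x.
Proof. by rewrite /scaleKC cstKM; apply: mulrA. Qed.
Fact scaleKC1 : left_id 1 scaleKC.
Proof. by move=> x; rewrite /scaleKC /cstK mpolyC1 inK1; apply: mul1r. Qed.
Fact scaleKCDr : right_distributive scaleKC +%R.
Proof. by move=> c x y; apply: mulrDr. Qed.
Fact scaleKCDl x : {morph scaleKC^~ x : a b / a + b}.
Proof. by move=> a b; rewrite /scaleKC /cstK mpolyCD inKD; apply: mulrDl. Qed.
HB.instance Definition _ :=
  GRing.Zmodule_isLmodule.Build C KC scaleKCA scaleKC1 scaleKCDr scaleKCDl.

Definition aK (w : WD n) (x : KC) : KC := actF w x.
Lemma aK_lin w (c : C) (x y : KC) : aK w (c *: x + y) = c *: aK w x + aK w y.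
Proof.
apply: etrans (actFD w _ _) _; congr (_ + _).
by apply: etrans (actF_mul w _ _) _; congr (_ * _); apply: actF_cst.
Qed.

Lemma aK1 (x : KC) : aK 1%g x = x. Proof. exact: actF1. Qed.
Lemma aKM v w (x : KC) : aK (v * w)%g x = aK v (aK w x). Proof. exact: actFM. Qed.

Definition inKC (p : Pol) : KC := inK p.
Lemma inKCZ (c : C) p : inKC (c *: p) = c *: inKC p.
Proof. by rewrite /inKC -mul_mpolyC inKM. Qed.
Lemma inKC_sum (I : Type) (r : seq I) (P : pred I) (f : I -> Pol) :
  inKC (\sum_(i <- r | P i) f i) = \sum_(i <- r | P i) inKC (f i).
Proof. exact: inK_sum. Qed.
Lemma aK_inKC w p : aK w (inKC p) = inKC (actP w p). Proof. exact: actF_inK. Qed.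
Lemma gact_inKC (a : galg C (WD n)) p : gact aK a (inKC p) = inKC (gact (@actP R n) a p).
Proof.
by rewrite /gact inKC_sum; apply: eq_bigr => w _; rewrite inKCZ aK_inKC.
Qed.

Definition BK (x : KC) : Prop := Otilde x.
Definition DK (P : KC -> KC) : Prop := @Dtilde R n P.
Lemma BK0 : BK 0. Proof. exact: Ot0. Qed.
Lemma BKD x y : BK x -> BK y -> BK (x + y). Proof. exact: OtD. Qed.
Lemma BKZ (c : C) x : BK x -> BK (c *: x).
Proof. by move=> h; apply: OtM => //; apply: Ot_cst. Qed.
Lemma BKact w x : BK x -> BK (aK w x). Proof. exact: actF_Ot. Qed.

Hypothesis n_gt0 : (0 < n)%N.
Lemma DK_D P : DK P -> forall x y, P (x + y) = P x + P y. Proof. exact: DtildeD. Qed.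
Lemma DK_Z P : DK P -> forall (c : C) x, P (c *: x) = c *: P x.
Proof. exact: (Dtilde_scale n_gt0). Qed.
Lemma DK_act P : DK P -> forall w x, P (aK w x) = aK w (P x).
Proof. exact: (Dtilde_actF n_gt0). Qed.
Lemma DK_B P : DK P -> forall x, BK x -> BK (P x). Proof. exact: (Dtilde_Ot n_gt0). Qed.
Lemma DK_exists (d : nat) (f g : 'I_d -> KC) (rho : WD n -> 'M[C]_d) :
  (forall w j, aK w (f j) = \sum_i rho w i j *: f i) ->
  (forall w j, aK w (g j) = \sum_i rho w i j *: g i) ->
  (forall i, BK (g i)) ->
  (forall c : 'I_d -> C, \sum_i c i *: f i = 0 -> forall i, c i = 0) ->
  exists2 P, DK P & forall i, g i = P (f i).
Proof. exact: (Dtilde_operator_exists n_gt0). Qed.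

Lemma mulCWE (a b : CW R n) : mulCW a b = (a : galg C (WD n)) * (b : galg C (WD n)).
Proof. by apply/ffunP => g; apply: etrans (ffunE _ g) (esym (galgE _ _ g)). Qed.
Lemma oneCWE : oneCW R n = (1 : galg C (WD n)).
Proof. by apply/ffunP => g; apply: etrans (ffunE _ g) (esym (galg1E _ g)). Qed.
Lemma primitiveE (e : CW R n) : primitive_idempotent e -> @primitive_elt _ (galg C (WD n)) e.
Proof.
case=> h1 h2 h3; split.
- by rewrite -mulCWE.
- exact/eqP.
by move=> e1 e2 a b c d; apply: h3; rewrite /idempotentCW ?mulCWE.
Qed.

Variable reps : {set {set cell n}}.
Hypothesis reps_P2 : representatives reps.
Local Notation Om := (rep_index reps).
Implicit Type w : Om.
Definition lam_of w : {set cell n} := (val w).1.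
Definition l_of w : nat := (val w).2.
Definition Std_of w : {set tableau n} := STabh (lam_of w) (bnum (lam_of w)).

Lemma lam_reps w : lam_of w \in reps.
Proof. by have /andP[] := valP w. Qed.
Lemma lam_P2 w : lam_of w \in P2 n.
Proof. by case: reps_P2 => /subsetP h _ _; apply: h; apply: lam_reps. Qed.
Lemma l_lt w : (l_of w < enumb (lam_of w))%N.
Proof. by have /andP[] := valP w. Qed.
Lemma reps_eq lam mu : lam \in reps -> mu \in reps -> mu = lam \/ mu = Sh lam -> mu = lam.
Proof.
case: reps_P2 => /subsetP sub h _ hl hm e.
have /eqP/cards1P[x hx] := h lam (sub _ hl).
have : lam \in reps :&: [set lam; Sh lam] by rewrite inE hl set21.
have : mu \in reps :&: [set lam; Sh lam].
  by rewrite inE hm; case: e => ->; rewrite ?set21 ?set22.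
by rewrite hx !inE => /eqP -> /eqP ->.
Qed.

Lemma Std_exists w : exists T, T \in Std_of w.
Proof.
case: reps_P2 => _ _ h; have /set0Pn[T hT] := h _ (lam_reps w).
exists T; rewrite /Std_of; have [//|_] := bnumP (lam_of w).
by rewrite STabh2; move: hT; rewrite inE => /andP[].
Qed.

Definition T0 w : tableau n := xchoose (Std_exists w).
Lemma T0_Std w : T0 w \in Std_of w. Proof. exact: xchooseP. Qed.
Lemma T0_Tab w : T0 w \in Tab (lam_of w). Proof. exact: STabh_Tab (T0_Std w). Qed.

Lemma cardWD_neq0 : #|{: WD n}|%:R != 0 :> C.
Proof. by rewrite pnatr_eq0 -lt0n; apply/card_gt0P; exists 1%g. Qed.

Theorem specht_units : exists rho : forall w, WD n -> 'M[C]_#|Std_of w|,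
  [/\ forall w, mxrep (rho w),
      forall w g j, actP g (low_specht R (l_of w) (enum_val j)) =
        \sum_i rho w g i j *: low_specht R (l_of w) (enum_val i),
      [/\ forall w i j k l, munit (rho w) i j * munit (rho w) k l
            = (j == k)%:R *: munit (rho w) i l,
          forall w w' i j k l, w != w' ->
            munit (rho w) i j * munit (rho w') k l = 0,
          \sum_w \sum_i munit (rho w) i i = 1 &
          forall a : galg C (WD n), exists c : forall w, 'I_#|Std_of w| -> 'I_#|Std_of w| -> C,
            a = \sum_w \sum_i \sum_j c w i j *: munit (rho w) i j],
      forall w i j k, gact (@actP R n) (munit (rho w) i j) (low_specht R (l_of w) (enum_val k))
            = (j == k)%:R *: low_specht R (l_of w) (enum_val i) &
      forall w w' i j (k : 'I_#|Std_of w'|), w != w' ->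
        gact (@actP R n) (munit (rho w) i j) (low_specht R (l_of w') (enum_val k)) = 0].
Proof.
pose beta w := projT1 (cid (separating_elt R n_gt0 (lam_P2 w) (l_lt w) (T0_Tab w))).
have betaP w := projT2 (cid (separating_elt R n_gt0 (lam_P2 w) (l_lt w) (T0_Tab w))).
apply: (@matrix_units C (WD n) Pol (@actP R n) (@actP_lin R n) (@actP1 R n) (@actPM R n)
  cardWD_neq0 Om (fun w => wt (lam_of w)) (tableau n) (fun w => low_specht R (l_of w))
  (fun w => Tab (lam_of w)) Std_of T0 beta).
- move=> w g T hT; exists ((-1) ^+ tsgn g (actT (prmW g) T)), (actT (prmW g) T).
  by split; [apply: Tab_actT|apply: actP_low].
- move=> w T hT; have [s ->] := Tab_trans (T0_Tab w) hT; exists (permW s), 1.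
  by rewrite scale1r actP_permW_low.
- by move=> w; have [h _ _ _] := betaP w.
- by move=> w T hT; have [_ h _ _] := betaP w; apply: h.
- move=> w w' T ne le hT; have [_ _ h1 h2] := betaP w.
  have [e|ne'] := eqVneq (lam_of w') (lam_of w).
    rewrite e in hT; apply: h1 => //; first by rewrite -e l_lt.
    apply: contra ne => /eqP el; apply/eqP/val_inj.
    by move: e el; rewrite /lam_of /l_of; case: (val w) (val w') => [a b] [a' b'] /= -> /val_inj ->.
  apply: (h2 (lam_of w')) => //; first exact: lam_P2.
  apply: contra ne' => /eqP e; apply/eqP; apply: reps_eq; rewrite ?lam_reps //.
  by right.
- by move=> w; apply/subsetP => T; apply: STabh_Tab.
- exact: T0_Std.
- by move=> w; apply: (Std_low_free n_gt0); apply: lam_P2.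
- exact: (card_WD_le n_gt0 reps_P2).
Qed.

End FunctionSpace.

(** * Primitive idempotents and higher Specht polynomials *)

Section Assembly.
Variables (R : realType) (n : nat).
Local Notation C := R[i].
Local Notation Pol := {mpoly C[n]}.
Local Notation K := (KX R n).
Hypothesis n_gt0 : (0 < n)%N.
Variable reps : {set {set cell n}}.
Hypothesis reps_P2 : representatives reps.
Local Notation Om := (rep_index reps).
Implicit Type w : Om.
Local Notation dim w := #|Std_of w|.
Local Notation low w i := (low_specht R (l_of w) (enum_val (i : 'I_(dim w)))).
Variable rho : forall w, WD n -> 'M[C]_(dim w).
Local Notation E w i j := (munit (@rho w) i j).
Hypothesis rho_rep : forall w, mxrep (@rho w).
Hypothesis Emul : forall w i j k l, E w i j * E w k l = (j == k)%:R *: E w i l.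
Hypothesis Eorth : forall w w' i j k l, w != w' -> E w i j * E w' k l = 0.
Hypothesis Espan : forall a : galg C (WD n), exists c : forall w, 'I_(dim w) -> 'I_(dim w) -> C,
  a = \sum_w \sum_i \sum_j c w i j *: E w i j.
Hypothesis E_low : forall w i j k, gact (@actP R n) (E w i j) (low w k) = (j == k)%:R *: low w i.

Lemma gact_transport r lam (a : galg C (WD n)) (p : Pol) :
  gact (@actP R n) a (transport r lam p) = transport r lam (gact (@actP R n) a p).
Proof.
rewrite /gact transport_sum; apply: eq_bigr => g _.
by rewrite transportZ transport_actP.
Qed.

Lemma enum_Std_Tab w (k : 'I_(dim w)) : enum_val k \in Tab (lam_of w).
Proof. exact: STabh_Tab (enum_valP k). Qed.

Definition hconst w : C := hook_const R (T0 reps_P2 w).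
Lemma hconst_neq0 w : hconst w != 0. Proof. exact: hook_const_neq0. Qed.
Definition higher w S (k : 'I_(dim w)) : Pol := higher_specht R (l_of w) S (enum_val k).
Arguments higher : clear implicits.
Lemma higherE w S k : higher w S k = hconst w *: transport (cell_index S) (lam_of w) (low w k).
Proof.
rewrite /higher (higher_spechtE R S (enum_Std_Tab k) (l_lt w)); congr (_ *: _).
have [_ e1] := TabP _ _ (enum_Std_Tab k); have [_ e2] := TabP _ _ (T0_Tab reps_P2 w).
by rewrite /hconst /hook_const e1 e2.
Qed.

Lemma E_higher w S i j k : gact (@actP R n) (E w i j) (higher w S k) = (j == k)%:R *: higher w S i.
Proof.
rewrite !higherE (gactZr (@actP_lin R n)) gact_transport E_low transportZ.
exact: scale_swap.
Qed.

Lemma higher_neq0 w S k : S \in STab (lam_of w) -> higher w S k != 0.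
Proof.
move=> hS; rewrite higherE scaler_eq0 negb_or hconst_neq0 /=.
exact: (transport_low_neq0 R n_gt0 _ (cell_index_strict hS) (enum_Std_Tab k)).
Qed.

(** A higher Specht polynomial is the image of a lowest one under the
    W-equivariant map transport, so the matrix units act on both in the same
    way. *)
Lemma corner_higher w S k : S \in STab (lam_of w) ->
  same_set (@eOtilde R n (E w k k)) (Dgen (higher w S k)).
Proof.
move=> hS x.
apply: (corner_generated (@aK_lin R n) (@aKM R n) (@BK0 R n) (@BKD R n) (@BKZ R n) (@BKact R n)
  (DK_D n_gt0) (DK_Z n_gt0) (DK_act n_gt0) (DK_B n_gt0) (DK_exists n_gt0) rho_rep Emul
  (z := inKC (higher w S k))).
- exact: Ot_poly.
- by rewrite gact_inKC E_higher eqxx scale1r.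
- by move=> /eqP; rewrite inK_eq0; apply/negP; apply: higher_neq0.
Qed.

Let z0 w (i : 'I_(dim w)) : KC R n := inKC (low w i).
Let z0_B w (i : 'I_(dim w)) : BK (z0 i). Proof. exact: Ot_poly. Qed.
Let z0_E w (i : 'I_(dim w)) : gact (@aK R n) (E w i i) (z0 i) = z0 i.
Proof. by rewrite gact_inKC E_low eqxx scale1r. Qed.
Let z0_neq0 w (i : 'I_(dim w)) : z0 i <> 0.
Proof.
move=> /eqP; rewrite inK_eq0; apply/negP.
exact: (low_neq0 R n_gt0 _ (enum_Std_Tab i)).
Qed.

Lemma actCW_M (a b : CW R n) (x : K) : actCW (mulCW a b) x = actCW a (actCW b x).
Proof. by rewrite mulCWE; apply: (gactM (@aK_lin R n) (@aKM R n)). Qed.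

(** The isomorphism with a module generated by a higher Specht polynomial is
    the action of the element that conjugates e to a diagonal matrix unit. *)
Theorem primitive_part (e : CW R n) : primitive_idempotent e ->
     [/\ [/\ Dsubmodule (eOtilde e),
             forall x, eOtilde e x -> Otilde x &
             nonzero_set (eOtilde e)],
         Dsimple (eOtilde e) &
         exists (lam : {set cell n}) (l : nat) (S T : tableau n),
           [/\ lam \in reps, (l < enumb lam)%N, S \in STabh lam 1,
               T \in STabh lam (bnum lam) &
               Diso (@applyK R n) (@applyK R n)
                    (eOtilde e) (Dgen (higher_specht R l S T)) /\
               exists u v : CW R n,
                 [/\ mulCW u v = oneCW R n, mulCW v u = oneCW R n &
                     same_set (eOtilde (mulCW (mulCW u e) v))
                          (Dgen (higher_specht R l S T))]]].
Proof.
move=> pe; have pe' := primitiveE pe; have [ee _ _] := pe'.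
have [w [i [u [v [uv vu uev]]]]] :=
  primitive_to_corner Emul Eorth Espan z0_E z0_neq0 pe'.
have sub : Dsubmodule (eOtilde e).
  exact: (image_submodule (@aK_lin R n) (@BK0 R n) (@BKD R n) (DK_D n_gt0) (DK_Z n_gt0)
    (DK_act n_gt0) (DK_B n_gt0)).
have nz : nonzero_set (eOtilde e).
  exact: (image_nonzero (@aK_lin R n) (@aK1 R n) (@aKM R n) (@BK0 R n) (@BKD R n) (@BKZ R n)
    (@BKact R n) Emul z0_B z0_E z0_neq0 ee uv vu uev).
have conj := image_conj (@aK_lin R n) (@aK1 R n) (@aKM R n) (@BK0 R n) (@BKD R n) (@BKZ R n)
    (@BKact R n) Emul ee vu uev.
split; first split => //.
- exact: (image_B (@BK0 R n) (@BKD R n) (@BKZ R n) (@BKact R n)).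
- split=> //.
  exact: (image_simple (@aK_lin R n) (@aK1 R n) (@aKM R n) (@BK0 R n) (@BKD R n) (@BKZ R n)
    (@BKact R n) (DK_D n_gt0) (DK_Z n_gt0) (DK_act n_gt0) (DK_B n_gt0) (DK_exists n_gt0)
    rho_rep Emul ee vu uev).
have [_ _ h1] := reps_P2; have /set0Pn[S hS] := h1 _ (lam_reps w).
have hS' : S \in STab (lam_of w) by move: hS; rewrite inE => /andP[].
have cs := corner_higher i hS'.
exists (lam_of w), (l_of w), S, (enum_val i); split=> //.
- exact: lam_reps.
- exact: l_lt.
- exact: enum_valP i.
split; last first.
  exists u, v; split; rewrite ?mulCWE ?oneCWE //.
  by move=> x; rewrite uev; apply: cs.
have vK x : actCW v (actCW u x) = x.
  by rewrite -actCW_M mulCWE vu; apply: (gact1 (@aK1 R n)).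
have uK x : actCW u (actCW v x) = x.
  by rewrite -actCW_M mulCWE uv; apply: (gact1 (@aK1 R n)).
exists (actCW u); split; first split.
- by move=> x /conj/cs.
- by move=> x y _ _ h; rewrite -[x]vK h vK.
- move=> z /cs hz; exists (actCW v z); last exact: uK.
  by apply/conj; rewrite -[gact _ _ _]/(actCW u (actCW v z)) uK.
- by move=> x y _ _; apply: (gactDr (@aK_lin R n)).
- move=> P x hP _; apply/esym.
  exact: (diff_gact (DK_D n_gt0) (DK_Z n_gt0) (DK_act n_gt0) hP).
Qed.

End Assembly.

(** * Change of basis and the Hermitian form *)

Section ChangeOfBasis.
Variables (F : fieldType) (G : finGroupType) (V : lmodType F) (act : G -> V -> V).
Hypothesis act_lin : forall g k u v, act g (k *: u + v) = k *: act g u + act g v.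
Variables (d : nat) (x : 'I_d -> V) (r : G -> 'M[F]_d) (Q Qi : 'M[F]_d).
Hypothesis rx : forall g j, act g (x j) = \sum_i r g i j *: x i.
Hypothesis QQi : Q *m Qi = 1%:M.
Definition combine (M : 'M[F]_d) (y : 'I_d -> V) j : V := \sum_k M k j *: y k.
Lemma combineM M N y j : combine M (combine N y) j = combine (N *m M) y j.
Proof.
rewrite /combine; under eq_bigr do rewrite scaler_sumr.
rewrite exchange_big; apply: eq_bigr => k _; rewrite mxE scaler_suml.
by apply: eq_bigr => l _; rewrite scalerA mulrC.
Qed.

Lemma combine1 y j : combine 1%:M y j = y j.
Proof.
rewrite /combine (bigD1 j) //= mxE eqxx scale1r big1 ?addr0 // => k /negPf kj.
by rewrite mxE kj scale0r.
Qed.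

Lemma combine_back j : x j = combine Qi (combine Q x) j.
Proof. by rewrite combineM QQi combine1. Qed.
Lemma act_combine g j : act g (combine Q x j) = combine (Qi *m r g *m Q) (combine Q x) j.
Proof.
rewrite combineM !mulmxA QQi mul1mx /combine (act_sum act_lin).
under eq_bigr do rewrite (actZ act_lin) rx scaler_sumr.
rewrite exchange_big; apply: eq_bigr => k _; rewrite mxE scaler_suml.
by apply: eq_bigr => l _; rewrite scalerA mulrC.
Qed.

Lemma conj_mxrep : Qi *m Q = 1%:M -> mxrep r -> mxrep (fun g => Qi *m r g *m Q).
Proof.
move=> QiQ [r1 rM]; split=> [|g h]; first by rewrite r1 mulmx1.
by rewrite rM -!mulmxA (mulmxA Q Qi) QQi mul1mx.
Qed.

End ChangeOfBasis.

Section Shear.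
Variables (F : fieldType) (d : nat) (i0 : 'I_d) (mu : 'I_d -> F).
Definition shear : 'M[F]_d := \matrix_(i, j) if (i == i0) && (j != i0) then mu j else 0.
Lemma shear_sq : shear *m shear = 0.
Proof.
apply/matrixP => i j; rewrite !mxE big1 // => k _; rewrite !mxE.
by case: (eqVneq k i0) => [->|]; rewrite ?andbF ?mul0r // andFb mulr0.
Qed.

Lemma shearK : (1%:M - shear) *m (1%:M + shear) = 1%:M.
Proof. by rewrite mulmxBl !mulmxDr !mul1mx mulmx1 shear_sq addr0 addrK. Qed.
Lemma shearVK : (1%:M + shear) *m (1%:M - shear) = 1%:M.
Proof. by rewrite mulmxDl !mulmxBr !mul1mx mulmx1 shear_sq subr0 subrK. Qed.
Lemma shear_col0 l : (1%:M - shear) l i0 = (l == i0)%:R.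
Proof. by rewrite !mxE eqxx andbF subr0. Qed.
Lemma combine_shear (V : lmodType F) (x : 'I_d -> V) j :
  combine (1%:M - shear) x j = x j - (if j != i0 then mu j else 0) *: x i0.
Proof.
rewrite /combine; under eq_bigr do rewrite !mxE scalerBl.
rewrite sumrB; congr (_ - _).
  rewrite (bigD1 j) //= eqxx scale1r big1 ?addr0 // => k /negPf kj; by rewrite kj scale0r.
rewrite (bigD1 i0) //= eqxx big1 ?addr0 // => k /negPf kj; by rewrite kj scale0r.
Qed.

End Shear.

Lemma sign_conjM (L : numClosedFieldType) (b : bool) (x y : L) :
  (-1) ^+ b * x * ((-1) ^+ b * y)^* = x * y^*.
Proof. by case: b; rewrite ?expr0 ?expr1 ?mul1r // !mulN1r rmorphN mulrNN. Qed.

Section HermitianForm.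
Variables (R : realType) (n : nat).
Local Notation C := R[i].
Local Notation Pol := {mpoly C[n]}.
Implicit Types (lam : {set cell n}) (p q : Pol).
(** The standard Hermitian form on the span of the monomials of the tableaux
    of shape lam, which W permutes up to sign. *)
Definition tab_form lam p q : C :=
  \sum_(U in Tab lam) p@_(mono (@rowc n) U) * (q@_(mono (@rowc n) U))^*.
Lemma tab_form_lin lam (k : C) p p' q : tab_form lam (k *: p + p') q = k * tab_form lam p q + tab_form lam p' q.
Proof.
rewrite /tab_form mulr_sumr -big_split; apply: eq_bigr => U _ /=.
by rewrite mcoeffD mcoeffZ mulrDl mulrA.
Qed.

Lemma tab_form0 lam q : tab_form lam 0 q = 0.
Proof. by rewrite /tab_form big1 // => U _; rewrite mcoeff0 mul0r. Qed.
Lemma tab_formZ lam (k : C) p q : tab_form lam (k *: p) q = k * tab_form lam p q.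
Proof. by have := tab_form_lin lam k p 0 q; rewrite addr0 tab_form0 addr0. Qed.
Lemma tab_form_sum lam (I : Type) (s : seq I) (P : pred I) (f : I -> Pol) q :
  tab_form lam (\sum_(i <- s | P i) f i) q = \sum_(i <- s | P i) tab_form lam (f i) q.
Proof.
elim/big_rec2: _ => [|i y x _ <-]; first exact: tab_form0.
by have := tab_form_lin lam 1 (f i) x q; rewrite scale1r mul1r.
Qed.

Lemma tab_form_conj lam p q : (tab_form lam p q)^* = tab_form lam q p.
Proof.
rewrite /tab_form raddf_sum; apply: eq_bigr => U _ /=.
by rewrite rmorphM [RHS]mulrC; congr (_ * _); apply: conjCK.
Qed.

Lemma tab_form_actP lam w p q : tab_form lam (actP w p) (actP w q) = tab_form lam p q.
Proof.
rewrite /tab_form [LHS](reindex_inj (can_inj (actTV (prmW w)))) /=.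
apply: eq_big => U; first by apply/idP/idP => /Tab_actT h; [rewrite -[U](actTV (prmW w))|].
move=> _; have e (r : Pol) V : (actP w r)@_(mono (@rowc n) (actT (prmW w) V)) =
    (-1) ^+ tsgn w (actT (prmW w) V) * r@_(mono (@rowc n) V).
  by rewrite mcoeff_actP msgn_mono mnm_act_mono actTV.
by rewrite (congr2 (fun a b => a * b^*) (e p U) (e q U)) sign_conjM.
Qed.

Lemma tab_form_neq0 lam p U : U \in Tab lam -> p@_(mono (@rowc n) U) != 0 -> tab_form lam p p != 0.
Proof.
move=> hU pU; rewrite /tab_form; under eq_bigr do rewrite -normCK.
rewrite psumr_neq0; last by move=> i _; rewrite exprn_ge0.
by apply/hasP; exists U; rewrite ?mem_index_enum //= hU /= exprn_gt0 // normr_gt0.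
Qed.

End HermitianForm.

(** * The generator attached to a realization *)

Section Generator.
Variables (R : realType) (n : nat).
Local Notation C := R[i].
Local Notation Pol := {mpoly C[n]}.
Hypothesis n_gt0 : (0 < n)%N.
Variable reps : {set {set cell n}}.
Hypothesis reps_P2 : representatives reps.
Local Notation Om := (rep_index reps).
Implicit Type w : Om.
Local Notation dim w := #|Std_of w|.
Local Notation low w i := (low_specht R (l_of w) (enum_val (i : 'I_(dim w)))).
Variable rho : forall w, WD n -> 'M[C]_(dim w).
Local Notation E w i j := (munit (@rho w) i j).
Hypothesis rho_rep : forall w, mxrep (@rho w).
Hypothesis rho_low : forall w g j, actP g (low w j) = \sum_i rho w g i j *: low w i.
Hypothesis Emul : forall w i j k l, E w i j * E w k l = (j == k)%:R *: E w i l.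
Hypothesis E_low : forall w i j k, gact (@actP R n) (E w i j) (low w k) = (j == k)%:R *: low w i.

Lemma index_of lam l : lam \in reps -> (l < enumb lam)%N ->
  exists w, lam_of w = lam /\ l_of w = l.
Proof.
move=> hl hle; have l2 : (l < 2)%N by move: hle; have [_|_] := bnumP lam => //; case: l.
have h : (lam \in reps) && (Ordinal l2 < enumb lam)%N by rewrite hl.
by exists (Sub (lam, Ordinal l2) h).
Qed.

(** The basis of lowest Specht polynomials is modified so that all its vectors
    other than the first one become orthogonal to it. Then the entry of index
    (i0, i0) of the matrix of g is the quotient of Hermitian products of g x_0
    with x_0 and of x_0 with itself, and its conjugate is the entry of the
    matrix of g^-1. This turns the idempotent, defined by conjugates, into a
    combination of matrix units. *)
Section Realization.
Variables (w : Om) (S1 : tableau n) (i0 : 'I_(dim w)).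
Hypothesis hS1 : S1 \in STabh (lam_of w) 1.
Local Notation lam := (lam_of w).
Local Notation x := (fun k : 'I_(dim w) => low w k).
Local Notation H := (tab_form (R := R) lam).

Lemma first_cell : (false, (Ordinal n_gt0, Ordinal n_gt0)) \in lam.
Proof.
have /is_diagramP hd : is_diagram lam by have := lam_P2 reps_P2 w; rewrite inE => /andP[].
have hT := STabh_Tab hS1; move: hS1; rewrite (STabh1E n_gt0) => /andP[_ hf].
by apply: (hd _ _ (Tab_in (Ordinal n_gt0) hT)) => //=; move: hf; case: (S1 _).1.
Qed.

Lemma low_notin (k : 'I_(dim w)) : ~ Jplus (x k).
Proof.
apply: (low_notin_Jplus n_gt0 (lam_P2 reps_P2 w) (enum_Std_Tab k)).
have [_ e] := TabP _ _ (enum_Std_Tab k); have := first_cell.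
by rewrite -e => /imsetP[j _ ej]; exists j; rewrite -ej.
Qed.

(** The matrix unit E_{0k} preserves the ideal and isolates the coefficient of
    x_k; the polynomial x_0 is not in the ideal. *)
Lemma low_independent (c : 'I_(dim w) -> C) : Jplus (\sum_k c k *: x k) -> forall k, c k = 0.
Proof.
move=> h k; apply/eqP; apply: contraT => ck; case: (@low_notin i0).
have := Jplus_gact (E w i0 k) h; rewrite (gact_sumr (@actP_lin R n)) (bigD1 k) //= big1 ?addr0.
  rewrite (gactZr (@actP_lin R n)) E_low eqxx scale1r => /(JplusZ (c k)^-1).
  by rewrite scalerA mulVf // scale1r.
move=> j /negPf jk; rewrite (gactZr (@actP_lin R n)) E_low eq_sym jk scale0r.
exact: scaler0.
Qed.

Definition proj_coef j : C := H (x j) (x i0) / H (x i0) (x i0).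
Local Notation Q := (1%:M - shear i0 proj_coef).
Local Notation Qi := (1%:M + shear i0 proj_coef).
Definition obasis j : Pol := combine Q x j.
Lemma H00 : H (x i0) (x i0) != 0.
Proof.
apply: (@tab_form_neq0 R n lam (x i0) (enum_val i0)); first exact: enum_Std_Tab.
rewrite (mcoeff_low_self R n_gt0 _ (enum_Std_Tab i0)); exact: oner_neq0.
Qed.

Lemma obasis0 : obasis i0 = x i0.
Proof. by rewrite /obasis combine_shear eqxx scale0r subr0. Qed.
Lemma obasis_orth j : j != i0 -> H (obasis j) (x i0) = 0.
Proof.
move=> ji; rewrite /obasis combine_shear ji.
rewrite -[X in H X _]/(x j - proj_coef j *: x i0) addrC -scaleNr tab_form_lin.
rewrite mulNr /proj_coef divfK ?H00 //; exact: addNr.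
Qed.

Definition rho' g := Qi *m rho w g *m Q.
Lemma rho'_rep : mxrep rho'.
Proof. exact: conj_mxrep (shearK _ _) (shearVK _ _) (rho_rep w). Qed.
Lemma obasis_act g j : actP g (obasis j) = \sum_i rho' g i j *: obasis i.
Proof. exact: (act_combine (@actP_lin R n) (@rho_low w) (shearK i0 proj_coef)). Qed.
Lemma rho'_00 g : rho' g i0 i0 = H (actP g (x i0)) (x i0) / H (x i0) (x i0).
Proof.
have e : actP g (x i0) = \sum_i rho' g i i0 *: obasis i by rewrite -obasis_act obasis0.
apply: (canRL (mulfK H00)); rewrite e; apply/esym.
apply: etrans (tab_form_sum _ _ _ _ _) _; rewrite (bigD1 i0) // tab_formZ obasis0.
rewrite big1 => [|j ji]; first exact: addr0.
by rewrite tab_formZ obasis_orth // mulr0.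
Qed.

Lemma rho'_conj g : (rho' g i0 i0)^* = rho' g^-1%g i0 i0.
Proof.
rewrite !rho'_00 fmorph_div /= !tab_form_conj -(tab_form_actP _ g^-1%g (x i0)) actPK.
by [].
Qed.

Lemma mx_repr_rho' : mx_repr [set: WD n] rho'.
Proof. by have [h1 h2] := rho'_rep; split=> // g h _ _; apply: h2. Qed.
Definition real_rep : mx_representation C [set: WD n] (dim w) := MxRepresentation mx_repr_rho'.

Definition eps : galg C (WD n) := rho_idempotent real_rep i0.
(** By rho'_conj the coefficients of eps are the entries (i0, i0) of the
    matrices of g^-1 in the new basis. The column i0 of Q is that of the
    identity, so only the row i0 of Qi enters. *)
Lemma epsE : eps = \sum_k Qi i0 k *: E w i0 k.
Proof.
apply/ffunP => g; rewrite galg_sumE [LHS]ffunE -[repr_mx real_rep g]/(rho' g) rho'_conj.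
rewrite /rho' -mulmxA mxE mulr_sumr; apply: eq_bigr => k _.
rewrite galgZE [munit _ _ _ _]ffunE mulrCA; congr (_ * _).
rewrite mxE (bigD1 i0) //= shear_col0 eqxx mulr1 big1 ?addr0 // => l /negPf li.
by rewrite shear_col0 li mulr0.
Qed.

Lemma Qi00 : Qi i0 i0 = 1.
Proof. by rewrite !mxE eqxx /= addr0. Qed.
Lemma eps_E : eps * E w i0 i0 = E w i0 i0.
Proof.
rewrite epsE mulr_suml (bigD1 i0) //= big1 ?addr0.
  by rewrite Qi00 scale1r Emul eqxx scale1r.
by move=> k /negPf ki; rewrite -scalerAl Emul ki scale0r scaler0.
Qed.

Lemma E_eps : E w i0 i0 * eps = eps.
Proof.
rewrite epsE mulr_sumr; apply: eq_bigr => k _.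
by rewrite -scalerAr Emul eqxx scale1r.
Qed.

(** Each of the two idempotents is a right multiple of the other one: eps E_00
    = E_00 and E_00 eps = eps. *)
Lemma image_eps : same_set (@eOtilde R n eps) (@eOtilde R n (E w i0 i0)).
Proof.
move=> z; split=> -[y yO ->].
  exists (actCW eps y); first exact: (B_op (@BK0 R n) (@BKD R n) (@BKZ R n) (@BKact R n)).
  rewrite -actCW_M mulCWE; congr (actCW _ y); exact: esym E_eps.
exists (actCW (E w i0 i0) y); first exact: (B_op (@BK0 R n) (@BKD R n) (@BKZ R n) (@BKact R n)).
rewrite -actCW_M mulCWE; congr (actCW _ y); exact: esym eps_E.
Qed.

(** For the canonical tableau the higher Specht polynomials are nonzero
    multiples of the lowest ones, which are a basis, modulo the ideal, of a
    space carrying the matrices rho. *)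
Lemma canonical_realization : exists2 S, S \in STabh lam 1 & matrix_realization lam (l_of w) S real_rep.
Proof.
have [S hS rowS] := canonical_tableau (lam_P2 reps_P2 w) first_cell.
exists S => //.
pose a (k : 'I_(dim w)) : C := hconst R reps_P2 w * #|Rstab (enum_val k)|%:R.
have a0 k : a k != 0.
  rewrite mulf_neq0 ?hconst_neq0 // pnatr_eq0 -lt0n.
  by apply/card_gt0P; exists 1%g; apply: Rstab1.
have aE k : @higher R n reps w S k = a k *: x k.
  rewrite (higherE R reps_P2) (transport_low_row R _ rowS (enum_Std_Tab k)).
  exact: scalerA.
have J0 : Jplus (0 : Pol) by exact: Jplus0.
exists obasis; split.
- move=> i; exists (fun T => Q (enum_rank_in (T0_Std reps_P2 w) T) i *
    (a (enum_rank_in (T0_Std reps_P2 w) T))^-1).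
  suff -> : \sum_(T in STabh lam (bnum lam)) (Q (enum_rank_in (T0_Std reps_P2 w) T) i *
    (a (enum_rank_in (T0_Std reps_P2 w) T))^-1) *: higher_specht R (l_of w) S T = obasis i.
    by rewrite subrr.
  rewrite (sum_ord (Std_of w)); apply: eq_bigr => k _; rewrite enum_valK_in.
  by rewrite -[higher_specht _ _ _ _]/(@higher R n reps w S k) aE scalerA divfK.
- move=> T hT; pose k : 'I_(dim w) := enum_rank_in (T0_Std reps_P2 w) T.
  exists (fun i => a k * Qi i k).
  suff -> : \sum_i (a k * Qi i k) *: obasis i = higher_specht R (l_of w) S T by rewrite subrr.
  have -> : T = enum_val k by rewrite enum_rankK_in.
  rewrite -[higher_specht _ _ _ _]/(@higher R n reps w S k) aE (combine_back x (shearK i0 proj_coef) k) [in RHS]/combine scaler_sumr.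
  by apply: eq_bigr => i _; rewrite scalerA.
- move=> c hc.
  have e : \sum_i c i *: obasis i = \sum_k (Q *m \col_i c i) k 0 *: x k.
    rewrite /obasis /combine; under eq_bigr do rewrite scaler_sumr.
    rewrite exchange_big; apply: eq_bigr => k _; rewrite mxE scaler_suml.
    by apply: eq_bigr => i _; rewrite scalerA !mxE mulrC.
  rewrite e in hc; have z := low_independent hc.
  have qz : Q *m \col_i c i = 0 by apply/matrixP => k j; rewrite (ord1 j) z mxE.
  move=> i; have := congr1 (fun M => (Qi *m M) i 0) qz.
  by rewrite mulmxA shearVK mul1mx mulmx0 !mxE.
- move=> g j; rewrite obasis_act subrr //.
Qed.

End Realization.

Theorem generator_exists lam l S1 : lam \in reps -> (l < enumb lam)%N -> S1 \in STabh lam 1 ->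
  exists (f : nat) (T : tableau n), specht_generator R lam l f S1 T.
Proof.
move=> hl hle hS1; have [w [e1 e2]] := index_of hl hle; rewrite -e1 in hS1 *; rewrite -e2.
have d0 : (0 < dim w)%N by apply/card_gt0P; exists (T0 reps_P2 w); apply: T0_Std.
pose i0 : 'I_(dim w) := Ordinal d0.
exists (dim w), (enum_val i0); split=> //; first exact: enum_valP i0.
have [S hS hr] := canonical_realization i0 hS1.
exists S, (real_rep i0), i0; split=> // z.
have hS1' : S1 \in STab (lam_of w) by move: hS1; rewrite inE => /andP[].
have h1 := image_eps i0 z.
have h2 := corner_higher n_gt0 reps_P2 rho_rep Emul E_low i0 hS1' z.
by split=> [/h1/h2|/h2/h1].
Qed.

End Generator.

(** * The direct sum decomposition *)

Section ModuloSubspace.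
Variables (F : fieldType) (V : lmodType F) (J : V -> Prop).
Hypothesis JD : forall u v, J u -> J v -> J (u + v).
Hypothesis JZ : forall k u, J u -> J (k *: u).
(** Modulo J, the v_i are combinations of the x_k and conversely, so two
    matrices have product 1. *)
Lemma independent_le f d (v : 'I_f -> V) (x : 'I_d -> V) :
  J 0 ->
  (forall c : 'I_f -> F, J (\sum_i c i *: v i) -> forall i, c i = 0) ->
  (forall i, exists c : 'I_d -> F, J (v i - \sum_k c k *: x k)) ->
  (forall k, exists c : 'I_f -> F, J (x k - \sum_i c i *: v i)) -> (f <= d)%N.
Proof.
move=> J0 free hA hB.
have [A AE] : {A : 'I_f -> 'I_d -> F | forall i, J (v i - \sum_k A i k *: x k)}.
  by exists (fun i => projT1 (cid (hA i))) => i; apply: projT2 (cid (hA i)).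
have [b bE] : {b : 'I_d -> 'I_f -> F | forall k, J (x k - \sum_i b k i *: v i)}.
  by exists (fun k => projT1 (cid (hB k))) => k; apply: projT2 (cid (hB k)).
pose MA : 'M[F]_(f, d) := \matrix_(i, k) A i k.
pose MB : 'M[F]_(d, f) := \matrix_(k, i) b k i.
apply: (@mulmx1_min _ _ _ MA MB); apply/matrixP => i j.
have Jsum (I : Type) (r : seq I) (P : pred I) (g : I -> V) :
    (forall a, P a -> J (g a)) -> J (\sum_(a <- r | P a) g a) by move=> h; apply: big_ind.
have key : J (\sum_j ((i == j)%:R - (MA *m MB) i j) *: v j).
  have -> : \sum_j ((i == j)%:R - (MA *m MB) i j) *: v j =
     (v i - \sum_k A i k *: x k) + \sum_k A i k *: (x k - \sum_j b k j *: v j).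
    under eq_bigr do rewrite scalerBl.
    rewrite sumrB [X in X - _](bigD1 i) //= eqxx scale1r big1 ?addr0; last first.
      by move=> l; rewrite eq_sym => /negPf ->; rewrite scale0r.
    under [X in _ = _ + X]eq_bigr do rewrite scalerBr.
    rewrite sumrB addrA subrK; congr (_ - _).
    under eq_bigr do rewrite mxE scaler_suml.
    rewrite exchange_big; apply: eq_bigr => k _; rewrite scaler_sumr.
    by apply: eq_bigr => l _; rewrite !mxE scalerA.
  by apply: JD => //; apply: Jsum => k _; apply: JZ.
by have /eqP := free _ key j; rewrite subr_eq0 => /eqP <-; rewrite mxE.
Qed.

End ModuloSubspace.

Section DirectSumDecomposition.
Variables (R : realType) (n : nat).
Local Notation C := R[i].
Local Notation Pol := {mpoly C[n]}.
Local Notation K := (KX R n).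
Hypothesis n_gt0 : (0 < n)%N.
Variable reps : {set {set cell n}}.
Hypothesis reps_P2 : representatives reps.
Local Notation Om := (rep_index reps).
Implicit Type w : Om.
Local Notation dim w := #|Std_of w|.
Local Notation low w i := (low_specht R (l_of w) (enum_val (i : 'I_(dim w)))).
Variable rho : forall w, WD n -> 'M[C]_(dim w).
Local Notation E w i j := (munit (@rho w) i j).
Hypothesis rho_rep : forall w, mxrep (@rho w).
Hypothesis Emul : forall w i j k l, E w i j * E w k l = (j == k)%:R *: E w i l.
Hypothesis Eorth : forall w w' i j k l, w != w' -> E w i j * E w' k l = 0.
Hypothesis Esum : \sum_w \sum_i E w i i = 1.
Hypothesis E_low : forall w i j k, gact (@actP R n) (E w i j) (low w k) = (j == k)%:R *: low w i.
Local Notation higher w S k := (@higher R n reps w S k).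

(** If all the higher Specht polynomials of S were in J_+, the realization
    would be zero. If one is not, then the matrix units show that all are
    independent modulo J_+, so that their number is the dimension. *)
Lemma realization_dim w S f (r : mx_representation C [set: WD n] f) (i0 : 'I_f) :
  matrix_realization (lam_of w) (l_of w) S r -> f = dim w.
Proof.
case=> v [h1 h2 h3 _].
have J0 : Jplus (0 : Pol) by exact: Jplus0.
have h1' i : exists c : 'I_(dim w) -> C, Jplus (v i - \sum_k c k *: higher w S k).
  have [c hc] := h1 i; exists (fun k => c (enum_val k)).
  by move: hc; rewrite (sum_ord (Std_of w)).
have h2' k : exists c : 'I_f -> C, Jplus (higher w S k - \sum_i c i *: v i).
  exact: h2 (enum_valP k).
(* The realization is not zero, as it has a vector of index i0. *)
have [k0 hk0] : exists k0, ~ Jplus (higher w S k0).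
  apply: contrapT => /forallNP h; have {}h k : Jplus (higher w S k) by apply: contrapT; apply: h.
  have [c hc] := h1' i0.
  have hv : Jplus (v i0).
    rewrite -[v i0](subrK (\sum_k c k *: higher w S k)); apply: (JplusD hc).
    by apply: Jplus_sum => k _; apply: JplusZ.
  have : (i0 == i0)%:R = 0 :> C.
    apply: (h3 (fun i => (i == i0)%:R)); rewrite (bigD1 i0) //= eqxx scale1r big1 ?addr0 //.
    by move=> j /negPf ->; apply: scale0r.
  by rewrite eqxx => /eqP; rewrite oner_eq0.
have indep (c : 'I_(dim w) -> C) : Jplus (\sum_k c k *: higher w S k) -> forall k, c k = 0.
  move=> h k; apply/eqP; apply: contraT => ck; case: hk0.
  have := Jplus_gact (E w k0 k) h; rewrite (gact_sumr (@actP_lin R n)) (bigD1 k) //= big1.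
    rewrite addr0 (gactZr (@actP_lin R n)) (E_higher reps_P2 E_low) eqxx scale1r => /(JplusZ (c k)^-1).
    by rewrite scalerA mulVf // scale1r.
  move=> j /negPf jk; rewrite (gactZr (@actP_lin R n)) (E_higher reps_P2 E_low) eq_sym jk scale0r.
  exact: scaler0.
apply/eqP; rewrite eqn_leq; apply/andP; split.
  exact: (independent_le (@JplusD R n) (@JplusZ R n) J0 h3 h1' h2').
exact: (independent_le (@JplusD R n) (@JplusZ R n) J0 indep h2' h1').
Qed.

Theorem direct_sum_part (f : {set cell n} -> nat -> nat)
          (S1 T : {set cell n} -> nat -> tableau n) :
     (forall lam l, lam \in reps -> (l < enumb lam)%N ->
        specht_generator R lam l (f lam l) (S1 lam l) (T lam l)) ->
     Diso (@act_family R n (copy_index reps f)) (@applyK R n)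
          (dsum (fun i : copy_index reps f =>
                   Dgen (higher_specht R (copy_l i)
                           (S1 (copy_lam i) (copy_l i))
                           (T (copy_lam i) (copy_l i)))))
          (@Otilde R n).
Proof.
move=> hgen.
have gw w : specht_generator R (lam_of w) (l_of w) (f (lam_of w) (l_of w))
    (S1 (lam_of w) (l_of w)) (T (lam_of w) (l_of w)) := hgen _ _ (lam_reps w) (l_lt w).
have fE w : f (lam_of w) (l_of w) = dim w.
  by have [_ _ [S [r [i0 [_ hr _ _]]]]] := gw w; apply: realization_dim i0 hr.
pose i0 w : 'I_(dim w) := enum_rank_in (T0_Std reps_P2 w) (T (lam_of w) (l_of w)).
have i0E w : enum_val (i0 w) = T (lam_of w) (l_of w).
  by have [_ hT _] := gw w; apply: enum_rankK_in.
pose k (a : copy_index reps f) : 'I_(dim (tag a)) := cast_ord (fE (tag a)) (tagged a).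
pose M (a : copy_index reps f) : KC R n -> Prop :=
  Dgen (higher_specht R (copy_l a) (S1 (copy_lam a) (copy_l a)) (T (copy_lam a) (copy_l a))).
have ME a x : M a x <-> @image_of C (WD n) (KC R n) (@aK R n) (@BK R n) (E (tag a) (i0 (tag a)) (i0 (tag a))) x.
  have hS : S1 (lam_of (tag a)) (l_of (tag a)) \in STab (lam_of (tag a)).
    by have [h _ _] := gw (tag a); move: h; rewrite inE => /andP[].
  have h : same_set (@eOtilde R n (E (tag a) (i0 (tag a)) (i0 (tag a))))
      (Dgen (higher_specht R (l_of (tag a)) (S1 (lam_of (tag a)) (l_of (tag a))) (enum_val (i0 (tag a))))).
    exact: (corner_higher n_gt0 reps_P2 rho_rep Emul E_low (i0 (tag a)) hS).
  by rewrite i0E in h; split; [move/h|move=> h'; apply/h].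
have k_bij (W : nmodType) (g : forall w, 'I_(dim w) -> W) :
    \sum_w \sum_i g w i = \sum_(a : copy_index reps f) g (tag a) (k a).
  transitivity (\sum_w \sum_(j < f (lam_of w) (l_of w)) g w (cast_ord (fE w) j)).
    apply: eq_bigr => w _; rewrite (reindex (cast_ord (fE w))) //.
    exists (cast_ord (esym (fE w))) => j _; [exact: cast_ordK|exact: cast_ordKV].
  by rewrite sig_big_dep; apply: eq_bigr => -[w j].
have k_orth a b : b != a -> E (tag a) (i0 (tag a)) (k a) * E (tag b) (k b) (i0 (tag b)) = 0.
  case: a b => [w j] [w' j'] ne.
  have [e|ww] := eqVneq w w'; last by rewrite Eorth.
  subst w'; rewrite Emul; case: eqP => [e|_]; last by rewrite scale0r.
  by move: ne; rewrite /k /= in e *; rewrite (cast_ord_inj e) eqxx.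
have [[h1 h2 h3] h4 h5] := decomposition (@aK_lin R n) (@aK1 R n) (@aKM R n) (@BK0 R n) (@BKD R n)
   (@BKZ R n) (@BKact R n) (DK_D n_gt0) (DK_Z n_gt0) (DK_act n_gt0) Emul Esum k_bij k_orth ME.
exists (fun m : {ffun copy_index reps f -> K} =>
   \sum_a gact (@aK R n) (E (tag a) (k a) (i0 (tag a))) (m a)); split.
- split; [exact: h1|exact: h2|exact: h3].
- by move=> m m' _ _; apply: h4.
- by move=> P m hP _; apply: h5.
Qed.

End DirectSumDecomposition.

Theorem corollary4p2 (R : realType) (n : nat) (n_gt0 : (0 < n)%N)
    (reps : {set {set cell n}}) (reps_P2 : representatives reps) :
  (forall e : CW R n, primitive_idempotent e ->
     [/\ [/\ Dsubmodule (eOtilde e),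
             forall x, eOtilde e x -> Otilde x &
             nonzero_set (eOtilde e)],
         Dsimple (eOtilde e) &
         exists (lam : {set cell n}) (l : nat) (S T : tableau n),
           [/\ lam \in reps, (l < enumb lam)%N, S \in STabh lam 1,
               T \in STabh lam (bnum lam) &
               Diso (@applyK R n) (@applyK R n)
                    (eOtilde e) (Dgen (higher_specht R l S T)) /\
               exists u v : CW R n,
                 [/\ mulCW u v = oneCW R n, mulCW v u = oneCW R n &
                     same_set (eOtilde (mulCW (mulCW u e) v))
                          (Dgen (higher_specht R l S T))]]])
  /\
  (forall (lam : {set cell n}) (l : nat) (S1 : tableau n),
     lam \in reps -> (l < enumb lam)%N -> S1 \in STabh lam 1 ->
     exists (f : nat) (T : tableau n), specht_generator R lam l f S1 T)
  /\
  (forall (f : {set cell n} -> nat -> nat)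
          (S1 T : {set cell n} -> nat -> tableau n),
     (forall lam l, lam \in reps -> (l < enumb lam)%N ->
        specht_generator R lam l (f lam l) (S1 lam l) (T lam l)) ->
     Diso (@act_family R n (copy_index reps f)) (@applyK R n)
          (dsum (fun i : copy_index reps f =>
                   Dgen (higher_specht R (copy_l i)
                           (S1 (copy_lam i) (copy_l i))
                           (T (copy_lam i) (copy_l i)))))
          (@Otilde R n)).
Proof.
have [rho [rho_rep rho_low [Emul Eorth Esum Espan] E_low _]] := specht_units R n_gt0 reps_P2.
split; first exact: (primitive_part n_gt0 reps_P2 rho_rep Emul Eorth Espan E_low).
split; first exact: (generator_exists n_gt0 reps_P2 rho_rep rho_low Emul E_low).
exact: (direct_sum_part n_gt0 reps_P2 rho_rep Emul Eorth Esum E_low).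
Qed.
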